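(* Let $\Omega, f, u_a, u_b, b, \varphi$ and the family $(\theta_\varepsilon)_{\varepsilon>0}$ satisfy the standing assumptions listed in the context, let $\lambda>0$, let $U_{ad}=\{u\in L^\infty(\Omega): u_a(x)\le u(x)\le u_b(x)\text{ for a.e. }x\in\Omega\}$, and let $S$ be the control-to-state map of the Kirchhoff equation described in the context. Let $J(y,u)=\int_\Omega\varphi(x,y(x))\,dx+\frac{\lambda}{2}\|u\|_{H^1(\Omega)}^2$. Denote by (P) the problem of minimizing $J(y,u)$ subject to $y=S(u)$ and $u\in U_{ad}\cap H^1(\Omega)$. For $\varepsilon>0$ denote by (P$_\varepsilon$) the problem of minimizing $$J_\varepsilon(y,u)=J(y,u)+\frac{1}{2\varepsilon}\int_\Omega (u_a-u)_+^2+(u-u_b)_+^2\,dx$$ subject to $y=S\big(u_a+\theta_\varepsilon(u-u_a)\big)$ and $u\in H^1(\Omega)$. Then: (1) For all $\varepsilon>0$, problem (P$_\varepsilon$) possesses a globally optimal solution $(\bar y_\varepsilon,\bar u_\varepsilon)\in\big(H^1_0(\Omega)\cap W^{2,p}(\Omega)\big)\times H^1(\Omega)$ for all $p\in[1,\infty)$. (2) Let $p\in[1,\infty)$. For any sequence $\varepsilon_n\searrow 0$ and globally optimal solutions $(\bar y_{\varepsilon_n},\bar u_{\varepsilon_n})$ of (P$_{\varepsilon_n}$), there is a subsequence of $(\bar y_{\varepsilon_n},\bar u_{\varepsilon_n})$ which converges weakly to some $(y^*,u^* )$ in $W^{2,p}(\Omega)\times H^1(\Omega)$. Moreover, $u^*\in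 U_{ad}$ holds and $(y^*,u^* )$ is a globally optimal solution of (P).
   Context: Standing assumptions: $1\le N\le 3$ and $\Omega\subset\mathbb{R}^N$ is a bounded domain of class $C^{1,1}$. The right-hand side $f\in L^\infty(\Omega)$ satisfies $f\ge f_0$ a.e. for some real $f_0>0$. The bounds $u_a,u_b\in C(\overline\Omega)$ satisfy $u_b\ge u_a\ge u_0$ for some real $u_0>0$. The coefficient $b\in W^{1,\infty}(\Omega)$ satisfies $b\ge b_0$ a.e. for some real $b_0>0$. Assumptions on $\varphi:\Omega\times\mathbb{R}\to\mathbb{R}$: $\varphi(\cdot,y)$ is measurable for all $y\in\mathbb{R}$; $\varphi(x,\cdot)$ is twice continuously differentiable for a.e. $x\in\Omega$; there is $K>0$ with $|D_y^\ell\varphi(x,0)|\le K$ for $\ell=0,1,2$ and a.e. $x\in\Omega$; and for every $M>0$ there is $L(M)>0$ such that $|D_y^2\varphi(x,y_1)-D_y^2\varphi(x,y_2)|\le L(M)|y_1-y_2|$ for a.e. $x\in\Omega$ and all $|y_1|,|y_2|\le M$. Cut-off functions: for each $\varepsilon>0$, $\theta_\varepsilon:\mathbb{R}\to\mathbb{R}$ is a monotone (nondecreasing), convex $C^3$ function with $\theta_\varepsilon(t)=t$ for $t>\varepsilon$, $\theta_\varepsilon(t)=0$ for $t<-\varepsilon$, and $\theta_\varepsilon'(t)\in[0,1]$ for all $t$. It acts pointwise on functions. In particular $u_a+\theta_\varepsilon(u-u_a)\ge u_a$. Control-to-state map: for $w\in L^2(\Omega)$ with $w\ge u_a$ a.e.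 (no upper bound is needed), $S(w)$ is the unique $y\in H^1_0(\Omega)$ with $\int_\Omega\nabla y\cdot\nabla v\,dx=\int_\Omega \frac{f\,v}{w+b\,\|\nabla y\|_{L^2(\Omega)}^2}\,dx$ for all $v\in H^1_0(\Omega)$, i.e. the weak solution of $-(w+b\,\|\nabla y\|_{L^2(\Omega)}^2)\Delta y=f$ in $\Omega$, $y=0$ on $\partial\Omega$; it exists, is unique and belongs to $W^{2,p}(\Omega)$ for all $p\in[1,\infty)$. Notation: $v_+=\max\{0,v\}$; $\|u\|_{H^1(\Omega)}^2=\|u\|_{L^2(\Omega)}^2+\|\nabla u\|_{L^2(\Omega)}^2$.
   Formalization: Part (2) is stated under the additional assumption that U_ad ∩ H^1(Ω) is nonempty; without it the claim fails, e.g. Ω=(0,1), u_a=u_b=1+√x, where (P) has no feasible point although every (P_ε) is solvable. *)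

(* Defs.v *)
From HB Require Import structures.
From mathcomp Require Import all_boot all_order all_algebra.
From mathcomp Require Import all_classical all_reals all_analysis.
Set Implicit Arguments.
Unset Strict Implicit.
Unset Printing Implicit Defensive.
Import Order.TTheory GRing.Theory Num.Theory.
Import numFieldNormedType.Exports.
Local Open Scope classical_set_scope.
Local Open Scope ring_scope.

Definition rV_display : measure_display. Proof. exact: default_measure_display. Qed.

(* The sigma-algebra generated by the coordinates, i.e. the Borel sets. *)
Section rV_measurable.
Context (R : realType) (n : nat).

Let coors : 'I_n -> 'rV[R]_n -> measurableTypeR R := fun i v => v ord0 i.

Let rV_set0 : g_sigma_preimage coors set0.
Proof. exact: sigma_algebra0. Qed.

Let rV_setC A : g_sigma_preimage coors A -> g_sigma_preimage coors (~` A).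
Proof. exact: sigma_algebraC. Qed.

Let rV_bigcup (F : (set 'rV[R]_n)^nat) : (forall i, g_sigma_preimage coors (F i)) ->
  g_sigma_preimage coors (\bigcup_i (F i)).
Proof. exact: sigma_algebra_bigcup. Qed.

HB.instance Definition _ := @isMeasurable.Build rV_display
  'rV[R]_n (g_sigma_preimage coors) rV_set0 rV_setC rV_bigcup.
End rV_measurable.

Section lebesgue_rV.
Context (R : realType).
Local Open Scope ereal_scope.

Definition rV_cons n (p : measurableTypeR R * 'rV[R]_n) : 'rV[R]_n.+1 :=
  \row_i if unlift ord0 i is Some j then p.2 ord0 j else p.1.

Lemma measurable_rV_coord n (i : 'I_n) :
  measurable_fun setT (fun v : 'rV[R]_n => v ord0 i : measurableTypeR R).
Proof.
move=> _ Y mY; rewrite setTI; apply: sub_sigma_algebra => /=.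
rewrite -bigcup_seq/=; exists i => /=; first by rewrite mem_index_enum.
by exists Y => //; rewrite setTI.
Qed.

Lemma measurable_fun_rV d (T : measurableType d) n (f : T -> 'rV[R]_n) :
  (forall i, measurable_fun setT (fun x => f x ord0 i : measurableTypeR R)) ->
  measurable_fun setT f.
Proof.
move=> mf.
have H : g_sigma_preimage (fun i x => f x ord0 i : measurableTypeR R)
    `<=` measurable.
  apply: smallest_sub; first exact: sigma_algebra_measurable.
  case: n => [|n] in f mf *; first by rewrite big_ord0.
  rewrite -bigcup_mkord_ord; apply: bigcup_sub => i Ii.
  by move=> A [B mB <-]; exact: mf.
move=> _ A mA; apply: H.
rewrite (_ : (fun _ => _) = (fun i => (fun v : 'rV[R]_n => v ord0 i) \o f))//.
by rewrite g_sigma_preimage_comp; exists A.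
Qed.

Lemma measurable_rV_cons n : measurable_fun setT (@rV_cons n).
Proof.
apply: measurable_fun_rV => i; case: (unliftP ord0 i) => [j ->|->].
  rewrite (_ : (fun _ => _) = (fun v : 'rV[R]_n => v ord0 j) \o snd).
    by apply: measurableT_comp => //; exact: measurable_rV_coord.
  by apply/funext => x; rewrite /rV_cons mxE liftK.
rewrite (_ : (fun _ => _) = fst)//.
by apply/funext => x; rewrite /rV_cons mxE unlift_none.
Qed.

Section step.
Context n (m : {sigma_finite_measure set 'rV[R]_n -> \bar R}).

Let pm : {measure set (measurableTypeR R * 'rV[R]_n)%type -> \bar R} :=
  @lebesgue_measure R \x m.

Definition lebesgue_rVS : set 'rV[R]_n.+1 -> \bar R :=
  pushforward (@lebesgue_measure R \x m) (@rV_cons n).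

Let lebesgue_rVS0 : lebesgue_rVS set0 = 0.
Proof. by rewrite /lebesgue_rVS /pushforward preimage_set0 (measure0 pm). Qed.

Let lebesgue_rVS_ge0 A : 0 <= lebesgue_rVS A.
Proof. exact: (measure_ge0 pm). Qed.

Let measurable_preimage_rV_cons A :
  measurable A -> measurable (@rV_cons n @^-1` A).
Proof. by move=> mA; rewrite -[X in measurable X]setTI; exact: measurable_rV_cons. Qed.

Let lebesgue_rVS_sigma_additive : semi_sigma_additive lebesgue_rVS.
Proof.
move=> F mF tF mUF; rewrite /lebesgue_rVS /pushforward preimage_bigcup.
apply: (@measure_semi_sigma_additive _ _ _ pm (fun k => @rV_cons n @^-1` F k)).
- by move=> k; exact: measurable_preimage_rV_cons.
- apply/trivIsetP => /= i j _ _ ij; rewrite -preimage_setI.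
  by move/trivIsetP : tF => /(_ _ _ _ _ ij) ->//; rewrite preimage_set0.
- by rewrite -preimage_bigcup; exact: measurable_preimage_rV_cons.
Qed.

HB.instance Definition _ := isMeasure.Build _ _ _ lebesgue_rVS
  lebesgue_rVS0 lebesgue_rVS_ge0 lebesgue_rVS_sigma_additive.

Let uncons (v : 'rV[R]_n.+1) : measurableTypeR R * 'rV[R]_n :=
  (v ord0 ord0, \row_i v ord0 (lift ord0 i)).

Let rV_consK : cancel (@rV_cons n) uncons.
Proof.
move=> [x v]; rewrite /uncons /rV_cons mxE unlift_none; congr pair.
by apply/rowP => i; rewrite !mxE liftK.
Qed.

Let unconsK : cancel uncons (@rV_cons n).
Proof.
move=> v; apply/rowP => i; rewrite /rV_cons mxE.
by case: unliftP => [j ->|->] //=; rewrite mxE.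
Qed.

Let measurable_uncons : measurable_fun setT uncons.
Proof.
apply/measurable_fun_pairP; split; first exact: measurable_rV_coord.
apply: measurable_fun_rV => i.
rewrite (_ : (fun _ => _) = (fun v : 'rV[R]_n.+1 => v ord0 (lift ord0 i))).
  exact: measurable_rV_coord.
by apply/funext => v; rewrite /= mxE.
Qed.

Let lebesgue_rVS_sigma_finite : sigma_finite setT lebesgue_rVS.
Proof.
have /sigma_finiteP[F [TF ndF Foo]] := sigma_finiteT (@lebesgue_measure R).
have /sigma_finiteP[G [TG ndG Goo]] := sigma_finiteT m.
exists (fun k => uncons @^-1` (F k `*` G k)).
  rewrite -preimage_bigcup; apply/esym/seteqP; split => // v _ /=.
  have [[i _ Fi] [j _ Gj]] : (\bigcup_i F i) (uncons v).1 /\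
    (\bigcup_i G i) (uncons v).2 by rewrite -TF -TG.
  exists (maxn i j) => //; split.
  - by move: Fi; exact/subsetPset/ndF/leq_maxl.
  - by move: Gj; exact/subsetPset/ndG/leq_maxr.
move=> k; have [mF Fk] := Foo k; have [mG Gk] := Goo k; split.
  rewrite -[X in measurable X]setTI; apply: measurable_uncons => //.
  exact: measurableX.
rewrite /lebesgue_rVS /pushforward -comp_preimage.
rewrite (_ : uncons \o @rV_cons n = id); last first.
  by apply/funext => p /=; exact: rV_consK.
by rewrite preimage_id product_measure1E// lte_mul_pinfty// ge0_fin_numE.
Qed.

HB.instance Definition _ := Measure_isSigmaFinite.Build _ _ _ lebesgue_rVS
  lebesgue_rVS_sigma_finite.
End step.

(* The n-fold product of the Lebesgue measure of R, carried to row vectors. *)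
Fixpoint lebesgue_rV n : {sigma_finite_measure set 'rV[R]_n -> \bar R} :=
  if n is k.+1 then lebesgue_rVS (lebesgue_rV k) else \d_(0 : 'rV[R]_0)%R.
End lebesgue_rV.

Section sobolev.
Context (R : realType) (N : nat).
Local Notation E := 'rV[R]_N.
Local Notation mu := (lebesgue_rV R N).
Implicit Types (Om : set E) (u g y v w : E -> R).

Definition pderiv (i : 'I_N) u : E -> R := fun x => 'D_(delta_mx ord0 i) u x.

(* All iterated partial derivatives exist and are (Frechet) differentiable,
   hence continuous: this is C^oo. *)
Definition smooth u :=
  forall (s : seq 'I_N) (x : E), differentiable (foldr pderiv u s) x.

Definition test_function Om u :=
  let supp := closure [set x | u x != 0] in
  [/\ smooth u, compact supp & supp `<=` Om].

Definition Lp Om (p : \bar R) u := u \_ Om \in Lfun mu p.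

Definition Lloc Om u := measurable_fun Om u /\
  forall K, K `<=` Om -> compact K -> mu.-integrable K (EFin \o u).

Definition weak_partial Om (i : 'I_N) u g :=
  [/\ Lloc Om u, Lloc Om g &
    forall v, test_function Om v ->
      \int[mu]_(x in Om) (u x * pderiv i v x) =
      - \int[mu]_(x in Om) (g x * v x)].

(* A representative of the weak derivative, which is unique up to a null set;
   the zero function if there is none. *)
Definition wpartial Om (i : 'I_N) u : E -> R :=
  xget (cst 0) [set g | weak_partial Om i u g].

Fixpoint sobolev Om (k : nat) (p : \bar R) u : Prop :=
  Lp Om p u /\
  (if k is k'.+1 then
     forall i, exists2 g, weak_partial Om i u g & sobolev Om k' p g
   else True).

(* The l^1 sum of the L^p norms of the weak derivatives; a mixed derivative
   occurs once for each order of differentiation. *)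
Fixpoint sobolev_norm Om (k : nat) (p : \bar R) u : R :=
  fine ('N[mu]_p[EFin \o (u \_ Om)]) +
  (if k is k'.+1 then \sum_(i < N) sobolev_norm Om k' p (wpartial Om i u)
   else 0).

Definition H1 Om u := sobolev Om 1 2%:E u.

Definition grad_dot Om u v : E -> R :=
  fun x => \sum_(i < N) wpartial Om i u x * wpartial Om i v x.

Definition grad_norm2 Om u : R := \int[mu]_(x in Om) grad_dot Om u u x.

Definition H1_norm2 Om u : R :=
  \int[mu]_(x in Om) (u x ^+ 2) + grad_norm2 Om u.

Definition H1_0 Om u := H1 Om u /\
  forall e, 0 < e -> exists2 v, test_function Om v &
    Num.sqrt (H1_norm2 Om (u - v)) < e.

(* u is C^1 with globally Lipschitz differential; in the definition of a C^{1,1}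
   domain the graph function matters only near a point, where a locally
   C^{1,1} function can be cut off. *)
Definition C11 n (u : 'rV[R]_n -> R) :=
  (forall x, differentiable u x) /\
  exists L, forall x z h, `|'d u x h - 'd u z h| <= L * `|x - z| * `|h|.

(* Near each boundary point, in coordinates z = x Q with Q orthogonal, Om is the
   strict epigraph of a C^{1,1} function of the coordinates other than z_k. *)
Definition C11_boundary Om :=
  forall x0, closure Om x0 -> ~ Om x0 ->
  exists (r : R) (Q : 'M[R]_N) (k : 'I_N) (g : 'rV[R]_N.-1 -> R),
    [/\ 0 < r, Q *m Q^T = 1%:M, C11 g &
      forall x, ball x0 r x ->
        (Om x <-> g (col' k (x *m Q)) < (x *m Q) ord0 k)].

Definition bounded_C11_domain Om :=
  [/\ open Om, connected Om, Om !=set0, bounded_set Om & C11_boundary Om].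

(* measurable_fun is Borel measurability; f is Lebesgue measurable iff it is a.e.
   equal to a Borel function. *)
Definition Lebesgue_measurable_fun Om u :=
  exists2 g, measurable_fun Om g & u = g %[ae mu in Om].

Definition nonlinearity Om (phi : E -> R -> R) :=
  [/\ forall t, Lebesgue_measurable_fun Om (phi ^~ t),
      {ae mu, forall x, Om x ->
        (forall l t, (l < 2)%N -> derivable (derive1n l (phi x)) t 1) /\
        continuous (derive1n 2 (phi x))},
      exists2 K, 0 < K & forall l, (l <= 2)%N ->
        {ae mu, forall x, Om x -> `|derive1n l (phi x) 0| <= K} &
      forall M, 0 < M -> exists2 L, 0 < L &
        {ae mu, forall x, Om x -> forall t1 t2, `|t1| <= M -> `|t2| <= M ->
          `|derive1n 2 (phi x) t1 - derive1n 2 (phi x) t2| <= L * `|t1 - t2|}].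

Definition cutoff (e : R) (th : R -> R) :=
  [/\ {homo th : s t / s <= t}, convex_function [set: R] th,
      (forall l t, (l < 3)%N -> derivable (derive1n l th) t 1) /\
      continuous (derive1n 3 th),
      (forall t, e < t -> th t = t) /\ (forall t, t < - e -> th t = 0) &
      forall t, 0 <= derive1 th t <= 1].

Definition kirchhoff_solution Om (f b w y : E -> R) :=
  H1_0 Om y /\ forall v, H1_0 Om v ->
    \int[mu]_(x in Om) grad_dot Om y v x =
    \int[mu]_(x in Om) (f x * v x / (w x + b x * grad_norm2 Om y)).

(* S maps (representatives of) controls w in L^2 with w >= ua to a representative
   of the weak solution, which exists, is unique and is W^{2,p}-regular. *)
Definition control_to_state Om (f b ua : E -> R) (S : (E -> R) -> E -> R) :=
  forall w, Lp Om 2%:E w -> {ae mu, forall x, Om x -> ua x <= w x} ->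
    [/\ kirchhoff_solution Om f b w (S w),
        forall y, kirchhoff_solution Om f b w y -> y = S w %[ae mu in Om] &
        forall p, 1 <= p -> sobolev Om 2 p%:E (S w)].

Definition Uad Om (ua ub : E -> R) u :=
  Lp Om +oo%E u /\ {ae mu, forall x, Om x -> ua x <= u x <= ub x}.

(* For y bounded, as every state is, the first integral is finite under
   nonlinearity. *)
Definition cost Om (phi : E -> R -> R) (lam : R) (yu : (E -> R) * (E -> R)) : R :=
  \int[mu]_(x in Om) phi x (yu.1 x) + lam / 2 * H1_norm2 Om yu.2.

Definition penalized_cost Om (phi : E -> R -> R) (lam : R) (ua ub : E -> R)
    (e : R) (yu : (E -> R) * (E -> R)) : R :=
  cost Om phi lam yu + (2 * e)^-1 *
    \int[mu]_(x in Om) (Num.max 0 (ua x - yu.2 x) ^+ 2 +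
                        Num.max 0 (yu.2 x - ub x) ^+ 2).

Definition feasible Om (S : (E -> R) -> E -> R) (ua ub : E -> R) :
    set ((E -> R) * (E -> R)) :=
  [set yu | [/\ H1_0 Om yu.1, yu.1 = S yu.2 %[ae mu in Om],
                H1 Om yu.2 & Uad Om ua ub yu.2]].

Definition penalized_feasible Om (S : (E -> R) -> E -> R) (ua : E -> R)
    (th : R -> R) : set ((E -> R) * (E -> R)) :=
  [set yu | [/\ H1_0 Om yu.1,
      yu.1 = S (fun x => ua x + th (yu.2 x - ua x)) %[ae mu in Om] &
      H1 Om yu.2]].

End sobolev.

Definition global_min (T : Type) (R : realType) (F : set T) (J : T -> R) (x : T) :=
  F x /\ forall z, F z -> J x <= J z.

(* Weak convergence in the seminormed space (X, nrm) where X is a linear subspace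
   of V: convergence of every bounded linear functional of X. *)
Definition weak_cvg (R : realType) (V : lmodType R) (X : set V) (nrm : V -> R)
    (v_ : nat -> V) (v : V) :=
  [/\ forall n, X (v_ n), X v &
    forall F : V -> R,
      (forall a x z, X x -> X z -> F (a *: x + z) = a * F x + F z) ->
      (exists C, forall x, X x -> `|F x| <= C * nrm x) ->
      F (v_ n) @[n --> \oo] --> F v].

(* Main.v *)
Require Import Defs.
From HB Require Import structures.
From mathcomp Require Import all_boot all_order all_algebra.
From mathcomp Require Import all_classical all_reals all_analysis.
From mathcomp Require Import measurable_realfun.
From mathcomp Require Import ring lra zify.
Set Implicit Arguments.
Unset Strict Implicit.
Unset Printing Implicit Defensive.
Import Order.TTheory GRing.Theory Num.Theory.
Import numFieldNormedType.Exports.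
Local Open Scope classical_set_scope.
Local Open Scope ring_scope.

(* The direct method. The penalty and the term lam/2 |u|^2 are bounded along minimizing
   sequences (resp. along the minimizers u_n, by comparison with a fixed u in U_ad), so
   by Rellich a subsequence of the controls converges a.e.; states converge a.e. by
   stability of the Kirchhoff equation, the first integral converges by dominated
   convergence, the H^1 norm is weakly lower semicontinuous and the penalty passes to
   the limit by Fatou.  Since |theta_e(t) - max(0, t)| <= 2 e, the controls
   u_a + theta_e(u - u_a) tend to u whenever u_a <= u, and the factor 1/(2 e_n) forces
   u_a <= u* <= u_b.

   Uniform W^{2,p} bounds for the states are not assumed: f >= f_0 > 0 makes every right-hand
   side close to a multiple of f that of an admissible control, so regularity of S gives
   regularity for the Poisson problem with bounded data, and Baire's theorem makes that
   regularity uniform.  Uniform L^oo bounds then follow by extending states by zero and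
   Morrey's inequality.  Spaces L^p are handled for even integers p only; Clarkson's
   inequality on iterated midpoints replaces reflexivity (lower semicontinuity of
   norms, and a Mazur-type argument for weak convergence). *)

(** * Real sequences and extraction of subsequences *)

Section real_sequences.
Context (R : realType).
Implicit Types (a : nat -> R) (s : nat -> nat).

(** The hypothesis on [S] is qualitative: every state lies in W^{2,p}, with no estimate, while weak
    convergence in W^{2,p} and the integral of [phi] require bounds uniform in the control.
    Regularity is therefore moved from the nonlocal equation to the linear Poisson problem, where
    data can be scaled, shifted and superposed.

    For even q the integrand |x|^q is the polynomial x^q, so convexity estimates are pointwise
    algebra and pass to sums over all weak derivatives without roots. As Om has finite measure,
    every p lies below such a q, and smallness in W^{2,q} gives smallness in W^{2,p}.

    Functions are approximated by averages over bisected cells: on each cell system such an average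
    takes finitely many values, and one bisection changes it by at most a side length times the
    average of one partial derivative. These increments, summed in L^2, give Rellich; summed
    pointwise with gradients in L^q, they give Morrey.

    Functions are representatives and not classes, so limits and values of [S] are identified only
    a.e. *)

Lemma cvgn_leP a (l : R) : a n @[n --> \oo] --> l <->
  forall e : R, 0 < e -> exists n0, forall n, (n0 <= n)%N -> `|a n - l| <= e.
Proof.
split.
  move=> /cvgrPdist_le al e e0; have [n0 _ h] := al e e0.
  by exists n0 => n /h; rewrite distrC.
move=> h; apply/cvgrPdist_le => e e0; have [n0 {}h] := h e e0.
by exists n0 => // n /h; rewrite distrC.
Qed.

Lemma cvgn_uniq a (l l' : R) : a n @[n --> \oo] --> l ->
  a n @[n --> \oo] --> l' -> l = l'.
Proof. by move=> /cvg_lim <-// /cvg_lim <-. Qed.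

Lemma cvgn_upper a (l M : R) : a n @[n --> \oo] --> l ->
  (forall n, a n <= M) -> l <= M.
Proof.
move=> al aM; rewrite -(cvg_lim _ al)//; apply: limr_le; last exact: nearW.
by apply/cvg_ex; exists l.
Qed.

Lemma cvgn_exprn a (l : R) m : a n @[n --> \oo] --> l ->
  a n ^+ m @[n --> \oo] --> l ^+ m.
Proof.
move=> al; elim: m => [|m ih]; first exact: cvg_cst.
rewrite exprS (_ : (fun n => _) = (fun n => a n * a n ^+ m)); last first.
  by apply/funext => n; rewrite exprS.
exact: cvgM.
Qed.

Lemma cauchy_seq_cvg a :
  (forall e : R, 0 < e -> exists n0, forall n m, (n0 <= n)%N -> (n0 <= m)%N ->
     `|a n - a m| <= e) -> cvgn a.
Proof.
move=> h; apply/cauchy_cvgP/cauchy_ballP => e e0; rewrite near_map2.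
have [n0 {}h] := h (e / 2) (divr_gt0 e0 (ltr0Sn R 1)).
exists ([set n | (n0 <= n)%N], [set n | (n0 <= n)%N]) => /=.
  by split; exists n0.
move=> [n m] [/= n0n n0m]; rewrite -ball_normE/=.
by apply: le_lt_trans (h _ _ n0n n0m) _; rewrite ltr_pdivrMr// ltr_pMr// ltr1n.
Qed.

Lemma expr_cvg0 (r : R) : 0 <= r < 1 ->
  forall e, 0 < e -> exists n0, forall n, (n0 <= n)%N -> r ^+ n <= e.
Proof.
move=> /andP[r0 r1] e e0.
have /cvgn_leP/(_ e e0)[n0 h] : r ^+ n @[n --> \oo] --> (0 : R).
  by apply: cvg_expr; rewrite ger0_norm.
by exists n0 => n /h; rewrite subr0 ger0_norm// exprn_ge0.
Qed.

Lemma sum_geometric_le (r : R) (m n : nat) : 0 <= r < 1 ->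
  \sum_(m <= i < n) r ^+ i <= r ^+ m / (1 - r).
Proof.
move=> /andP[r0 r1]; have r10 : 0 < 1 - r by rewrite subr_gt0.
have [nm|/ltnW mn] := leqP n m.
  by rewrite big_geq// divr_ge0 ?exprn_ge0// ltW.
rewrite ler_pdivlMr// mulrC mulr_sumr.
under eq_bigr => i _ do rewrite mulrBl mul1r -exprS.
rewrite (@telescope_sumr_eq _ m n (fun i => - r ^+ i))//.
  by rewrite opprK addrC gerBl exprn_ge0.
by move=> k _; rewrite opprK addrC.
Qed.

Lemma geometric_increments a (C r : R) : 0 <= r < 1 ->
  (forall k, `|a k.+1 - a k| <= C * r ^+ k) ->
  forall m n, (m <= n)%N -> `|a n - a m| <= C * (r ^+ m / (1 - r)).
Proof.
move=> r01 h m n mn.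
have C0 : 0 <= C by have := h 0%N; rewrite expr0 mulr1; apply: le_trans.
rewrite -telescope_sumr//; apply: le_trans (ler_norm_sum _ _ _) _.
apply: (@le_trans _ _ (\sum_(m <= i < n) C * r ^+ i)); first exact: ler_sum.
by rewrite -mulr_sumr ler_wpM2l// sum_geometric_le.
Qed.

Lemma geometric_increments_cvg a (C r : R) : 0 <= r < 1 ->
  (forall k, `|a k.+1 - a k| <= C * r ^+ k) -> cvgn a.
Proof.
move=> r01 h; apply: cauchy_seq_cvg => e e0.
have C0 : 0 <= C by have := h 0%N; rewrite expr0 mulr1; apply: le_trans.
have r1 : 0 < 1 - r by case/andP: r01 => ? ?; rewrite subr_gt0.
have C1 : 0 < C + 1 by rewrite ltr_wpDl.
have [n0 hn0] := expr_cvg0 r01 (divr_gt0 (mulr_gt0 e0 r1) C1).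
have H n m : (n0 <= m)%N -> (m <= n)%N -> `|a n - a m| <= e.
  move=> n0m mn; apply: le_trans (geometric_increments r01 h mn) _.
  rewrite mulrA ler_pdivrMr//.
  apply: (@le_trans _ _ ((C + 1) * r ^+ m)).
    by rewrite ler_wpM2r ?lerDl// exprn_ge0; case/andP: r01.
  by rewrite mulrC -ler_pdivlMr// hn0.
exists n0 => n m n0n n0m; have [mn|/ltnW nm] := leqP m n; first exact: H.
by rewrite distrC; exact: H.
Qed.

Lemma increasing_leq s : {homo s : m n / (m < n)%N} -> forall n, (n <= s n)%N.
Proof. by move=> hs; elim=> // n ih; apply: leq_ltn_trans ih _; exact: hs. Qed.

Lemma increasing_choice (P : nat -> nat -> Prop) :
  (forall k, exists n0, forall n, (n0 <= n)%N -> P k n) ->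
  exists s, {homo s : m n / (m < n)%N} /\ forall k, P k (s k).
Proof.
move=> /(_ _)/cid-/all_sig[N hN].
pose s := fix s k := if k is k'.+1 then maxn (s k').+1 (N k) else N 0%N.
exists s; split; last first.
  by move=> [|k]; apply: hN => //=; exact: leq_maxr.
apply: homo_ltn => [? ? ?|k /=]; first exact: ltn_trans.
by rewrite leq_max leqnn.
Qed.

Lemma increasing_choice_frequent (P : nat -> Prop) :
  (forall n0, exists2 n, (n0 <= n)%N & P n) ->
  exists s, {homo s : m n / (m < n)%N} /\ forall k, P (s k).
Proof.
move=> h.
have /(_ _)/cid-/all_sig[N hN] : forall n0, exists n, (n0 <= n)%N /\ P n.
  by move=> n0; have [n ? ?] := h n0; exists n.
pose s := fix s k := if k is k'.+1 then N (s k').+1 else N 0%N.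
exists s; split; last by move=> [|k] /=; case: (hN 0%N) => // ? ?; case: (hN (s k).+1).
by apply: homo_ltn => [? ? ?|k /=]; [exact: ltn_trans | case: (hN (s k).+1)].
Qed.

Lemma comp_increasing s t : {homo s : m n / (m < n)%N} ->
  {homo t : m n / (m < n)%N} -> {homo s \o t : m n / (m < n)%N}.
Proof. by move=> hs ht m n mn /=; exact/hs/ht. Qed.

(** Weaker than being a subsequence: the ranks [k] need not increase, and finitely many terms are
    free. It is what a diagonal sequence satisfies with respect to each stage, and it still
    transfers limits. *)
Definition almost_subseq s' s :=
  exists m, forall n, (m <= n)%N -> exists2 k, (n <= k)%N & s' n = s k.

Lemma almost_subseq_cvg (a : nat -> R) (l : R) s s' : almost_subseq s' s ->
  a (s n) @[n --> \oo] --> l -> a (s' n) @[n --> \oo] --> l.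
Proof.
move=> [m ss'] /cvgn_leP al; apply/cvgn_leP => e e0.
have [n0 h] := al e e0; exists (maxn m n0) => n; rewrite geq_max => /andP[mn nn].
by have [k nk ->] := ss' n mn; apply: h; exact: leq_trans nk.
Qed.

(** Cantor's diagonal argument. Stage [S j.+1] is extracted from [S j] so that [P j] holds, and
    [n |-> S n n] is an almost subsequence of every stage. *)
Lemma diagonal_subsequence (P : nat -> (nat -> nat) -> Prop) :
  (forall j s s', almost_subseq s' s -> P j s -> P j s') ->
  (forall j s, {homo s : m n / (m < n)%N} ->
     exists2 t, {homo t : m n / (m < n)%N} & P j (s \o t)) ->
  exists2 s, {homo s : m n / (m < n)%N} & forall j, P j s.
Proof.
move=> hsub hext.
(* Stated for every [s], increasing or not, so that the recursion defining the stages carries no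
   proof. *)
have H (j : nat) (s : nat -> nat) : exists t, {homo s : m n / (m < n)%N} ->
    {homo t : m n / (m < n)%N} /\ P j (s \o t).
  have [hs|nhs] := pselect {homo s : m n / (m < n)%N}; last by exists id.
  by have [t ht hP] := hext j s hs; exists t.
pose T j s := sval (cid (H j s)).
have hT j s : {homo s : m n / (m < n)%N} ->
    {homo T j s : m n / (m < n)%N} /\ P j (s \o T j s).
  by rewrite /T; case: cid.
pose S := fix S j := if j is j'.+1 then S j' \o T j' (S j') else id.
have hS j : {homo S j : m n / (m < n)%N}.
  elim: j => [|j ih] //=; apply: comp_increasing => //.
  by have [] := hT j _ ih.
have PS j : P j (S j.+1) by have [] := hT j _ (hS j).
have SS j i n : exists2 k, (n <= k)%N & S (j + i)%N n = S j k.
  elim: i n => [|i ih] n; first by rewrite addn0; exists n.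
  rewrite addnS /=; have [hTj _] := hT (j + i)%N _ (hS (j + i)%N).
  have [k nk ->] := ih (T (j + i)%N (S (j + i)%N) n).
  by exists k => //; apply: leq_trans nk; exact: increasing_leq.
exists (fun n => S n n).
  apply: homo_ltn => [? ? ?|n]; first exact: ltn_trans.
  have [hTn _] := hT n _ (hS n); rewrite /=.
  by apply: hS; apply: increasing_leq.
move=> j; apply: hsub (PS j); exists j.+1 => n jn.
by have := SS j.+1 (n - j.+1)%N n; rewrite subnKC.
Qed.

Lemma bounded_subsequence a (M : R) : (forall n, `|a n| <= M) ->
  exists2 s, {homo s : m n / (m < n)%N} & cvgn (a \o s).
Proof.
move=> aM; have [|s ns cs] := @bolzano_weierstrass _ a.
  by exists M; split; [exact: num_real | move=> x Mx n _; exact: le_trans (aM n) (ltW Mx)].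
by exists s => // m n mn; rewrite ltnNge; have := ns n m; rewrite !leEnat => ->; rewrite -ltnNge.
Qed.

End real_sequences.

(** * Inequalities between powers *)

Section power_inequalities.
Context (R : realType).
Implicit Types x y a b : R.

Lemma exprD_ge m x y : 0 <= x -> 0 <= y ->
  x ^+ m.+1 + y ^+ m.+1 <= (x + y) ^+ m.+1.
Proof.
move=> x0 y0; elim: m => [|m ih]; first by rewrite !expr1.
rewrite [leRHS]exprS; apply: le_trans (ler_wpM2l (addr_ge0 x0 y0) ih).
rewrite [x ^+ m.+2]exprS [y ^+ m.+2]exprS.
have := mulr_ge0 x0 (exprn_ge0 m.+1 y0).
have := mulr_ge0 y0 (exprn_ge0 m.+1 x0).
lra.
Qed.

(** The induction step is Chebyshev's inequality: x - y and x^{m+1} - y^{m+1} have the same sign, so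
    the mixed terms are dominated by the pure powers. *)
Lemma exprD_le m x y : 0 <= x -> 0 <= y ->
  (x + y) ^+ m.+1 <= 2 ^+ m * (x ^+ m.+1 + y ^+ m.+1).
Proof.
move=> x0 y0; elim: m => [|m ih]; first by rewrite !expr1 expr0 mul1r.
rewrite [leLHS]exprS; apply: le_trans (ler_wpM2l (addr_ge0 x0 y0) ih) _.
rewrite [x ^+ m.+2]exprS [y ^+ m.+2]exprS [2 ^+ m.+1]exprS.
set X := x ^+ m.+1; set Y := y ^+ m.+1.
have H : 0 <= (x - y) * (X - Y).
  have [xy|yx] := leP x y.
    by apply: mulr_le0; rewrite subr_le0 // lerXn2r.
  by apply: mulr_ge0; rewrite subr_ge0 ?lerXn2r ?nnegrE// ltW.
have := mulr_ge0 (exprn_ge0 m (ler0n R 2)) H; nra.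
Qed.

(** Exponents are always written [m.+1.*2], which is even and at least 2 for every [m]; the case
    [m = 0] stands for L^2. *)
Lemma even_expr_ge0 m x : 0 <= x ^+ m.+1.*2.
Proof. by rewrite exprn_even_ge0// odd_double. Qed.

Lemma even_exprE m x : x ^+ m.+1.*2 = (x ^+ 2) ^+ m.+1.
Proof. by rewrite -mul2n exprM. Qed.

Lemma even_expr_norm m x : `|x| ^+ m.+1.*2 = x ^+ m.+1.*2.
Proof. by rewrite !even_exprE real_normK// num_real. Qed.

(** Superadditivity of the power m+1 on the two squares, the parallelogram identity, then convexity.
    The constants multiply to 2^{m+1} 2^m = 2^{q-1} with q = 2(m+1). *)
Lemma clarkson m a b : (a + b) ^+ m.+1.*2 + (a - b) ^+ m.+1.*2 <=
  2 ^+ m.+1.*2.-1 * (a ^+ m.+1.*2 + b ^+ m.+1.*2).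
Proof.
rewrite !even_exprE; apply: le_trans (exprD_ge _ (sqr_ge0 _) (sqr_ge0 _)) _.
have -> : (a + b) ^+ 2 + (a - b) ^+ 2 = 2 * (a ^+ 2 + b ^+ 2) by ring.
have -> : m.+1.*2.-1 = (m.+1 + m)%N by lia.
rewrite exprMn exprD -mulrA ler_wpM2l ?exprn_ge0//.
by apply: exprD_le; exact: sqr_ge0.
Qed.

Lemma even_exprD_le m a b : (a + b) ^+ m.+1.*2 <=
  2 ^+ m.+1.*2.-1 * (a ^+ m.+1.*2 + b ^+ m.+1.*2).
Proof.
by apply: le_trans (clarkson m a b); rewrite lerDl even_expr_ge0.
Qed.

Lemma clarkson_half m a b : ((a + b) / 2) ^+ m.+1.*2 + ((a - b) / 2) ^+ m.+1.*2 <=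
  (a ^+ m.+1.*2 + b ^+ m.+1.*2) / 2.
Proof.
rewrite !expr_div_n -mulrDl ler_pdivrMr ?exprn_gt0//.
apply: le_trans (clarkson m a b) _; rewrite le_eqVlt; apply/orP; left; apply/eqP.
by rewrite doubleS /= [X in _ / 2 * X]exprS; field.
Qed.

(** The discriminant condition, with the degenerate case [c = 0] included. It gives Cauchy-Schwarz
    and, with [a = 0], the Euler-Lagrange equation of a quadratic energy. *)
Lemma quadratic_ge0 (a b c : R) : 0 <= c ->
  (forall t, 0 <= a + t * b *+ 2 + t ^+ 2 * c) -> b ^+ 2 <= a * c.
Proof.
move=> c0 h; have a0 : 0 <= a by have := h 0; lra.
move: c0; rewrite le_eqVlt => /predU1P[c0|c0]; last first.
  have := h (- b / c); have -> : a + - b / c * b *+ 2 + (- b / c) ^+ 2 * c =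
    (a * c - b ^+ 2) / c by field; rewrite gt_eqF.
  by rewrite pmulr_lge0 ?invr_gt0// subr_ge0.
rewrite -c0 mulr0 in h *; have [->|b0] := eqVneq b 0; first by rewrite expr0n.
have := h (- (a + 1) / b / 2); rewrite mulr0 addr0.
have -> : - (a + 1) / b / 2 * b *+ 2 = - (a + 1) by field.
lra.
Qed.

(** The graph of t^{m+1} lies above its tangent at [a], rearranged without subtraction. *)
Lemma tangent_power m (a t : R) : 0 <= a -> 0 <= t ->
  m.+1%:R * a ^+ m * t <= t ^+ m.+1 + m%:R * a ^+ m.+1.
Proof.
move=> a0 t0; elim: m => [|m ih]; first by rewrite expr0 expr1 mul0r addr0 !mul1r.
have H : 0 <= (t ^+ m.+1 - a ^+ m.+1) * (t - a).
  have [ta|/ltW at_] := leP t a.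
    by apply: mulr_le0; rewrite subr_le0 // lerXn2r.
  by apply: mulr_ge0; rewrite subr_ge0 // lerXn2r.
have := ler_wpM2l a0 ih; move: H; rewrite -!natr1 ![_ ^+ m.+2]exprS ![_ ^+ m.+1]exprS.
set X := a ^+ m; set Y := t ^+ m; nra.
Qed.

End power_inequalities.

(** * Integration, and L^q for even q as a set of functions *)

Section integrals.
Context d (T : measurableType d) (R : realType) (mu : {measure set T -> \bar R}).
Variables (D : set T) (mD : measurable D).
Implicit Types (f g h u v : T -> R).

Local Notation L1 f := (mu.-integrable D (EFin \o f)).
Local Notation I f := (Rintegral mu D f).

Lemma L1_measurable f : L1 f -> measurable_fun D f.
Proof. by move=> /measurable_int /measurable_EFinP. Qed.

Lemma L1_le f g : measurable_fun D f -> L1 g ->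
  (forall x, D x -> `|f x| <= g x) -> L1 f.
Proof.
move=> mf ig fg; apply: le_integrable ig => //; first exact/measurable_EFinP.
by move=> x Dx /=; rewrite lee_fin (le_trans (fg x Dx))// ler_norm.
Qed.

Lemma L1D f g : L1 f -> L1 g -> L1 (fun x => f x + g x).
Proof. by move=> hf hg; exact: (integrableD mD hf hg). Qed.

Lemma L1Z a f : L1 f -> L1 (fun x => a * f x).
Proof. by move=> hf; exact: (integrableZl mD a hf). Qed.

Lemma L1N f : L1 f -> L1 (fun x => - f x).
Proof. by move=> hf; exact: (integrableN hf). Qed.

Lemma L1B f g : L1 f -> L1 g -> L1 (fun x => f x - g x).
Proof. by move=> hf hg; exact: (integrableB mD hf hg). Qed.

Lemma L1_norm f : L1 f -> L1 (fun x => `|f x|).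
Proof. exact: integrable_norm. Qed.

Lemma L1_0 : L1 (fun=> 0).
Proof. exact: integrable0. Qed.

Lemma L1_sum (J : Type) (s : seq J) (F : J -> T -> R) :
  (forall j, L1 (F j)) -> L1 (fun x => \sum_(j <- s) F j x).
Proof.
move=> hF; elim: s => [|j s ih].
  by under [X in _.-integrable _ X]eq_fun do rewrite /= big_nil; exact: L1_0.
under [X in _.-integrable _ X]eq_fun do rewrite /= big_cons.
exact: L1D.
Qed.

Lemma I_sum (J : Type) (s : seq J) (F : J -> T -> R) :
  (forall j, L1 (F j)) ->
  I (fun x => \sum_(j <- s) F j x) = \sum_(j <- s) I (F j).
Proof.
move=> hF; elim: s => [|j s ih].
  under eq_Rintegral do rewrite big_nil.
  by rewrite Rintegral_cst// mul0r big_nil.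
under eq_Rintegral do rewrite big_cons.
by rewrite RintegralD ?ih ?big_cons//; exact: L1_sum.
Qed.

Lemma IN f : L1 f -> I (fun x => - f x) = - I f.
Proof.
move=> hf; under eq_Rintegral do rewrite -mulN1r.
by rewrite RintegralZl// mulN1r.
Qed.

Lemma I_EFin f : L1 f -> (I f)%:E = (\int[mu]_(x in D) (f x)%:E)%E.
Proof. by move=> hf; rewrite fineK//; exact: integrable_fin_num. Qed.

Lemma ae_L1 f g : measurable_fun D g -> f = g %[ae mu in D] -> L1 f -> L1 g.
Proof.
move=> mg fg /integrableP[mf foo]; apply/integrableP; split.
  exact/measurable_EFinP.
suff <- : (\int[mu]_(x in D) `|(EFin \o f) x| =
          \int[mu]_(x in D) `|(EFin \o g) x|)%E by [].
apply: ae_eq_integral => //.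
- exact: measurableT_comp.
- by apply: measurableT_comp => //; exact/measurable_EFinP.
- by apply: filterS fg => x h Dx /=; rewrite h.
Qed.

Lemma ae_I f g : measurable_fun D f -> measurable_fun D g ->
  f = g %[ae mu in D] -> I f = I g.
Proof.
move=> mf mg fg; congr fine; apply: ae_eq_integral => //;
  [exact/measurable_EFinP|exact/measurable_EFinP|].
by apply: filterS fg => x h Dx /=; rewrite h.
Qed.

Lemma L1_le_ae f g : measurable_fun D f -> L1 g ->
  {ae mu, forall x, D x -> `|f x| <= g x} -> L1 f.
Proof.
move=> mf ig fg; apply/integrableP; split; first exact/measurable_EFinP.
case/integrableP: ig => mg; apply: le_lt_trans.
apply: ae_ge0_le_integral => //.
- by apply: measurableT_comp => //; exact/measurable_EFinP.
- exact: measurableT_comp.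
- apply: filterS fg => x h Dx /=.
  by rewrite lee_fin; apply: le_trans (h Dx) (ler_norm _).
Qed.

Lemma I_le_ae f g : L1 f -> L1 g -> {ae mu, forall x, D x -> f x <= g x} ->
  I f <= I g.
Proof.
move=> hf hg fg.
have mf := L1_measurable hf; have mg := L1_measurable hg.
(* [f] agrees a.e. with min(f, g), which lies below [g] everywhere. *)
have hm : L1 (fun x => Num.min (f x) (g x)).
  apply: L1_le (L1D (L1_norm hf) (L1_norm hg)) _.
    exact: measurable_minr.
  move=> x _; rewrite minEle; case: ifP => _; first by rewrite lerDl.
  by rewrite lerDr.
rewrite (@ae_I f (fun x => Num.min (f x) (g x)))//.
- by apply: le_Rintegral => // x _; rewrite ge_min lexx orbT.
- exact: L1_measurable.
- by apply: filterS fg => x h Dx; rewrite min_l// h.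
Qed.

Lemma I_eq0_ae f : L1 f -> (forall x, D x -> 0 <= f x) -> I f = 0 ->
  {ae mu, forall x, D x -> f x = 0}.
Proof.
move=> hf f0 If0.
have /ae_eq_integral_abs h : measurable_fun D (EFin \o f).
  exact/measurable_EFinP/L1_measurable.
have /(h mu mD) : (\int[mu]_(x in D) `|(EFin \o f) x| = 0)%E.
  rewrite -[RHS](congr1 EFin If0) I_EFin//; apply: eq_integral => x /set_mem Dx.
  by rewrite gee0_abs// lee_fin f0.
by apply: filterS => x hx /hx [].
Qed.

Lemma I_dct (f_ : nat -> T -> R) f g :
  (forall n, measurable_fun D (f_ n)) -> measurable_fun D f -> L1 g ->
  {ae mu, forall x, D x -> f_ n x @[n --> \oo] --> f x} ->
  (forall n, {ae mu, forall x, D x -> `|f_ n x| <= g x}) ->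
  L1 f /\ I (f_ n) @[n --> \oo] --> I f.
Proof.
move=> mf_ mf ig ff fg.
have [|||||hf _ h] := @dominated_convergence _ _ _ mu D mD
    (fun n => EFin \o f_ n) (EFin \o f) (EFin \o g).
- by move=> n; exact/measurable_EFinP.
- exact/measurable_EFinP.
- by apply: filterS ff => x h Dx; apply: cvg_EFin; [exact: nearW|exact: h].
- exact: ig.
- have := ae_foralln fg; apply: filterS => x h n Dx.
  by rewrite lee_fin; exact: h.
split=> //; apply: fine_cvg; rewrite fineK //.
exact: integrable_fin_num.
Qed.

Lemma I_fatou (f_ : nat -> T -> R) f (M : R) :
  (forall n, L1 (f_ n)) -> (forall n x, D x -> 0 <= f_ n x) ->
  measurable_fun D f ->
  {ae mu, forall x, D x -> f_ n x @[n --> \oo] --> f x} ->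
  (forall n, I (f_ n) <= M) -> L1 f /\ I f <= M.
Proof.
move=> hf_ f0 mf ff IM.
have M0 : 0 <= M by apply: le_trans (IM 0%N); apply: Rintegral_ge0 => x; exact: f0.
have H : (\int[mu]_(x in D) `|(EFin \o f) x| <= M%:E)%E.
  have mEf_ n : measurable_fun D (EFin \o f_ n).
    exact/measurable_EFinP/L1_measurable.
  have := fatou mu mD mEf_ (fun n x Dx => f0 n x Dx).
  rewrite (@ae_eq_integral _ _ _ mu _ (fun x => `|(EFin \o f) x|%E))//.
  - move/le_trans; apply; rewrite limn_einf_lim.
    apply: lime_le; first exact: is_cvg_einfs.
    apply: nearW => n; apply: ge_ereal_inf.
    exists (\int[mu]_(x in D) (f_ n x)%:E)%E; first by exists n => /=.
    by rewrite -I_EFin// lee_fin.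
  - apply: (@measurableT_comp _ _ _ _ _ _ -%E) => //.
    by apply: measurable_fun_limn_esup => n; exact: measurableT_comp.
  - by apply: measurableT_comp => //; exact/measurable_EFinP.
  - apply: filterS ff => x h Dx /=.
    have hx : (EFin \o f_ n) x @[n --> \oo] --> (f x)%:E.
      by apply: cvg_EFin; [exact: nearW|exact: h].
    rewrite is_cvg_limn_einfE; last by apply/cvg_ex; eexists; exact: hx.
    rewrite (cvg_lim _ hx)// ger0_norm//.
    have := h Dx => /cvgn_leP hh; rewrite leNgt; apply/negP => fx0.
    have [n0 /(_ n0 (leqnn _))] := hh (- f x / 2) ltac:(by rewrite divr_gt0 ?oppr_gt0).
    have := f0 n0 x Dx; rewrite ler_norml => ? /andP[_]; lra.
have hf : L1 f.
  apply/integrableP; split; first exact/measurable_EFinP.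
  by apply: le_lt_trans H _; rewrite ltry.
split => //; rewrite -lee_fin; apply: le_trans H.
by rewrite I_EFin//; apply: le_integral => //; [exact: integrable_abse|move=> x _; rewrite /= lee_fin ler_norm].
Qed.

(** Borel-Cantelli in integral form: the sum of the series is integrable, hence finite a.e., and it
    dominates each term. *)
Lemma ae_bounded_of_summable (f_ : nat -> T -> R) :
  (forall k, L1 (f_ k)) -> (forall k x, D x -> 0 <= f_ k x) ->
  (forall k, I (f_ k) <= 2^-1 ^+ k) ->
  {ae mu, forall x, D x -> exists C, forall k, f_ k x <= C}.
Proof.
move=> hf f0 hI.
have mf k : measurable_fun D (EFin \o f_ k).
  exact/measurable_EFinP/L1_measurable.
pose F x := (\sum_(0 <= k <oo) (EFin \o f_ k) x)%E.
have F0 x : D x -> (0 <= F x)%E.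
  by move=> Dx; apply: nneseries_ge0 => k _ _; rewrite lee_fin f0.
have hF : mu.-integrable D F.
  apply/integrableP; split.
    by apply: ge0_emeasurable_sum => // k x Dx _; rewrite lee_fin f0.
  rewrite (_ : (\int[mu]_(x in D) `|F x|)%E = (\int[mu]_(x in D) F x)%E); last first.
    by apply: eq_integral => x /set_mem Dx; rewrite gee0_abs// F0.
  rewrite integral_nneseries//.
  apply: (@le_lt_trans _ _ (2%:E)); last exact: ltry.
  apply: lime_le.
    apply: is_cvg_nneseries => k _ _; apply: integral_ge0 => x Dx.
    by rewrite lee_fin f0.
  apply: nearW => n.
  rewrite (eq_bigr (fun k => (I (f_ k))%:E)); last by move=> k _; rewrite I_EFin.
  rewrite sumEFin lee_fin; apply: (@le_trans _ _ (\sum_(0 <= k < n) 2^-1 ^+ k)).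
    by apply: ler_sum => k _.
  apply: le_trans (sum_geometric_le _ _ _) _; first lra.
  by rewrite expr0 mul1r [X in X - _]splitr !div1r addrK invrK.
have := integrable_ae mD hF; apply: filterS => x h Dx.
exists (fine (F x)) => k; rewrite -lee_fin fineK ?h//.
rewrite /F (@nneseriesD1 _ _ k xpredT)//; last by move=> j _; rewrite lee_fin f0.
by rewrite leeDl// nneseries_ge0// => j _ _; rewrite lee_fin f0.
Qed.

(** Multiplication by the indicator of the complement of a measurable null set makes the sequence
    converge everywhere on [D], so that the limit is measurable without completeness of the
    measure. *)
Lemma ae_limit (u_ : nat -> T -> R) : (forall n, measurable_fun D (u_ n)) ->
  {ae mu, forall x, D x -> cvgn (u_ ^~ x)} ->
  exists2 u : T -> R, measurable_fun D u &
    {ae mu, forall x, D x -> u_ n x @[n --> \oo] --> u x}.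
Proof.
move=> mu_ [N [mN N0 sN]].
pose h n x := u_ n x * \1_(~` N) x.
have hE n x : ~ N x -> h n x = u_ n x.
  by move=> nNx; rewrite /h indicE mem_set ?mulr1.
have h0 n x : N x -> h n x = 0.
  by move=> Nx; rewrite /h indicE memNset ?mulr0//; apply.
have ch x : D x -> cvgn (h ^~ x).
  move=> Dx; have [Nx|nNx] := pselect (N x).
    by rewrite (_ : h ^~ x = cst 0) //; [exact: is_cvg_cst|apply/funext => n; rewrite h0].
  rewrite (_ : h ^~ x = u_ ^~ x); last by apply/funext => n; rewrite hE.
  by apply: contrapT => nc; apply: nNx; apply: sN => /= /(_ Dx).
exists (fun x => lim (h ^~ x @ \oo)).
  apply: (@measurable_fun_cvg _ _ _ D h) => [n|x Dx].
    by apply: measurable_funM => //; apply: measurable_indic; exact: measurableC.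
  exact: ch.
exists N; split => // x /= /not_implyP[Dx nx]; apply: contrapT => nNx; apply: nx.
by have := ch x Dx; rewrite (_ : h ^~ x = u_ ^~ x)//; apply/funext => n; rewrite hE.
Qed.

Definition Lev m f := measurable_fun D f /\ L1 (fun x => f x ^+ m.+1.*2).

Lemma Lev_ae m f g : measurable_fun D g -> f = g %[ae mu in D] -> Lev m f -> Lev m g.
Proof.
move=> mg fg [mf hf]; split => //; apply: ae_L1 hf; first exact: measurable_funX.
by apply: filterS fg => x h Dx; rewrite h.
Qed.

Lemma LevZ m a f : Lev m f -> Lev m (fun x => a * f x).
Proof.
move=> [mf hf]; split; first exact: measurable_funM.
by under [X in _.-integrable _ X]eq_fun do rewrite /= exprMn; exact: L1Z.
Qed.

Lemma LevD m f g : Lev m f -> Lev m g -> Lev m (fun x => f x + g x).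
Proof.
move=> [mf hf] [mg hg]; split; first exact: measurable_funD.
apply: L1_le (L1Z (2 ^+ m.+1.*2.-1) (L1D hf hg)) _.
  by apply: measurable_funX; exact: measurable_funD.
by move=> x _; rewrite ger0_norm ?even_expr_ge0//; exact: even_exprD_le.
Qed.

Lemma LevB m f g : Lev m f -> Lev m g -> Lev m (fun x => f x - g x).
Proof.
move=> hf hg; have := LevD hf (LevZ (- 1) hg).
by under eq_fun do rewrite mulN1r.
Qed.

Lemma Lev0_mul f g : Lev 0 f -> Lev 0 g -> L1 (fun x => f x * g x).
Proof.
move=> [mf hf] [mg hg]; apply: L1_le (L1D hf hg) _; first exact: measurable_funM.
move=> x _; rewrite ler_norml; apply/andP; split.
  by have := sqr_ge0 (f x + g x); have := sqr_ge0 (f x); have := sqr_ge0 (g x); nra.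
by have := sqr_ge0 (f x - g x); have := sqr_ge0 (f x); have := sqr_ge0 (g x); nra.
Qed.

Lemma cauchy_schwarz f g : Lev 0 f -> Lev 0 g ->
  (I (fun x => f x * g x)) ^+ 2 <= I (fun x => f x ^+ 2) * I (fun x => g x ^+ 2).
Proof.
move=> hf hg; apply: quadratic_ge0; first by apply: Rintegral_ge0 => x _; exact: sqr_ge0.
move=> t; have hfg := Lev0_mul hf hg.
case: hf => mf hf; case: hg => mg hg.
have -> : I (fun x => f x ^+ 2) + t * I (fun x => f x * g x) *+ 2 +
    t ^+ 2 * I (fun x => g x ^+ 2) = I (fun x => (f x + t * g x) ^+ 2).
  rewrite -mulrnAl -RintegralZl// -[t ^+ 2 * _]RintegralZl//.
  rewrite -RintegralD//; last exact: L1Z.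
  rewrite -RintegralD//; [|by apply: L1D => //; exact: L1Z|exact: L1Z].
  by apply: eq_Rintegral => x _; ring.
by apply: Rintegral_ge0 => x _; exact: sqr_ge0.
Qed.

Definition norm2 f := Num.sqrt (I (fun x => f x ^+ 2)).

Lemma norm2_ge0 f : 0 <= norm2 f. Proof. exact: sqrtr_ge0. Qed.

Lemma I_sqr_ge0 f : 0 <= I (fun x => f x ^+ 2).
Proof. by apply: Rintegral_ge0 => x _; exact: sqr_ge0. Qed.

Lemma sqr_norm2 f : norm2 f ^+ 2 = I (fun x => f x ^+ 2).
Proof. by rewrite sqr_sqrtr// I_sqr_ge0. Qed.

Lemma cauchy_schwarz_norm2 f g : Lev 0 f -> Lev 0 g ->
  `|I (fun x => f x * g x)| <= norm2 f * norm2 g.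
Proof.
move=> hf hg; rewrite -sqrtrM ?I_sqr_ge0// -sqrtr_sqr.
by apply: ler_wsqrtr; exact: cauchy_schwarz.
Qed.

Lemma norm2D f g : Lev 0 f -> Lev 0 g ->
  norm2 (fun x => f x + g x) <= norm2 f + norm2 g.
Proof.
move=> hf hg; rewrite -(@ler_pXn2r _ 2)// ?nnegrE ?addr_ge0 ?norm2_ge0//.
rewrite sqr_norm2 sqrrD !sqr_norm2.
have := cauchy_schwarz_norm2 hf hg; rewrite ler_norml => /andP[_ h].
have hfg := Lev0_mul hf hg; case: hf => mf hf; case: hg => mg hg.
have -> : I (fun x => (f x + g x) ^+ 2) =
    I (fun x => f x ^+ 2) + 2 * I (fun x => f x * g x) + I (fun x => g x ^+ 2).
  rewrite -RintegralZl// -RintegralD//; last exact: L1Z.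
  rewrite -RintegralD//; last by apply: L1D => //; exact: L1Z.
  by apply: eq_Rintegral => x _; ring.
by move: h; set A := norm2 f * _; lra.
Qed.

(** Along a subsequence the integrals are at most 4^{-k}. Weighted by 2^k they remain summable, so
    2^k |u_{s k} - u|^q is bounded in k at almost every point, which forces convergence there. *)
Lemma cvg_Lev_ae m (u_ : nat -> T -> R) u : (forall n, Lev m (u_ n)) -> Lev m u ->
  I (fun x => (u_ n x - u x) ^+ m.+1.*2) @[n --> \oo] --> 0 ->
  exists2 s, {homo s : m n / (m < n)%N} &
    {ae mu, forall x, D x -> u_ (s n) x @[n --> \oo] --> u x}.
Proof.
move=> hu_ hu /cvgn_leP hc.
pose e k : R := 2^-1 ^+ k * 2^-1 ^+ k.
have e0 k : 0 < e k by rewrite mulr_gt0 ?exprn_gt0.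
have [k|s [hs hP]] := @increasing_choice (fun k n =>
    `|I (fun x => (u_ n x - u x) ^+ m.+1.*2) - 0| <= e k).
  exact: hc.
exists s => //.
pose f k x := 2 ^+ k * (u_ (s k) x - u x) ^+ m.+1.*2.
have hd k : L1 (fun x => (u_ (s k) x - u x) ^+ m.+1.*2) by case: (LevB (hu_ (s k)) hu).
have : {ae mu, forall x, D x -> exists C, forall k, f k x <= C}.
apply: ae_bounded_of_summable; last first.
- move=> k; have := hP k; rewrite subr0 => /(le_trans (ler_norm _)) h.
  rewrite RintegralZl//; apply: le_trans (ler_wpM2l (exprn_ge0 _ _) h) _ => //.
  by rewrite /e mulrA -exprMn divff// expr1n mul1r.
- by move=> k x _; apply: mulr_ge0; [exact: exprn_ge0|exact: even_expr_ge0].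
- by move=> k; exact: L1Z.
apply: filterS => x h Dx; have [C hC] := h Dx.
apply/cvgn_leP => r r0.
have C0 : 0 <= C by apply: le_trans (hC 0%N); apply: mulr_ge0; [exact: exprn_ge0|exact: even_expr_ge0].
have [] := @expr_cvg0 R 2^-1 _ (r ^+ m.+1.*2 / (C + 1)); first by apply/andP; split; lra.
  by rewrite divr_gt0 ?exprn_gt0// ltr_wpDl.
move=> n0 h0; exists n0 => n n0n.
rewrite -(@ler_pXn2r _ m.+1.*2) ?nnegrE ?(ltW r0)//.
have {}h0 := h0 n n0n; rewrite ler_pdivlMr ?ltr_wpDl// in h0.
rewrite even_expr_norm; apply: le_trans h0.
have := hC n; rewrite /f -(@ler_pM2l _ (2^-1 ^+ n)) ?exprn_gt0//.
rewrite mulrA -exprMn mulVf// expr1n mul1r => /le_trans; apply.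
by rewrite ler_wpM2l ?exprn_ge0// lerDl.
Qed.

Lemma riesz_fischer m (u_ : nat -> T -> R) : (forall n, Lev m (u_ n)) ->
  (forall e : R, 0 < e -> exists n0, forall i j, (n0 <= i)%N -> (n0 <= j)%N ->
    I (fun x => (u_ i x - u_ j x) ^+ m.+1.*2) <= e) ->
  exists2 u, Lev m u &
    I (fun x => (u_ n x - u x) ^+ m.+1.*2) @[n --> \oo] --> 0.
Proof.
move=> hu_ hc.
pose e k : R := 2^-1 ^+ k * (4^-1 ^+ k) ^+ m.+1.*2.
(* The second factor of [e k] absorbs the weight 4^k put on the increments before the q-th power;
   the first one, 2^{-k}, keeps the result summable. *)
have e0 k : 0 < e k by rewrite mulr_gt0 ?exprn_gt0.
have [k|s [hs hP]] := @increasing_choice (fun k n =>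
    forall j, (n <= j)%N -> I (fun x => (u_ n x - u_ j x) ^+ m.+1.*2) <= e k).
  have [n0 h] := hc _ (e0 k); exists n0 => n nn0 j nj.
  by apply: h => //; exact: leq_trans nj.
pose f k x := (4 ^+ k * (u_ (s k) x - u_ (s k.+1) x)) ^+ m.+1.*2.
have hd i j : L1 (fun x => (u_ i x - u_ j x) ^+ m.+1.*2) by case: (LevB (hu_ i) (hu_ j)).
have aec : {ae mu, forall x, D x -> cvgn (fun n => u_ (s n) x)}.
  have : {ae mu, forall x, D x -> exists C, forall k, f k x <= C}.
  apply: ae_bounded_of_summable; last first.
  - move=> k; have := hP k (s k.+1) (ltnW (hs _ _ (ltnSn k))) => h.
    under eq_Rintegral do rewrite /f exprMn.
    rewrite RintegralZl//.
    apply: le_trans (ler_wpM2l (exprn_ge0 _ _) h) _ => //.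
    by rewrite /e mulrCA -exprMn -exprMn divff// !expr1n mulr1.
  - by move=> k x _; rewrite even_expr_ge0.
  - move=> k; under [X in _.-integrable _ X]eq_fun do rewrite /= /f exprMn.
    exact: L1Z.
  apply: filterS => x h Dx; have [C hC] := h Dx.
  (* max(1, C) is at most its own q-th power, so it bounds the q-th root of [C] without a root being
     taken. *)
  have C1 : 1 <= Num.max 1 C by rewrite le_max lexx.
  apply: (@geometric_increments_cvg _ _ (Num.max 1 C) 4^-1).
    by apply/andP; split; lra.
  move=> k; have : `|4 ^+ k * (u_ (s k) x - u_ (s k.+1) x)| <= Num.max 1 C.
    rewrite -(@ler_pXn2r _ m.+1.*2) ?nnegrE ?(le_trans ler01 C1)//.
    rewrite even_expr_norm; apply: le_trans (hC k) _.
    apply: (@le_trans _ _ (Num.max 1 C)); first by rewrite le_max lexx orbT.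
    by rewrite ler_eXnr.
  rewrite normrM ger0_norm ?exprn_ge0// distrC => h'.
  by rewrite exprVn ler_pdivlMr ?exprn_gt0// mulrC.
have [u mu_ hu] := ae_limit (fun n => (hu_ (s n)).1) aec.
(* Fatou in the second index, along the a.e. convergent subsequence shifted so that its indices are
   at least [n0]. *)
have H r n0 n : (forall j, (n0 <= j)%N ->
    I (fun x => (u_ n x - u_ j x) ^+ m.+1.*2) <= r) ->
    L1 (fun x => (u_ n x - u x) ^+ m.+1.*2) /\
    I (fun x => (u_ n x - u x) ^+ m.+1.*2) <= r.
  move=> h; apply: (@I_fatou (fun k x => (u_ n x - u_ (s (n0 + k)%N) x) ^+ m.+1.*2)).
  - by move=> k; exact: hd.
  - by move=> k x _; rewrite even_expr_ge0.
  - by apply: measurable_funX; apply: measurable_funB => //; case: (hu_ n).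
  - apply: filterS hu => x hx Dx.
    have hx' : u_ (s (n0 + k)%N) x @[k --> \oo] --> u x.
      rewrite (_ : (fun k => _) = (fun k => u_ (s (k + n0)%N) x)); last first.
        by apply/funext => k; rewrite addnC.
      by rewrite (cvg_shiftn n0 (fun k => u_ (s k) x)); exact: hx.
    by apply: cvgn_exprn; apply: cvgB => //; exact: cvg_cst.
  - by move=> k; apply: h; apply: leq_trans (leq_addr k n0) (increasing_leq hs _).
have [n0 hn0] := hc 1 ltr01.
have Lu : Lev m u.
  have [h _] := H 1 n0 n0 (fun j hj => hn0 _ _ (leqnn _) hj).
  have hL : Lev m (fun x => u_ n0 x - u x).
    by split => //; apply: measurable_funB => //; case: (hu_ n0).
  have := LevB (hu_ n0) hL.
  by under [X in Lev _ X -> _]eq_fun do rewrite opprB addrC subrK.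
exists u => //; apply/cvgn_leP => r r0; have [n1 hn1] := hc r r0.
exists n1 => n n1n; rewrite subr0 ger0_norm; last first.
  by apply: Rintegral_ge0 => x _; exact: even_expr_ge0.
by have [] := H r n1 n (fun j hj => hn1 _ _ n1n hj).
Qed.

End integrals.

(** * Iterated midpoints and uniform convexity *)

Section midpoint_hull.
Context (R : realType) (V : lmodType R).
Implicit Types (u : nat -> V) (C X : set V) (Phi : V -> R).

Definition midpoint_closed C := forall a b, C a -> C b -> C (2^-1 *: (a + b)).

(* The set of iterated midpoints of [u k], [k >= n]. *)
Definition tail_hull u n : set V := fun z =>
  forall C, midpoint_closed C -> (forall k, (n <= k)%N -> C (u k)) -> C z.

Lemma tail_hull_gen u n k : (n <= k)%N -> tail_hull u n (u k).
Proof. by move=> nk C _; exact. Qed.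

Lemma tail_hull_mid u n : midpoint_closed (tail_hull u n).
Proof.
by move=> a b ha hb C mC hC; apply: (mC); [apply: ha|apply: hb].
Qed.

Lemma tail_hull_le u n m : (n <= m)%N -> tail_hull u m `<=` tail_hull u n.
Proof.
by move=> nm z hz C mC hC; apply: (hz) => // k mk; apply: hC; exact: leq_trans mk.
Qed.

(* The elements of almost minimal [Phi] in the tail hulls form a Cauchy sequence. *)
Lemma cauchy_tail_hull (X : set V) Phi u (M : R) : midpoint_closed X ->
  (forall a, 0 <= Phi a) ->
  (forall a b, X a -> X b -> Phi (2^-1 *: (a + b)) + Phi (2^-1 *: (a - b)) <=
     (Phi a + Phi b) / 2) ->
  (forall n, X (u n)) -> (forall n, Phi (u n) <= M) ->
  exists2 z, forall n, tail_hull u n (z n) &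
    forall e : R, 0 < e -> exists n0, forall i j, (n0 <= i)%N -> (n0 <= j)%N ->
      Phi (2^-1 *: (z i - z j)) <= e.
Proof.
move=> mX Phi0 hPhi Xu PhiM.
pose al n := inf (Phi @` tail_hull u n).
have hi n : has_inf (Phi @` tail_hull u n).
  split; first by exists (Phi (u n)), (u n) => //; exact: tail_hull_gen.
  by exists 0 => _ [z _ <-].
have al_le n z : tail_hull u n z -> al n <= Phi z.
  by move=> hz; apply: ge_inf; [case: (hi n)|exists z].
have alM n : al n <= M by apply: le_trans (PhiM n); apply: al_le; exact: tail_hull_gen.
have al_nd i j : (i <= j)%N -> al i <= al j.
  move=> ij; apply: lb_le_inf; first by case: (hi j).
  by move=> _ [z hz <-]; apply: al_le; exact: tail_hull_le hz.
have hs : has_sup (range al) by split; [exists (al 0%N), 0%N|exists M => _ [n _ <-]].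
have /(_ _)/cid2-/all_sig2[z hz hzPhi] : forall n, exists2 z, tail_hull u n z &
    Phi z <= al n + n.+1%:R^-1.
  move=> n; have [|_ [z hz <-] lt] := @inf_adherent _ (Phi @` tail_hull u n) n.+1%:R^-1 _ (hi n).
    by rewrite invr_gt0.
  by exists z => //; exact: ltW.
have Xz n : X (z n) by apply: hz.
exists z => // e e0; have e20 : 0 < e / 2 by rewrite divr_gt0.
have [_ [n0 _ <-] hn0] := sup_adherent e20 hs.
have [n1 _ hn1] := near_infty_natSinv_lt (PosNum e20).
have H i j : (maxn n0 n1 <= i)%N -> (i <= j)%N ->
    Phi (2^-1 *: (z i - z j)) <= e /\ Phi (2^-1 *: (z j - z i)) <= e.
  rewrite geq_max => /andP[n0i n1i] ij.
  have := hPhi _ _ (Xz i) (Xz j); have := hPhi _ _ (Xz j) (Xz i).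
  (* The midpoint still lies in the hull of the tail from [i], so the parallelogram inequality
     leaves for the half difference only the gap between the infima and the tolerances. The infima
     increase and are bounded, so the gap tends to zero. *)
  have : al i <= Phi (2^-1 *: (z i + z j)).
    by apply: al_le; apply: tail_hull_mid => //; exact: tail_hull_le (hz j).
  rewrite [z j + z i]addrC.
  have := hzPhi i; have := hzPhi j.
  have : al j <= sup (range al) by apply: ub_le_sup; [case: hs|exists j].
  have := al_nd _ _ n0i; have := hn1 _ n1i; have := hn1 _ (leq_trans n1i ij) => /=.
  move: hn0; set s := sup _; set x := i.+1%:R^-1; set y := j.+1%:R^-1.
  by move=> *; split; lra.
exists (maxn n0 n1) => i j hi' hj'.
by have [ij|/ltnW ji] := leqP i j; [case: (H i j)|case: (H j i)].
Qed.

End midpoint_hull.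

(** * Boxes, Lebesgue measure and test functions *)

Section boxes.
Context (R : realType) (n : nat).
Local Notation E := 'rV[R]_n.
Implicit Types (a b x : E) (A U : set E).

Definition rbox (F : 'I_n -> set R) : set E := [set x | forall i, F i (x ord0 i)].
Definition obox a b := rbox (fun i => `]a ord0 i, b ord0 i[%classic).
Definition cbox a b := rbox (fun i => `[a ord0 i, b ord0 i]%classic).
Definition hbox a b := rbox (fun i => `[a ord0 i, b ord0 i[%classic).

Lemma obox_cbox a b : obox a b `<=` cbox a b.
Proof. by move=> x h i; apply: subset_itv_oo_cc; exact: h. Qed.

Lemma hbox_cbox a b : hbox a b `<=` cbox a b.
Proof. by move=> x h i; apply: subset_itv_co_cc; exact: h. Qed.

Lemma obox_hbox a b : obox a b `<=` hbox a b.
Proof. by move=> x h i; apply: subset_itv_oo_co; exact: h. Qed.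

Lemma obox_setI a b c d : obox a b `&` obox c d =
  obox (\row_i Num.max (a ord0 i) (c ord0 i)) (\row_i Num.min (b ord0 i) (d ord0 i)).
Proof.
apply/seteqP; split=> x /=.
  move=> [h1 h2] i; have := h1 i; have := h2 i; rewrite /= !in_itv/= !mxE.
  by rewrite gt_max lt_min => /andP[-> ->] /andP[-> ->].
by move=> h; split=> i; have := h i; rewrite /= !in_itv/= !mxE gt_max lt_min
  => /andP[/andP[? ?] /andP[? ?]]; apply/andP.
Qed.

Lemma rV_ballE (x y : E) (e : R) : 0 < e ->
  ball x e y <-> forall i, `|x ord0 i - y ord0 i| < e.
Proof.
move=> e0; split.
  by move=> [_ h] i; have := h ord0 i; rewrite -ball_normE.
by move=> h; split=> // i j; rewrite (ord1 i) -ball_normE; exact: h.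
Qed.

Lemma rV_norm_coord (x : E) i : `|x ord0 i| <= `|x|.
Proof.
rewrite [leRHS]mx_normrE; apply: le_trans (le_bigmax _ _ (ord0, i)) => //=.
Qed.

Lemma measurable_rbox (F : 'I_n -> set R) : (forall i, measurable (F i)) ->
  measurable (rbox F).
Proof.
move=> mF; rewrite (_ : rbox F = \bigcap_(i in [set: 'I_n])
    ((fun x : E => x ord0 i) @^-1` (F i))); last first.
  by apply/seteqP; split=> x /= h i; [move=> _|]; exact: h.
apply: fin_bigcap_measurable => // i _.
by have := @measurable_rV_coord R n i measurableT (F i) (mF i); rewrite setTI.
Qed.

Lemma measurable_obox a b : measurable (obox a b).
Proof. by apply: measurable_rbox => i; exact: measurable_itv. Qed.

Lemma measurable_cbox a b : measurable (cbox a b).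
Proof. by apply: measurable_rbox => i; exact: measurable_itv. Qed.

Lemma measurable_hbox a b : measurable (hbox a b).
Proof. by apply: measurable_rbox => i; exact: measurable_itv. Qed.

Lemma compact_cbox a b : compact (cbox a b).
Proof. by apply: rV_compact => i; exact: segment_compact. Qed.

(** Cubes with rational centre and side 2/(k+1), restricted to those whose closure lies in [U]. All
    sides of one cube are equal because the bisection estimates start from a cube. *)
Lemma open_cube_cover U : open U -> exists (P : set nat) (F : nat -> E * E),
  (forall k, P k -> cbox (F k).1 (F k).2 `<=` U /\ exists2 h : R, 0 < h &
     forall i, (F k).2 ord0 i - (F k).1 ord0 i = h) /\
  U = \bigcup_(k in P) obox (F k).1 (F k).2.
Proof.
move=> oU.
pose G (p : 'rV[rat]_n * nat) : E * E :=
  ((\row_i (ratr (p.1 ord0 i) - p.2.+1%:R^-1), \row_i (ratr (p.1 ord0 i) + p.2.+1%:R^-1))).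
pose H (k : nat) : E * E := if unpickle k is Some p then G p else (0, 0).
exists [set k | (exists p : 'rV[rat]_n * nat, unpickle k = Some p) /\ cbox (H k).1 (H k).2 `<=` U], H.
split.
  move=> k [[q qE] h]; split=> //; exists (2 * q.2.+1%:R^-1).
    by rewrite mulr_gt0// invr_gt0.
  by move=> i; rewrite /H qE /G /= !mxE; ring.
apply/seteqP; split; last first.
  by move=> x [k [_ hk] hx]; apply: hk; exact: obox_cbox.
move=> x Ux; have /nbhs_ballP[e e0 xeU] := open_nbhs_nbhs (conj oU Ux).
have [k _ hk] := near_infty_natSinv_lt (PosNum (divr_gt0 e0 (ltr0Sn R 1))).
have {}hk := hk k (leqnn k); rewrite /= in hk.
have k0 : 0 < k.+1%:R^-1 :> R by rewrite invr_gt0.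
have /(_ _)/cid-/all_sig[q hq] : forall i, exists q : rat,
    `|ratr q - x ord0 i| < k.+1%:R^-1.
  move=> i; have [|q] := @rat_in_itvoo R (x ord0 i - k.+1%:R^-1) (x ord0 i + k.+1%:R^-1).
    by rewrite ltrD2l gt0_cp.
  rewrite in_itv/= => /andP[h1 h2]; exists q.
  by move: h1 h2; rewrite ltr_norml; set c := _^-1 => *; apply/andP; split; lra.
pose p : 'rV[rat]_n * nat := (\row_i q i, k).
have HE : H (pickle p) = G p by rewrite /H pickleK.
exists (pickle p); last first.
  move=> i; rewrite HE /G /= in_itv/= !mxE; have := hq i.
  by rewrite ltr_norml; set c := _^-1 => /andP[? ?]; apply/andP; split; lra.
split; first by exists p; rewrite pickleK.
move=> y hy; apply: xeU; apply/rV_ballE => // i.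
have := hy i; rewrite HE /G /= in_itv/= !mxE; have := hq i.
move: hk; rewrite ltr_norml; set c := _^-1 => hk /andP[? ?] /andP[? ?].
by rewrite ltr_norml; apply/andP; split; lra.
Qed.

Lemma rV_open_measurable U : open U -> measurable U.
Proof.
move=> /open_cube_cover[P [F [_ ->]]].
by apply: bigcup_measurable => k _; exact: measurable_obox.
Qed.

Lemma rV_closed_measurable A : closed A -> measurable A.
Proof.
by move=> /closed_openC/rV_open_measurable/measurableC; rewrite setCK.
Qed.

Lemma rV_continuous_measurable (f : E -> R) : continuous f -> measurable_fun setT f.
Proof.
move=> cf; apply: (measurability _ (RGenOpens.measurableE R)).
move=> _ [_ [a [b ->] <-]]; rewrite setTI; apply: rV_open_measurable.
by move/continuousP : cf; apply; exact: interval_open.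
Qed.

Lemma rV_within_continuous_measurable A (f : E -> R) : measurable A ->
  {within A, continuous f} -> measurable_fun A f.
Proof.
move=> mA cf; apply: (measurability _ (RGenOpens.measurableE R)).
move=> _ [_ [a [b ->] <-]].
have oI : open `]a, b[%classic by exact: interval_open.
have /continuousP/(_ _ oI)/open_subspaceP[V oV VD] := cf.
by rewrite setIC -VD; apply: measurableI => //; exact: rV_open_measurable.
Qed.

Let oboxes : set (set E) := [set obox p.1 p.2 | p in [set: E * E]].

(** A slab of points whose i-th coordinate lies in an open interval is a countable union of growing
    boxes, and these slabs generate the measurable sets. *)
Lemma measurable_sub_oboxes : @measurable _ E `<=` <<s oboxes >>.
Proof.
apply: smallest_sub; first exact: smallest_sigma_algebra.
rewrite -bigcup_seq; apply: bigcup_sub => i _ _ [Y mY <-]; rewrite setTI.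
have {}mY : (@RGenOpens.G R).-sigma.-measurable Y by rewrite -RGenOpens.measurableE.
move: Y mY; apply: smallest_sub.
  split.
  - by rewrite /= preimage_set0; exact: sigma_algebra0.
  - by move=> A /= h; rewrite setTD preimage_setC; exact: sigma_algebraC.
  - by move=> F h /=; rewrite preimage_bigcup; exact: sigma_algebra_bigcup.
move=> _ [s [t ->]] /=.
pose a k : E := \row_j (if j == i then s else - k%:R).
pose b k : E := \row_j (if j == i then t else k%:R).
rewrite (_ : _ @^-1` _ = \bigcup_k obox (a k) (b k)).
  by apply: sigma_algebra_bigcup => k; apply: sub_sigma_algebra; exists (a k, b k).
apply/seteqP; split=> x /=; last first.
  by move=> [k _ /(_ i)]; rewrite /= !mxE eqxx.
move=> xi; have hk := archi_boundP (normr_ge0 x).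
exists (Num.bound `|x|) => // j; rewrite /= !mxE; have [->//|_] := eqVneq j i.
have := le_lt_trans (rV_norm_coord x j) hk.
by rewrite in_itv/= ltr_norml.
Qed.

Local Notation mu := (lebesgue_rV R n).

(* By Dynkin's pi-lambda theorem, since boxes generate the measurable sets. *)
Lemma ae_eq0_of_oboxes a b (g : E -> R) : mu.-integrable (obox a b) (EFin \o g) ->
  (forall c d, obox c d `<=` obox a b -> \int[mu]_(x in obox c d) g x = 0) ->
  {ae mu, forall x, obox a b x -> g x = 0}.
Proof.
move=> ig h0; set B := obox a b; have mB : measurable B := measurable_obox a b.
pose H := [set A : set E | measurable A /\ \int[mu]_(x in A `&` B) g x = 0].
have igA A : measurable A -> mu.-integrable (A `&` B) (EFin \o g).
  by move=> mA; apply: integrableS ig => //; exact: measurableI.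
have lH : lambda_system setT H.
  split => //.
  - by split => //; rewrite setTI h0.
  - move=> A C CA [mA hA] [mC hC]; split; first exact: measurableD.
    have : \int[mu]_(x in ((A `\` C) `&` B) `|` (C `&` B)) g x =
      \int[mu]_(x in (A `\` C) `&` B) g x + \int[mu]_(x in C `&` B) g x.
      apply: Rintegral_setU; [|exact: measurableI| |].
      + by apply: measurableI => //; exact: measurableD.
      + by rewrite -setIUl; apply: igA; apply: measurableU => //; exact: measurableD.
      + by apply/disj_setPS => x [[[_ nC] _] [Cx _]].
    rewrite -setIUl (_ : (A `\` C) `|` C = A) ?hA ?hC ?addr0; first by move=> <-.
    by rewrite setUC setDUK.
  - move=> F ndF hF; have mUF : measurable (\bigcup_k F k).
      by apply: bigcup_measurable => k _; case: (hF k).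
    split=> //.
    have mg : measurable_fun B g by exact: L1_measurable ig.
    have mgr A : measurable A -> measurable_fun B (g \_ A).
      move=> mA; apply/(measurable_restrict g mA mB).
      by apply: measurable_funS mg => //; exact: subIsetl.
    have [|||||_ hc] := @I_dct _ _ _ mu B mB (fun k => g \_ (F k))
      (g \_ (\bigcup_k F k)) (fun x => `|g x|).
    + by move=> k; apply: mgr; case: (hF k).
    + exact: mgr.
    + exact: integrable_norm.
    + apply: aeW => x Bx; apply/cvgn_leP => e e0.
      have [[k _ Fkx]|nF] := pselect ((\bigcup_k F k) x).
        exists k => m km; rewrite !patchE mem_set; last first.
          by have /subsetPset := ndF _ _ km; exact.
        by rewrite mem_set ?subrr ?normr0 ?ltW//; exists k.
      exists 0%N => m _; rewrite !patchE memNset ?memNset ?subrr ?normr0 ?ltW//.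
      by move=> Fx; apply: nF; exists m.
    + move=> k; apply: aeW => x Bx; rewrite patchE; case: ifP => // _.
      by rewrite normr0.
    rewrite setIC Rintegral_mkcondr; apply: cvgn_uniq hc _.
    rewrite (_ : (fun k => _) = cst 0); first exact: cvg_cst.
    apply/funext => k; rewrite -Rintegral_mkcondr setIC; by case: (hF k).
have GH : oboxes `<=` H.
  move=> _ [[c d] _ <-] /=; split; first exact: measurable_obox.
  by rewrite obox_setI h0// -obox_setI; exact: subIsetr.
have Gsub : setI_closed oboxes.
  by move=> _ _ [p _ <-] [q _ <-]; rewrite obox_setI; eexists (_, _).
have HA A : measurable A -> \int[mu]_(x in A `&` B) g x = 0.
  move=> /measurable_sub_oboxes mA.
  by have [] := lambda_system_subset Gsub lH GH (fun X _ => subsetT X) mA.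
have : ae_eq mu B (EFin \o g) (cst 0%E).
  apply: integral_ae_eq => // A AB mA; rewrite integral_cst// mul0e.
  have <- : A `&` B = A by exact/setIidl.
  rewrite -[LHS]I_EFin ?HA//; first exact: measurableI.
  exact: igA.
by apply: filterS => x h /h [].
Qed.

End boxes.

Section volume.
Context (R : realType).
Local Notation leb := (@lebesgue_measure R).

Lemma lebesgue_rbox n (F : 'I_n -> set R) : (forall i, measurable (F i)) ->
  lebesgue_rV R n (rbox F) = (\prod_i leb (F i))%E.
Proof.
elim: n F => [|n ih] F mF.
  rewrite big_ord0 /= /dirac indicE mem_set//.
  by move=> [].
pose G (i : 'I_n) := F (lift ord0 i).
have mG : measurable (rbox G) by apply: measurable_rbox => i; exact: mF.
rewrite big_ord_recl /= /lebesgue_rVS /pushforward.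
rewrite (_ : _ @^-1` _ = F ord0 `*` rbox G).
  rewrite (product_measure1E leb (lebesgue_rV R n) (mF ord0) mG).
  by rewrite ih// => i; exact: mF.
apply/seteqP; split => -[x v] /=.
  move=> h; split; first by have := h ord0; rewrite mxE unlift_none.
  by move=> i; have := h (lift ord0 i); rewrite mxE liftK.
by move=> [h1 h2] i; rewrite mxE; case: unliftP => [j ->|-> //]; exact: h2.
Qed.

Lemma lebesgue_itv_box n (a b : 'rV[R]_n) (c d : bool) :
  (forall i, a ord0 i <= b ord0 i) ->
  lebesgue_rV R n (rbox (fun i => [set` Interval (BSide c (a ord0 i)) (BSide d (b ord0 i))]))
    = (\prod_i (b ord0 i - a ord0 i))%:E.
Proof.
move=> ab; rewrite lebesgue_rbox; last by move=> i; exact: measurable_itv.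
rewrite -prodEFin; apply: eq_bigr => i _.
rewrite lebesgue_measure_itv/= lte_fin; case: ltP => [_//|ba].
by have -> : b ord0 i = a ord0 i; [apply/eqP; rewrite eq_le ba ab|rewrite subrr].
Qed.

Definition volume n (a b : 'rV[R]_n) := \prod_i (b ord0 i - a ord0 i).

Lemma lebesgue_hbox n (a b : 'rV[R]_n) : (forall i, a ord0 i <= b ord0 i) ->
  lebesgue_rV R n (hbox a b) = (volume a b)%:E.
Proof. exact: lebesgue_itv_box. Qed.

Lemma lebesgue_cbox_lty n (a b : 'rV[R]_n) : (lebesgue_rV R n (cbox a b) < +oo)%E.
Proof.
have [ab|nab] := pselect (forall i, a ord0 i <= b ord0 i).
  by rewrite lebesgue_itv_box// ltry.
rewrite (_ : cbox a b = set0) ?measure0// -subset0 => x h; apply: nab => i.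
by have := h i; rewrite /= in_itv/= => /andP[]; exact: le_trans.
Qed.

Lemma negligible_hbox_obox n (a b : 'rV[R]_n) :
  (lebesgue_rV R n).-negligible (hbox a b `\` obox a b).
Proof.
have [ab|nab] := pselect (forall i, a ord0 i <= b ord0 i); last first.
  rewrite (_ : hbox a b = set0) ?set0D; first exact: negligible_set0.
  rewrite -subset0 => x h; apply: nab => i.
  by have := h i; rewrite /= in_itv/= => /andP[ax /ltW]; exact: le_trans.
have mh := measurable_hbox a b; have mo := measurable_obox a b.
exists (hbox a b `\` obox a b); split => //; first exact: measurableD.
rewrite measureD//= ?setIidr; last 2 first.
- exact: obox_hbox.
- by apply: le_lt_trans (lebesgue_cbox_lty a b); apply: le_measure; rewrite ?inE//;
    [exact: measurable_cbox|exact: hbox_cbox].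
by rewrite [X in (X - _)%E]lebesgue_itv_box// [X in (_ - X)%E]lebesgue_itv_box// subee.
Qed.

Lemma bounded_sub_cbox n (A : set 'rV[R]_n) : bounded_set A ->
  exists2 M : R, 0 < M & A `<=` cbox (const_mx (- M)) (const_mx M).
Proof.
move=> [M [_ hM]]; exists (`|M| + 1); first by rewrite ltr_wpDl.
move=> x Ax i; rewrite /= in_itv/= !mxE -ler_norml.
apply: le_trans (rV_norm_coord _ _) _; apply: hM => //.
by rewrite (le_lt_trans (ler_norm _))// ltrDl.
Qed.

Lemma bounded_lebesgue_lty n (A : set 'rV[R]_n) : measurable A -> bounded_set A ->
  (lebesgue_rV R n A < +oo)%E.
Proof.
move=> mA /bounded_sub_cbox[M _ AM]; apply: le_lt_trans (lebesgue_cbox_lty (const_mx (- M)) (const_mx M)).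
by apply: le_measure; rewrite ?inE//; exact: measurable_cbox.
Qed.

End volume.

Section fundamental_lemma.
Context (R : realType) (n : nat).
Local Notation E := 'rV[R]_n.
Local Notation mu := (lebesgue_rV R n).

Lemma ae_covered (Om : set E) (P : E -> Prop) : open Om ->
  (forall a b, cbox a b `<=` Om -> {ae mu, forall x, obox a b x -> P x}) ->
  {ae mu, forall x, Om x -> P x}.
Proof.
move=> /open_cube_cover[A [F [hF OmE]]] h.
have : {ae mu, forall x, forall k, A k -> obox (F k).1 (F k).2 x -> P x}.
  apply: ae_foralln => k; have [Ak|nAk] := pselect (A k); last by apply: aeW.
  by apply: filterS (h _ _ (hF k Ak).1) => x hx _.
by apply: filterS => x hx; rewrite OmE => -[k Ak] /hx; exact.
Qed.

Lemma Lloc_cbox Om (g : E -> R) a b : Lloc Om g -> cbox a b `<=` Om ->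
  mu.-integrable (cbox a b) (EFin \o g).
Proof. by move=> [_ h] abOm; apply: h => //; exact: compact_cbox. Qed.

Lemma ae_eq0_Lloc Om (g : E -> R) : open Om -> Lloc Om g ->
  (forall a b, cbox a b `<=` Om -> \int[mu]_(x in obox a b) g x = 0) ->
  {ae mu, forall x, Om x -> g x = 0}.
Proof.
move=> oOm lg h; apply: ae_covered => // a b abOm.
apply: ae_eq0_of_oboxes.
  apply: integrableS (Lloc_cbox lg abOm) => //.
  - exact: measurable_cbox.
  - exact: measurable_obox.
  - exact: obox_cbox.
move=> c d cdab.
have <- : obox c d `&` obox a b = obox c d by exact/setIidl.
rewrite obox_setI; apply: h; apply: subset_trans abOm => x hx i.
have := hx i; rewrite /= !in_itv/= !mxE ge_max le_min.
by move=> /andP[/andP[_ ->] /andP[_ ->]].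
Qed.

End fundamental_lemma.

(** * Smooth functions of one variable, and bumps *)

Section smooth_real.
Context (R : realType).
Implicit Types (f g : R -> R) (t : R).

Fixpoint smoothn k f : Prop :=
  if k is k'.+1 then (forall t, derivable f t 1) /\ smoothn k' (derive1 f) else True.

Definition smooth1 f := forall k, smoothn k f.

Lemma smoothnS k f : smoothn k.+1 f -> smoothn k f.
Proof. by elim: k f => [//|k ih] f [df /ih h]. Qed.

Lemma smooth1_derivable f t : smooth1 f -> derivable f t 1.
Proof. by move=> /(_ 1%N)[]. Qed.

Lemma smooth1_derive f : smooth1 f -> smooth1 (derive1 f).
Proof. by move=> h k; have [] := h k.+1. Qed.

Lemma smooth1_continuous f : smooth1 f -> continuous f.
Proof.
move=> h t; apply: differentiable_continuous.
by apply/derivable1_diffP; exact: smooth1_derivable.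
Qed.

Lemma smooth1_ext_derive f (df : R -> R) : (forall t : R, is_derive t 1 f (df t)) ->
  smooth1 df -> smooth1 f.
Proof.
move=> hf hdf [//|k] /=; split; first by move=> t; exact: ex_derive.
rewrite (_ : (derive1 f) = df)//; apply/funext => t.
by rewrite derive1E; exact: derive_val.
Qed.

Lemma smooth1_cst c : smooth1 (cst c).
Proof.
move=> k; elim: k c => [//|k ih] c; split; first by move=> t; exact: derivable_cst.
rewrite (_ : derive1 (cst c) = cst 0)//; apply/funext => t.
by rewrite derive1_cst.
Qed.

Lemma smoothnD k f g : smoothn k f -> smoothn k g -> smoothn k (fun t => f t + g t).
Proof.
elim: k f g => [//|k ih] f g [df hf] [dg hg]; split.
  by move=> t; exact: derivableD.
rewrite (_ : derive1 _ = (fun t => (derive1 f) t + (derive1 g) t)); first exact: ih.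
by apply/funext => t; rewrite !derive1E; exact: deriveD.
Qed.

Lemma smoothnM k f g : smoothn k f -> smoothn k g -> smoothn k (fun t => f t * g t).
Proof.
elim: k f g => [//|k ih] f g hf hg.
case: (hf) => df hf'; case: (hg) => dg hg'; split.
  by move=> t; exact: derivableM.
rewrite (_ : derive1 _ = (fun t => f t * (derive1 g) t + g t * (derive1 f) t)).
  by apply: smoothnD; apply: ih => //; exact: smoothnS.
by apply/funext => t; rewrite !derive1E; exact: deriveM.
Qed.

Lemma smooth1M f g : smooth1 f -> smooth1 g -> smooth1 (fun t => f t * g t).
Proof. by move=> hf hg k; exact: smoothnM. Qed.

Lemma smooth1D f g : smooth1 f -> smooth1 g -> smooth1 (fun t => f t + g t).
Proof. by move=> hf hg k; exact: smoothnD. Qed.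

Lemma is_derive_affine f (df : R -> R) (a b : R) t :
  (forall s : R, is_derive s 1 f (df s)) ->
  is_derive t 1 (fun s => f (a * s + b)) (a * df (a * t + b)).
Proof.
move=> h; have h1 : is_derive t 1 (fun s : R => a * s + b) a.
  by apply: is_derive_eq; rewrite /= addr0 [_ *: _]mulr1.
have := @is_derive1_comp R f (fun s => a * s + b) t _ _ (h _) h1.
by move=> h2; apply: is_derive_eq h2 _; rewrite mulrC.
Qed.

Lemma smooth1_affine f (a b : R) : smooth1 f -> smooth1 (fun t => f (a * t + b)).
Proof.
move=> + k; elim: k f => [//|k ih] f hf.
have H t : is_derive t 1 (fun s => f (a * s + b)) (a * (derive1 f) (a * t + b)).
  apply: is_derive_affine => s; rewrite derive1E; apply: derivableP.
  exact: smooth1_derivable.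
split; first by move=> t; exact: ex_derive.
rewrite (_ : derive1 _ = (fun t => cst a t * (derive1 f) (a * t + b))).
  by apply: smoothnM; [exact: smooth1_cst|apply: ih; exact: smooth1_derive].
by apply/funext => t; rewrite derive1E; exact: derive_val.
Qed.

(* [flat k t = t^-k exp(-1/t)] for [t > 0]; the span of these functions is
   closed under differentiation. *)
Definition flat k t : R := if 0 < t then t ^- k * expR (- t^-1) else 0.

Lemma flat_ge0 k t : 0 <= flat k t.
Proof.
by rewrite /flat; case: ifP => // t0; rewrite mulr_ge0 ?expR_ge0// invr_ge0 exprn_ge0// ltW.
Qed.

(** A single term of the exponential series, exp(1/t) >= t^{-(k+2)}/(k+2)!, beats t^{-k} with two
    powers to spare. The quadratic bound makes the difference quotient at 0 tend to 0. *)
Lemma flat_le k t : flat k t <= k.+2`!%:R * t ^+ 2.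
Proof.
rewrite /flat; case: ifP => t0; last by rewrite mulr_ge0// sqr_ge0.
have tk0 : 0 < t ^+ k by rewrite exprn_gt0.
have F0 : 0 < k.+2`!%:R :> R by rewrite ltr0n fact_gt0.
have h : t ^- k.+2 / k.+2`!%:R <= expR t^-1.
  have ti0 : 0 <= t^-1 by rewrite invr_ge0 ltW.
  by apply: le_trans (expR_ge1Dxn k.+1 ti0); rewrite exprVn lerDr.
rewrite expRN -invfM invf_ple ?posrE ?mulr_gt0 ?expR_gt0 ?exprn_gt0//.
rewrite invfM -ler_pdivrMl//; apply: le_trans h.
by rewrite le_eqVlt; apply/orP; left; apply/eqP; rewrite -addn2 exprD; field;
  rewrite !gt_eqF.
Qed.

Lemma is_derive_flat k t :
  is_derive t 1 (flat k) (- (k%:R) * flat k.+1 t + flat k.+2 t).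
Proof.
have [t0|t0|->] := ltrgt0P t.
- have tn0 : t != 0 by rewrite gt_eqF.
  apply: (@near_eq_is_derive _ _ _ (fun s : R => (s ^+ k)^-1 * expR (- s^-1))) => //.
    by near=> s; rewrite /flat ifT//; near: s; exact: lt_nbhsr.
  have hV j : is_derive t 1 (fun s : R => (s ^+ j)^-1) (- (j%:R) * t ^- j.+1).
    pose p := (@GRing.exp R)^~ j.
    have tj0 : p t != 0 by rewrite expf_neq0.
    have dj : derivable p t 1 := @exprn_derivable R j t 1.
    apply: DeriveDef; first exact: (@derivableV _ _ p t 1 tj0 dj).
    have -> := @deriveV _ _ p t 1 tj0 dj; rewrite [X in _ *: X]exp_derive; clear dj; rewrite /p in tj0 *; clear p; rewrite -![_ *: _]/(_ * _) mulr1.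
    case: j tj0 => [|j] tj0; first by rewrite oppr0 !mul0r mulr0.
    by rewrite /= ![t ^+ _.+1]exprS; field; rewrite tn0 expf_neq0.
  have h2 : is_derive t 1 (fun s : R => expR (- s^-1)) (expR (- t^-1) * t ^- 2).
    apply: (@is_derive1_comp R expR (fun s => - s^-1)).
    rewrite (_ : (fun s : R => - s^-1) = - (fun s : R => (s ^+ 1)^-1)) //.
    by apply: is_derive_eq; rewrite mulN1r opprK.
  have h1 := hV k.
  apply: is_derive_eq; rewrite /flat t0 -![_ *: _]/(_ * _).
  by rewrite -[k.+2]addn2 -[k.+1]addn1 !exprD; field; rewrite tn0 expf_neq0.
- rewrite /flat !ifF ?mulr0 ?addr0 ?le_gtF ?ltW//.
  apply: (@near_eq_is_derive _ _ _ (cst 0)) => //.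
  by near=> s; rewrite /flat ifF// le_gtF// ltW//; near: s; exact: lt_nbhsl.
- rewrite {2 3}/flat ltxx mulr0 addr0.
  have H : h^-1 *: ((flat k \o shift 0) (h *: 1) - flat k 0) @[h --> 0^'] --> (0 : R).
    apply/cvgr0Pnorm_le => e e0; pose C : R := k.+2`!%:R.
    have C0 : 0 < C by rewrite /C ltr0n fact_gt0.
    near=> h; have h0 : h != 0 by near: h; exact: nbhs_dnbhs_neq.
    rewrite /= addr0 -![_ *: _]/(_ * _) mulr1 [X in _ - X]/flat ltxx subr0.
    rewrite normrM (ger0_norm (flat_ge0 _ _)).
    apply: (@le_trans _ _ (`|h^-1| * (C * h ^+ 2))).
      by rewrite ler_wpM2l// flat_le.
    have -> : `|h^-1| * (C * h ^+ 2) = C * `|h|.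
      by rewrite -[h ^+ 2]real_normK ?num_real// normfV; field; rewrite normr_eq0.
    rewrite -ler_pdivlMl// mulrC; near: h; apply: dnbhs0_le.
    by rewrite divr_gt0.
  apply: DeriveDef; last exact: cvg_lim.
  by apply/cvg_ex; exists 0.
Unshelve. all: by end_near. Qed.

Lemma smooth1_flat k : smooth1 (flat k).
Proof.
move=> n; elim: n k => [//|n ih] k; split.
  by move=> t; have := is_derive_flat k t => ?; exact: ex_derive.
rewrite (_ : derive1 _ = (fun t => cst (- (k%:R)) t * flat k.+1 t + flat k.+2 t)).
  by apply: smoothnD => //; apply: smoothnM => //; exact: smooth1_cst.
apply/funext => t; have := is_derive_flat k t => ?.
by rewrite derive1E derive_val.
Qed.

(* Smooth functions supported in [a, b] increasing to the indicator of ]a, b[. *)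
Definition bumpf (a b : R) (m : nat) t : R :=
  flat 0 (m.+1%:R * (t - a)) * flat 0 (m.+1%:R * (b - t)).

Lemma smooth1_bump a b m : smooth1 (bumpf a b m).
Proof.
apply: smooth1M.
  rewrite (_ : (fun _ => _) = (fun t => flat 0 (m.+1%:R * t + (- (m.+1%:R * a))))).
    exact/smooth1_affine/smooth1_flat.
  by apply/funext => t; rewrite mulrBr.
rewrite (_ : (fun _ => _) = (fun t => flat 0 ((- (m.+1%:R)) * t + m.+1%:R * b))).
  exact/smooth1_affine/smooth1_flat.
by apply/funext => t; rewrite mulrBr mulNr addrC.
Qed.

Lemma flat0_le1 t : flat 0 t <= 1.
Proof.
rewrite /flat; case: ifP => // t0; rewrite expr0 invr1 mul1r -expR0 ler_expR.
by rewrite oppr_le0 invr_ge0 ltW.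
Qed.

Lemma bump_ge0 a b m t : 0 <= bumpf a b m t.
Proof. by rewrite mulr_ge0 ?flat_ge0. Qed.

Lemma bump_le1 a b m t : bumpf a b m t <= 1.
Proof. by rewrite mulr_ile1 ?flat_ge0 ?flat0_le1. Qed.

Lemma bump_out a b m t : t \notin `]a, b[ -> bumpf a b m t = 0.
Proof.
rewrite in_itv/= negb_and -!leNgt => /orP[ta|bt]; rewrite /bumpf /flat.
  by rewrite ifF ?mul0r// le_gtF// pmulr_rle0// subr_le0.
by rewrite [X in _ * X]ifF ?mulr0// le_gtF// pmulr_rle0// subr_le0.
Qed.

Lemma bump_cvg a b t : bumpf a b m t @[m --> \oo] --> (\1_(`]a, b[%classic) t : R).
Proof.
have [tab|tab] := boolP (t \in `]a, b[); last first.
  rewrite indicE memNset; last by apply/negP.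
  rewrite (_ : (fun _ => _) = cst 0); first exact: cvg_cst.
  by apply/funext => m; exact: bump_out.
rewrite indicE mem_set// mulr1n.
have flat1 (s : R) : 0 < s -> flat 0 (m.+1%:R * s) @[m --> \oo] --> (1 : R).
  move=> s0; rewrite (_ : (fun _ => _) = (fun m : nat => expR (- s^-1 * m.+1%:R^-1))).
    rewrite -[X in _ --> X](@expR0 R); apply: continuous_cvg; first exact: continuous_expR.
    rewrite -[X in _ --> X](mulr0 (- s^-1)); apply: cvgM; first exact: cvg_cst.
    exact: cvg_harmonic.
  apply/funext => m; rewrite /flat mulr_gt0// expr0 invr1 mul1r invfM mulNr.
  by rewrite mulrC.
rewrite -(mulr1 1); move: tab; rewrite in_itv/= => /andP[ta tb].
by apply: cvgM; apply: flat1; rewrite subr_gt0.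
Qed.

End smooth_real.

Section antiderivative.
Context (R : realType).
Local Notation leb := (@lebesgue_measure R).

Lemma integrable_bump (a b : R) m : leb.-integrable setT (EFin \o bumpf a b m).
Proof.
apply: (@L1_le _ _ _ leb setT measurableT _ \1_(`]a, b[%classic)).
- by apply: continuous_measurable_fun; exact/smooth1_continuous/smooth1_bump.
- exact: integrable_indic_itv.
- move=> t _; rewrite ger0_norm ?bump_ge0// indicE.
  have [tab|tab] := boolP (t \in `]a, b[); first by rewrite mem_set ?bump_le1.
  by rewrite bump_out// ler0n.
Qed.

Lemma bump_antiderivative (a b : R) m :
  {F : R -> R | forall t : R, is_derive t 1 F (bumpf a b m t)}.
Proof.
exists (fun t => \int[leb]_(s in [set` Interval -oo%O (BRight t)]) bumpf a b m s) => t.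
have [||||d1 d2] := @continuous_FTC1 R (bumpf a b m) -oo%O t (t + 1).
- by rewrite ltrDl.
- by apply: integrableS (integrable_bump a b m).
- exact: ltNyr.
- exact/smooth1_continuous/smooth1_bump.
by apply: DeriveDef; [exact: d1|rewrite derive1E in d2; exact: d2].
Qed.

(** A bump minus its translate by [h] has a compactly supported primitive, W(t) = F(t) - F(t - h).
    By the mean value theorem W(t) is [h] times a value of the bump, which gives support and bound.
    Its derivative compares the two halves of an interval of length 2h. *)
Lemma shifted_bump_antiderivative (a h : R) m : 0 < h -> exists W : R -> R,
  [/\ smooth1 W,
     forall t : R, is_derive t 1 W (bumpf a (a + h) m t - bumpf (a + h) (a + h + h) m t),
     forall t, t \notin `]a, a + h + h[ -> W t = 0 &
     forall t, 0 <= W t <= h].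
Proof.
move=> h0; have [F hF] := bump_antiderivative a (a + h) m.
pose W t := F t - F (1 * t + - h).
have dW (t : R) : is_derive t 1 W (bumpf a (a + h) m t - bumpf (a + h) (a + h + h) m t).
  have := is_derive_affine 1 (- h) t hF; rewrite mul1r => h1.
  apply: is_derive_eq; congr (_ - _); rewrite mul1r /bumpf.
  by congr (flat _ _ * flat _ _); ring.
have hW t : exists2 c, t - h < c < t & W t = bumpf a (a + h) m c * h.
  have th : t - h < t by rewrite gtrBl.
  have [|c] := @MVT R F (bumpf a (a + h) m) _ _ th (fun x _ => hF x).
    apply: continuous_subspaceT => x; apply: differentiable_continuous.
    by apply/derivable1_diffP; have := hF x => ?; exact: ex_derive.
  rewrite in_itv/= => hc; rewrite (_ : t - (t - h) = h); last by ring.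
  move=> e.
  by exists c => //; rewrite /W mul1r e.
exists W; split => //.
- apply: smooth1_ext_derive dW _; apply: smooth1D; first exact: smooth1_bump.
  rewrite (_ : (fun _ => _) = (fun t => cst (- 1) t * bumpf (a + h) (a + h + h) m t)).
    by apply: smooth1M; [exact: smooth1_cst|exact: smooth1_bump].
  by apply/funext => t; rewrite mulN1r.
- move=> t tout; have [c /andP[hc1 hc2] ->] := hW t; rewrite bump_out ?mul0r//.
  move: tout; rewrite !in_itv/= !negb_and -!leNgt => /orP[ta|tb]; apply/orP.
    by left; rewrite (le_trans (ltW hc2)).
  by right; apply: le_trans (ltW hc1); lra.
- move=> t; have [c _ ->] := hW t; rewrite mulr_ge0 ?bump_ge0 ?(ltW h0)//=.
  by rewrite ger_pMl// bump_le1.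
Qed.

End antiderivative.

Section product_functions.
Context (R : realType) (n : nat).
Local Notation E := 'rV[R]_n.
Implicit Types (psi : 'I_n -> R -> R) (x : E).

Definition prodf psi : E -> R := fun x => \prod_i psi i (x ord0 i).

Lemma is_derive_prodf psi i x (d : R) : is_derive (x ord0 i) (1 : R) (psi i) d ->
  is_derive x (delta_mx ord0 i : E) (prodf psi) (d * \prod_(j | j != i) psi j (x ord0 j)).
Proof.
move=> [dd dE]; set c := \prod_(j | j != i) psi j (x ord0 j).
have H : (fun h : R => h^-1 *: ((prodf psi \o shift x) (h *: delta_mx ord0 i) - prodf psi x)) =
    (fun h => c * (h^-1 *: ((psi i \o shift (x ord0 i)) (h *: 1) - psi i (x ord0 i)))).
  apply/funext => h; rewrite /= /prodf (bigD1 i)//= [X in _ - X](bigD1 i)//=.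
  rewrite (eq_bigr (fun j => psi j (x ord0 j))); last first.
    by move=> j ji; rewrite !mxE (negPf ji) andbF mulr0 add0r.
  rewrite !mxE !eqxx /= -/c.
  by rewrite -!mulrBl -![_ *: _]/(_ * _) mulrA mulrC.
have hc : c * (h^-1 *: ((psi i \o shift (x ord0 i)) (h *: 1) - psi i (x ord0 i))) @[h --> 0^']
    --> c * d.
  by rewrite -dE; apply: cvgM; [exact: cvg_cst|exact: dd].
apply: DeriveDef; first by rewrite /derivable H; apply/cvg_ex; exists (c * d).
by rewrite /derive H mulrC; exact: cvg_lim.
Qed.

Lemma differentiable_prodf psi : (forall i t, derivable (psi i) t 1) ->
  forall x, differentiable (prodf psi) x.
Proof.
move=> dpsi x; rewrite /prodf.
have H (s : seq 'I_n) : differentiable (fun x : E => \prod_(i <- s) psi i (x ord0 i)) x.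
  elim: s => [|i s ih].
    rewrite (_ : (fun _ => _) = cst 1); first exact: differentiable_cst.
    by apply/funext => y; rewrite big_nil.
  rewrite (_ : (fun _ => _) = (psi i \o (fun y : E => y ord0 i)) *
    (fun y : E => \prod_(i <- s) psi i (y ord0 i))).
    apply: differentiableM => //; apply: differentiable_comp.
      exact: differentiable_coord.
    by apply/derivable1_diffP; exact: dpsi.
  by apply/funext => y; rewrite big_cons.
exact: H.
Qed.

(** A partial derivative of a product function is the product function with one factor
    differentiated, so the class is stable under all iterated derivatives. *)
Lemma smooth_prodf psi : (forall i, smooth1 (psi i)) -> smooth (prodf psi).
Proof.
move=> hpsi s x.
have [psi' -> h'] : exists2 psi', foldr (@pderiv R n) (prodf psi) s = prodf psi' &
    forall i, smooth1 (psi' i).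
  elim: s => [|i s [psi' E' h']]; first by exists psi.
  exists (fun j => if j == i then derive1 (psi' j) else psi' j).
    rewrite /= E'; apply/funext => y; rewrite /pderiv.
    have hd : is_derive (y ord0 i) (1 : R) (psi' i) (derive1 (psi' i) (y ord0 i)).
      by rewrite derive1E; apply: derivableP; exact: smooth1_derivable.
    have hd' := is_derive_prodf hd; rewrite derive_val /prodf [RHS](bigD1 i)//= eqxx.
    by congr (_ * _); apply: eq_bigr => j /negPf ->.
  by move=> j; case: ifP => _ //; exact: smooth1_derive.
by apply: differentiable_prodf => i t; exact: smooth1_derivable.
Qed.

Lemma prodf_test (Om : set E) psi (a b : E) : (forall i, smooth1 (psi i)) ->
  (forall i t, t \notin `]a ord0 i, b ord0 i[ -> psi i t = 0) -> cbox a b `<=` Om ->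
  test_function Om (prodf psi).
Proof.
move=> hs h0 abOm.
have sub : closure [set x | prodf psi x != 0] `<=` cbox a b.
  have cl : closed (cbox a b).
    by apply: compact_closed; [exact: norm_hausdorff|exact: compact_cbox].
  rewrite [X in _ `<=` X](closure_id _).1//; apply: closure_subset => x /= hx.
  apply: obox_cbox => i /=; apply: contraNT hx => hi.
  by rewrite /prodf (bigD1 i)//= (h0 _ _ hi) mul0r.
split; first exact: smooth_prodf.
- by apply: subclosed_compact sub; [exact: closed_closure|exact: compact_cbox].
- exact: subset_trans abOm.
Qed.

Lemma prodf_out psi (a b : E) x :
  (forall i t, t \notin `]a ord0 i, b ord0 i[ -> psi i t = 0) -> ~ obox a b x -> prodf psi x = 0.
Proof.
move=> h0 nx; have [i hi] : exists i, ~ x ord0 i \in `]a ord0 i, b ord0 i[.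
  by apply/existsNP => h; apply: nx.
by rewrite /prodf (bigD1 i)//= h0 ?mul0r//; apply/negP.
Qed.

Lemma cvgn_prodf (psi : nat -> 'I_n -> R -> R) (phi : 'I_n -> R -> R) x :
  (forall i, psi m i (x ord0 i) @[m --> \oo] --> phi i (x ord0 i)) ->
  prodf (psi m) x @[m --> \oo] --> prodf phi x.
Proof.
move=> h; rewrite /prodf.
have H (s : seq 'I_n) : \prod_(i <- s) psi m i (x ord0 i) @[m --> \oo] -->
    \prod_(i <- s) phi i (x ord0 i).
  elim: s => [|i s ih].
    rewrite big_nil (_ : (fun _ => _) = cst 1); first exact: cvg_cst.
    by apply/funext => m; rewrite big_nil.
  rewrite big_cons (_ : (fun _ => _) = (fun m => psi m i (x ord0 i) *
    \prod_(i <- s) psi m i (x ord0 i))); first exact: cvgM.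
  by apply/funext => m; rewrite big_cons.
exact: H.
Qed.

End product_functions.

Section integral_support.
Context d (T : measurableType d) (R : realType) (mu : {measure set T -> \bar R}).
Implicit Types (A B : set T) (f g : T -> R).

Lemma L1_S A B f : measurable A -> measurable B -> B `<=` A ->
  mu.-integrable A (EFin \o f) -> mu.-integrable B (EFin \o f).
Proof. by move=> mA mB BA; exact: integrableS. Qed.

Lemma I_support A B f : B `<=` A -> (forall x, A x -> ~ B x -> f x = 0) ->
  \int[mu]_(x in A) f x = \int[mu]_(x in B) f x.
Proof.
move=> BA f0; rewrite -[in RHS](setIidr BA) Rintegral_mkcondr.
apply: eq_Rintegral => x /set_mem Ax; rewrite patchE.
by case: ifPn => // /negP nB; apply: f0 => // Bx; apply: nB; exact/mem_set.
Qed.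

Lemma L1_support A B f : measurable A -> measurable B -> B `<=` A ->
  (forall x, A x -> ~ B x -> f x = 0) ->
  mu.-integrable B (EFin \o f) -> mu.-integrable A (EFin \o f).
Proof.
move=> mA mB BA f0 ifB.
have : mu.-integrable (A `&` B) (EFin \o f) by rewrite (setIidr BA).
move=> /integrable_restrict => /(_ mB mA).
apply: eq_integrable => // x /set_mem Ax; rewrite patchE /=.
case: ifPn => // /negP nB; rewrite f0// => Bx; apply: nB; exact/mem_set.
Qed.

Lemma I_negligible A B f : measurable A -> measurable B -> B `<=` A ->
  mu.-negligible (A `\` B) -> mu.-integrable A (EFin \o f) ->
  \int[mu]_(x in A) f x = \int[mu]_(x in B) f x.
Proof.
move=> mA mB BA [N [mN N0 sN]] ifA.
rewrite -[in RHS](setIidr BA) Rintegral_mkcondr; have mf := L1_measurable ifA.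
apply: ae_I => //.
  by apply/(measurable_restrict f mB mA); apply: measurable_funS mf.
exists N; split=> // x /= /not_implyP[Ax h]; apply: sN; split=> // Bx; apply: h.
by rewrite patchE mem_set.
Qed.

End integral_support.

(** * Weak derivatives on cubes, Rellich and Morrey *)

Section weak_derivatives_on_boxes.
Context (R : realType) (N : nat).
Local Notation E := 'rV[R]_N.
Local Notation mu := (lebesgue_rV R N).
Implicit Types (Om : set E) (u g v : E -> R) (a b x : E).

Definition upd x i (t : R) : E := \row_j (if j == i then t else x ord0 j).

Lemma upd_eq x i t : upd x i t ord0 i = t. Proof. by rewrite mxE eqxx. Qed.

Lemma upd_neq x i t j : j != i -> upd x i t ord0 j = x ord0 j.
Proof. by rewrite mxE => /negPf ->. Qed.

Lemma I_hbox_obox a b u : mu.-integrable (hbox a b) (EFin \o u) ->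
  \int[mu]_(x in hbox a b) u x = \int[mu]_(x in obox a b) u x.
Proof.
move=> h; apply: I_negligible => //; [exact: measurable_hbox|exact: measurable_obox|
  exact: obox_hbox|exact: negligible_hbox_obox].
Qed.

Lemma Lloc_hbox Om g a b : Lloc Om g -> cbox a b `<=` Om ->
  mu.-integrable (hbox a b) (EFin \o g).
Proof.
move=> lg abOm; apply: integrableS (Lloc_cbox lg abOm) => //;
  [exact: measurable_cbox|exact: measurable_hbox|exact: hbox_cbox].
Qed.

Lemma Lloc_obox Om g a b : Lloc Om g -> cbox a b `<=` Om ->
  mu.-integrable (obox a b) (EFin \o g).
Proof.
move=> lg abOm; apply: integrableS (Lloc_cbox lg abOm) => //;
  [exact: measurable_cbox|exact: measurable_obox|exact: obox_cbox].
Qed.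

Lemma LlocB Om g g' : open Om -> Lloc Om g -> Lloc Om g' -> Lloc Om (fun x => g x - g' x).
Proof.
move=> oOm [mg hg] [mg' hg']; split; first exact: measurable_funB.
move=> K KOm cK; apply: L1B; [|exact: hg|exact: hg'].
by apply: rV_closed_measurable; apply: compact_closed => //; exact: norm_hausdorff.
Qed.

Lemma Lloc_mul Om g v a b (M : R) : open Om -> Lloc Om g -> cbox a b `<=` Om ->
  measurable_fun setT v -> (forall x, `|v x| <= M) ->
  (forall x, ~ obox a b x -> v x = 0) ->
  [/\ mu.-integrable Om (EFin \o (fun x => g x * v x)),
      mu.-integrable (obox a b) (EFin \o (fun x => g x * v x)) &
      \int[mu]_(x in Om) (g x * v x) = \int[mu]_(x in obox a b) (g x * v x)].
Proof.
move=> oOm lg abOm mv vM v0; have mo := measurable_obox a b.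
have mOm := rV_open_measurable oOm.
have ig := Lloc_obox lg abOm.
have obOm : obox a b `<=` Om by apply: subset_trans abOm; exact: obox_cbox.
have h0 x : Om x -> ~ obox a b x -> g x * v x = 0 by move=> _ /v0 ->; rewrite mulr0.
have h : mu.-integrable (obox a b) (EFin \o (fun x => g x * v x)).
  apply: L1_le (L1Z mo M (L1_norm ig)) _ => //.
    apply: measurable_funM; first exact: L1_measurable ig.
    exact: measurable_funTS.
  by move=> x _; rewrite normrM mulrC ler_wpM2r.
split=> //; last exact: I_support.
exact: L1_support obOm h0 h.
Qed.

Definition bumps a b m : E -> R :=
  prodf (fun i => bumpf (a ord0 i) (b ord0 i) m).

Lemma prodf_measurable (psi : 'I_N -> R -> R) : (forall i, smooth1 (psi i)) ->
  measurable_fun setT (prodf psi).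
Proof.
move=> h; apply: rV_continuous_measurable => x; apply: differentiable_continuous.
by apply: differentiable_prodf => i t; exact: smooth1_derivable.
Qed.

Lemma bumps_out a b m x : ~ obox a b x -> bumps a b m x = 0.
Proof. by apply: prodf_out => i t; exact: bump_out. Qed.

Lemma bumps_norm_le1 a b m x : `|bumps a b m x| <= 1.
Proof.
rewrite ger0_norm; last by apply: prodr_ge0 => i _; exact: bump_ge0.
by apply: prodr_ile1 => i _; rewrite bump_ge0 bump_le1.
Qed.

Lemma bumps_cvg a b x : obox a b x -> bumps a b m x @[m --> \oo] --> (1 : R).
Proof.
move=> hx; rewrite (_ : 1 = prodf (fun i => \1_(`]a ord0 i, b ord0 i[%classic) : R -> R) x).
  by apply: cvgn_prodf => i; exact: bump_cvg.
by rewrite /prodf big1// => i _; rewrite indicE mem_set//; exact: hx.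
Qed.

Lemma bumps_measurable a b m : measurable_fun setT (bumps a b m).
Proof. by apply: prodf_measurable => i; exact: smooth1_bump. Qed.

Lemma bumps_test Om a b m : cbox a b `<=` Om -> test_function Om (bumps a b m).
Proof.
by apply: prodf_test => [i|i t]; [exact: smooth1_bump|exact: bump_out].
Qed.

Lemma I_bumps_cvg Om g a b : open Om -> Lloc Om g -> cbox a b `<=` Om ->
  \int[mu]_(x in Om) (g x * bumps a b m x) @[m --> \oo] --> \int[mu]_(x in obox a b) g x.
Proof.
move=> oOm lg abOm; have mo := measurable_obox a b.
have H m := Lloc_mul oOm lg abOm (bumps_measurable a b m) (bumps_norm_le1 a b m)
  (@bumps_out a b m).
rewrite (_ : (fun m => _) = (fun m => \int[mu]_(x in obox a b) (g x * bumps a b m x))).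
  have [|||||_ //] := @I_dct _ _ _ mu _ mo (fun m x => g x * bumps a b m x) g (fun x => `|g x|).
  - by move=> m; case: (H m) => _ /L1_measurable.
  - exact: L1_measurable (Lloc_obox lg abOm).
  - exact: L1_norm (Lloc_obox lg abOm).
  - apply: aeW => x hx; rewrite -[X in _ --> X]mulr1.
    by apply: cvgM; [exact: cvg_cst|exact: bumps_cvg].
  - move=> m; apply: aeW => x _; rewrite normrM.
    by rewrite ler_piMr// bumps_norm_le1.
by apply/funext => m; case: (H m).
Qed.

(** Both functions have the same integrals against product bumps, hence over every box whose closure
    lies in Om. *)
Lemma weak_partial_unique Om i u g g' : open Om -> weak_partial Om i u g ->
  weak_partial Om i u g' -> g = g' %[ae mu in Om].
Proof.
move=> oOm [_ lg hg] [_ lg' hg'].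
have := ae_eq0_Lloc oOm (LlocB oOm lg lg'); set P := (X in (X -> _) -> _) => H.
have : P.
  move=> a b abOm; have mo := measurable_obox a b.
  rewrite RintegralB//; [|exact: Lloc_obox abOm|exact: Lloc_obox abOm].
  apply/eqP; rewrite subr_eq0; apply/eqP.
  apply: cvgn_uniq (I_bumps_cvg oOm lg abOm) _.
  rewrite (_ : (fun m => _) = (fun m => \int[mu]_(x in Om) (g' x * bumps a b m x))).
    exact: I_bumps_cvg.
  apply/funext => m; apply: oppr_inj.
  by rewrite -hg ?hg'//; exact: bumps_test.
by move/H; apply: filterS => x h /h /eqP; rewrite subr_eq0 => /eqP.
Qed.

(** The test function is the primitive [W] in the coordinate [i] times bumps in the others. Its i-th
    derivative tends to the indicator of the lower half minus that of the upper half, while its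
    absolute value stays below [h]. *)
Lemma weak_partial_halves Om i u g a b (h : R) : open Om -> weak_partial Om i u g ->
  cbox a b `<=` Om -> a ord0 i < b ord0 i -> h = (b ord0 i - a ord0 i) / 2 ->
  `|\int[mu]_(x in hbox a (upd b i (a ord0 i + h))) u x -
    \int[mu]_(x in hbox (upd a i (a ord0 i + h)) b) u x| <=
  h * \int[mu]_(x in hbox a b) `|g x|.
Proof.
move=> oOm [lu lg ug] abOm abi hE.
have h0 : 0 < h by rewrite hE divr_gt0// subr_gt0.
have hh : a ord0 i + h + h = b ord0 i by rewrite hE; field.
set b1 := upd b i _; set a2 := upd a i _.
have s1 : cbox a b1 `<=` Om.
  apply: subset_trans abOm => x hx j; have := hx j; rewrite /= !in_itv/=.
  move=> /andP[-> hxb] /=; apply: le_trans hxb _; rewrite mxE; case: eqP => // ->.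
  by rewrite -hh lerDl ltW.
have s2 : cbox a2 b `<=` Om.
  apply: subset_trans abOm => x hx j; have := hx j; rewrite /= !in_itv/=.
  move=> /andP[hxa ->]; rewrite andbT; apply: le_trans hxa; rewrite mxE.
  by case: eqP => // ->; rewrite lerDl ltW.
rewrite !I_hbox_obox; [|exact: L1_norm (Lloc_hbox lg abOm)|exact: Lloc_hbox s2|exact: Lloc_hbox s1].
have hc : `|\int[mu]_(x in Om) (u x * bumps a b1 m x) -
    \int[mu]_(x in Om) (u x * bumps a2 b m x)| @[m --> \oo] -->
    `|\int[mu]_(x in obox a b1) u x - \int[mu]_(x in obox a2 b) u x|.
  by apply: cvg_norm; apply: cvgB; exact: I_bumps_cvg.
apply: cvgn_upper hc _ => m.
have [W [sW dW W0 Wh]] := shifted_bump_antiderivative (a ord0 i) m h0.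
pose psi j := if j == i then W else bumpf (a ord0 j) (b ord0 j) m.
have spsi j : smooth1 (psi j) by rewrite /psi; case: ifP => _ //; exact: smooth1_bump.
have psi0 j t : t \notin `]a ord0 j, b ord0 j[ -> psi j t = 0.
  by rewrite /psi; case: eqP => [->|_]; [rewrite -hh; exact: W0|exact: bump_out].
have tv := prodf_test spsi psi0 abOm; have := ug _ tv.
have mo := measurable_obox a b.
have -> : \int[mu]_(x in Om) (u x * pderiv i (prodf psi) x) =
    \int[mu]_(x in Om) (u x * bumps a b1 m x) - \int[mu]_(x in Om) (u x * bumps a2 b m x).
  rewrite -RintegralB; last 3 first.
  - exact: rV_open_measurable.
  - by have [] := Lloc_mul oOm lu s1 (bumps_measurable a b1 m) (bumps_norm_le1 a b1 m)
      (@bumps_out a b1 m).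
  - by have [] := Lloc_mul oOm lu s2 (bumps_measurable a2 b m) (bumps_norm_le1 a2 b m)
      (@bumps_out a2 b m).
  apply: eq_Rintegral => x _; rewrite -mulrBr; congr (_ * _).
  have dpsi : is_derive (x ord0 i) (1 : R) (psi i)
      (bumpf (a ord0 i) (a ord0 i + h) m (x ord0 i) -
       bumpf (a ord0 i + h) (a ord0 i + h + h) m (x ord0 i)).
    by rewrite /psi eqxx; exact: dW.
  have hd' := is_derive_prodf dpsi; rewrite /pderiv derive_val.
  have -> : bumps a b1 m x = bumpf (a ord0 i) (a ord0 i + h) m (x ord0 i) *
      \prod_(j | j != i) psi j (x ord0 j).
    rewrite /bumps /prodf (bigD1 i)//= upd_eq; congr (_ * _).
    by apply: eq_bigr => j ji; rewrite /psi (negPf ji) upd_neq.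
  have -> : bumps a2 b m x = bumpf (a ord0 i + h) (a ord0 i + h + h) m (x ord0 i) *
      \prod_(j | j != i) psi j (x ord0 j).
    rewrite /bumps /prodf (bigD1 i)//= upd_eq hh; congr (_ * _).
    by apply: eq_bigr => j ji; rewrite /psi (negPf ji) upd_neq.
  by rewrite mulrBl.
move=> ->; rewrite normrN.
have psiM x : `|prodf psi x| <= h.
  rewrite /prodf (bigD1 i)//= normrM /psi eqxx; have /andP[w0 w1] := Wh (x ord0 i).
  rewrite (ger0_norm w0) -[leRHS]mulr1; apply: ler_pM => //.
  rewrite normr_prod; apply: prodr_ile1 => j ji; rewrite normr_ge0/=.
  by rewrite (negPf ji) ger0_norm ?bump_ge0// bump_le1.
have [i1 i2 ->] := Lloc_mul oOm lg abOm (prodf_measurable spsi) psiM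
  (fun x => @prodf_out _ _ psi a b x psi0).
apply: le_trans (le_normr_Rintegral mo i2) _.
have ig := L1_norm (Lloc_obox lg abOm).
rewrite -RintegralZl//; apply: le_Rintegral => //; [exact: L1_norm|exact: L1Z|].
by move=> x _; rewrite normrM mulrC ler_wpM2r.
Qed.

End weak_derivatives_on_boxes.

Section bounded_integrable.
Context d (T : measurableType d) (R : realType) (mu : {measure set T -> \bar R}).
Variables (D : set T) (mD : measurable D) (Doo : (mu D < +oo)%E).
Local Notation L1 f := (mu.-integrable D (EFin \o f)).

Lemma L1_cst (c : R) : L1 (cst c).
Proof.
apply/integrableP; split; first by apply/measurable_EFinP; exact: measurable_cst.
rewrite [ltLHS](_ : _ = \int[mu]_(x in D) (cst `|c|%:E) x)%E//.
by rewrite integral_cst// lte_mul_pinfty.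
Qed.

Lemma L1_bounded (f : T -> R) (M : R) : measurable_fun D f ->
  (forall x, D x -> `|f x| <= M) -> L1 f.
Proof. by move=> mf fM; exact: L1_le (L1_cst M) fM. Qed.

Lemma Lev_bounded m (f : T -> R) (M : R) : measurable_fun D f ->
  (forall x, D x -> `|f x| <= M) -> Lev mu D m f.
Proof.
move=> mf fM; split=> //; apply: (@L1_bounded _ (M ^+ m.+1.*2)).
  exact: measurable_funX.
by move=> x Dx; rewrite normrX; apply: lerXn2r; rewrite ?nnegrE ?(le_trans _ (fM x Dx))// fM.
Qed.

Lemma Lev_L1 (f : T -> R) : Lev mu D 0 f -> L1 f.
Proof.
move=> hf; have h1 : Lev mu D 0 (cst 1).
  by apply: (@Lev_bounded _ _ 1) => // x _; rewrite normr1.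
by have := Lev0_mul mD hf h1; under [X in _.-integrable _ X -> _]eq_fun do rewrite /= mulr1.
Qed.

Lemma I_norm_le_norm2 (f : T -> R) : Lev mu D 0 f ->
  \int[mu]_(x in D) `|f x| <= norm2 mu D f * Num.sqrt (fine (mu D)).
Proof.
move=> hf; have h1 : Lev mu D 0 (cst 1).
  by apply: (@Lev_bounded _ _ 1) => // x _; rewrite normr1.
have hn : Lev mu D 0 (fun x => `|f x|).
  case: hf => mf hf; split; first exact: measurableT_comp.
  by under [X in _.-integrable _ X]eq_fun do rewrite /= even_expr_norm.
have := cauchy_schwarz_norm2 mD hn h1.
under eq_Rintegral do rewrite mulr1.
move=> /(le_trans (ler_norm _)) /le_trans; apply.
rewrite /norm2; under eq_Rintegral do rewrite (even_expr_norm 0).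
rewrite le_eqVlt; apply/orP; left; apply/eqP; congr (_ * Num.sqrt _).
by under eq_Rintegral do rewrite expr1n; rewrite Rintegral_cst// mul1r.
Qed.

(** Jensen's inequality, obtained by integrating the tangent inequality taken at the mean value of
    [f]. *)
Lemma jensen_power m (f : T -> R) : L1 f -> L1 (fun x => f x ^+ m.+1) ->
  (forall x, D x -> 0 <= f x) -> 0 < fine (mu D) ->
  ((\int[mu]_(x in D) f x) / fine (mu D)) ^+ m.+1 <=
  (\int[mu]_(x in D) (f x ^+ m.+1)) / fine (mu D).
Proof.
move=> hf hfm f0 D0; set a := _ / fine _.
have a0 : 0 <= a by rewrite divr_ge0 ?(ltW D0)//; exact: Rintegral_ge0.
have H : \int[mu]_(x in D) (m.+1%:R * a ^+ m * f x) <=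
    \int[mu]_(x in D) (f x ^+ m.+1 + m%:R * a ^+ m.+1).
  apply: le_Rintegral => //; first exact: L1Z.
    by apply: L1D => //; exact: L1_cst.
  by move=> x Dx; apply: tangent_power => //; exact: f0.
move: H; rewrite RintegralZl// RintegralD//; last exact: L1_cst.
rewrite Rintegral_cst// ler_pdivlMr//.
have -> : \int[mu]_(x in D) f x = a * fine (mu D) by rewrite /a mulfVK// gt_eqF.
rewrite -natr1 exprS; set X := a ^+ m; set Y := fine _; set Z := Rintegral _ _ _; nra.
Qed.

Lemma norm2_sub_sym (f g : T -> R) :
  norm2 mu D (fun x => f x - g x) = norm2 mu D (fun x => g x - f x).
Proof.
by congr Num.sqrt; apply: eq_Rintegral => x _; rewrite -sqrrN opprB.
Qed.

Lemma norm2_triangle (f g h : T -> R) : Lev mu D 0 f -> Lev mu D 0 g -> Lev mu D 0 h ->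
  norm2 mu D (fun x => f x - h x) <=
  norm2 mu D (fun x => f x - g x) + norm2 mu D (fun x => g x - h x).
Proof.
move=> hf hg hh; apply: le_trans (norm2D mD (LevB mD hf hg) (LevB mD hg hh)).
rewrite le_eqVlt; apply/orP; left; apply/eqP; congr Num.sqrt.
by apply: eq_Rintegral => x _; rewrite addrA subrK.
Qed.

Lemma norm2_riesz_fischer (a_ : nat -> T -> R) : (forall n, Lev mu D 0 (a_ n)) ->
  (forall e : R, 0 < e -> exists n0, forall i j, (n0 <= i)%N -> (i <= j)%N ->
    norm2 mu D (fun x => a_ i x - a_ j x) <= e) ->
  exists2 a, Lev mu D 0 a & norm2 mu D (fun x => a_ n x - a x) @[n --> \oo] --> 0.
Proof.
move=> ha hc; have [e e0|a la hlim] := @riesz_fischer _ _ _ mu D mD 0 a_ ha.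
  have [|n0 h0] := hc (Num.sqrt e); first by rewrite sqrtr_gt0.
  exists n0; have H i j : (n0 <= i)%N -> (i <= j)%N ->
      \int[mu]_(x in D) (a_ i x - a_ j x) ^+ 2 <= e.
    move=> n0i ij; rewrite -sqr_norm2 -[leRHS](sqr_sqrtr (ltW e0)).
    by apply: lerXn2r; rewrite ?nnegrE ?norm2_ge0 ?sqrtr_ge0// h0.
  move=> i j n0i n0j; have [ij|/ltnW ji] := leqP i j; first exact: H.
  rewrite (_ : Rintegral _ _ _ = \int[mu]_(x in D) (a_ j x - a_ i x) ^+ 2); first exact: H.
  by apply: eq_Rintegral => x _; rewrite -sqrrN opprB.
exists a => //; rewrite -[X in _ --> X](@sqrtr0 R).
by apply: continuous_cvg => //; exact: sqrt_continuous.
Qed.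

Lemma norm2_geometric (a_ : nat -> T -> R) (C r : R) : (forall n, Lev mu D 0 (a_ n)) ->
  0 < r < 1 ->
  (forall k, norm2 mu D (fun x => a_ k.+1 x - a_ k x) <= C * r ^+ k) ->
  exists2 a, Lev mu D 0 a &
    forall k, norm2 mu D (fun x => a_ k x - a x) <= C * (r ^+ k / (1 - r)).
Proof.
move=> ha r01 hC; have [r0 r1] := andP r01.
have C0 : 0 <= C by have := hC 0%N; rewrite expr0 mulr1; apply: le_trans; exact: norm2_ge0.
have r10 : 0 < 1 - r by rewrite subr_gt0.
have H k m : (k <= m)%N -> norm2 mu D (fun x => a_ k x - a_ m x) <= C * (r ^+ k / (1 - r)).
  move=> km; apply: (@le_trans _ _ (C * \sum_(k <= i < m) r ^+ i)); last first.
    by rewrite ler_wpM2l// sum_geometric_le// ltW.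
  elim: m km => [|m ih]; first by rewrite leqn0 => /eqP ->; rewrite big_geq// mulr0 /norm2;
    under eq_Rintegral do rewrite subrr expr0n; rewrite Rintegral_cst// mul0r sqrtr0.
  rewrite leq_eqVlt => /predU1P[->|].
    by rewrite big_geq// mulr0 /norm2;
      under eq_Rintegral do rewrite subrr expr0n; rewrite Rintegral_cst// mul0r sqrtr0.
  rewrite ltnS => km; apply: le_trans (norm2_triangle (ha k) (ha m) (ha m.+1)) _.
  rewrite big_nat_recr//= mulrDr; apply: lerD; first exact: ih.
  by rewrite norm2_sub_sym.
have hsmall e : 0 < e -> exists n0, forall n, (n0 <= n)%N -> C * (r ^+ n / (1 - r)) <= e.
  move=> e0; have C1 : 0 < C + 1 by rewrite ltr_wpDl.
  have [||n0 h0] := @expr_cvg0 R r _ (e * (1 - r) / (C + 1)).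
  - by rewrite (ltW r0).
  - by rewrite divr_gt0// mulr_gt0.
  exists n0 => n /h0 h; rewrite mulrA ler_pdivrMr//.
  apply: (@le_trans _ _ ((C + 1) * r ^+ n)).
    by rewrite ler_wpM2r ?exprn_ge0 ?lerDl// ltW.
  by rewrite mulrC -ler_pdivlMr.
have [e e0|a la hlim] := norm2_riesz_fischer ha.
  have [n0 h0] := hsmall e e0; exists n0 => i j n0i ij.
  exact: le_trans (H i j ij) (h0 i n0i).
exists a => // k; apply/ler_addgt0Pr => e e0.
have /cvgn_leP/(_ e e0)[n0 h0] := hlim.
have kn : (k <= maxn k n0)%N by rewrite leq_maxl.
apply: le_trans (norm2_triangle (ha k) (ha (maxn k n0)) la) _.
apply: lerD; first exact: H.
by have := h0 (maxn k n0) (leq_maxr _ _); rewrite subr0; apply: le_trans; exact: ler_norm.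
Qed.

End bounded_integrable.

(** * Bisected cells and averages over them *)

Section bisection.
Context (R : realType) (N : nat).
Local Notation E := 'rV[R]_N.
Local Notation mu := (lebesgue_rV R N).
Implicit Types (i : 'I_N) (s : seq 'I_N) (p : E * E) (x : E) (u g : E -> R).

(** Half-open, so that a bisection is an exact partition and every point of the cell has a unique
    subcell. *)
Definition cell p : set E := hbox p.1 p.2.
Definition side p i : R := p.2 ord0 i - p.1 ord0 i.
Definition middle p i : R := p.1 ord0 i + side p i / 2.
Definition lower i p : E * E := (p.1, upd p.2 i (middle p i)).
Definition upper i p : E * E := (upd p.1 i (middle p i), p.2).
Definition bisect i p x : E * E := if x ord0 i < middle p i then lower i p else upper i p.
Definition nondeg p := forall i, 0 < side p i.

(* The cell containing [x] after bisecting [p] along the coordinates in [s]. *)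
Fixpoint subcell s p x : E * E := if s is i :: s' then subcell s' (bisect i p x) x else p.

Definition avg u p := (\int[mu]_(x in cell p) u x) / volume p.1 p.2.
Definition cell_avg s p u x := avg u (subcell s p x).

Lemma subcell_rcons s i p x : subcell (rcons s i) p x = bisect i (subcell s p x) x.
Proof. by elim: s p => [//|j s ih] p /=. Qed.

Lemma side_lower p i j : side (lower i p) j = side p j / (if j == i then 2 else 1).
Proof.
rewrite /side /lower /= mxE; case: eqP => [->|_]; last by rewrite divr1.
by rewrite /middle /side; field.
Qed.

Lemma side_upper p i j : side (upper i p) j = side p j / (if j == i then 2 else 1).
Proof.
rewrite /side /upper /= mxE; case: eqP => [->|_]; last by rewrite divr1.
by rewrite /middle /side; field.
Qed.

Lemma side_half p i x j : side (bisect i p x) j = side p j / (if j == i then 2 else 1).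
Proof. by rewrite /bisect; case: ifP => _; [exact: side_lower|exact: side_upper]. Qed.

Lemma side_subcell s p x j : side (subcell s p x) j = side p j / 2 ^+ count_mem j s.
Proof.
elim: s p => [|i s ih] p /=; first by rewrite expr0 divr1.
rewrite ih side_half eq_sym; case: eqP => _ /=; last by rewrite divr1.
by rewrite add1n exprS invfM mulrA.
Qed.

Lemma volumeE p : volume p.1 p.2 = \prod_j side p j.
Proof. by []. Qed.

Lemma volume_split p q i : (forall j, side q j = side p j / (if j == i then 2 else 1)) ->
  volume q.1 q.2 = volume p.1 p.2 / 2.
Proof.
move=> h; rewrite !volumeE (bigD1 i)//= [in RHS](bigD1 i)//= h eqxx mulrAC.
congr (_ * _ / _); apply: eq_bigr => j /negPf ji.
by rewrite h ji divr1.
Qed.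

Lemma volume_half p i x : volume (bisect i p x).1 (bisect i p x).2 = volume p.1 p.2 / 2.
Proof. by apply: (@volume_split _ _ i) => j; exact: side_half. Qed.

Lemma volume_subcell s p x :
  volume (subcell s p x).1 (subcell s p x).2 = volume p.1 p.2 / 2 ^+ size s.
Proof.
elim: s p => [|i s ih] p /=; first by rewrite expr0 divr1.
by rewrite ih volume_half exprS invfM mulrA.
Qed.

Lemma proper_lower p i : nondeg p -> nondeg (lower i p).
Proof. by move=> h j; rewrite side_lower divr_gt0//; case: ifP. Qed.

Lemma proper_upper p i : nondeg p -> nondeg (upper i p).
Proof. by move=> h j; rewrite side_upper divr_gt0//; case: ifP. Qed.

Lemma proper_half p i x : nondeg p -> nondeg (bisect i p x).
Proof. by rewrite /bisect; case: ifP => _ h; [exact: proper_lower|exact: proper_upper]. Qed.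

Lemma proper_subcell s p x : nondeg p -> nondeg (subcell s p x).
Proof. by elim: s p => [//|i s ih] p h /=; apply: ih; exact: proper_half. Qed.

Lemma proper_volume p : nondeg p -> 0 < volume p.1 p.2.
Proof. by move=> h; apply: prodr_gt0 => i _; exact: h. Qed.

Lemma middle_lt p i : nondeg p -> p.1 ord0 i < middle p i < p.2 ord0 i.
Proof.
by move=> /(_ i); rewrite /middle /side => h; apply/andP; split; lra.
Qed.

Lemma in_lower p i x : nondeg p ->
  cell (lower i p) x <-> cell p x /\ x ord0 i < middle p i.
Proof.
move=> pp; have /andP[m1 m2] := middle_lt i pp; split.
  move=> h; split=> [j|]; last by have := h i; rewrite /= mxE eqxx in_itv/= => /andP[].
  have := h j; rewrite /= !in_itv/= mxE => /andP[->]; case: eqP => // -> hx.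
  by apply: lt_trans hx _.
move=> [h hx] j; have := h j; rewrite /= !in_itv/= mxE => /andP[-> hj].
by case: eqP => // ->.
Qed.

Lemma in_upper p i x : nondeg p ->
  cell (upper i p) x <-> cell p x /\ middle p i <= x ord0 i.
Proof.
move=> pp; have /andP[m1 m2] := middle_lt i pp; split.
  move=> h; split=> [j|]; last by have := h i; rewrite /= mxE eqxx in_itv/= => /andP[].
  have := h j; rewrite /= !in_itv/= mxE => /andP[+ ->]; case: eqP => [->|_ ->//] hx.
  by rewrite (le_trans (ltW m1) hx).
move=> [h hx] j; have := h j; rewrite /= !in_itv/= mxE => /andP[hj ->].
by case: eqP => [->|_]; rewrite ?hx ?hj.
Qed.

Lemma cell_split p i : nondeg p -> cell p = cell (lower i p) `|` cell (upper i p).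
Proof.
move=> pp; apply/seteqP; split=> x; last first.
  by move=> [/(in_lower _ _ pp)[]|/(in_upper _ _ pp)[]].
move=> px; have [xm|mx] := ltP (x ord0 i) (middle p i).
  by left; apply/in_lower.
by right; apply/in_upper.
Qed.

Lemma cell_disj p i : nondeg p -> [disjoint cell (lower i p) & cell (upper i p)].
Proof.
move=> pp; apply/disj_setPS => x [/(in_lower _ _ pp)[_ h1] /(in_upper _ _ pp)[_]].
by rewrite leNgt h1.
Qed.

Lemma measurable_cell p : measurable (cell p). Proof. exact: measurable_hbox. Qed.

Lemma mu_cell p : nondeg p -> mu (cell p) = (volume p.1 p.2)%:E.
Proof. by move=> pp; apply: lebesgue_hbox => i; have := pp i; rewrite subr_gt0 => /ltW. Qed.

Lemma mu_cell_lty p : (mu (cell p) < +oo)%E.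
Proof.
apply: le_lt_trans (lebesgue_cbox_lty p.1 p.2); apply: le_measure; rewrite ?inE.
- exact: measurable_cell.
- exact: measurable_cbox.
- exact: hbox_cbox.
Qed.

Lemma half_lower p i x : x ord0 i < middle p i -> bisect i p x = lower i p.
Proof. by rewrite /bisect => ->. Qed.

Lemma half_upper p i x : middle p i <= x ord0 i -> bisect i p x = upper i p.
Proof. by rewrite /bisect ltNge => ->. Qed.

Lemma in_half p i x : nondeg p -> cell p x -> cell (bisect i p x) x.
Proof.
move=> pp px; have [xm|mx] := ltP (x ord0 i) (middle p i).
  by rewrite half_lower//; apply/in_lower.
by rewrite half_upper//; apply/in_upper.
Qed.

Lemma in_subcell s p x : nondeg p -> cell p x -> cell (subcell s p x) x.
Proof.
elim: s p => [//|i s ih] p pp px /=; apply: ih; first exact: proper_half.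
exact: in_half.
Qed.

Lemma sub_half p i x : nondeg p -> cell (bisect i p x) `<=` cell p.
Proof.
by move=> pp y; rewrite /bisect; case: ifP => _; [move/(in_lower _ _ pp) => []|move/(in_upper _ _ pp) => []].
Qed.

Lemma sub_subcell s p x : nondeg p -> cell (subcell s p x) `<=` cell p.
Proof.
elim: s p => [|i s ih] p pp /=; first exact: subset_refl.
by move=> y hy; apply: (@sub_half p i x pp); apply: ih hy; exact: proper_half.
Qed.

Lemma csub_half p i x : nondeg p -> cbox (bisect i p x).1 (bisect i p x).2 `<=` cbox p.1 p.2.
Proof.
move=> pp y; have /andP[m1 m2] := middle_lt i pp.
rewrite /bisect; case: ifP => _ h j; have := h j; rewrite /= !in_itv/= mxE => /andP[].
  by move=> ->; case: eqP => // -> hx; rewrite (le_trans hx (ltW m2)).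
by move=> + ->; case: eqP => [->|_ ->//] hx; rewrite (le_trans (ltW m1) hx).
Qed.

Lemma csub_subcell s p x : nondeg p ->
  cbox (subcell s p x).1 (subcell s p x).2 `<=` cbox p.1 p.2.
Proof.
elim: s p => [|i s ih] p pp /=; first exact: subset_refl.
by move=> y hy; apply: (@csub_half p i x pp); apply: ih hy; exact: proper_half.
Qed.

Lemma measurable_subcell s p (W : E * E -> R) :
  measurable_fun setT (fun x => W (subcell s p x)).
Proof.
elim: s p => [|i s ih] p /=; first exact: measurable_cst.
rewrite (_ : (fun x => _) = (fun x => if x ord0 i < middle p i
    then W (subcell s (lower i p) x) else W (subcell s (upper i p) x))).
  apply: measurable_fun_ifT => //; apply: measurable_fun_ltr => //.
  exact: measurable_rV_coord.
by apply/funext => x; rewrite /bisect; case: ifP.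
Qed.

Lemma subcell_bounded s p (W : E * E -> R) :
  exists M : R, forall x, `|W (subcell s p x)| <= M.
Proof.
elim: s p => [|i s ih] p /=; first by exists `|W p|.
have [M1 h1] := ih (lower i p); have [M2 h2] := ih (upper i p).
exists (Num.max M1 M2) => x; rewrite le_max /bisect.
by case: ifP => _; rewrite ?h1 ?h2 ?orbT.
Qed.

Lemma L1_subcell s p (W : E * E -> R) u : mu.-integrable (cell p) (EFin \o u) ->
  mu.-integrable (cell p) (EFin \o (fun x => W (subcell s p x) * u x)).
Proof.
move=> hu; have [M hM] := subcell_bounded s p W; have mp := measurable_cell p.
apply: L1_le (L1Z mp M (L1_norm hu)) _ => //.
  apply: measurable_funM; last exact: L1_measurable hu.
  by apply: measurable_funTS; exact: measurable_subcell.
by move=> x _; rewrite normrM ler_wpM2r.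
Qed.

Lemma L1_cell_cst p c : mu.-integrable (cell p) (EFin \o cst c).
Proof. by apply: L1_cst; [exact: measurable_cell|exact: mu_cell_lty]. Qed.

Lemma I_split i p u : nondeg p -> mu.-integrable (cell p) (EFin \o u) ->
  \int[mu]_(x in cell p) u x =
  \int[mu]_(x in cell (lower i p)) u x + \int[mu]_(x in cell (upper i p)) u x.
Proof.
move=> pp; rewrite (cell_split i pp) => hu.
by apply: Rintegral_setU => //; [exact: measurable_cell|exact: measurable_cell|exact: cell_disj].
Qed.

(** [cell_avg] is the conditional expectation given the partition into subcells, and
    [W (subcell s p x)] is an arbitrary function constant on each of them. The induction bisects
    once and treats the halves separately. *)
Lemma I_cell_avg s p (W : E * E -> R) u : nondeg p ->
  mu.-integrable (cell p) (EFin \o u) ->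
  \int[mu]_(x in cell p) (W (subcell s p x) * cell_avg s p u x) =
  \int[mu]_(x in cell p) (W (subcell s p x) * u x).
Proof.
elim: s p => [|i s ih] p pp hu /=.
  rewrite /cell_avg /= RintegralZl; [|exact: measurable_cell|exact: L1_cell_cst].
  rewrite [RHS](RintegralZl _ (measurable_cell p) hu).
  congr (_ * _); rewrite Rintegral_cst; last exact: measurable_cell.
  rewrite [X in _ * X](congr1 fine (mu_cell pp))/= mulfVK// gt_eqF//.
  exact: proper_volume.
have sl : cell (lower i p) `<=` cell p by move=> x /(in_lower _ _ pp)[].
have su : cell (upper i p) `<=` cell p by move=> x /(in_upper _ _ pp)[].
have hl : mu.-integrable (cell (lower i p)) (EFin \o u).
  by apply: integrableS sl hu => //; exact: measurable_cell.
have hup : mu.-integrable (cell (upper i p)) (EFin \o u).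
  by apply: integrableS su hu => //; exact: measurable_cell.
rewrite (I_split i pp); last first.
  have := @L1_subcell (i :: s) p (fun q => W q * avg u q) (cst 1) (L1_cell_cst _ _).
  by under [X in _.-integrable _ X -> _]eq_fun do rewrite /= mulr1.
rewrite (I_split i pp); last exact: (@L1_subcell (i :: s)).
congr (_ + _).
  transitivity (\int[mu]_(x in cell (lower i p))
      (W (subcell s (lower i p) x) * cell_avg s (lower i p) u x)).
    apply: eq_Rintegral => x /set_mem /(in_lower _ _ pp)[_ h].
    by rewrite /cell_avg /= half_lower.
  rewrite ih//; last exact: proper_lower.
  apply: eq_Rintegral => x /set_mem /(in_lower _ _ pp)[_ h].
  by rewrite half_lower.
transitivity (\int[mu]_(x in cell (upper i p))
    (W (subcell s (upper i p) x) * cell_avg s (upper i p) u x)).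
  apply: eq_Rintegral => x /set_mem /(in_upper _ _ pp)[_ h].
  by rewrite /cell_avg /= half_upper.
rewrite ih//; last exact: proper_upper.
apply: eq_Rintegral => x /set_mem /(in_upper _ _ pp)[_ h].
by rewrite half_upper.
Qed.

Lemma Lloc_cell Om u p : Lloc Om u -> cbox p.1 p.2 `<=` Om ->
  mu.-integrable (cell p) (EFin \o u).
Proof. exact: Lloc_hbox. Qed.

(** The average over a half minus the average over the cell is, up to sign, the difference of the
    integrals over the two halves divided by the volume of the cell. *)
Lemma avg_half Om i p x u g : open Om -> weak_partial Om i u g ->
  cbox p.1 p.2 `<=` Om -> nondeg p ->
  `|avg u (bisect i p x) - avg u p| <= side p i / 2 * avg (fun y => `|g y|) p.
Proof.
move=> oOm wu pOm pp; case: (wu) => lu lg _.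
have up : mu.-integrable (cell p) (EFin \o u) := Lloc_cell lu pOm.
have := @weak_partial_halves _ _ Om i u g p.1 p.2 (side p i / 2) oOm wu pOm _ erefl.
rewrite -subr_gt0 => /(_ (pp i)).
rewrite -[X in X - _]/(\int[mu]_(x in cell (lower i p)) u x).
rewrite -[X in _ - X]/(\int[mu]_(x in cell (upper i p)) u x).
rewrite -[X in _ * X]/(\int[mu]_(x in cell p) `|g x|).
have V0 := proper_volume pp.
rewrite /avg volume_half (I_split i pp up).
set V := volume _ _ in V0 *; set A := Rintegral _ (cell (lower i p)) _.
set B := Rintegral _ (cell (upper i p)) _; set G := Rintegral _ (cell p) _.
move=> H; have {}H : `|A - B| / V <= side p i / 2 * (G / V).
  by rewrite mulrA ler_wpM2r// invr_ge0 ltW.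
apply: le_trans H; rewrite /bisect; case: ifP => _; rewrite -/A -/B.
  by rewrite (_ : _ - _ = (A - B) / V) ?normrM ?(ger0_norm (ltW (_ : 0 < V^-1))) ?invr_gt0//; field; rewrite gt_eqF.
rewrite (_ : _ - _ = - ((A - B) / V)) ?normrN ?normrM ?(ger0_norm (ltW (_ : 0 < V^-1))) ?invr_gt0//.
by field; rewrite gt_eqF.
Qed.

Lemma cell_avg_step Om s i p x u g : open Om -> weak_partial Om i u g ->
  cbox p.1 p.2 `<=` Om -> nondeg p ->
  `|cell_avg (rcons s i) p u x - cell_avg s p u x| <=
  side p i / 2 ^+ count_mem i s * cell_avg s p (fun y => `|g y|) x.
Proof.
move=> oOm wu pOm pp; rewrite /cell_avg subcell_rcons.
have pq := proper_subcell s x pp.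
have qOm : cbox (subcell s p x).1 (subcell s p x).2 `<=` Om.
  by move=> y hy; apply: pOm; exact: csub_subcell hy.
apply: le_trans (avg_half x oOm wu qOm pq) _; rewrite -(side_subcell s p x).
apply: ler_wpM2r.
  by rewrite divr_ge0 ?(ltW (proper_volume pq))//; apply: Rintegral_ge0.
by rewrite ler_pdivrMr// ler_pMr ?ler1n//; exact: pq.
Qed.

Lemma cell_avg_power m s p x g : nondeg p -> mu.-integrable (cell p) (EFin \o g) ->
  mu.-integrable (cell p) (EFin \o (fun y => g y ^+ m.+1)) ->
  (forall y, 0 <= g y) -> cell p x ->
  cell_avg s p g x ^+ m.+1 <= cell_avg s p (fun y => g y ^+ m.+1) x.
Proof.
move=> pp ig igm g0 px; rewrite /cell_avg /avg.
have pq := proper_subcell s x pp; have sq : cell (subcell s p x) `<=` cell p by exact: sub_subcell.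
have mq := measurable_cell (subcell s p x).
have := @jensen_power _ _ _ mu _ mq (mu_cell_lty _) m g.
rewrite [X in 0 < X](congr1 fine (mu_cell pq)) [X in _ / X](congr1 fine (mu_cell pq))
  [X in _ <= _ / X](congr1 fine (mu_cell pq)) /=; apply.
- by apply: integrableS sq ig => //; exact: measurable_cell.
- by apply: integrableS sq igm => //; exact: measurable_cell.
- by move=> y _.
- exact: proper_volume.
Qed.

End bisection.

Section cyclic_bisection.
Context (R : realType) (n : nat).
Local Notation N := n.+1.
Local Notation E := 'rV[R]_N.
Local Notation mu := (lebesgue_rV R N).
Implicit Types (k : nat) (i : 'I_N) (p : E * E) (x : E) (u g : E -> R).

(** The coordinates are bisected cyclically, so that all sides of a cube shrink at the same rate. *)
Definition dir k : 'I_N := inord (k %% N).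
Definition dirs k : seq 'I_N := mkseq dir k.

Lemma dirsS k : dirs k.+1 = rcons (dirs k) (dir k).
Proof. by rewrite /dirs mkseqS. Qed.

Lemma size_dirs k : size (dirs k) = k. Proof. exact: size_mkseq. Qed.

Lemma count_dirs i k : (k %/ N <= count_mem i (dirs k))%N.
Proof.
have H m : (m <= count_mem i (dirs (m * N)))%N.
  elim: m => // m ih; rewrite mulSn addnC /dirs /mkseq iotaD map_cat count_cat.
  apply: (@leq_trans (m + 1)%N); first by rewrite addn1.
  apply: leq_add => //; rewrite -has_count.
  apply/hasP; exists i; last exact: eqxx.
  apply/mapP; exists (m * N + i)%N; first by rewrite mem_iota add0n leq_addr ltn_add2l ltn_ord.
  by apply: val_inj; rewrite /dir /= inordK ?ltn_pmod// modnMDl modn_small.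
apply: leq_trans (H _) _.
rewrite [in leqRHS](divn_eq k N) {2}/dirs /mkseq iotaD map_cat count_cat.
exact: leq_addr.
Qed.

(** Plays the part of the m-th root of 1/2: for r = 1 - 1/(2(m+1)) Bernoulli's inequality gives r^m
    >= 1 - m/(2(m+1)) >= 1/2. *)
Lemma bernoulli_ratio m : exists2 r : R, 0 < r < 1 & 2^-1 <= r ^+ m.
Proof.
exists (1 - (2 * m.+1%:R)^-1).
  rewrite gtrBl subr_gt0 invr_gt0 mulr_gt0//= andbT invf_lt1 ?mulr_gt0//.
  by rewrite -natrM ltr1n; lia.
have H j : (j <= m)%N -> 1 - j%:R * (2 * m.+1%:R)^-1 <= (1 - (2 * m.+1%:R)^-1) ^+ j :> R.
  elim: j => [|j ih] jm; first by rewrite mul0r subr0 expr0.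
  have {}ih := ih (ltnW jm); set c := _^-1 in ih *.
  have c0 : 0 <= c by rewrite invr_ge0 mulr_ge0.
  have c1 : 0 <= 1 - c.
    by rewrite subr_ge0 invf_le1 ?mulr_gt0// -natrM ler1n; lia.
  rewrite exprS; apply: le_trans (ler_wpM2l c1 ih).
  rewrite -natr1; have := mulr_ge0 (ler0n R j) (mulr_ge0 c0 c0); lra.
apply: le_trans (H m (leqnn m)); rewrite invfM mulrCA.
have : (m%:R / m.+1%:R : R) <= 1 by rewrite ler_pdivrMr// mul1r ler_nat.
by move: (_ / _ : R) => z; lra.
Qed.

(** After [k] bisections each coordinate has been halved at least floor(k/N) times. The factor 2
    pays for the incomplete last cycle. *)
Lemma geometric_sides : exists2 r : R, 0 < r < 1 &
  forall i k, (2 ^+ count_mem i (dirs k))^-1 <= 2 * r ^+ k.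
Proof.
have [r /andP[r0 r1] hr] := bernoulli_ratio N; exists r; first by rewrite r0.
move=> i k; apply: (@le_trans _ _ (2 ^+ (k %/ N))^-1).
  by rewrite lef_pV2 ?posrE ?exprn_gt0// ler_weXn2l ?ler1n// count_dirs.
have h1 : (2 ^+ (k %/ N))^-1 <= r ^+ (N * (k %/ N)).
  by rewrite -exprVn exprM; apply: lerXn2r; rewrite ?nnegrE ?invr_ge0// exprn_ge0// ltW.
apply: le_trans h1 _; rewrite -ler_pdivrMl// mulrC.
have hr' := ler_wpM2l (exprn_ge0 (N * (k %/ N)) (ltW r0)) hr.
apply: le_trans hr' _; rewrite -exprD.
apply: ler_wiXn2l; [exact: ltW|exact: ltW|].
by have := divn_eq k N; have := ltn_pmod k (ltn0Sn n); lia.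
Qed.

Section l2_approximation.
Variables (Om : set E) (oOm : open Om) (p : E * E) (pp : nondeg p).
Hypothesis pOm : cbox p.1 p.2 `<=` Om.
Variables (H : R) (sideH : forall i, side p i = H).
Variables (r : R) (r01 : 0 < r < 1).
Hypothesis rP : forall i k, (2 ^+ count_mem i (dirs k))^-1 <= 2 * r ^+ k.

Let D := cell p.
Let mD : measurable D := measurable_cell p.
Let Doo : (mu D < +oo)%E := mu_cell_lty p.
Let nrm := norm2 mu D.

Lemma H_gt0 : 0 < H. Proof. by rewrite -(sideH ord0); exact: pp. Qed.

Lemma cell_avg_measurable s u : measurable_fun D (cell_avg s p u).
Proof. by apply: measurable_funTS; exact: (measurable_subcell s p (avg u)). Qed.

Lemma cell_avg_Lev m s u : Lev mu D m (cell_avg s p u).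
Proof.
have [M hM] := subcell_bounded s p (avg u).
apply: (@Lev_bounded _ _ _ _ _ mD Doo m _ M) => [|x _]; last exact: hM.
exact: cell_avg_measurable.
Qed.

Lemma I_cell_avg1 s u : mu.-integrable D (EFin \o u) ->
  \int[mu]_(x in D) cell_avg s p u x = \int[mu]_(x in D) u x.
Proof.
move=> hu; have := I_cell_avg s (fun=> 1) pp hu.
by under eq_Rintegral do rewrite mul1r; under [X in _ = X]eq_Rintegral do rewrite mul1r.
Qed.

(** On each cell Jensen's inequality replaces the squared average of |g| by the average of g^2, and
    averaging over cells does not change the integral over the whole cell. *)
Lemma cell_avg_norm2_step k u g : weak_partial Om (dir k) u g -> Lev mu D 0 g ->
  nrm (fun x => cell_avg (dirs k.+1) p u x - cell_avg (dirs k) p u x) <=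
  2 * H * r ^+ k * nrm g.
Proof.
move=> wu hg; have [r0 r1] := andP r01; have H0 := H_gt0.
set c := 2 * H * r ^+ k; have c0 : 0 <= c by rewrite !mulr_ge0 ?exprn_ge0// ltW.
rewrite /nrm /norm2 -{1}(ger0_norm c0) -sqrtr_sqr -sqrtrM ?sqr_ge0//.
apply: ler_wsqrtr.
have ig : mu.-integrable D (EFin \o (fun x => g x ^+ 2)) by case: hg.
have ing : mu.-integrable D (EFin \o (fun x => `|g x|)).
  exact: L1_norm (Lev_L1 mD Doo hg).
have ig2 : mu.-integrable D (EFin \o (fun x => `|g x| ^+ 2)).
  by under [X in _.-integrable _ X]eq_fun do rewrite /= (even_expr_norm 0).
rewrite -(I_cell_avg1 (dirs k) ig) -RintegralZl//; last first.
  by have := cell_avg_Lev 0 (dirs k) (fun x => g x ^+ 2) => /(Lev_L1 mD Doo).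
apply: le_Rintegral => //.
- by have [] := LevB mD (cell_avg_Lev 0 (dirs k.+1) u) (cell_avg_Lev 0 (dirs k) u).
- by apply: L1Z => //; have := cell_avg_Lev 0 (dirs k) (fun x => g x ^+ 2) => /(Lev_L1 mD Doo).
move=> x Dx; rewrite dirsS.
have h1 := cell_avg_step (dirs k) x oOm wu pOm pp.
have h2 := @cell_avg_power _ _ 1 (dirs k) p x (fun y => `|g y|) pp ing ig2 (fun y => normr_ge0 _) Dx.
rewrite -(even_expr_norm 0).
have A0 : 0 <= cell_avg (dirs k) p (fun y => `|g y|) x.
  rewrite /cell_avg divr_ge0//; first by apply: Rintegral_ge0.
  exact/ltW/proper_volume/proper_subcell.
apply: (@le_trans _ _ ((c * cell_avg (dirs k) p (fun y => `|g y|) x) ^+ 2)).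
  apply: lerXn2r; rewrite ?nnegrE ?normr_ge0 ?(mulr_ge0 c0 A0)//.
  apply: le_trans h1 _; apply: ler_wpM2r => //.
  by rewrite sideH /c -mulrA mulrCA ler_wpM2l// ltW.
rewrite exprMn ler_wpM2l ?sqr_ge0//; apply: le_trans h2 _.
by rewrite (_ : (fun y => `|g y| ^+ 2) = (fun y => g y ^+ 2))//;
  apply/funext => y; exact: (even_expr_norm 0).
Qed.

Lemma subcell_near c d x : D x -> obox c d x ->
  exists k0, forall k, (k0 <= k)%N -> cell (subcell (dirs k) p x) `<=` obox c d.
Proof.
move=> Dx Ax; have [r0 r1] := andP r01; have H0 := H_gt0.
have [k0 _ hk0] : \forall k \near \oo, forall i : 'I_N,
    H * (2 * r ^+ k) <= Num.min (x ord0 i - c ord0 i) (d ord0 i - x ord0 i).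
  apply: filter_forall => i; set e := Num.min _ _.
  have e0 : 0 < e.
    by have := Ax i; rewrite /= in_itv/= lt_min !subr_gt0.
  have [||n0 h0] := @expr_cvg0 R r _ (e / (H * 2)).
  - by rewrite (ltW r0).
  - by rewrite divr_gt0// mulr_gt0.
  by exists n0 => // k /h0; rewrite ler_pdivlMr ?mulr_gt0// mulrC mulrA.
exists k0 => k /hk0 h y hy i; have := h i; rewrite le_min => /andP[h1 h2].
have hx := in_subcell (dirs k) pp Dx.
have hs : side (subcell (dirs k) p x) i <= H * (2 * r ^+ k).
  by rewrite side_subcell sideH; apply: ler_wpM2l (rP _ _); exact: ltW.
have := hx i; have := hy i; rewrite /side in hs; rewrite /= !in_itv/=.
move=> /andP[? ?] /andP[? ?]; apply/andP; split; lra.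
Qed.

(** For an open box [A], the union of the current subcells contained in [A] has an indicator
    constant on subcells, against which [u] and its average have the same integral. As the cells
    shrink this indicator tends to that of [A], so w - u has zero integral over every box. *)
Lemma cell_avg_limit (u w : E -> R) : mu.-integrable D (EFin \o u) -> Lev mu D 0 w ->
  norm2 mu D (fun x => cell_avg (dirs k) p u x - w x) @[k --> \oo] --> 0 ->
  w = u %[ae mu in D].
Proof.
move=> hu lw hlim; have hw := Lev_L1 mD Doo lw.
have hwu : mu.-integrable D (EFin \o (fun x => w x - u x)) by exact: L1B.
have DoD : obox p.1 p.2 `<=` D by exact: obox_hbox.
have : {ae mu, forall x, obox p.1 p.2 x -> w x - u x = 0}.
  apply: ae_eq0_of_oboxes.
    by apply: integrableS hwu => //; exact: measurable_obox.
  move=> c d cdp; set A := obox c d; have mA : measurable A := measurable_obox c d.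
  have AD : A `<=` D by apply: subset_trans DoD.
  pose W (q : E * E) : R := if `[< cell q `<=` A >] then 1 else 0.
  have W1 q : `|W q| <= 1 by rewrite /W; case: ifP => _; rewrite ?normr1// normr0.
  have hWu k : mu.-integrable D (EFin \o (fun x => W (subcell (dirs k) p x) * u x)).
    exact: L1_subcell.
  have hWw k : mu.-integrable D (EFin \o (fun x => W (subcell (dirs k) p x) * w x)).
    exact: L1_subcell.
  have lP k : Lev mu D 0 (cell_avg (dirs k) p u) by exact: cell_avg_Lev.
  have hP k : mu.-integrable D (EFin \o (cell_avg (dirs k) p u)) by exact: Lev_L1 (lP k).
  have hWP k : mu.-integrable D (EFin \o (fun x => W (subcell (dirs k) p x) * cell_avg (dirs k) p u x)).
    exact: L1_subcell.
  have lim0 : \int[mu]_(x in D) (W (subcell (dirs k) p x) * (w x - u x)) @[k --> \oo] --> (0 : R).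
    apply/cvgn_leP => e e0; set c0 := Num.sqrt (fine (mu D)).
    have c00 : 0 <= c0 by exact: sqrtr_ge0.
    have e1 : 0 < e / (c0 + 1) by rewrite divr_gt0// ltr_wpDl.
    have /cvgn_leP/(_ _ e1)[n0 hn0] := hlim; exists n0 => k /hn0.
    rewrite subr0 ger0_norm ?norm2_ge0// => h; rewrite subr0.
    have -> : \int[mu]_(x in D) (W (subcell (dirs k) p x) * (w x - u x)) =
        \int[mu]_(x in D) (W (subcell (dirs k) p x) * (w x - cell_avg (dirs k) p u x)).
      under eq_Rintegral do rewrite mulrBr.
      under [RHS]eq_Rintegral do rewrite mulrBr.
      by rewrite !RintegralB// I_cell_avg.
    have hd := LevB mD lw (lP k).
    apply: le_trans (le_normr_Rintegral _ _) _ => //.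
      exact: L1_subcell (Lev_L1 mD Doo hd).
    apply: (@le_trans _ _ (\int[mu]_(x in D) `|w x - cell_avg (dirs k) p u x|)).
      apply: le_Rintegral => //.
      - by apply: L1_norm; exact: L1_subcell (Lev_L1 mD Doo hd).
      - exact: L1_norm (Lev_L1 mD Doo hd).
      - by move=> x _; rewrite normrM ler_piMl.
    apply: le_trans (I_norm_le_norm2 mD Doo hd) _; rewrite norm2_sub_sym -/c0.
    apply: (@le_trans _ _ (e / (c0 + 1) * c0)); first by rewrite ler_wpM2r.
    by rewrite mulrAC ler_pdivrMr ?ltr_wpDl// ler_wpM2l ?lerDl// ltW.
  have := @I_dct _ _ _ mu D mD (fun k x => W (subcell (dirs k) p x) * (w x - u x))
    ((fun x => w x - u x) \_ A) (fun x => `|w x - u x|).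
  move=> [|||||_ hc].
  - by move=> k; apply: L1_measurable; exact: L1_subcell.
  - apply/(measurable_restrict _ mA mD); rewrite (setIidr AD).
    by apply: measurable_funS (L1_measurable hwu).
  - exact: L1_norm.
  - apply: aeW => x Dx; apply/cvgn_leP => e e0; rewrite patchE.
    have [Ax|nAx] := pselect (A x).
      have [k0 hk0] := subcell_near Dx Ax; exists k0 => k /hk0 h.
      by rewrite mem_set// /W asboolT// mul1r subrr normr0 ltW.
    exists 0%N => k _; rewrite memNset// /W asboolF ?mul0r ?subrr ?normr0 ?ltW// => h.
    by apply: nAx; apply: h; exact: in_subcell.
  - by move=> k; apply: aeW => x _; rewrite normrM ler_piMl.
  by have <- := cvgn_uniq hc lim0; rewrite -Rintegral_mkcondr (setIidr AD).
have [N0 [mN0 N00 sN0]] := negligible_hbox_obox p.1 p.2.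
move=> h; have h' : {ae mu, forall x, ~ N0 x}.
  by exists N0; split=> // x /= /contrapT.
apply: filterS2 h h' => x h h' Dx; apply/eqP; rewrite -subr_eq0; apply/eqP/h.
by apply: contrapT => nx; apply: h'; exact: sN0.
Qed.

(* Poincare's inequality, in the form of an approximation by step functions. *)
Lemma cell_avg_approx u (g : 'I_N -> E -> R) k : Lev mu D 0 u ->
  (forall i, weak_partial Om i u (g i)) -> (forall i, Lev mu D 0 (g i)) ->
  norm2 mu D (fun x => cell_avg (dirs k) p u x - u x) <=
  2 * H * (\sum_i norm2 mu D (g i)) * (r ^+ k / (1 - r)).
Proof.
move=> lu wu lg; set C := 2 * H * _.
have [r0 r1] := andP r01; have H0 := H_gt0.
have [||w lw hw] := @norm2_geometric _ _ _ mu D mD (fun k => cell_avg (dirs k) p u) C r _ r01.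
- by move=> j; exact: cell_avg_Lev.
- move=> j; have h := cell_avg_norm2_step (wu (dir j)) (lg (dir j)).
  apply: le_trans h _.
  rewrite /C mulrAC ler_wpM2r ?exprn_ge0 ?(ltW r0)// ler_wpM2l ?mulr_ge0 ?(ltW H0)//.
  by rewrite (bigD1 (dir j))//= lerDl sumr_ge0// => i _; exact: norm2_ge0.
suff wE : w = u %[ae mu in D].
  rewrite (_ : norm2 _ _ _ = norm2 mu D (fun x => cell_avg (dirs k) p u x - w x)) //.
  congr Num.sqrt; apply: ae_I => //.
  - by apply: measurable_funX; apply: measurable_funB; [exact: cell_avg_measurable|case: lu].
  - by apply: measurable_funX; apply: measurable_funB; [exact: cell_avg_measurable|case: lw].
  - by apply: filterS wE => x h Dx; rewrite h.
apply: (cell_avg_limit (Lev_L1 mD Doo lu) lw).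
have C0 : 0 <= C by rewrite !mulr_ge0 ?(ltW H0)// sumr_ge0// => i _; exact: norm2_ge0.
apply/cvgn_leP => e e0; have r10 : 0 < 1 - r by rewrite subr_gt0.
have C1 : 0 < C + 1 by rewrite ltr_wpDl.
have [||n0 h0] := @expr_cvg0 R r _ (e * (1 - r) / (C + 1)).
- by rewrite (ltW r0).
- by rewrite divr_gt0// mulr_gt0.
exists n0 => j /h0 h; rewrite subr0 ger0_norm ?norm2_ge0//; apply: le_trans (hw j) _.
rewrite mulrA ler_pdivrMr//; apply: (@le_trans _ _ ((C + 1) * r ^+ j)).
  by rewrite ler_wpM2r ?exprn_ge0 ?lerDl// ltW.
by rewrite mulrC -ler_pdivlMr.
Qed.

End l2_approximation.

End cyclic_bisection.

Arguments dir {n} k.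
Arguments dirs {n} k.

Section restriction.
Context d (T : measurableType d) (R : realType) (mu : {measure set T -> \bar R}).
Variables (A B : set T) (mA : measurable A) (mB : measurable B) (BA : B `<=` A).
Implicit Types f : T -> R.

Lemma Lev_S m f : Lev mu A m f -> Lev mu B m f.
Proof.
by move=> [mf hf]; split; [exact: measurable_funS mf|exact: integrableS hf].
Qed.

Lemma I_S f : mu.-integrable A (EFin \o f) -> (forall x, 0 <= f x) ->
  \int[mu]_(x in B) f x <= \int[mu]_(x in A) f x.
Proof.
move=> hf f0; rewrite -[X in Rintegral _ X](setIidr BA) Rintegral_mkcondr.
apply: le_Rintegral => //.
  have : mu.-integrable (A `&` B) (EFin \o f).
    by rewrite (setIidr BA); exact: integrableS hf.
  move=> /integrable_restrict => /(_ mB mA); apply: eq_integrable => // x _ /=.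
  by rewrite !patchE; case: ifP.
by move=> x _; rewrite patchE; case: ifP.
Qed.

Lemma norm2_S f : Lev mu A 0 f -> norm2 mu B f <= norm2 mu A f.
Proof.
by move=> [_ hf]; apply: ler_wsqrtr; apply: I_S => // x; exact: sqr_ge0.
Qed.

End restriction.

Section tree.
Context (R : realType) (N : nat).
Local Notation E := 'rV[R]_N.
Implicit Types (w : seq ('I_N * bool)) (p : E * E).

(** Names a subcell by a finite word of choices instead of by a point in it. Words form a countable
    type, as a diagonal extraction requires. *)
Fixpoint node w p : E * E := if w is ib :: w' then
  node w' (if ib.2 then lower ib.1 p else upper ib.1 p) else p.

Lemma subcell_node s p x : exists w, subcell s p x = node w p.
Proof.
elim: s p => [|i s ih] p /=; first by exists [::].
have [w ->] := ih (bisect i p x).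
by exists ((i, x ord0 i < middle p i) :: w).
Qed.

Lemma sub_node w p : nondeg p -> cell (node w p) `<=` cell p.
Proof.
elim: w p => [|[i c] w ih] p pp /=; first exact: subset_refl.
move=> y /ih; case: c => /=.
  by move=> /(_ (proper_lower i pp)) /(in_lower _ _ pp)[].
by move=> /(_ (proper_upper i pp)) /(in_upper _ _ pp)[].
Qed.

End tree.

(** * Rellich compactness and Morrey's inequality *)

Section compactness.
Context (R : realType) (n : nat).
Local Notation N := n.+1.
Local Notation E := 'rV[R]_N.
Local Notation mu := (lebesgue_rV R N).
Implicit Types (p : E * E) (x : E).

(** Along a diagonal subsequence the integrals over all of the countably many subcells converge. At
    each fixed depth the step approximations then converge in L^2 by dominated convergence, and they
    are close to the functions uniformly in the sequence, so the functions are Cauchy in L^2. *)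
Lemma rellich_cell (Om : set E) p (h M : R) (u_ : nat -> E -> R)
    (g_ : nat -> 'I_N -> E -> R) : open Om -> cbox p.1 p.2 `<=` Om -> 0 < h ->
  (forall i, side p i = h) ->
  (forall j i, weak_partial Om i (u_ j) (g_ j i)) ->
  (forall j, Lev mu (cell p) 0 (u_ j)) -> (forall j i, Lev mu (cell p) 0 (g_ j i)) ->
  (forall j, norm2 mu (cell p) (u_ j) <= M) ->
  (forall j i, norm2 mu (cell p) (g_ j i) <= M) ->
  exists2 t, {homo t : m n / (m < n)%N} &
    {ae mu, forall x, cell p x -> cvgn (fun j => u_ (t j) x)}.
Proof.
move=> oOm pOm h0 sideh wu lu lg uM gM; set D := cell p.
have pp : nondeg p by move=> i; rewrite sideh.
have [r r01 rP] := geometric_sides R n.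
have mD : measurable D := measurable_cell p.
have Doo := mu_cell_lty p; have M0 : 0 <= M by apply: le_trans (uM 0%N); exact: norm2_ge0.
set c0 := Num.sqrt (fine (mu D)).
have iu j : mu.-integrable D (EFin \o u_ j) by exact: Lev_L1 (lu j).
have wK j (w : seq ('I_N * bool)) : `|\int[mu]_(x in cell (node w p)) u_ j x| <= M * c0.
  have sw := @sub_node _ _ w p pp; have mw := measurable_cell (node w p).
  apply: le_trans (le_normr_Rintegral mw (integrableS mD mw sw (iu j))) _.
  apply: le_trans (I_S mD mw sw (L1_norm (iu j)) (fun x => normr_ge0 _)) _.
  apply: le_trans (I_norm_le_norm2 mD Doo (lu j)) _.
  by rewrite ler_wpM2r ?sqrtr_ge0.
pose P k (s : nat -> nat) := if unpickle k is Some w then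
  cvgn (fun j => \int[mu]_(x in cell (node w p)) u_ (s j) x) else True.
have [|k s hs|t1 ht1 hP] := @diagonal_subsequence P.
- move=> k s s' ss'; rewrite /P; case: (unpickle k) => [w|//]; move=> /cvg_ex[l hl].
  by apply/cvg_ex; exists l; exact: (almost_subseq_cvg (a := fun j => \int[mu]_(x in cell (node w p)) u_ j x) ss' hl).
- rewrite /P; case: unpickle => [w|]; last by exists id.
  by have [t ht hc] := bounded_subsequence (fun j => wK (s j) w); exists t.
pose v_ j := u_ (t1 j).
have cv k x : cvgn (fun j => cell_avg (dirs k) p (v_ j) x).
  have [w hw] := subcell_node (dirs k) p x.
  have := hP (pickle w); rewrite /P pickleK => /cvg_ex[l hl].
  apply/cvg_ex; exists (l / volume (node w p).1 (node w p).2).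
  rewrite /cell_avg /avg hw; apply: cvgM; [exact: hl|exact: cvg_cst].
have lP k j : Lev mu D 0 (cell_avg (dirs k) p (v_ j)) by exact: cell_avg_Lev.
have avgc k : exists2 L, Lev mu D 0 L &
    norm2 mu D (fun x => cell_avg (dirs k) p (v_ j) x - L x) @[j --> \oo] --> 0.
  set V := volume p.1 p.2 / 2 ^+ k; have V0 : 0 < V.
    by rewrite divr_gt0 ?exprn_gt0//; exact: proper_volume.
  pose K := M * c0 / V.
  have PK j x : `|cell_avg (dirs k) p (v_ j) x| <= K.
    rewrite /cell_avg /avg volume_subcell size_dirs -/V normrM.
    rewrite [X in _ * X]ger0_norm ?invr_ge0 ?(ltW V0)//.
    have [w ->] := subcell_node (dirs k) p x.
    by rewrite ler_wpM2r ?invr_ge0 ?(ltW V0)// wK.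
  pose L x : R := lim (cell_avg (dirs k) p (v_ j) x @[j --> \oo]).
  have mL : measurable_fun D L.
    apply: (@measurable_fun_cvg _ _ _ D (fun j => cell_avg (dirs k) p (v_ j))).
      by move=> j; case: (lP k j).
    by move=> x _; exact: cv.
  have LK x : `|L x| <= K.
    have : `|cell_avg (dirs k) p (v_ j) x| @[j --> \oo] --> `|L x| by apply: cvg_norm; exact: cv.
    by move/cvgn_upper; apply => j; exact: PK.
  have lL : Lev mu D 0 L by exact: (@Lev_bounded _ _ _ _ _ mD Doo 0 L K mL (fun x _ => LK x)).
  exists L => //.
  have [|||||_ hc] := @I_dct _ _ _ mu D mD
    (fun j x => (cell_avg (dirs k) p (v_ j) x - L x) ^+ 2) (cst 0) (cst ((K + K) ^+ 2)).
  - by move=> j; apply: measurable_funX; apply: measurable_funB => //; case: (lP k j).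
  - exact: measurable_cst.
  - exact: L1_cst.
  - apply: aeW => x Dx; have hx : cell_avg (dirs k) p (v_ j) x - L x @[j --> \oo] --> L x - L x.
      by apply: cvgB; [exact: cv|exact: cvg_cst].
    have := @cvgn_exprn R _ _ 2 hx.
    by rewrite subrr expr0n.
  - move=> j; apply: aeW => x _; rewrite normrX; apply: lerXn2r; rewrite ?nnegrE//.
      by rewrite addr_ge0// (le_trans _ (LK x)).
    by apply: le_trans (ler_normB _ _) _; exact: lerD.
  rewrite Rintegral_cst// mul0r in hc.
  rewrite -[X in _ --> X](@sqrtr0 R).
  by apply: continuous_cvg => //; exact: sqrt_continuous.
have [r0 r1] := andP r01; have r10 : 0 < 1 - r by rewrite subr_gt0.
pose C := 2 * h * (\sum_(i < N) M); have C0 : 0 <= C.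
  by apply: mulr_ge0; [rewrite mulr_ge0// ltW|apply: sumr_ge0 => i _].
have approx k j : norm2 mu D (fun x => cell_avg (dirs k) p (v_ j) x - v_ j x) <= C * (r ^+ k / (1 - r)).
  apply: le_trans (cell_avg_approx oOm pp pOm sideh r01 rP k (lu (t1 j)) (wu (t1 j)) (lg (t1 j))) _.
  apply: ler_wpM2r; first by rewrite divr_ge0 ?exprn_ge0 ?(ltW r0) ?(ltW r10).
  by apply: ler_wpM2l; [rewrite mulr_ge0// ltW|apply: ler_sum => i _; exact: gM].
have [e e0|v lv hv] := @norm2_riesz_fischer _ _ _ mu D mD v_ (fun j => lu (t1 j)).
  have C1 : 0 < C + 1 by rewrite ltr_wpDl.
  have [||k hk] := @expr_cvg0 R r _ (e / 4 * (1 - r) / (C + 1)).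
  - by rewrite (ltW r0).
  - by rewrite divr_gt0// mulr_gt0// divr_gt0.
  have {}hk : C * (r ^+ k / (1 - r)) <= e / 4.
    have {}hk := hk k (leqnn k); rewrite mulrA ler_pdivrMr//.
    apply: (@le_trans _ _ ((C + 1) * r ^+ k)).
      by rewrite ler_wpM2r ?exprn_ge0 ?lerDl// ltW.
    by rewrite mulrC -ler_pdivlMr.
  have [L lL /cvgn_leP/(_ (e / 4) (divr_gt0 e0 (ltr0Sn R 3)))[n0 hn0]] := avgc k.
  have {}hn0 j : (n0 <= j)%N -> norm2 mu D (fun x => cell_avg (dirs k) p (v_ j) x - L x) <= e / 4.
    by move=> /hn0; rewrite subr0 ger0_norm ?norm2_ge0.
  exists n0 => i j n0i ij; have n0j := leq_trans n0i ij.
  have lv j' : Lev mu D 0 (v_ j') by exact: lu.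
  apply: le_trans (norm2_triangle mD (lv i) (lP k i) (lv j)) _.
  have h1 := norm2_triangle mD (lP k i) lL (lv j).
  have h2 := norm2_triangle mD lL (lP k j) (lv j).
  have a1 := approx k i; have a2 := approx k j; have b1 := hn0 i n0i; have b2 := hn0 j n0j.
  rewrite norm2_sub_sym in a1; rewrite norm2_sub_sym in b2.
  rewrite [leRHS](_ : e = e / 4 + (e / 4 + (e / 4 + e / 4))); last by field.
  apply: lerD; first exact: le_trans hk.
  apply: le_trans h1 _; apply: lerD => //; apply: le_trans h2 _; apply: lerD => //.
  exact: le_trans hk.
have [|t2 ht2 hae] := @cvg_Lev_ae _ _ _ mu D mD 0 v_ v (fun j => lu (t1 j)) lv.
  rewrite (_ : (fun j => _) = (fun j => norm2 mu D (fun x => v_ j x - v x) ^+ 2)).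
    by have := @cvgn_exprn R _ _ 2 hv; rewrite expr0n.
  by apply/funext => j; rewrite sqr_norm2.
exists (t1 \o t2); first exact: comp_increasing.
by apply: filterS hae => x hx Dx; apply/cvg_ex; exists (v x); exact: hx.
Qed.

(* Only a.e. convergence is claimed (Rellich on each cube of an exhaustion, then a
   diagonal subsequence), so no regularity of the boundary is needed. *)
Lemma rellich (Om : set E) (M : R) (u_ : nat -> E -> R) (g_ : nat -> 'I_N -> E -> R) :
  open Om ->
  (forall j i, weak_partial Om i (u_ j) (g_ j i)) ->
  (forall j, Lev mu Om 0 (u_ j)) -> (forall j i, Lev mu Om 0 (g_ j i)) ->
  (forall j, norm2 mu Om (u_ j) <= M) -> (forall j i, norm2 mu Om (g_ j i) <= M) ->
  exists2 t, {homo t : m n / (m < n)%N} &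
    {ae mu, forall x, Om x -> cvgn (fun j => u_ (t j) x)}.
Proof.
move=> oOm wu lu lg uM gM; have mOm := rV_open_measurable oOm.
have [A [F [hF OmE]]] := open_cube_cover oOm.
pose P k (s : nat -> nat) := A k ->
  {ae mu, forall x, cell (F k) x -> cvgn (fun j => u_ (s j) x)}.
have [|k s hs|t ht hP] := @diagonal_subsequence P.
- move=> k s s' ss' h /h; apply: filterS => x hx /hx /cvg_ex[l hl].
  by apply/cvg_ex; exists l; exact: (almost_subseq_cvg (a := fun j => u_ j x) ss' hl).
- rewrite /P; have [Ak|nAk] := pselect (A k); last by exists id.
  have [FOm [h h0 sh]] := hF k Ak.
  have sub : cell (F k) `<=` Om by apply: subset_trans FOm; exact: hbox_cbox.
  have mc := measurable_cell (F k).
  have [|||||t ht hc] := @rellich_cell Om (F k) h M (u_ \o s) (g_ \o s) oOm FOm h0 sh.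
  + by move=> j i; exact: wu.
  + by move=> j; exact: Lev_S (lu _).
  + by move=> j i; exact: Lev_S (lg _ _).
  + by move=> j; apply: le_trans (uM (s j)); apply: norm2_S (lu _).
  + by move=> j i; apply: le_trans (gM (s j) i); apply: norm2_S (lg _ _).
  by exists t.
exists t => //.
have : {ae mu, forall x, forall k, A k -> cell (F k) x -> cvgn (fun j => u_ (t j) x)}.
  apply: ae_foralln => k; have [Ak|nAk] := pselect (A k); last by apply: aeW.
  by apply: filterS (hP k Ak) => x hx _.
apply: filterS => x hx; rewrite {1}OmE => -[k Ak Fx].
by apply: hx Ak _; exact: obox_hbox.
Qed.

(* Morrey's inequality: the averages over nested cells differ geometrically little
   once the gradient is in L^q with q large. *)
Lemma morrey_cell p (h : R) : 0 < h -> (forall i, side p i = h) ->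
  exists m : nat, forall I0 J0 : R, exists C : R,
  forall (Om : set E) (u : E -> R) (g : 'I_N -> E -> R), open Om ->
  cbox p.1 p.2 `<=` Om ->
  (forall i, weak_partial Om i u (g i)) -> Lev mu (cell p) 0 u ->
  (forall i, Lev mu (cell p) 0 (g i)) -> (forall i, Lev mu (cell p) m (g i)) ->
  (forall i, \int[mu]_(x in cell p) (g i x ^+ m.+1.*2) <= I0) ->
  `|\int[mu]_(x in cell p) u x| <= J0 ->
  {ae mu, forall x, cell p x -> `|u x| <= C}.
Proof.
move=> h0 sideh; set D := cell p.
have pp : nondeg p by move=> i; rewrite sideh.
have mD : measurable D := measurable_cell p; have Doo := mu_cell_lty p.
have [r r01 rP] := geometric_sides R n; have [r0 r1] := andP r01.
(* Passing from the L^q norm of the gradient to an average over a cell of volume V/2^k costs 2^k in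
   the q-th power. With r^q <= 1/4 the side lengths contribute 4^{-k}, which leaves 2^{-k}. *)
have [||m hm] := @expr_cvg0 R r _ 4^-1; [by rewrite (ltW r0)|by rewrite invr_gt0|].
have {hm} rq : r ^+ m.+1.*2 <= 4^-1 by apply: hm; lia.
exists m => I0 J0; set q := m.+1.*2 in rq *.
(* [ro] stands for the q-th root of 1/2: it is the ratio of the geometric bound on the pointwise
   increments. *)
have [ro /andP[ro0 ro1] hro] := bernoulli_ratio R q.
have V0 := proper_volume pp; set V := volume p.1 p.2 in V0.
(* The maximum with 1 gives K <= K^q, again in place of a q-th root. *)
pose K := Num.max 1 ((2 * h) ^+ q / V * I0).
have K1 : 1 <= K by rewrite le_max lexx.
pose C := J0 / V + K * (ro ^+ 0 / (1 - ro)).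
exists C => Om u g oOm pOm wu lu lg lgm gI uJ.
have ig i : mu.-integrable D (EFin \o (fun x => `|g i x|)).
  by apply: L1_norm; exact: Lev_L1 (lg i).
have igm i : mu.-integrable D (EFin \o (fun x => `|g i x| ^+ q)).
  by under [X in _.-integrable _ X]eq_fun do rewrite /= even_expr_norm; case: (lgm i).
have step k x : D x ->
    `|cell_avg (dirs k.+1) p u x - cell_avg (dirs k) p u x| <= K * ro ^+ k.
  move=> Dx; rewrite dirsS; set i := dir k.
  have hs := cell_avg_step (dirs k) x oOm (wu i) pOm pp.
  have hp := @cell_avg_power _ _ q.-1 (dirs k) p x (fun y => `|g i y|) pp (ig i) (igm i)
    (fun y => normr_ge0 _) Dx.
  rewrite -[q.-1.+1]/q in hp.
  have A0 : 0 <= cell_avg (dirs k) p (fun y => `|g i y|) x.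
    rewrite /cell_avg divr_ge0//; first by apply: Rintegral_ge0.
    exact/ltW/proper_volume/proper_subcell.
  have K0 : 0 <= K * ro ^+ k by rewrite mulr_ge0 ?exprn_ge0 ?(le_trans ler01 K1)// ltW.
  rewrite -(@ler_pXn2r _ q) ?nnegrE//.
  apply: le_trans (_ : (2 * h * r ^+ k * cell_avg (dirs k) p (fun y => `|g i y|) x) ^+ q <= _).
    apply: lerXn2r; rewrite ?nnegrE ?normr_ge0//.
      by apply: mulr_ge0 => //; rewrite !mulr_ge0// ?(ltW h0)// exprn_ge0// ltW.
    apply: le_trans hs _; apply: ler_wpM2r => //.
    by rewrite sideh -mulrA mulrCA ler_wpM2l// ltW.
  rewrite exprMn; have B0 : 0 <= (2 * h * r ^+ k) ^+ q.
    by rewrite exprn_ge0// !mulr_ge0 ?exprn_ge0// ltW.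
  apply: le_trans (ler_wpM2l B0 hp) _.
  have Iq : \int[mu]_(y in cell (subcell (dirs k) p x)) (`|g i y| ^+ q) <= I0.
    apply: le_trans (I_S mD (measurable_cell _) (sub_subcell pp) (igm i) _) _.
      by move=> y; rewrite exprn_ge0.
    by under eq_Rintegral do rewrite even_expr_norm; exact: gI.
  have I00 : 0 <= I0 by apply: le_trans Iq; apply: Rintegral_ge0 => y _; rewrite exprn_ge0.
  have V2 : 0 <= (V / 2 ^+ k)^-1 by rewrite invr_ge0 divr_ge0 ?exprn_ge0// ltW.
  apply: (@le_trans _ _ ((2 * h * r ^+ k) ^+ q * (I0 * (V / 2 ^+ k)^-1))).
    apply: ler_wpM2l => //; rewrite /cell_avg /avg volume_subcell size_dirs -/V.
    exact: ler_wpM2r.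
  have -> : (2 * h * r ^+ k) ^+ q * (I0 * (V / 2 ^+ k)^-1) =
      (2 * h) ^+ q / V * I0 * ((r ^+ q) ^+ k * 2 ^+ k).
    by rewrite exprMn -[(r ^+ k) ^+ q]exprM mulnC exprM; field; rewrite gt_eqF//= expf_neq0.
  have rk : (r ^+ q) ^+ k * 2 ^+ k <= (ro ^+ q) ^+ k.
    apply: (@le_trans _ _ (2^-1 ^+ k)); last first.
      by apply: lerXn2r; rewrite ?nnegrE ?invr_ge0// exprn_ge0// ltW.
    rewrite -exprMn; apply: lerXn2r; rewrite ?nnegrE ?invr_ge0//.
      by rewrite mulr_ge0// exprn_ge0// ltW.
    by move: rq; set z := r ^+ q; lra.
  have rk0 : 0 <= (r ^+ q) ^+ k * 2 ^+ k by rewrite mulr_ge0 ?exprn_ge0// ltW.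
  apply: (@le_trans _ _ (K * (ro ^+ q) ^+ k)).
    apply: ler_pM => //; last by rewrite le_max lexx orbT.
    by rewrite mulr_ge0// divr_ge0 ?(ltW V0)// exprn_ge0// mulr_ge0// ltW.
  rewrite [leRHS]exprMn -[(ro ^+ k) ^+ q]exprM mulnC exprM.
  apply: ler_wpM2r; first by rewrite !exprn_ge0// ltW.
  by rewrite -[leLHS]expr1; apply: ler_weXn2l.
have bound k x : D x -> `|cell_avg (dirs k) p u x| <= C.
  move=> Dx; have := @geometric_increments R (fun k => cell_avg (dirs k) p u x) K ro.
  move=> /(_ _ _ 0%N k (leq0n k)) hk.
  have {}hk : `|cell_avg (dirs k) p u x - cell_avg (dirs 0) p u x| <= K * (ro ^+ 0 / (1 - ro)).
    by apply: hk => [|j]; [rewrite (ltW ro0)|exact: step].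
  have h00 : `|cell_avg (dirs 0) p u x| <= J0 / V.
    rewrite /cell_avg /= /avg -/V normrM [X in _ * X]ger0_norm ?invr_ge0 ?(ltW V0)//.
    by rewrite ler_wpM2r ?invr_ge0 ?(ltW V0).
  rewrite -[cell_avg (dirs k) p u x](subrK (cell_avg (dirs 0) p u x)) addrC.
  by apply: le_trans (ler_normD _ _) _; exact: lerD.
have lP k : Lev mu D 0 (cell_avg (dirs k) p u) by exact: cell_avg_Lev.
have lim0 : norm2 mu D (fun x => cell_avg (dirs k) p u x - u x) @[k --> \oo] --> 0.
  set G := 2 * h * \sum_i norm2 mu D (g i).
  have G0 : 0 <= G.
    by apply: mulr_ge0; [rewrite mulr_ge0// ltW|apply: sumr_ge0 => i _; exact: norm2_ge0].
  have r10 : 0 < 1 - r by rewrite subr_gt0.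
  have G1 : 0 < G + 1 by rewrite ltr_wpDl.
  apply/cvgn_leP => e e0.
  have [||k0 hk] := @expr_cvg0 R r _ (e * (1 - r) / (G + 1)).
  - by rewrite (ltW r0).
  - by rewrite divr_gt0// mulr_gt0.
  exists k0 => k /hk hk'; rewrite subr0 ger0_norm ?norm2_ge0//.
  apply: le_trans (cell_avg_approx oOm pp pOm sideh r01 rP k lu wu lg) _; rewrite -/G.
  rewrite mulrA ler_pdivrMr//; apply: (@le_trans _ _ ((G + 1) * r ^+ k)).
    by rewrite ler_wpM2r ?exprn_ge0 ?lerDl// ltW.
  by rewrite mulrC -ler_pdivlMr.
have [|t _ hae] := @cvg_Lev_ae _ _ _ mu D mD 0 _ u lP lu.
  rewrite (_ : (fun j => _) = (fun k => norm2 mu D (fun x => cell_avg (dirs k) p u x - u x) ^+ 2)).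
    by have := @cvgn_exprn R _ _ 2 lim0; rewrite expr0n.
  by apply/funext => j; rewrite sqr_norm2.
apply: filterS hae => x hx Dx.
by apply: cvgn_upper (cvg_norm (hx Dx)) _ => k; exact: bound.
Qed.

End compactness.

(** * Sobolev spaces with even integer exponents *)

Section lebesgue_spaces.
Context (R : realType) (N : nat).
Local Notation E := 'rV[R]_N.
Local Notation mu := (lebesgue_rV R N).
Variables (Om : set E) (mOm : measurable Om).
Implicit Types (u v : E -> R) (p : R).

Lemma LpP m u : Lp Om (m.+1.*2)%:R%:E u <-> Lev mu Om m u.
Proof.
have q1 : 1 <= (m.+1.*2)%:R :> R by rewrite ler1n doubleS.
have powE : (fun x => (`|(u \_ Om) x| `^ (m.+1.*2)%:R)%:E) =
    ((EFin \o (fun x => u x ^+ m.+1.*2)) \_ Om).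
  apply/funext => x; rewrite powR_mulrn// even_expr_norm !patchE /=.
  by case: ifP => //; rewrite expr0n doubleS.
split=> [h|[mu_ iu]].
  have := Lfun_integrable q1 h; move: h => /andP[/[!inE]/= mf _].
  rewrite powE => hi; split; first exact: ((measurable_restrictT u mOm).2 mf).
  exact: ((integrable_mkcond _ mOm).2 hi).
apply/andP; split; rewrite inE /=.
  exact: ((measurable_restrictT u mOm).1 mu_).
rewrite /finite_norm unlock /=; apply: poweR_lty.
have /integrableP[_] := (integrable_mkcond _ mOm).1 iu; rewrite -powE.
by congr (_ < _)%E; apply: eq_integral => x _; rewrite abse_EFin ger0_norm ?powR_ge0.
Qed.

Lemma Lp_oo_bounded u : Lp Om +oo%E u -> measurable_fun Om u /\
  exists2 M, 0 < M & {ae mu, forall x, Om x -> `|u x| <= M}.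
Proof.
move=> /andP[/[!inE]/= mf hf]; split; first exact: ((measurable_restrictT u mOm).2 mf).
move: hf; rewrite /finite_norm unlock /=; case: ifPn => [_ hf|].
  have : exists M : R, (ess_sup_inf.ess_sup mu (abse \o (EFin \o (u \_ Om))) <= M%:E)%E.
    by move: hf; case: (ess_sup_inf.ess_sup _ _) => [r|//|] _; [exists r|exists 0; rewrite leNye].
  move=> [M /ess_sup_inf.ess_supP hM]; exists (`|M| + 1); first by rewrite ltr_wpDl.
  apply: filterS hM => x /= + Omx; rewrite patchE mem_set//= lee_fin => h.
  by apply: le_trans h _; rewrite ler_wpDr// ler_norm.
(* The degenerate branch of the L^oo norm, where the whole space is null and every property holds
   a.e. *)
rewrite -leNgt => h0 _; exists 1 => //.
have mu0 : mu [set: E] = 0%E by apply/eqP; rewrite eq_le h0 measure_ge0.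
exists setT; split => //.
Qed.

Lemma bounded_Lp_oo u (M : R) : measurable_fun Om u ->
  {ae mu, forall x, Om x -> `|u x| <= M} -> Lp Om +oo%E u.
Proof.
move=> mf hM; apply/andP; split; rewrite inE /=.
  exact: ((measurable_restrictT u mOm).1 mf).
rewrite /finite_norm unlock /=; case: ifPn => [_|//].
apply: (@le_lt_trans _ _ (Num.max 0 M)%:E); last by rewrite ltry.
apply/ess_sup_inf.ess_supP; apply: filterS hM => x h /=; rewrite lee_fin patchE.
by case: ifPn => [/set_mem/h hx|_]; rewrite ?normr0 le_max ?hx ?lexx ?orbT.
Qed.

Hypothesis Omoo : (mu Om < +oo)%E.

(** From s^p <= 1 + s^q for s = |u|/t. The free scale [t] is what later turns a small q-integral
    into a small p-integral on a set of finite measure. *)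
Lemma Lev_powR m p u (t : R) : Lev mu Om m u -> 1 <= p <= (m.+1.*2)%:R -> 0 < t ->
  [/\ mu.-integrable Om (EFin \o (fun x => `|u x| `^ p)) &
    \int[mu]_(x in Om) (`|u x| `^ p) <=
    t `^ p * (fine (mu Om) + \int[mu]_(x in Om) (u x ^+ m.+1.*2) / t ^+ m.+1.*2)].
Proof.
move=> [mf iu] /andP[p1 pq] t0; have p0 := lt_le_trans ltr01 p1.
set q := m.+1.*2 in iu pq *.
have tq0 : 0 < t ^+ q by rewrite exprn_gt0.
have ptw x : `|u x| `^ p <= t `^ p * (1 + u x ^+ q / t ^+ q).
  rewrite -even_expr_norm -/q -[X in 1 + X]expr_div_n.
  have -> : `|u x| = t * (`|u x| / t) by rewrite mulrC divfK// gt_eqF.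
  set s := `|u x| / t; have s0 : 0 <= s by rewrite divr_ge0// ltW.
  rewrite powRM ?(ltW t0)// [t * s]mulrC mulfK ?gt_eqF// ler_wpM2l ?powR_ge0//.
  have [s1|s1] := lerP s 1.
    rewrite (@le_trans _ _ 1) ?lerDl ?exprn_ge0//.
    have := @ge0_ler_powR R p (ltW p0) s 1.
    by rewrite !nnegrE powR1 => /(_ s0 ler01 s1).
  rewrite (@le_trans _ _ (s ^+ q)) ?lerDr//.
  by rewrite -powR_mulrn// ler_powR// (ltW s1).
have iq : mu.-integrable Om (EFin \o (fun x => u x ^+ q / t ^+ q)).
  under eq_fun do rewrite /= mulrC; exact: L1Z.
have i1 : mu.-integrable Om (EFin \o (fun x => 1 + u x ^+ q / t ^+ q)).
  by apply: (@L1D _ _ _ _ _ mOm (cst 1)) => //; exact: L1_cst.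
have ig := L1Z mOm (t `^ p) i1.
have iup : mu.-integrable Om (EFin \o (fun x => `|u x| `^ p)).
  apply: (L1_le mOm _ ig).
    by apply: (measurableT_comp (measurable_powR _)); exact: measurableT_comp.
  by move=> x _; rewrite ger0_norm ?powR_ge0.
split => //; apply: le_trans (le_Rintegral mOm iup ig (fun x _ => ptw x)) _.
rewrite RintegralZl// ler_wpM2l ?powR_ge0//.
rewrite (RintegralD mOm (L1_cst mOm Omoo 1) iq).
rewrite Rintegral_cst// mul1r lerD2l.
by under eq_Rintegral do rewrite mulrC; rewrite RintegralZl// mulrC.
Qed.

Lemma Lev_small m p (e : R) : 1 <= p <= (m.+1.*2)%:R -> 0 < e ->
  exists2 de, 0 < de & forall u, Lev mu Om m u ->
  \int[mu]_(x in Om) (u x ^+ m.+1.*2) <= de ->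
  \int[mu]_(x in Om) (`|u x| `^ p) <= e `^ p.
Proof.
move=> pq e0; have p1 : 1 <= p by case/andP: pq.
set A := fine (mu Om) + 1; have A1 : 1 <= A by rewrite lerDr fine_ge0.
have A0 := lt_le_trans ltr01 A1.
have t0 : 0 < e / A by rewrite divr_gt0.
(* With scale t = e/A the bound becomes (e/A)^p (mu(Om) + 1) = e^p A^{1-p}, at most e^p since A >=
   1. *)
exists ((e / A) ^+ m.+1.*2); first by rewrite exprn_gt0.
move=> u lu hu; have [_ h] := Lev_powR lu pq t0; apply: le_trans h _.
apply: (@le_trans _ _ ((e / A) `^ p * A)).
  rewrite ler_wpM2l ?powR_ge0// lerD2l ler_pdivrMr ?exprn_gt0//.
  by rewrite mul1r.
rewrite powRM ?invr_ge0 ?(ltW A0) ?(ltW e0)// -mulrA ler_piMr ?powR_ge0//.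
rewrite -powR_inv1 ?(ltW A0)// -powRrM mulN1r -[X in _ * X]powRr1 ?(ltW A0)// -powRD.
  by have := @ler_powR _ _ A1 (- p + 1) 0; rewrite powRr0; apply; rewrite addrC subr_le0.
by apply/implyP => _; rewrite gt_eqF.
Qed.

Lemma Lnorm_small m p (e : R) : 1 <= p <= (m.+1.*2)%:R -> 0 < e ->
  exists2 de, 0 < de & forall u, Lev mu Om m u ->
  \int[mu]_(x in Om) (u x ^+ m.+1.*2) <= de ->
  fine ('N[mu]_p%:E[EFin \o (u \_ Om)]) <= e.
Proof.
move=> pq e0; have /andP[p1 _] := pq; have p0 := lt_le_trans ltr01 p1.
have [de de0 h] := Lev_small pq e0; exists de => // u lu hu.
have [iu _] := Lev_powR lu pq ltr01.
rewrite unlock; have -> : (\int[mu]_x `|(EFin \o u \_ Om) x| `^ p)%E =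
    (\int[mu]_(x in Om) (`|u x| `^ p))%:E.
  rewrite (I_EFin mOm iu) [RHS]integral_mkcond; apply: eq_integral => x _.
  rewrite /=.
  by rewrite !patchE; case: ifP => // _; rewrite normr0 powR0 ?gt_eqF.
rewrite poweR_EFin /=; apply: le_trans (_ : (e `^ p) `^ p^-1 <= _).
  rewrite ge0_ler_powR ?invr_ge0 ?nnegrE ?powR_ge0 ?(ltW p0) ?h//.
  by apply: Rintegral_ge0 => x _; exact: powR_ge0.
by rewrite -powRrM mulfV ?gt_eqF// powRr1// ltW.
Qed.

Lemma Lev_cvg_L1 m (u_ : nat -> E -> R) u : (forall n, Lev mu Om m (u_ n)) -> Lev mu Om m u ->
  \int[mu]_(x in Om) ((u_ n x - u x) ^+ m.+1.*2) @[n --> \oo] --> 0 ->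
  \int[mu]_(x in Om) `|u_ n x - u x| @[n --> \oo] --> 0.
Proof.
move=> lu_ lu h; apply/cvgn_leP => e e0.
have [||de de0 hde] := @Lev_small m 1 e; [by rewrite lexx ler1n doubleS|by []|].
move/cvgn_leP : h => /(_ _ de0)[n0 hn]; exists n0 => n /hn {}hn.
move: hn; rewrite !subr0 => hn; rewrite ger0_norm; last by apply: Rintegral_ge0.
rewrite -[leRHS]powRr1 ?(ltW e0)//; apply: le_trans (hde (fun x => u_ n x - u x) _ _).
- by under [leRHS]eq_Rintegral do rewrite powRr1//.
- exact: LevB.
- exact: le_trans (ler_norm _) hn.
Qed.

Lemma Lev_le m m' u : (m' <= m)%N -> Lev mu Om m u -> Lev mu Om m' u.
Proof.
move=> m'm lu; have [mf _] := lu; split => //.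
have [||iu _] := @Lev_powR m (m'.+1.*2)%:R u 1 lu => //.
  by rewrite ler1n ler_nat leq_double ltnS m'm doubleS.
apply: eq_integrable iu => // x _ /=.
by rewrite powR_mulrn// even_expr_norm.
Qed.

Lemma Lev_L1m m u : Lev mu Om m u -> mu.-integrable Om (EFin \o u).
Proof. by move=> /(Lev_le (leq0n m)); exact: Lev_L1. Qed.

End lebesgue_spaces.

Section test_functions.
Context (R : realType) (N : nat).
Local Notation E := 'rV[R]_N.
Local Notation mu := (lebesgue_rV R N).
Implicit Types (Om : set E) (u g v : E -> R).

Lemma test_continuous Om v : test_function Om v -> continuous v.
Proof. by move=> [sv _ _] x; apply: differentiable_continuous; exact: (sv [::]). Qed.

Lemma test_derivable Om v (i : 'I_N) x : test_function Om v ->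
  derivable v x (delta_mx ord0 i : E).
Proof. by move=> [sv _ _]; apply: diff_derivable; exact: (sv [::]). Qed.

Lemma test_out Om v x : test_function Om v -> ~ closure [set x | v x != 0] x -> v x = 0.
Proof.
move=> _ nx; apply/eqP/negPn/negP => vx; apply: nx; exact: subset_closure.
Qed.

Lemma test_pderiv Om i v : test_function Om v -> test_function Om (pderiv i v).
Proof.
move=> tv; have [sv cv vO] := tv.
have sub : closure [set x | pderiv i v x != 0] `<=` closure [set x | v x != 0].
  rewrite [X in _ `<=` X](closure_id _).1; last exact: closed_closure.
  apply: closure_subset => x /= dx; apply: contrapT => nx; case/negP: dx; apply/eqP.
  have -> : pderiv i v x = pderiv i (cst 0) x; last exact: derive_cst.
  apply: near_eq_derive.
  have : open (~` closure [set x | v x != 0]) by apply: closed_openC; exact: closed_closure.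
  rewrite openE => /(_ x nx); apply: filterS => y ny; exact: test_out tv ny.
split; last exact: subset_trans vO.
- by move=> s x; have := sv (rcons s i) x; rewrite foldr_rcons.
- by apply: subclosed_compact sub => //; exact: closed_closure.
Qed.

Lemma test_bounded Om v : test_function Om v -> exists2 M, 0 < M & forall x, `|v x| <= M.
Proof.
move=> tv; have [_ cv _] := tv.
have : bounded_set (v @` closure [set x | v x != 0]).
  apply: compact_bounded; apply: continuous_compact => //.
  by apply: continuous_subspaceT; exact: test_continuous tv.
move=> /pinfty_ex_gt0[M M0 hM]; exists M => // x.
have [hx|hx] := pselect (closure [set x | v x != 0] x); first by apply: hM; exists x.
by rewrite (test_out tv hx) normr0 ltW.
Qed.

Lemma test_measurable Om v : test_function Om v -> measurable_fun setT v.
Proof. by move=> tv; apply: rV_continuous_measurable; exact: test_continuous tv. Qed.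

Lemma L1_test Om u v : open Om -> Lloc Om u -> test_function Om v ->
  mu.-integrable Om (EFin \o (fun x => u x * v x)).
Proof.
move=> oOm [mu_ iu] tv; have [_ cv vO] := tv; have [M M0 hM] := test_bounded tv.
have mOm := rV_open_measurable oOm.
have mK : measurable (closure [set x | v x != 0]).
  by apply: rV_closed_measurable; exact: closed_closure.
have mv := test_measurable tv.
apply: (L1_support mOm mK vO) => [x _ nx|]; first by rewrite (test_out tv nx) mulr0.
apply: (L1_le mK _ (L1Z mK M (L1_norm (iu _ vO cv)))).
  by apply: measurable_funM; [exact: measurable_funS mu_|exact: measurable_funS mv].
by move=> x _; rewrite normrM mulrC ler_wpM2r.
Qed.

End test_functions.

Section weak_derivatives.
Context (R : realType) (N : nat).
Local Notation E := 'rV[R]_N.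
Local Notation mu := (lebesgue_rV R N).
Variables (Om : set E) (oOm : open Om).
Implicit Types (u g v : E -> R).
Let mOm : measurable Om := rV_open_measurable oOm.

Lemma Lloc_lin a c u v : Lloc Om u -> Lloc Om v -> Lloc Om (fun x => a * u x + c * v x).
Proof.
move=> [mu_ iu] [mv iv]; split=> [|K KO cK].
  by apply: measurable_funD; exact: measurable_funM.
have mK : measurable K.
  by apply: rV_closed_measurable; apply: compact_closed => //; exact: norm_hausdorff.
by apply: (L1D mK); apply: L1Z => //; [exact: iu|exact: iv].
Qed.

Lemma weak_partial_lin a c i u v g h : weak_partial Om i u g -> weak_partial Om i v h ->
  weak_partial Om i (fun x => a * u x + c * v x) (fun x => a * g x + c * h x).
Proof.
move=> [lu lg hu] [lv lh hv]; split; [exact: Lloc_lin|exact: Lloc_lin|move=> w tw].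
have tdw := test_pderiv i tw.
have lin (s t z : E -> R) : Lloc Om s -> Lloc Om t -> test_function Om z ->
    \int[mu]_(x in Om) ((a * s x + c * t x) * z x) =
    a * \int[mu]_(x in Om) (s x * z x) + c * \int[mu]_(x in Om) (t x * z x).
  move=> ls lt tz.
  have i1 := L1_test oOm ls tz; have i2 := L1_test oOm lt tz.
  under eq_Rintegral do rewrite mulrDl -!mulrA.
  by rewrite (RintegralD mOm (L1Z mOm a i1) (L1Z mOm c i2)) !RintegralZl.
by rewrite !lin// hu// hv// opprD !mulrN.
Qed.

Lemma weak_partial_ae i u v g : measurable_fun Om u -> measurable_fun Om v ->
  u = v %[ae mu in Om] -> weak_partial Om i u g -> weak_partial Om i v g.
Proof.
move=> mu_ mv uv [[_ iu] lg hu]; split => //.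
  split => // K KO cK.
  have mK : measurable K.
    by apply: rV_closed_measurable; apply: compact_closed => //; exact: norm_hausdorff.
  apply: (ae_L1 mK _ _ (iu K KO cK)); first exact: measurable_funS mv.
  by apply: filterS uv => x h /KO.
move=> w tw; rewrite -hu//; have mw := test_measurable (test_pderiv i tw).
have mwO : measurable_fun Om (pderiv i w) by exact: measurable_funS mw.
apply: (ae_I mOm); [exact: measurable_funM|exact: measurable_funM|].
by apply: filterS uv => x h Ox; rewrite h.
Qed.

(** Equality everywhere and not only a.e.: the two functions have the same set of weak derivatives,
    and [wpartial] chooses from that set. *)
Lemma wpartial_ae i u v : measurable_fun Om u -> measurable_fun Om v ->
  u = v %[ae mu in Om] -> wpartial Om i u = wpartial Om i v.
Proof.
move=> mu_ mv uv; congr (xget _ _); apply/seteqP; split => g /=.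
  exact: weak_partial_ae.
by apply: weak_partial_ae => //; apply: filterS uv => x h Ox; rewrite h.
Qed.

Lemma wpartialP i u g : weak_partial Om i u g -> weak_partial Om i u (wpartial Om i u).
Proof. by move=> h; apply: (@xgetPex _ (cst 0) [set g | weak_partial Om i u g]); exists g. Qed.

Lemma wpartial_eq i u g : weak_partial Om i u g -> wpartial Om i u = g %[ae mu in Om].
Proof. by move=> h; apply: (weak_partial_unique oOm _ h); exact: wpartialP h. Qed.

Lemma Lev_Lloc m u : (mu Om < +oo)%E -> Lev mu Om m u -> Lloc Om u.
Proof.
move=> Omoo lu; split; first by case: lu.
move=> K KO cK; apply: (L1_S mOm _ KO (Lev_L1m mOm Omoo lu)).
by apply: rV_closed_measurable; apply: compact_closed => //; exact: norm_hausdorff.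
Qed.

Lemma weak_partial_limit i (u_ g_ : nat -> E -> R) u g :
  (forall n, weak_partial Om i (u_ n) (g_ n)) -> Lloc Om u -> Lloc Om g ->
  (forall n, mu.-integrable Om (EFin \o (fun x => `|u_ n x - u x|))) ->
  (forall n, mu.-integrable Om (EFin \o (fun x => `|g_ n x - g x|))) ->
  \int[mu]_(x in Om) `|u_ n x - u x| @[n --> \oo] --> 0 ->
  \int[mu]_(x in Om) `|g_ n x - g x| @[n --> \oo] --> 0 ->
  weak_partial Om i u g.
Proof.
move=> wu lu lg iu ig hu hg; split => // w tw.
have pass (s_ : nat -> E -> R) s v : (forall n, Lloc Om (s_ n)) -> Lloc Om s ->
    (forall n, mu.-integrable Om (EFin \o (fun x => `|s_ n x - s x|))) ->
    \int[mu]_(x in Om) `|s_ n x - s x| @[n --> \oo] --> 0 -> test_function Om v ->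
    \int[mu]_(x in Om) (s_ n x * v x) @[n --> \oo] --> \int[mu]_(x in Om) (s x * v x).
  move=> ls_ ls is_ hs tv; have [M M0 hM] := test_bounded tv.
  apply/cvgn_leP => e e0; have eM : 0 < e / M by rewrite divr_gt0.
  move/cvgn_leP : hs => /(_ _ eM)[n0 hn0]; exists n0 => n /hn0; rewrite subr0.
  rewrite ger0_norm; last by apply: Rintegral_ge0.
  rewrite ler_pdivlMr// => hn; have i1 := L1_test oOm (ls_ n) tv; have i2 := L1_test oOm ls tv.
  rewrite -RintegralB//; apply: le_trans (le_normr_Rintegral mOm (L1B mOm i1 i2)) _.
  apply: le_trans hn; rewrite mulrC -RintegralZl//.
  apply: le_Rintegral => //; [exact: L1_norm (L1B mOm i1 i2)|exact: L1Z|].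
  by move=> x _; rewrite -mulrBl normrM mulrC ler_wpM2r.
have h1 := pass u_ u (pderiv i w) (fun n => let: And3 a _ _ := wu n in a) lu iu hu (test_pderiv i tw).
have h2 := pass g_ g w (fun n => let: And3 _ a _ := wu n in a) lg ig hg tw.
apply: cvgn_uniq h1 _.
rewrite (_ : (fun n => _) = (fun n => - \int[mu]_(x in Om) (g_ n x * w x))); first exact: cvgN.
by apply/funext => n; have [_ _ ->] := wu n.
Qed.

End weak_derivatives.

Section power_convexity.
Context (R : realType).

(** Convexity of the q-th power at x + y = s (x/s) + t (y/t), multiplied by s^{q-1}. It stands in
    for the triangle inequality in L^q: the coefficient of x^q is 1, and s may be taken close to
    1. *)
Lemma even_expr_convex m (s t x y : R) : 0 < s -> 0 < t -> s + t = 1 ->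
  s ^+ m.+1.*2.-1 * (x + y) ^+ m.+1.*2 <=
  x ^+ m.+1.*2 + (s / t) ^+ m.+1.*2.-1 * y ^+ m.+1.*2.
Proof.
move=> s0 t0 st; have q1 : m.+1.*2 = m.+1.*2.-1.+1 by rewrite doubleS.
move: (m.+1.*2.-1) q1 => q q1.
pose X := `|x| / s; pose Y := `|y| / t; pose a := s * X + t * Y.
have X0 : 0 <= X by rewrite divr_ge0// ltW.
have Y0 : 0 <= Y by rewrite divr_ge0// ltW.
have a0 : 0 <= a by rewrite addr_ge0// mulr_ge0// ltW.
have conv : a ^+ q.+1 <= s * X ^+ q.+1 + t * Y ^+ q.+1.
  have h1 := tangent_power q a0 X0; have h2 := tangent_power q a0 Y0.
  have : s * (q.+1%:R * a ^+ q * X) + t * (q.+1%:R * a ^+ q * Y) <=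
      s * (X ^+ q.+1 + q%:R * a ^+ q.+1) + t * (Y ^+ q.+1 + q%:R * a ^+ q.+1).
    by apply: lerD; rewrite ler_pM2l.
  have -> : s * (q.+1%:R * a ^+ q * X) + t * (q.+1%:R * a ^+ q * Y) =
      q%:R * a ^+ q.+1 + a ^+ q.+1.
    by rewrite [in RHS]exprS -[q.+1]addn1 natrD /a; ring.
  have -> : s * (X ^+ q.+1 + q%:R * a ^+ q.+1) + t * (Y ^+ q.+1 + q%:R * a ^+ q.+1) =
      q%:R * a ^+ q.+1 + (s * X ^+ q.+1 + t * Y ^+ q.+1).
    by rewrite (_ : t = 1 - s); [ring|rewrite -st addrC addKr].
  by rewrite lerD2l.
have aE : a = `|x| + `|y| by rewrite /a /X /Y ![_ * (_ / _)]mulrC !divfK// gt_eqF.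
have le1 : (x + y) ^+ m.+1.*2 <= a ^+ m.+1.*2.
  rewrite -even_expr_norm; apply: lerXn2r; rewrite ?nnegrE// aE.
  exact: ler_normD.
apply: le_trans (ler_wpM2l (exprn_ge0 q (ltW s0)) le1) _.
rewrite {1}q1; apply: le_trans (ler_wpM2l (exprn_ge0 q (ltW s0)) conv) _.
have xE : x ^+ m.+1.*2 = s ^+ q.+1 * X ^+ q.+1.
  by rewrite -exprMn mulrC divfK ?gt_eqF// -q1 even_expr_norm.
have yE : y ^+ m.+1.*2 = t ^+ q.+1 * Y ^+ q.+1.
  by rewrite -exprMn [t * Y]mulrC divfK ?gt_eqF// -q1 even_expr_norm.
rewrite xE yE le_eqVlt; apply/orP; left; apply/eqP; move: (X ^+ q.+1) (Y ^+ q.+1) => X' Y'.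
rewrite expr_div_n !exprS; have : t ^+ q != 0 by rewrite expf_neq0// gt_eqF.
by move: (t ^+ q) (s ^+ q) => T S T0; field.
Qed.

Lemma cvgn_lower (a : nat -> R) (l M : R) : a n @[n --> \oo] --> l ->
  (forall n, M <= a n) -> M <= l.
Proof.
move=> h hM; rewrite -lerN2; apply: (@cvgn_upper R (fun n => - a n)); first exact: cvgN.
by move=> n; rewrite lerN2.
Qed.

Lemma cvg0_sum (I : Type) (s : seq I) (a : nat -> I -> R) :
  (forall i, a n i @[n --> \oo] --> 0) -> \sum_(i <- s) a n i @[n --> \oo] --> 0.
Proof.
move=> h; elim: s => [|i s ih].
  by rewrite (_ : (fun n => _) = fun=> 0); [exact: cvg_cst|apply/funext => n; rewrite big_nil].
rewrite (_ : (fun n => _) = fun n => a n i + \sum_(i <- s) a n i); last first.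
  by apply/funext => n; rewrite big_cons.
by rewrite -[X in _ --> X]addr0; exact: cvgD.
Qed.

Lemma cvg0_le (a b : nat -> R) : (forall n, 0 <= a n <= b n) ->
  b n @[n --> \oo] --> 0 -> a n @[n --> \oo] --> 0.
Proof. by move=> h hb; apply: squeeze_cvgr (cvg_cst 0) hb; apply: nearW. Qed.

End power_convexity.

(** * Completeness, Clarkson's inequality and lower semicontinuity in W^{k,q} *)

Section even_sobolev.
Context (R : realType) (N : nat).
Local Notation E := 'rV[R]_N.
Local Notation mu := (lebesgue_rV R N).
Variables (Om : set E) (oOm : open Om) (Omoo : (mu Om < +oo)%E).
Implicit Types (u v g : E -> R) (k m : nat).
Let mOm : measurable Om := rV_open_measurable oOm.

(** The space [sobolev Om k q] with the chosen derivatives [wpartial] in place of an existential, so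
    that the derivatives are functions of [u]. *)
Fixpoint Wev k m u : Prop := Lev mu Om m u /\
  (if k is k'.+1 then
     forall i, weak_partial Om i u (wpartial Om i u) /\ Wev k' m (wpartial Om i u)
   else True).

(** The sum of the q-th powers of the L^q norms of all iterated derivatives. Without roots it is
    additive over derivatives, so pointwise inequalities between q-th powers carry over to it. *)
Fixpoint wsum k m u : R := \int[mu]_(x in Om) (u x ^+ m.+1.*2) +
  (if k is k'.+1 then \sum_(i < N) wsum k' m (wpartial Om i u) else 0).

Lemma Wev_Lev k m u : Wev k m u -> Lev mu Om m u.
Proof. by case: k => [|k] []. Qed.

Lemma Wev_ae k m u v : measurable_fun Om v -> u = v %[ae mu in Om] ->
  Wev k m u -> Wev k m v /\ wsum k m u = wsum k m v.
Proof.
move=> mv uv wu; have lu := Wev_Lev wu; have lv := Lev_ae mOm mv uv lu.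
have mu_ : measurable_fun Om u by case: lu.
have I_eq : \int[mu]_(x in Om) (u x ^+ m.+1.*2) = \int[mu]_(x in Om) (v x ^+ m.+1.*2).
  apply: (ae_I mOm); [exact: measurable_funX|exact: measurable_funX|].
  by apply: filterS uv => x h Ox; rewrite h.
case: k wu => [|k] [_ hk] /=; rewrite I_eq //; split.
  split => // i; have [hi Wi] := hk i; rewrite -(wpartial_ae oOm i mu_ mv uv).
  by split => //; exact: weak_partial_ae hi.
by congr (_ + _); apply: eq_bigr => i _; rewrite (wpartial_ae oOm i mu_ mv uv).
Qed.

Lemma sobolevP k m u : sobolev Om k (m.+1.*2)%:R%:E u <-> Wev k m u.
Proof.
elim: k u => [|k ih] u /=.
  by split=> -[/(LpP mOm) h _].
split=> -[/(LpP mOm) h hk]; split => // i.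
  have [g hg /ih Wg] := hk i; have hw := wpartialP hg; split => //.
  have [_ [mw _] _] := hw.
  apply: (proj1 (Wev_ae mw _ Wg)).
  by apply: filterS (wpartial_eq oOm hg) => x e Ox; rewrite e.
have [h1 h2] := hk i; exists (wpartial Om i u) => //; exact/ih.
Qed.

Definition lin (a c : R) u v : E -> R := fun x => a * u x + c * v x.

Lemma linB u v : lin 1 (-1) u v = fun x => u x - v x.
Proof. by apply/funext => x; rewrite /lin mul1r mulN1r. Qed.

Lemma I_linB m u v : \int[mu]_(x in Om) ((u x - v x) ^+ m.+1.*2) =
  \int[mu]_(x in Om) (lin 1 (-1) u v x ^+ m.+1.*2).
Proof. by rewrite linB. Qed.

Lemma Wev_partial k m u i : Wev k.+1 m u -> weak_partial Om i u (wpartial Om i u) /\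
  Wev k m (wpartial Om i u).
Proof. by case=> _. Qed.

(** The induction step of [Wev_lin], isolated because later inductions on the order need its last
    clause: [wsum] does not distinguish the chosen derivative of a combination from the combination
    of the chosen derivatives. *)
Lemma Wev_lin_aux k m : (forall u v a c, Wev k m u -> Wev k m v -> Wev k m (lin a c u v)) ->
  forall u v a c i, Wev k.+1 m u -> Wev k.+1 m v ->
  [/\ weak_partial Om i (lin a c u v) (wpartial Om i (lin a c u v)),
    Wev k m (wpartial Om i (lin a c u v)) &
    wsum k m (wpartial Om i (lin a c u v)) = wsum k m (lin a c (wpartial Om i u) (wpartial Om i v))].
Proof.
move=> ih u v a c i wu wv.
have [hu Wu] := Wev_partial i wu; have [hv Wv] := Wev_partial i wv.
have hl := weak_partial_lin oOm a c hu hv; have hw := wpartialP hl; split => //.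
all: have [_ [mw _] _] := hw.
all: have W1 := ih _ _ a c Wu Wv.
all: have ae1 : lin a c (wpartial Om i u) (wpartial Om i v) = wpartial Om i (lin a c u v) %[ae mu in Om]
  by apply: filterS (wpartial_eq oOm hl) => x e Ox; rewrite e.
  exact: (proj1 (Wev_ae mw ae1 W1)).
by rewrite (proj2 (Wev_ae mw ae1 W1)).
Qed.

Lemma Wev_lin k m u v a c : Wev k m u -> Wev k m v -> Wev k m (lin a c u v).
Proof.
elim: k u v a c => [|k ih] u v a c wu wv.
  split => //; apply: LevD => //; apply: LevZ => //; [exact: Wev_Lev wu|exact: Wev_Lev wv].
split=> [|i].
  by apply: LevD => //; apply: LevZ => //; [exact: Wev_Lev wu|exact: Wev_Lev wv].
by have [] := Wev_lin_aux ih a c i wu wv.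
Qed.

Lemma wpartial_lin k m u v a c i : Wev k.+1 m u -> Wev k.+1 m v ->
  wpartial Om i (lin a c u v) = lin a c (wpartial Om i u) (wpartial Om i v) %[ae mu in Om].
Proof.
move=> wu wv; have [hu _] := Wev_partial i wu; have [hv _] := Wev_partial i wv.
exact: wpartial_eq (weak_partial_lin oOm a c hu hv).
Qed.

(** Transfers an inequality between real q-th powers to [wsum] at every order. Two terms on the left
    are allowed so that Clarkson's inequality is an instance. *)
Lemma wsum_lin_le k m u v (a1 c1 a2 c2 A B : R) :
  (forall x y, (a1 * x + c1 * y) ^+ m.+1.*2 + (a2 * x + c2 * y) ^+ m.+1.*2 <=
     A * x ^+ m.+1.*2 + B * y ^+ m.+1.*2) -> Wev k m u -> Wev k m v ->
  wsum k m (lin a1 c1 u v) + wsum k m (lin a2 c2 u v) <= A * wsum k m u + B * wsum k m v.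
Proof.
move=> h; have base (s t : E -> R) : Lev mu Om m s -> Lev mu Om m t ->
    \int[mu]_(x in Om) (lin a1 c1 s t x ^+ m.+1.*2) + \int[mu]_(x in Om) (lin a2 c2 s t x ^+ m.+1.*2)
    <= A * \int[mu]_(x in Om) (s x ^+ m.+1.*2) + B * \int[mu]_(x in Om) (t x ^+ m.+1.*2).
  move=> ls lt.
  have i1 : mu.-integrable Om (EFin \o (fun x => lin a1 c1 s t x ^+ m.+1.*2)).
    by have [] : Lev mu Om m (lin a1 c1 s t) by apply: LevD => //; exact: LevZ.
  have i2 : mu.-integrable Om (EFin \o (fun x => lin a2 c2 s t x ^+ m.+1.*2)).
    by have [] : Lev mu Om m (lin a2 c2 s t) by apply: LevD => //; exact: LevZ.
  have [_ js] := ls; have [_ jt] := lt.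
  rewrite -!RintegralZl// -!RintegralD//; try exact: L1Z.
  exact: (le_Rintegral mOm (L1D mOm i1 i2) (L1D mOm (L1Z mOm A js) (L1Z mOm B jt)) (fun x _ => h _ _)).
elim: k u v => [|k ih] u v wu wv /=.
  by rewrite !addr0; apply: base; [exact: Wev_Lev wu|exact: Wev_Lev wv].
rewrite addrACA !mulrDr [leRHS]addrACA; apply: lerD.
  by apply: base; [exact: Wev_Lev wu|exact: Wev_Lev wv].
rewrite !mulr_sumr -!big_split /=; apply: ler_sum => i _.
have [_ _ ->] := Wev_lin_aux (@Wev_lin k m) a1 c1 i wu wv.
have [_ _ ->] := Wev_lin_aux (@Wev_lin k m) a2 c2 i wu wv.
by have [_ Wu] := Wev_partial i wu; have [_ Wv] := Wev_partial i wv; exact: ih.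
Qed.

Lemma wsum_ge0 k m u : 0 <= wsum k m u.
Proof.
have I0 v : 0 <= \int[mu]_(x in Om) (v x ^+ m.+1.*2).
  by apply: Rintegral_ge0 => x _; exact: even_expr_ge0.
elim: k u => [|k ih] u /=; first by rewrite addr0.
by rewrite addr_ge0// sumr_ge0.
Qed.

Lemma wsum_lin k m u v (a c A B : R) :
  (forall x y, (a * x + c * y) ^+ m.+1.*2 <= A * x ^+ m.+1.*2 + B * y ^+ m.+1.*2) ->
  Wev k m u -> Wev k m v -> wsum k m (lin a c u v) <= A * wsum k m u + B * wsum k m v.
Proof.
move=> h wu wv; have := @wsum_lin_le k m u v a c 0 0 A B.
move=> /(_ _ wu wv) h'; apply: le_trans (h' _); first by rewrite lerDl wsum_ge0.
by move=> x y; rewrite !mul0r addr0 expr0n doubleS addr0.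
Qed.

Lemma wsum_I k m u : \int[mu]_(x in Om) (u x ^+ m.+1.*2) <= wsum k m u.
Proof. by case: k => [|k] /=; rewrite lerDl// sumr_ge0// => i _; exact: wsum_ge0. Qed.

Lemma wsum_partial k m u i : wsum k m (wpartial Om i u) <= wsum k.+1 m u.
Proof.
rewrite /= (bigD1 i)//= addrCA lerDl addr_ge0//.
  by apply: Rintegral_ge0 => x _; exact: even_expr_ge0.
by rewrite sumr_ge0// => j _; exact: wsum_ge0.
Qed.

Lemma sobolev_norm_small k m p (e : R) : 1 <= p <= (m.+1.*2)%:R -> 0 < e ->
  exists2 de, 0 < de & forall u, Wev k m u -> wsum k m u <= de ->
    sobolev_norm Om k p%:E u <= e.
Proof.
move=> pq; elim: k e => [|k ih] e e0.
  have [de de0 h] := Lnorm_small mOm Omoo pq e0; exists de => // u [lu _] /=.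
  by rewrite !addr0; exact: h.
have [de de0 h] := Lnorm_small mOm Omoo pq (divr_gt0 e0 (ltr0Sn R 1)).
(* [N.+1] and not [N], which may be zero here. *)
have eN : 0 < e / 2 / N.+1%:R by rewrite !divr_gt0.
have [de' de'0 h'] := ih _ eN; exists (Num.min de de'); first by rewrite lt_min de0.
move=> u wu; rewrite le_min => /andP[h1 h2] /=; rewrite [leRHS]splitr; apply: lerD.
  by apply: h; [exact: Wev_Lev wu|exact: le_trans (wsum_I _ _ _) h1].
apply: (@le_trans _ _ (\sum_(i < N) (e / 2 / N.+1%:R))).
  apply: ler_sum => i _; apply: h'; first by have [] := Wev_partial i wu.
  exact: le_trans (wsum_partial _ _ _ _) h2.
rewrite sumr_const card_ord -[leLHS]mulr_natr -mulrA ler_piMr ?divr_ge0 ?(ltW e0)//.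
by rewrite mulrC ler_pdivrMr// mul1r ler_nat.
Qed.

Lemma Wev_complete k m (u_ : nat -> E -> R) : (forall n, Wev k m (u_ n)) ->
  (forall e : R, 0 < e -> exists n0, forall i j, (n0 <= i)%N -> (n0 <= j)%N ->
    wsum k m (lin 1 (-1) (u_ i) (u_ j)) <= e) ->
  exists2 u, Wev k m u & wsum k m (lin 1 (-1) (u_ n) u) @[n --> \oo] --> 0.
Proof.
elim: k u_ => [|k ih] u_ wu cau.
  have [|e e0|u lu hu] := @riesz_fischer _ _ _ mu Om mOm m u_.
  - by move=> n; exact: Wev_Lev (wu n).
  - have [n0 hn] := cau e e0; exists n0 => i j i0 j0; apply: le_trans (hn i j i0 j0).
    by rewrite /= addr0 linB.
  exists u; first by split.
  rewrite (_ : (fun n => _) = (fun n => \int[mu]_(x in Om) ((u_ n x - u x) ^+ m.+1.*2)))//.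
  by apply/funext => n; rewrite /= addr0 linB.
have lu_ n : Lev mu Om m (u_ n) by exact: Wev_Lev (wu n).
have [||u lu hu] := @riesz_fischer _ _ _ mu Om mOm m u_ => //.
  move=> e e0; have [n0 hn] := cau e e0; exists n0 => i j i0 j0.
  by apply: le_trans (hn i j i0 j0); rewrite I_linB; exact: wsum_I.
have Wp i n : Wev k m (wpartial Om i (u_ n)) by have [] := Wev_partial i (wu n).
have /choice[g hg] : forall i, exists g, Wev k m g /\
    wsum k m (lin 1 (-1) (wpartial Om i (u_ n)) g) @[n --> \oo] --> 0.
  move=> i; have [||g Wg hg] := @ih (fun n => wpartial Om i (u_ n)); last by exists g.
    by [].
  move=> e e0; have [n0 hn] := cau e e0; exists n0 => a b a0 b0.
  apply: le_trans (hn a b a0 b0).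
  have [_ _ <-] := Wev_lin_aux (@Wev_lin k m) 1 (-1) i (wu a) (wu b).
  exact: wsum_partial.
have L1abs (s t : E -> R) : Lev mu Om m s -> Lev mu Om m t ->
    mu.-integrable Om (EFin \o (fun x => `|s x - t x|)).
  by move=> ls lt; apply: L1_norm; apply: (@Lev_L1m _ _ _ mOm Omoo m); exact: LevB.
have wpu i : weak_partial Om i u (g i).
  have [Wg hgi] := hg i; have lg := Wev_Lev Wg.
  apply: (@weak_partial_limit _ _ _ oOm i u_ (fun n => wpartial Om i (u_ n))).
  - by move=> n; have [] := Wev_partial i (wu n).
  - exact: Lev_Lloc lu.
  - exact: Lev_Lloc lg.
  - by move=> n; exact: L1abs.
  - by move=> n; apply: L1abs => //; exact: Wev_Lev (Wp i n).
  - exact: Lev_cvg_L1 hu.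
  - apply: (@Lev_cvg_L1 _ _ _ mOm Omoo m) (fun n => Wev_Lev (Wp i n)) lg _.
    apply: cvg0_le hgi => n; rewrite I_linB wsum_I andbT.
    by apply: Rintegral_ge0 => x _; exact: even_expr_ge0.
have Wu : Wev k.+1 m u.
  split => // i; have hw := wpartialP (wpu i); split => //.
  have [_ [mw _] _] := hw; have [Wg _] := hg i.
  apply: (proj1 (Wev_ae mw _ Wg)).
  by apply: filterS (wpartial_eq oOm (wpu i)) => x e Ox; rewrite e.
exists u => //.
rewrite (_ : (fun n => _) = (fun n => \int[mu]_(x in Om) ((u_ n x - u x) ^+ m.+1.*2) +
    \sum_i wsum k m (lin 1 (-1) (wpartial Om i (u_ n)) (g i)))).
  rewrite -[X in _ --> X]addr0; apply: cvgD => //.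
  by apply: cvg0_sum => i; have [] := hg i.
apply/funext => n /=; rewrite I_linB; congr (_ + _); apply: eq_bigr => i _.
have hl := weak_partial_lin oOm 1 (-1) (proj1 (Wev_partial i (wu n))) (wpu i).
have [_ [mw _] _] := wpartialP hl; have [Wg _] := hg i.
rewrite (proj2 (Wev_ae mw _ (Wev_lin 1 (-1) (Wp i n) Wg)))//.
by apply: filterS (wpartial_eq oOm hl) => x e Ox; rewrite e.
Qed.

Lemma wsumZ k m u (a : R) : Wev k m u -> wsum k m (fun x => a * u x) <= a ^+ m.+1.*2 * wsum k m u.
Proof.
move=> wu; have := @wsum_lin k m u u a 0 (a ^+ m.+1.*2) 0.
rewrite (_ : lin a 0 u u = fun x => a * u x); last first.
  by apply/funext => x; rewrite /lin mul0r addr0.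
rewrite mul0r addr0; apply => // x y.
by rewrite !mul0r !addr0 exprMn.
Qed.

Lemma Wev_mid_le k m u v M : Wev k m u -> Wev k m v -> wsum k m u <= M -> wsum k m v <= M ->
  wsum k m (lin 2^-1 2^-1 u v) <= M.
Proof.
move=> wu wv hu hv; apply: le_trans (_ : 2^-1 * wsum k m u + 2^-1 * wsum k m v <= _).
  apply: wsum_lin => // x y; have := clarkson_half m x y.
  have := even_expr_ge0 m ((x - y) / 2); rewrite -!mulrDr => h0 h.
  by rewrite mulrC [leRHS]mulrC; lra.
by lra.
Qed.

(** The set of functions whose value at [x] is within [e] of u(x) is closed under midpoints. *)
Lemma tail_hull_limit (u_ : nat -> E -> R) (z : nat -> E -> R) u x :
  (forall n, @tail_hull R (E -> R : lmodType R) u_ n (z n)) ->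
  u_ n x @[n --> \oo] --> u x -> z n x @[n --> \oo] --> u x.
Proof.
move=> hz /cvgn_leP h; apply/cvgn_leP => e /h[n0 hn]; exists n0 => n n0n.
apply: (hz n [set v | `|v x - u x| <= e]) => [a b /= ha hb|k nk /=]; last first.
  by apply: hn; exact: leq_trans nk.
rewrite [_ x](_ : _ = 2^-1 * (a x + b x))//.
have -> : 2^-1 * (a x + b x) - u x = 2^-1 * (a x - u x) + 2^-1 * (b x - u x) by field.
apply: le_trans (ler_normD _ _) _; rewrite !normrM ger0_norm ?invr_ge0//; lra.
Qed.

Lemma wsum_clarkson k m u v : Wev k m u -> Wev k m v ->
  wsum k m (lin 2^-1 2^-1 u v) + wsum k m (lin 2^-1 (- 2^-1) u v) <= (wsum k m u + wsum k m v) / 2.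
Proof.
move=> wu wv; rewrite mulrDl [wsum k m u / 2]mulrC [wsum k m v / 2]mulrC.
apply: wsum_lin_le => // x y; have := clarkson_half m x y.
have -> : 2^-1 * x + 2^-1 * y = (x + y) / 2 by field.
have -> : 2^-1 * x + - 2^-1 * y = (x - y) / 2 by field.
by rewrite -mulrDr [2^-1 * _]mulrC.
Qed.

Lemma wsum_double k m u v : Wev k m u -> Wev k m v ->
  wsum k m (lin 1 (-1) u v) <= 2 ^+ m.+1.*2 * wsum k m (lin 2^-1 (- 2^-1) u v).
Proof.
move=> wu wv; rewrite (_ : lin 1 (-1) u v = fun x => 2 * lin 2^-1 (- 2^-1) u v x); last first.
  by apply/funext => x; rewrite /lin; field.
by apply: wsumZ; exact: Wev_lin.
Qed.

Lemma lin_midE u v : 2^-1 *: (u + v : E -> R) = lin 2^-1 2^-1 u v.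
Proof. by apply/funext => x; rewrite /lin -mulrDr. Qed.

Lemma lin_midB u v : 2^-1 *: (u - v : E -> R) = lin 2^-1 (- 2^-1) u v.
Proof. by apply/funext => x; rewrite /lin mulNr -mulrBr. Qed.

Lemma hull_limit_ae k m (u_ z : nat -> E -> R) u v :
  (forall n, @tail_hull R (E -> R : lmodType R) u_ n (z n)) -> (forall n, Wev k m (z n)) ->
  Wev k m v -> wsum k m (lin 1 (-1) (z n) v) @[n --> \oo] --> 0 ->
  {ae mu, forall x, Om x -> u_ n x @[n --> \oo] --> u x} -> v = u %[ae mu in Om].
Proof.
move=> hz wz wv hv hu.
have [|t ht hae] := @cvg_Lev_ae _ _ _ mu Om mOm m z v (fun n => Wev_Lev (wz n)) (Wev_Lev wv).
  apply: cvg0_le hv => n; rewrite I_linB wsum_I andbT.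
  by apply: Rintegral_ge0 => x _; exact: even_expr_ge0.
apply: filterS2 hu hae => x h1 h2 Ox.
have h3 := tail_hull_limit hz (h1 Ox).
apply: cvgn_uniq (h2 Ox) _; apply: (almost_subseq_cvg (a := fun n => z n x) (s := id)) h3.
by exists 0%N => n _; exists (t n) => //; exact: increasing_leq.
Qed.

(** A Banach-Saks property: Clarkson's inequality for [wsum] is the uniform convexity that makes
    almost minimal elements of the tail hulls Cauchy, and completeness provides the strong limit. *)
Lemma Wev_hull k m (u_ : nat -> E -> R) (M : R) : (forall n, Wev k m (u_ n)) ->
  (forall n, wsum k m (u_ n) <= M) ->
  exists z : nat -> E -> R, [/\ forall n, @tail_hull R (E -> R : lmodType R) u_ n (z n),
    forall n, Wev k m (z n), forall n, wsum k m (z n) <= M &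
    exists2 u, Wev k m u & wsum k m (lin 1 (-1) (z n) u) @[n --> \oo] --> 0].
Proof.
move=> wu hM.
have [|a|a b wa wb|||z hz hc] := @cauchy_tail_hull R (E -> R : lmodType R)
  (Wev k m) (wsum k m) u_ M => //.
- by move=> a b wa wb; rewrite lin_midE; exact: Wev_lin.
- exact: wsum_ge0.
- by rewrite lin_midE lin_midB; exact: wsum_clarkson.
have zP n : Wev k m (z n) /\ wsum k m (z n) <= M.
  apply: (hz n [set v | Wev k m v /\ wsum k m v <= M]) => [a b /= [wa ha] [wb hb]|j _ //].
  by rewrite lin_midE; split; [exact: Wev_lin|exact: Wev_mid_le].
exists z; split => //; [by move=> n; have [] := zP n|by move=> n; have [] := zP n|].
apply: Wev_complete => [n|e e0]; first by have [] := zP n.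
have e1 : 0 < e / 2 ^+ m.+1.*2 by rewrite divr_gt0// exprn_gt0.
have [n0 hn] := hc _ e1; exists n0 => i j i0 j0; have {hn} := hn i j i0 j0.
rewrite lin_midB ler_pdivlMr ?exprn_gt0// mulrC; apply: le_trans.
by apply: wsum_double; [have [] := zP i|have [] := zP j].
Qed.

(** For each s < 1, weighted convexity gives s^{q-1} wsum(u) <= wsum(z_n) + K wsum(z_n - u), with
    [K] depending on [s]. The limit is taken in n first, then in s. *)
Lemma wsum_limit_le k m (z : nat -> E -> R) u (M : R) : (forall n, Wev k m (z n)) -> Wev k m u ->
  (forall n, wsum k m (z n) <= M) -> wsum k m (lin 1 (-1) (z n) u) @[n --> \oo] --> 0 ->
  wsum k m u <= M.
Proof.
move=> wz wu hM hz; set q := m.+1.*2.-1.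
have step (s : R) : 0 < s -> s < 1 -> s ^+ q * wsum k m u <= M.
  move=> s0 s1; have t0 : 0 < 1 - s by rewrite subr_gt0.
  pose K := (s / (1 - s)) ^+ q.
  have h n : s ^+ q * wsum k m u <= M + K * wsum k m (lin 1 (-1) (z n) u).
    have sq0 : 0 < s ^+ q by rewrite exprn_gt0.
    rewrite -ler_pdivlMl// mulrDr mulrA; apply: le_trans (_ : (s ^+ q)^-1 * wsum k m (z n) +
      (s ^+ q)^-1 * K * wsum k m (lin 1 (-1) (z n) u) <= _); last first.
      by rewrite lerD2r ler_pM2l ?invr_gt0.
    rewrite [X in wsum k m X <= _](_ : u = lin 1 (-1) (z n) (lin 1 (-1) (z n) u)); last first.
      by apply/funext => x; rewrite /lin; ring.
    apply: wsum_lin => //; last by apply: Wev_lin.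
    move=> x y; have := @even_expr_convex R m s (1 - s) x (- y) s0 t0.
    rewrite subrKC => /(_ erefl); rewrite -(even_expr_norm m (- y)) normrN even_expr_norm -/q -/K => hc.
    by rewrite mul1r mulN1r -mulrA -mulrDr ler_pdivlMl.
  rewrite -[M]addr0 -[X in M + X](mulr0 K).
  have : M + K * wsum k m (lin 1 (-1) (z n) u) @[n --> \oo] --> M + K * 0.
    by apply: cvgD; [exact: cvg_cst|apply: cvgM => //; exact: cvg_cst].
  by move=> hc; apply: (cvgn_lower hc) => n; exact: h.
have [n hn] : exists n : nat, True by exists 0%N.
have cv : (1 - n.+2%:R^-1) ^+ q * wsum k m u @[n --> \oo] --> (1 : R) ^+ q * wsum k m u.
  apply: cvgM; last exact: cvg_cst.
  apply: (@cvgn_exprn R (fun n => 1 - n.+2%:R^-1) 1 q).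
  rewrite -[X in _ --> X]subr0; apply: cvgB; first exact: cvg_cst.
  have := @cvg_harmonic R; rewrite -(cvg_shiftn 1) /=.
  by apply: cvg_trans; apply: near_eq_cvg; apply: nearW => j; rewrite /= addn1.
rewrite expr1n mul1r in cv; apply: (cvgn_upper cv) => j; apply: step.
  by rewrite subr_gt0 invf_lt1// ltr1n.
by rewrite ltrBlDr ltrDl invr_gt0.
Qed.

(** Iterated midpoints inherit both the bound and the a.e. limit, so their strong limit is [u] up to
    a null set. *)
Lemma Wev_lsc k m (u_ : nat -> E -> R) u (M : R) : (forall n, Wev k m (u_ n)) ->
  (forall n, wsum k m (u_ n) <= M) -> measurable_fun Om u ->
  {ae mu, forall x, Om x -> u_ n x @[n --> \oo] --> u x} ->
  Wev k m u /\ wsum k m u <= M.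
Proof.
move=> wu hM mfu hu; have [z [hz wz zM [v wv hv]]] := Wev_hull wu hM.
have vu := hull_limit_ae hz wz wv hv hu.
have [W1 <-] := Wev_ae mfu vu wv; split => //; exact: wsum_limit_le hv.
Qed.

End even_sobolev.

(** * Integration by parts *)

Section integration_by_parts.
Context (R : realType).
Local Notation leb := (@lebesgue_measure R).

Lemma rV_cons0_line n (v : 'rV[R]_n) (t : R) :
  rV_cons (t, v) = rV_cons (0, v) + t *: delta_mx ord0 ord0 :> 'rV[R]_n.+1.
Proof.
apply/rowP => i; rewrite !mxE; case: unliftP => [j ->|->] /=.
  by rewrite mulr0 addr0.
by rewrite mulr1 add0r.
Qed.

Lemma rV_cons_lift_line n (v : 'rV[R]_n) (t s : R) (j : 'I_n) :
  rV_cons (t, v + s *: delta_mx ord0 j) =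
  rV_cons (t, v) + s *: delta_mx ord0 (lift ord0 j) :> 'rV[R]_n.+1.
Proof.
apply/rowP => i; rewrite !mxE; case: unliftP => [k ->|->] /=.
  by rewrite !mxE (inj_eq lift_inj).
by rewrite mulr0 addr0.
Qed.

(** Fubini and induction on the dimension. If [i] is the first coordinate, the fundamental theorem
    of calculus applies on each line; otherwise the first coordinate is frozen. The hypotheses
    concern lines only, so that they survive slicing. *)
Lemma integral_derive_eq0 n (i : 'I_n) (F dF : 'rV[R]_n -> R) (M C : R) :
  (forall x (t : R), is_derive t 1 (fun s : R => F (x + s *: delta_mx ord0 i))
     (dF (x + t *: delta_mx ord0 i))) ->
  (forall x, continuous (fun s : R => dF (x + s *: delta_mx ord0 i))) ->
  measurable_fun setT dF -> (forall x, `|dF x| <= C) ->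
  (forall x, ~ cbox (const_mx (- M)) (const_mx M) x -> F x = 0 /\ dF x = 0) ->
  (\int[lebesgue_rV R n]_x (dF x)%:E = 0)%E.
Proof.
elim: n i F dF => [[]//|n ih] i F dF hF cF mF hC hM.
set m := lebesgue_rV R n.
have mcb := measurable_cbox (const_mx (- M)) (const_mx M : 'rV[R]_n.+1).
have iF : (lebesgue_rV R n.+1).-integrable setT (EFin \o dF).
  apply: (L1_support measurableT mcb) => //.
    by move=> x _ /hM[].
  apply: (@L1_bounded _ _ _ _ _ mcb _ dF C) => //; first exact: lebesgue_cbox_lty.
  exact: measurable_funS mF.
have mdF : measurable_fun setT (EFin \o dF) by apply/measurable_EFinP.
have mdFc : measurable_fun setT (EFin \o dF \o @rV_cons R n).
  by apply: measurableT_comp => //; exact: measurable_rV_cons.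
have ip : (leb \x m)%E.-integrable setT ((EFin \o dF) \o @rV_cons R n).
  apply/integrableP; split => //; move/integrableP : iF => [_].
  rewrite /= /lebesgue_rVS ge0_integral_pushforward//; first exact: measurable_rV_cons.
  by apply/measurable_EFinP; exact: measurableT_comp.
rewrite [LHS](_ : _ = (\int[leb \x m]_z (dF (rV_cons z))%:E)%E); last first.
  rewrite /= /lebesgue_rVS integral_pushforward//; exact: measurable_rV_cons.
case: (unliftP ord0 i) => [j|] ij; subst i.
  rewrite -(integral12_prod_meas1 ip) -[RHS](integral0 leb setT).
  apply: eq_integral => t _; rewrite /fubini_F /=.
  apply: (ih j (fun v => F (rV_cons (t, v))) (fun v => dF (rV_cons (t, v)))).
  - move=> x s; rewrite (_ : (fun s => _) = fun s => F (rV_cons (t, x) + s *: delta_mx ord0 (lift ord0 j))).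
      by rewrite rV_cons_lift_line; exact: hF.
    by apply/funext => s'; rewrite rV_cons_lift_line.
  - move=> x; rewrite (_ : (fun s => _) = fun s => dF (rV_cons (t, x) + s *: delta_mx ord0 (lift ord0 j))).
      exact: cF.
    by apply/funext => s'; rewrite rV_cons_lift_line.
  - apply: measurableT_comp => //; apply: measurableT_comp; first exact: measurable_rV_cons.
    exact: pair1_measurable.
  - by move=> x; exact: hC.
  - move=> x nx; apply: hM => h; apply: nx => k; have := h (lift ord0 k).
    by rewrite !mxE liftK.
rewrite -(integral21_prod_meas1 ip) -[RHS](integral0 m setT).
apply: eq_integral => v _; rewrite /fubini_G /=.
(* Strictly larger than [M], so that the end points of the interval lie where [F] vanishes. *)
pose M' := `|M| + 1; have M'0 : 0 < M' by rewrite ltr_wpDl.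
have MM' : M < M' by rewrite (le_lt_trans (ler_norm M))// ltrDl.
have out t : M < `|t| -> ~ cbox (const_mx (- M)) (const_mx M : 'rV[R]_n.+1) (rV_cons (t, v)).
  move=> Mt h; have := h ord0; rewrite !mxE unlift_none /= in_itv /= -ler_norml.
  by rewrite leNgt Mt.
have hG (t : R) : is_derive t 1 (fun s => F (rV_cons (s, v))) (dF (rV_cons (t, v))).
  rewrite (_ : (fun s => _) = fun s => F (rV_cons (0, v) + s *: delta_mx ord0 ord0)).
    by rewrite (rV_cons0_line v t); exact: hF.
  by apply/funext => s'; rewrite (rV_cons0_line v s').
have cG : continuous (fun t => dF (rV_cons (t, v))).
  rewrite (_ : (fun s => _) = fun s => dF (rV_cons (0, v) + s *: delta_mx ord0 ord0)).
    exact: cF.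
  by apply/funext => s'; rewrite (rV_cons0_line v s').
have cFv : continuous (fun s => F (rV_cons (s, v))).
  by move=> t; apply: differentiable_continuous; apply/derivable1_diffP; have [] := hG t.
have -> : (\int[leb]_t (dF (rV_cons (t, v)))%:E =
    \int[leb]_(t in `[(- M')%R, M']) (dF (rV_cons (t, v)))%:E)%E.
  rewrite [RHS]integral_mkcond; apply: eq_integral => t _; rewrite patchE; case: ifPn => //.
  rewrite notin_setE /= in_itv /= -ler_norml => /negP; rewrite -ltNge => tM.
  by have [_ ->] := hM _ (out t (lt_trans MM' tM)).
rewrite (@continuous_FTC2 R _ (fun s => F (rV_cons (s, v)))).
- have M'n : M < `|M'| by rewrite ger0_norm ?(ltW M'0).
  have M'n' : M < `|- M'| by rewrite normrN.
  by rewrite (hM _ (out M' M'n)).1 (hM _ (out (- M') M'n')).1 subee.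
- by rewrite gtrN.
- exact: continuous_subspaceT.
- split; first by move=> t _; have [] := hG t.
    by apply: cvg_at_right_filter; exact: cFv.
  by apply: cvg_at_left_filter; exact: cFv.
- by move=> t _; rewrite derive1E; have [_] := hG t.
Qed.

End integration_by_parts.

Section test_integration.
Context (R : realType) (N : nat).
Local Notation E := 'rV[R]_N.
Local Notation mu := (lebesgue_rV R N).
Implicit Types (Om : set E) (u v g : E -> R) (i : 'I_N) (x : E).

Lemma is_derive_line i u (d : R) x (t : R) :
  is_derive (x + t *: delta_mx ord0 i) (delta_mx ord0 i : E) u d ->
  is_derive t 1 (fun s : R => u (x + s *: delta_mx ord0 i)) d.
Proof.
move=> [du dd].
have fE : (fun h : R => h^-1 *: (u (x + (h *: 1 + t) *: delta_mx ord0 i) - u (x + t *: delta_mx ord0 i)))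
  = (fun h : R => h^-1 *: (u (h *: delta_mx ord0 i + (x + t *: delta_mx ord0 i)) - u (x + t *: delta_mx ord0 i))).
  apply/funext => h; congr (_ *: (u _ - _)).
  by rewrite [h *: 1]mulr1 scalerDl addrCA.
split; first by rewrite /derivable /= fE.
by rewrite -dd /derive /= fE.
Qed.

Lemma line_continuous (x e : E) : continuous (fun s : R => x + s *: e).
Proof. by move=> s; apply: cvgD; [exact: cvg_cst|exact: cvgZr_tmp]. Qed.

Lemma I_derive_eq0 i (F dF : E -> R) (K : set E) : compact K ->
  (forall x, is_derive x (delta_mx ord0 i : E) F (dF x)) -> continuous dF ->
  (forall x, ~ K x -> F x = 0 /\ dF x = 0) -> \int[mu]_x dF x = 0.
Proof.
move=> cK hF cF hK; have [M M0 KM] := bounded_sub_cbox (compact_bounded cK).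
have : bounded_set (dF @` K).
  by apply: compact_bounded; apply: continuous_compact => //; exact: continuous_subspaceT.
move=> /pinfty_ex_gt0[C C0 hC].
suff h : (\int[mu]_x (dF x)%:E = 0)%E by rewrite /Rintegral h.
apply: (@integral_derive_eq0 R N i F dF M C).
- by move=> x t; apply: is_derive_line.
- move=> x s; apply: (@continuous_comp _ _ _ (fun s : R => x + s *: delta_mx ord0 i : E) dF).
    exact: line_continuous.
  exact: cF.
- exact: rV_continuous_measurable.
- move=> x; have [Kx|nKx] := pselect (K x); first by apply: hC; exists x.
  by rewrite (hK x nKx).2 normr0 ltW.
- by move=> x nx; apply: hK => /KM.
Qed.

Lemma I_parts Om i v (phi dphi : E -> R) : test_function Om v ->
  (forall x, is_derive x (delta_mx ord0 i : E) phi (dphi x)) ->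
  continuous phi -> continuous dphi ->
  \int[mu]_x (v x * dphi x + pderiv i v x * phi x) = 0.
Proof.
move=> tv hphi cphi cdphi; have [_ cv _] := tv; have tdv := test_pderiv i tv.
have dv x : is_derive x (delta_mx ord0 i : E) v (pderiv i v x).
  by split=> //; exact: test_derivable tv.
have out x : ~ closure [set x | v x != 0] x -> v x = 0 /\ pderiv i v x = 0.
  move=> nx; split; first exact: test_out tv nx.
  have -> : pderiv i v x = pderiv i (cst 0) x; last exact: derive_cst.
  apply: near_eq_derive.
  have : open (~` closure [set x | v x != 0]) by apply: closed_openC; exact: closed_closure.
  rewrite openE => /(_ x nx); apply: filterS => y ny; exact: test_out tv ny.
apply: (I_derive_eq0 (i := i) (F := fun x => v x * phi x) cv).
- move=> x; have h1 := dv x; have h2 := hphi x.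
  have h := is_deriveM h1 h2; rewrite [pderiv i v x * _]mulrC; exact: h.
- have c1 := test_continuous tv; have c2 := test_continuous tdv.
  by move=> x; exact: cvgD (cvgM (c1 x) (cdphi x)) (cvgM (c2 x) (cphi x)).
- by move=> x /out[-> ->]; rewrite !mul0r addr0.
Qed.

Lemma continuous_Lloc Om u : measurable Om -> continuous u -> Lloc Om u.
Proof.
move=> mOm cu; have mu_ := rV_continuous_measurable cu.
split=> [|K _ cK]; first exact: measurable_funS mu_.
have mK : measurable K.
  by apply: rV_closed_measurable; apply: compact_closed => //; exact: norm_hausdorff.
have : bounded_set (u @` K).
  by apply: compact_bounded; apply: continuous_compact => //; exact: continuous_subspaceT.
move=> /pinfty_ex_gt0[C C0 hC].
apply: (@L1_bounded _ _ _ _ _ mK _ u C).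
- by apply: bounded_lebesgue_lty => //; exact: compact_bounded.
- exact: measurable_funS mu_.
- by move=> x Kx; apply: hC; exists x.
Qed.

Lemma test_weak_partial Om Om' i v : open Om -> test_function Om' v ->
  weak_partial Om i v (pderiv i v).
Proof.
move=> oOm tv; have tdv := test_pderiv i tv; have mOm := rV_open_measurable oOm.
have lv := continuous_Lloc mOm (test_continuous tv).
have ldv := continuous_Lloc mOm (test_continuous tdv).
split => // w tw; have tdw := test_pderiv i tw.
have cw := test_continuous tw; have cdw := test_continuous tdw.
have i1 := L1_test oOm lv tdw; have i2 := L1_test oOm ldv tw.
apply/eqP; rewrite -addr_eq0 -RintegralD//; apply/eqP.
have dw x : is_derive x (delta_mx ord0 i : E) w (pderiv i w x).
  by split=> //; exact: test_derivable tw.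
have dv x : is_derive x (delta_mx ord0 i : E) v (pderiv i v x).
  by split=> //; exact: test_derivable tv.
have := I_parts tw dv (test_continuous tv) (test_continuous tdv).
rewrite (@I_support _ _ _ mu setT Om)//.
  by under eq_Rintegral do rewrite addrC [w _ * _]mulrC [pderiv i w _ * _]mulrC.
have [_ _ wO] := tw; have [_ _ dwO] := tdw; move=> x _ nx.
rewrite (test_out tw) ?(test_out tdw) ?mul0r ?addr0//; first by move=> /dwO.
by move=> /wO.
Qed.

End test_integration.

(** * The Dirichlet problem *)

Section dirichlet_form.
Context (R : realType) (N : nat).
Local Notation E := 'rV[R]_N.
Local Notation mu := (lebesgue_rV R N).
Variables (Om : set E) (oOm : open Om) (Omoo : (mu Om < +oo)%E).
Implicit Types (u v w g y : E -> R) (i : 'I_N).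
Let mOm : measurable Om := rV_open_measurable oOm.
Local Notation W1 := (Wev Om 1 0).
Local Notation I2 u := (\int[mu]_(x in Om) (u x ^+ 2)).

Definition dotg u v := \int[mu]_(x in Om) grad_dot Om u v x.

Lemma H1P u : H1 Om u <-> W1 u.
Proof. exact: (@sobolevP _ _ _ oOm 1 0 u). Qed.

Lemma W1_partial u i : W1 u -> Lev mu Om 0 (wpartial Om i u).
Proof. by move=> /(Wev_partial i)[_ /Wev_Lev]. Qed.

Lemma L1_partials u v i : W1 u -> W1 v ->
  mu.-integrable Om (EFin \o (fun x => wpartial Om i u x * wpartial Om i v x)).
Proof. by move=> wu wv; apply: (Lev0_mul mOm); exact: W1_partial. Qed.

Lemma dotgE u v : W1 u -> W1 v ->
  dotg u v = \sum_i \int[mu]_(x in Om) (wpartial Om i u x * wpartial Om i v x).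
Proof.
by move=> wu wv; rewrite /dotg /grad_dot I_sum// => i; exact: L1_partials.
Qed.

Lemma dotgC u v : dotg u v = dotg v u.
Proof.
by apply: eq_Rintegral => x _; apply: eq_bigr => i _; rewrite mulrC.
Qed.

Lemma dotg_lin a c u v w : W1 u -> W1 v -> W1 w ->
  dotg (lin a c u v) w = a * dotg u w + c * dotg v w.
Proof.
move=> wu wv ww; rewrite !dotgE//; last exact: Wev_lin.
rewrite !mulr_sumr -big_split /=; apply: eq_bigr => i _.
have i1 := L1_partials i wu ww; have i2 := L1_partials i wv ww.
rewrite -!RintegralZl// -RintegralD//; try exact: L1Z.
have mw : measurable_fun Om (wpartial Om i w) by have [] := W1_partial i ww.
apply: (ae_I mOm).
- apply: measurable_funM => //; have W := Wev_lin oOm a c wu wv.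
  by have [] := W1_partial i W.
- by apply: measurable_funD; apply: measurable_funM => //; apply: L1_measurable i1 || apply: L1_measurable i2.
- apply: filterS (wpartial_lin oOm a c i wu wv) => x h Ox.
  by rewrite h// /lin mulrDl !mulrA.
Qed.

Lemma dotg_ge0 u : 0 <= dotg u u.
Proof.
by apply: Rintegral_ge0 => x _; apply: sumr_ge0 => i _; rewrite -expr2 sqr_ge0.
Qed.

Lemma dotg_sum u : W1 u -> dotg u u = \sum_i wsum Om 0 0 (wpartial Om i u).
Proof.
move=> wu; rewrite dotgE//; apply: eq_bigr => i _; rewrite /= addr0.
by apply: eq_Rintegral => x _; rewrite -expr2.
Qed.

Lemma wsum1E u : W1 u -> wsum Om 1 0 u = I2 u + dotg u u.
Proof. by move=> wu; rewrite dotg_sum. Qed.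

Lemma H1_norm2E u : W1 u -> H1_norm2 Om u = wsum Om 1 0 u.
Proof. by move=> wu; rewrite wsum1E. Qed.

Lemma dotg_le_wsum u : W1 u -> dotg u u <= wsum Om 1 0 u.
Proof. by move=> wu; rewrite wsum1E// lerDr I_sqr_ge0. Qed.

Lemma dotg_lin2 a c u v : W1 u -> W1 v -> dotg (lin a c u v) (lin a c u v) =
  a ^+ 2 * dotg u u + (a * c) * dotg u v *+ 2 + c ^+ 2 * dotg v v.
Proof.
move=> wu wv; have W := Wev_lin oOm a c wu wv.
rewrite (dotg_lin a c wu wv W) (dotgC u (lin a c u v)) (dotgC v (lin a c u v)).
rewrite (dotg_lin a c wu wv wu) (dotg_lin a c wu wv wv) (dotgC v u).
by move: (dotg u u) (dotg u v) (dotg v v) => p q r; ring.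
Qed.

Lemma dotg_cauchy_schwarz u v : W1 u -> W1 v -> dotg u v ^+ 2 <= dotg u u * dotg v v.
Proof.
move=> wu wv; apply: quadratic_ge0; first exact: dotg_ge0.
move=> t; have := dotg_ge0 (lin 1 t u v); rewrite dotg_lin2//.
by rewrite expr1n !mul1r.
Qed.

Lemma dotg_cvg (u_ : nat -> E -> R) u v : (forall n, W1 (u_ n)) -> W1 u -> W1 v ->
  dotg (lin 1 (-1) (u_ n) u) (lin 1 (-1) (u_ n) u) @[n --> \oo] --> 0 ->
  dotg (u_ n) v @[n --> \oo] --> dotg u v.
Proof.
move=> wu_ wu wv h; have wd n := Wev_lin oOm 1 (-1) (wu_ n) wu.
have dE n : dotg (u_ n) v - dotg u v = dotg (lin 1 (-1) (u_ n) u) v.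
  by rewrite dotg_lin// mul1r mulN1r.
have : (dotg (u_ n) v - dotg u v) ^+ 2 @[n --> \oo] --> 0.
  apply: (@cvg0_le _ _ (fun n => dotg (lin 1 (-1) (u_ n) u) (lin 1 (-1) (u_ n) u) * dotg v v)).
    by move=> n; rewrite sqr_ge0 dE dotg_cauchy_schwarz.
  rewrite -[X in _ --> X](mul0r (dotg v v)); apply: cvgM => //; exact: cvg_cst.
move=> /cvgn_leP h2; apply/cvgn_leP => e e0.
have [n0 hn] := h2 _ (exprn_gt0 2 e0); exists n0 => n /hn.
rewrite subr0 ger0_norm ?sqr_ge0// => h3; rewrite -(@ler_pXn2r _ 2) ?nnegrE ?(ltW e0)//.
by rewrite real_normK ?num_real.
Qed.

Lemma W1_test v : test_function Om v -> W1 v.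
Proof.
move=> tv; have [M M0 hM] := test_bounded tv.
split=> [|i].
  by apply: (@Lev_bounded _ _ _ _ _ mOm Omoo 0 v M) => //; apply: measurable_funS (test_measurable tv).
have tdv := test_pderiv i tv; have [M' _ hM'] := test_bounded tdv.
have wp := test_weak_partial i oOm tv; have hw := wpartialP wp; split => //; split => //.
have [_ [mw _] _] := hw.
apply: (@Lev_ae _ _ _ _ _ mOm 0 (pderiv i v)) => //.
  by apply: filterS (wpartial_eq oOm wp) => x h Ox; rewrite h.
apply: (@Lev_bounded _ _ _ _ _ mOm Omoo 0 _ M') => //.
exact: measurable_funS (test_measurable tdv).
Qed.

Lemma I_wpartial_test v i : test_function Om v ->
  \int[mu]_(x in Om) (wpartial Om i v x ^+ 2) = \int[mu]_(x in Om) (pderiv i v x ^+ 2).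
Proof.
move=> tv; have wp := test_weak_partial i oOm tv; have [_ [mw _] _] := wpartialP wp.
apply: (ae_I mOm); [exact: measurable_funX| |].
  by apply: measurable_funX; apply: measurable_funS (test_measurable (test_pderiv i tv)).
by apply: filterS (wpartial_eq oOm wp) => x h Ox; rewrite h.
Qed.

Lemma H1_0P u : H1_0 Om u <-> W1 u /\
  forall e, 0 < e -> exists2 v, test_function Om v & wsum Om 1 0 (lin 1 (-1) u v) <= e.
Proof.
have uvE v : u - v = lin 1 (-1) u v.
  by apply/funext => x; rewrite /lin mul1r mulN1r.
split=> [[/H1P wu h]|[wu h]].
  split => // e e0; have e1 : 0 < Num.sqrt e by rewrite sqrtr_gt0.
  have [v tv hv] := h _ e1; exists v => //.
  have wd := Wev_lin oOm 1 (-1) wu (W1_test tv).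
  by move: hv; rewrite uvE ltr_sqrt// => /ltW; rewrite H1_norm2E.
split; first exact/H1P.
move=> e e0; have e1 : 0 < e ^+ 2 / 2 by rewrite divr_gt0// exprn_gt0.
have [v tv hv] := h _ e1; exists v => //.
have wd := Wev_lin oOm 1 (-1) wu (W1_test tv).
rewrite uvE H1_norm2E// -[ltRHS]ger0_norm ?(ltW e0)// -sqrtr_sqr ltr_sqrt ?exprn_gt0//.
by apply: le_lt_trans hv _; rewrite ltr_pdivrMr// ltr_pMr ?exprn_gt0// ltr1n.
Qed.

Lemma H1_0_W1 u : H1_0 Om u -> W1 u. Proof. by move=> /H1_0P[]. Qed.

Lemma sqrD_le (x y a c : R) : (a * x + c * y) ^+ 2 <= 2 * a ^+ 2 * x ^+ 2 + 2 * c ^+ 2 * y ^+ 2.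
Proof. by have := sqr_ge0 (a * x - c * y); nra. Qed.

Lemma wsum_sqr k u v a c : Wev Om k 0 u -> Wev Om k 0 v ->
  wsum Om k 0 (lin a c u v) <= 2 * a ^+ 2 * wsum Om k 0 u + 2 * c ^+ 2 * wsum Om k 0 v.
Proof. by move=> wu wv; apply: wsum_lin => // x y; exact: sqrD_le. Qed.

Lemma H1_0_closed u : W1 u ->
  (forall e, 0 < e -> exists2 v, H1_0 Om v & wsum Om 1 0 (lin 1 (-1) u v) <= e) -> H1_0 Om u.
Proof.
move=> wu h; apply/H1_0P; split => // e e0.
have e4 : 0 < e / 4 by rewrite divr_gt0.
have [v /H1_0P[wv hv] uv] := h _ e4; have [z tz vz] := hv _ e4; exists z => //.
have wz := W1_test tz.
have -> : lin 1 (-1) u z = lin 1 1 (lin 1 (-1) u v) (lin 1 (-1) v z).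
  by apply/funext => x; rewrite /lin; ring.
apply: le_trans (wsum_sqr 1 1 (Wev_lin oOm 1 (-1) wu wv) (Wev_lin oOm 1 (-1) wv wz)) _.
by move: uv vz; move: (wsum _ _ _ (lin _ _ u v)) (wsum _ _ _ (lin _ _ v z)) => p q; rewrite !expr1n; lra.
Qed.

Lemma H1_0_lin a c u v : H1_0 Om u -> H1_0 Om v -> H1_0 Om (lin a c u v).
Proof.
move=> /H1_0P[wu hu] /H1_0P[wv hv]; apply/H1_0P; split; first exact: Wev_lin.
move=> e e0; pose K := 1 + 2 * a ^+ 2 + 2 * c ^+ 2.
have a0 := sqr_ge0 a; have c0 := sqr_ge0 c.
have K0 : 0 < K by rewrite /K; lra.
have eK : 0 < e / K by rewrite divr_gt0.
have [u' tu' hu'] := hu _ eK; have [v' tv' hv'] := hv _ eK.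
exists (lin a c u' v').
  have [su cu uO] := tu'; have [sv cv vO] := tv'.
  have sub : closure [set x | lin a c u' v' x != 0] `<=`
      closure [set x | u' x != 0] `|` closure [set x | v' x != 0].
    rewrite -closureU; apply: closure_subset => x /= h; apply: contrapT => /not_orP[/negP nu /negP nv].
    by case/negP: h; rewrite /lin (eqP (negbNE nu)) (eqP (negbNE nv)) !mulr0 addr0.
  split.
  - move=> s x; have -> : foldr (@pderiv R N) (lin a c u' v') s =
      lin a c (foldr (@pderiv R N) u' s) (foldr (@pderiv R N) v' s).
      elim: s => [//|i s ih] /=; rewrite ih; apply/funext => y; rewrite /pderiv.
      have d1 : is_derive y (delta_mx ord0 i : E) (foldr (@pderiv R N) u' s)
          ('D_(delta_mx ord0 i) (foldr (@pderiv R N) u' s) y).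
        by split=> //; apply: diff_derivable; exact: su.
      have d2 : is_derive y (delta_mx ord0 i : E) (foldr (@pderiv R N) v' s)
          ('D_(delta_mx ord0 i) (foldr (@pderiv R N) v' s) y).
        by split=> //; apply: diff_derivable; exact: sv.
      have d3 := is_deriveD (is_deriveZ a d1) (is_deriveZ c d2).
      by have [_] := d3.
    have := differentiableD (differentiableZ a (su s x)) (differentiableZ c (sv s x)).
    exact.
  - by apply: subclosed_compact (compactU cu cv) sub; exact: closed_closure.
  - by move=> x /sub[/uO|/vO].
have -> : lin 1 (-1) (lin a c u v) (lin a c u' v') = lin a c (lin 1 (-1) u u') (lin 1 (-1) v v').
  by apply/funext => x; rewrite /lin; ring.
have W1 := Wev_lin oOm 1 (-1) wu (W1_test tu'); have W2 := Wev_lin oOm 1 (-1) wv (W1_test tv').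
apply: le_trans (wsum_sqr a c W1 W2) _.
apply: (@le_trans _ _ (2 * a ^+ 2 * (e / K) + 2 * c ^+ 2 * (e / K))).
  exact: lerD (ler_wpM2l (mulr_ge0 (ler0n R 2) a0) hu') (ler_wpM2l (mulr_ge0 (ler0n R 2) c0) hv').
rewrite -mulrDl mulrA ler_pdivrMr// [leRHS]mulrC ler_pM2r//.
by rewrite /K -[leLHS]add0r -addrA lerD2r.
Qed.

Lemma H1_0_test v : test_function Om v -> H1_0 Om v.
Proof.
move=> tv; apply/H1_0P; split; first exact: W1_test.
move=> e e0; exists v => //.
have wv := W1_test tv.
have -> : lin 1 (-1) v v = fun x => 0 * v x by apply/funext => x; rewrite /lin; ring.
by apply: le_trans (wsumZ oOm 0 wv) _; rewrite expr0n mul0r ltW.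
Qed.

(** Integrating by parts against the coordinate x_k turns the integral of v^2 into that of -2 x_k v
    d_k v. Young's inequality bounds it by half of the left-hand side plus 2 M^2 times the integral
    of (d_k v)^2, whence 4 M^2. *)
Lemma poincare_test (k : 'I_N) v (M : R) : test_function Om v ->
  (forall x, Om x -> `|x ord0 k| <= M) ->
  I2 v <= 4 * M ^+ 2 * \int[mu]_(x in Om) (pderiv k v x ^+ 2).
Proof.
move=> tv hM; have tdv := test_pderiv k tv.
pose phi (x : E) : R := x ord0 k * v x; pose dphi (x : E) : R := x ord0 k * pderiv k v x + v x.
have cx : continuous (fun x : E => x ord0 k) by move=> x; exact: coord_continuous.
have dx x : is_derive x (delta_mx ord0 k : E) (fun x : E => x ord0 k) (1 : R).
  (* The coordinate function written as a product function, whose partial derivatives are known. *)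
  pose psi (j : 'I_N) : R -> R := if j == k then id else cst 1.
  have -> : (fun x : E => x ord0 k) = prodf psi.
    apply/funext => z; rewrite /prodf (bigD1 k)//= /psi eqxx big1 ?mulr1// => j /negbTE jk.
    by rewrite jk.
  have h : is_derive (x ord0 k) (1 : R) (psi k) 1 by rewrite /psi eqxx; exact: is_derive_id.
  have := is_derive_prodf h; rewrite big1 ?mulr1// => j /negbTE jk.
  by rewrite /psi jk.
have dv x : is_derive x (delta_mx ord0 k : E) v (pderiv k v x).
  by split=> //; exact: test_derivable tv.
have cv := test_continuous tv; have cdv := test_continuous tdv.
have := @I_parts _ _ Om k v phi dphi tv _ _ _; rewrite (@I_support _ _ _ mu setT Om)//; last first.
  have [_ _ vO] := tv; have [_ _ dvO] := tdv; move=> x _ nx.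
  by rewrite (test_out tv) ?(test_out tdv) ?mul0r ?addr0// => [/dvO|/vO].
have bd w : test_function Om w -> Lev mu Om 0 w.
  move=> tw; have [K _ hK] := test_bounded tw.
  by apply: (@Lev_bounded _ _ _ _ _ mOm Omoo 0 w K) => //; apply: measurable_funS (test_measurable tw).
have [mv iv] := bd _ tv; have [mdv idv] := bd _ tdv.
have mx : measurable_fun Om (fun x : E => x ord0 k).
  by apply: measurable_funS (rV_continuous_measurable cx).
have ixv : mu.-integrable Om (EFin \o (fun x : E => x ord0 k * v x * pderiv k v x)).
  apply: (@Lev0_mul _ _ _ mu Om mOm (fun x : E => x ord0 k * v x)) => //.
  split; first exact: measurable_funM.
  apply: (L1_le mOm _ (L1Z mOm (M ^+ 2) iv)); first by apply: measurable_funX; exact: measurable_funM.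
  move=> x Ox; rewrite ger0_norm ?sqr_ge0// exprMn ler_wpM2r ?sqr_ge0//.
  rewrite -(ger0_norm (sqr_ge0 (x ord0 k))) normrX; apply: lerXn2r; rewrite ?nnegrE//.
    exact: le_trans (hM x Ox).
  exact: hM.
have i2 := L1Z mOm 2 ixv.
have E1 : \int[mu]_(x in Om) (v x * dphi x + pderiv k v x * phi x) =
    I2 v + \int[mu]_(x in Om) (2 * (x ord0 k * v x * pderiv k v x)).
  rewrite -(RintegralD mOm iv i2); apply: eq_Rintegral => x _; rewrite /dphi /phi.
  by rewrite -[1.*2]/2%N; ring.
rewrite E1 => h; have {h} h0 : I2 v = \int[mu]_(x in Om) (- (2 * (x ord0 k * v x * pderiv k v x))).
  rewrite (IN mOm i2); apply/eqP; rewrite -addr_eq0; apply/eqP; apply: h.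
  - move=> x; have h := is_deriveM (dx x) (dv x).
    rewrite (_ : dphi x = x ord0 k *: pderiv k v x + v x *: (1 : R)) //.
    by rewrite /dphi; congr (_ + _); rewrite [RHS]mulr1.
  - by move=> x; exact: cvgM (cx x) (cv x).
  - by move=> x; exact: cvgD (cvgM (cx x) (cdv x)) (cv x).
have : I2 v <= 2^-1 * I2 v + 2 * M ^+ 2 * \int[mu]_(x in Om) (pderiv k v x ^+ 2).
  rewrite [leLHS]h0 -!RintegralZl// -(RintegralD mOm (L1Z mOm 2^-1 iv) (L1Z mOm (2 * M ^+ 2) idv)).
  apply: le_Rintegral => //.
  - exact: L1N.
  - exact: (L1D mOm (L1Z mOm 2^-1 iv) (L1Z mOm (2 * M ^+ 2) idv)).
  - move=> x Ox; have := hM x Ox; rewrite -[1.*2]/2%N.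
    move: (x ord0 k) (v x) (pderiv k v x) => a s t; rewrite ler_norml => /andP[h1 h2].
    have h3 : a ^+ 2 <= M ^+ 2 by nra.
    have h4 := sqr_ge0 (s + 2 * (a * t)); have h5 : a ^+ 2 * t ^+ 2 <= M ^+ 2 * t ^+ 2.
      by rewrite ler_wpM2r ?sqr_ge0.
    by move: h4 h5; rewrite !expr2; lra.
by move: (I2 v) (\int[mu]_(x in Om) _) => p q; lra.
Qed.

Lemma poincare : bounded_set Om -> 'I_N ->
  exists2 K, 0 < K & forall u, H1_0 Om u -> I2 u <= K * dotg u u.
Proof.
move=> bO k; have [M M0 hM] := bounded_sub_cbox bO.
have arith (C a b c p q r e : R) : p <= C * a -> r <= 2 * p + 2 * q ->
    C * a <= C * (2 * b + 2 * c) -> 4 * C * (q + c) + 2 * (q + c) <= e -> 0 <= c -> 0 <= C * q ->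
    r <= e + 4 * C * b by lra.
have hk x : Om x -> `|x ord0 k| <= M.
  by move=> /hM /(_ k) /=; rewrite !mxE in_itv /= -ler_norml.
pose C := 4 * M ^+ 2; have C0 : 0 < C by rewrite mulr_gt0// exprn_gt0.
exists (4 * C) => [|u /H1_0P[wu hu]]; first by rewrite mulr_gt0.
(* Replacing [u] by a test function and back doubles the constant twice, and the remainder [d]
   enters with weight at most 4C + 2. *)
apply/ler_addgt0Pl => e e0; have D0 : 0 < 4 * C + 2 by rewrite addr_gt0// mulr_gt0.
have [v tv hv] := hu _ (divr_gt0 e0 D0); have wv := W1_test tv.
have wd := Wev_lin oOm 1 (-1) wu wv; set d := lin 1 (-1) u v in hv wd.
have uE : u = lin 1 1 v d by apply/funext => x; rewrite /d /lin; ring.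
have vE : v = lin 1 (-1) u d by apply/funext => x; rewrite /d /lin; ring.
have pv : I2 v <= C * dotg v v.
  apply: le_trans (poincare_test tv hk) _; rewrite -/C ler_pM2l// -I_wpartial_test//.
  rewrite dotgE// (bigD1 k)//=.
  under [X in _ <= X + _]eq_Rintegral do rewrite -expr2.
  by rewrite lerDl sumr_ge0// => i _; apply: Rintegral_ge0 => x _; rewrite -expr2 sqr_ge0.
have h1 : I2 u <= 2 * I2 v + 2 * I2 d.
  have W0 w : W1 w -> Wev Om 0 0 w by move=> /Wev_Lev; split.
  have := wsum_sqr 1 1 (W0 _ wv) (W0 _ wd); rewrite -uE /= !addr0 !expr1n !mulr1.
  exact.
have h2 : dotg v v <= 2 * dotg u u + 2 * dotg d d.
  rewrite [in leLHS]vE dotg_lin2//; have := dotg_ge0 (lin 1 1 u d); rewrite dotg_lin2//.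
  by move: (dotg u u) (dotg u d) (dotg d d) => p q r; rewrite sqrrN !expr1n; lra.
have h3 : I2 d + dotg d d <= e / (4 * C + 2) by rewrite -wsum1E.
have d0 := dotg_ge0 d; have d1 := I_sqr_ge0 mu Om d.
have h4 : C * dotg v v <= C * (2 * dotg u u + 2 * dotg d d) by rewrite ler_pM2l.
have h5 : 4 * C * (I2 d + dotg d d) + 2 * (I2 d + dotg d d) <= e.
  by rewrite -mulrDl mulrC -ler_pdivlMr.
have h6 : 0 <= C * I2 d by rewrite mulr_ge0// ltW.
exact: arith pv h1 h4 h5 d0 h6.
Qed.

End dirichlet_form.

(** * Weak solutions of the Poisson problem *)

Section poisson.
Context (R : realType) (N : nat).
Local Notation E := 'rV[R]_N.
Local Notation mu := (lebesgue_rV R N).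
Variables (Om : set E) (oOm : open Om) (Omoo : (mu Om < +oo)%E).
Implicit Types (u v w g y : E -> R) (i : 'I_N).
Let mOm : measurable Om := rV_open_measurable oOm.
Local Notation dotg := (dotg Om).
Local Notation I2 u := (\int[mu]_(x in Om) (u x ^+ 2)).

(* Weak form of [- Laplacian y = g] with zero boundary values. *)
Definition sol g y := H1_0 Om y /\
  forall v, H1_0 Om v -> dotg y v = \int[mu]_(x in Om) (g x * v x).

Lemma H1_0_Lev y : H1_0 Om y -> Lev mu Om 0 y.
Proof. by move=> /(H1_0_W1 oOm Omoo)/Wev_Lev. Qed.

Lemma I_lin_mul a c (f g v : E -> R) : Lev mu Om 0 f -> Lev mu Om 0 g -> Lev mu Om 0 v ->
  \int[mu]_(x in Om) (lin a c f g x * v x) =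
  a * \int[mu]_(x in Om) (f x * v x) + c * \int[mu]_(x in Om) (g x * v x).
Proof.
move=> lf lg lv; have i1 := Lev0_mul mOm lf lv; have i2 := Lev0_mul mOm lg lv.
rewrite -!RintegralZl// -(RintegralD mOm (L1Z mOm a i1) (L1Z mOm c i2)).
by apply: eq_Rintegral => x _; rewrite /lin; ring.
Qed.

Lemma sol_lin a c g1 g2 y1 y2 : Lev mu Om 0 g1 -> Lev mu Om 0 g2 ->
  sol g1 y1 -> sol g2 y2 -> sol (lin a c g1 g2) (lin a c y1 y2).
Proof.
move=> l1 l2 [h1 e1] [h2 e2]; split; first exact: H1_0_lin.
move=> v hv; rewrite dotg_lin//; try exact: (H1_0_W1 oOm Omoo).
by rewrite e1// e2// I_lin_mul//; exact: H1_0_Lev.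
Qed.

Variables (K : R) (K0 : 0 < K).
Hypothesis pK : forall u, H1_0 Om u -> I2 u <= K * dotg u u.

(** Young's inequality weighted by the Poincare constant, so that the gradient term appears with
    coefficient 1/4 and can be absorbed. *)
Lemma I_young g v : Lev mu Om 0 g -> H1_0 Om v ->
  \int[mu]_(x in Om) (g x * v x) <= K * I2 g + dotg v v / 4.
Proof.
move=> lg hv; have lv := H1_0_Lev hv; have [_ ig] := lg; have [_ iv] := lv.
have i1 := L1Z mOm K ig; have i2 := L1Z mOm ((4 * K)^-1) iv.
have K4 : 0 < 4 * K by rewrite mulr_gt0.
apply: le_trans (_ : K * I2 g + (4 * K)^-1 * I2 v <= _).
  rewrite -!RintegralZl// -(RintegralD mOm i1 i2).
  apply: (le_Rintegral mOm (Lev0_mul mOm lg lv) (L1D mOm i1 i2)) => x _.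
  have := sqr_ge0 (2 * K * g x - v x); rewrite -[1.*2]/2%N.
  move: (g x) (v x) => s t h; rewrite -(ler_pM2l K4) mulrDr [_ * (_^-1 * _)]mulrA divff ?gt_eqF// mul1r.
  by move: h; rewrite !expr2; lra.
rewrite lerD2l ler_pdivrMl//; have := pK hv; move: (I2 v) (dotg v v) => p q; lra.
Qed.

Lemma sol_bound g y : Lev mu Om 0 g -> sol g y ->
  dotg y y <= 2 * K * I2 g /\ wsum Om 1 0 y <= (K + 1) * (2 * K) * I2 g.
Proof.
move=> lg [hy ey]; have := I_young lg hy; rewrite -(ey _ hy) => h.
have h1 : dotg y y <= 2 * K * I2 g.
  have : 0 <= K * I2 g by rewrite mulr_ge0 ?(ltW K0)//; exact: I_sqr_ge0.
  by move: h; move: (dotg y y) (I2 g) => p q; lra.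
split => //; rewrite wsum1E//; last exact: (H1_0_W1 oOm Omoo).
have := pK hy; rewrite -mulrA; move: h1 (I2 y) => h1 q h2.
apply: (@le_trans _ _ ((K + 1) * dotg y y)); first by rewrite mulrDl mul1r lerD2r.
by rewrite ler_pM2l// addr_gt0.
Qed.

Lemma sol_dist g1 g2 y1 y2 : Lev mu Om 0 g1 -> Lev mu Om 0 g2 -> sol g1 y1 -> sol g2 y2 ->
  wsum Om 1 0 (lin 1 (-1) y1 y2) <= (K + 1) * (2 * K) * I2 (lin 1 (-1) g1 g2).
Proof.
move=> l1 l2 s1 s2; have [] := sol_bound _ (sol_lin 1 (-1) l1 l2 s1 s2) => //.
by apply: LevD => //; exact: LevZ.
Qed.

Lemma test_0 : test_function Om (cst 0).
Proof.
have c0 : closure [set x : E | (cst 0 x : R) != 0] = set0.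
  by rewrite (_ : [set x : E | _] = set0) ?closure0// -subset0 => x /=; rewrite eqxx.
split; rewrite ?c0//; last exact: compact0.
move=> s x; have -> : foldr (@pderiv R N) (cst 0) s = cst 0.
  by elim: s => [//|i s ih] /=; rewrite ih; apply/funext => z; rewrite /pderiv derive_cst.
exact: differentiable_cst.
Qed.

(** Minimization of the Dirichlet energy [J]. The parallelogram identity makes a minimizing sequence
    Cauchy in H^1, and the equation is the first-order condition at the limit. *)
Lemma sol_exists g : Lev mu Om 0 g -> exists y, sol g y.
Proof.
move=> lg.
have arith (t p q : R) : 0 <= 2 * t * p + (2 * t) ^+ 2 * (q / 2) - - 0 ->
  0 <= t * p *+ 2 + t ^+ 2 * (q / 2 * 4) by rewrite oppr0 subr0; lra.
pose G v := \int[mu]_(x in Om) (g x * v x).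
have GE a c u v : H1_0 Om u -> H1_0 Om v -> G (lin a c u v) = a * G u + c * G v.
  move=> hu hv; have := I_lin_mul a c (H1_0_Lev hu) (H1_0_Lev hv) lg.
  by rewrite /G; under eq_Rintegral do rewrite mulrC;
     under [X in _ = _ * X + _]eq_Rintegral do rewrite mulrC;
     under [X in _ = _ + _ * X]eq_Rintegral do rewrite mulrC.
pose J v := dotg v v / 2 - G v.
have Jlow v : H1_0 Om v -> - (K * I2 g) <= J v.
  move=> hv; have := I_young lg hv; have := dotg_ge0 Om v; rewrite /J -/(G v).
  by move: (dotg v v) (G v) (I2 g) => p q r; lra.
pose A : set R := [set J v | v in H1_0 Om].
have Ainf : has_inf A.
  split; first by exists (J (cst 0)), (cst 0) => //; exact: H1_0_test test_0.
  by exists (- (K * I2 g)) => _ [v hv <-]; exact: Jlow.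
have infA v : H1_0 Om v -> inf A <= J v.
  by move=> hv; apply: ge_inf; [case: Ainf|exists v].
have /choice[v_ hv_] : forall n : nat, exists v, H1_0 Om v /\ J v < inf A + n.+1%:R^-1.
  move=> n; have n0 : 0 < n.+1%:R^-1 :> R by rewrite invr_gt0.
  by have [_ [v hv <-] h] := inf_adherent n0 Ainf; exists v.
have h_ n : H1_0 Om (v_ n) by case: (hv_ n).
have w_ n : Wev Om 1 0 (v_ n) := H1_0_W1 oOm Omoo (h_ n).
have par a b : H1_0 Om a -> H1_0 Om b ->
    dotg (lin 1 (-1) a b) (lin 1 (-1) a b) = 4 * (J a + J b - 2 * J (lin 2^-1 2^-1 a b)).
  move=> ha hb; have wa := H1_0_W1 oOm Omoo ha; have wb := H1_0_W1 oOm Omoo hb.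
  rewrite /J GE// !dotg_lin2//.
  by move: (dotg a a) (dotg a b) (dotg b b) (G a) (G b) => p q r s t; field.
have ginv (e : R) : 0 < e -> exists n0, forall n, (n0 <= n)%N -> n.+1%:R^-1 <= e.
  move=> e0; have := @cvg_harmonic R => /cvgn_leP/(_ _ e0)[n0 hn]; exists n0 => n /hn.
  by rewrite subr0 ger0_norm ?invr_ge0.
have [|y wy hy] := @Wev_complete _ _ _ oOm Omoo 1 0 v_ w_.
  move=> e e0; have K1 : 0 < (K + 1) * 8 by rewrite mulr_gt0// addr_gt0.
  have [n0 hn] := ginv _ (divr_gt0 e0 K1); exists n0 => i j /hn hi /hn hj.
  have hd := H1_0_lin oOm Omoo 1 (-1) (h_ i) (h_ j).
  rewrite (wsum1E oOm); last exact: H1_0_W1 hd.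
  apply: (@le_trans _ _ ((K + 1) * dotg (lin 1 (-1) (v_ i) (v_ j)) (lin 1 (-1) (v_ i) (v_ j)))).
    by rewrite mulrDl mul1r lerD2r; exact: pK.
  have Kp : 0 < K + 1 by rewrite addr_gt0.
  rewrite mulrC -(ler_pdivlMr _ _ Kp) (par _ _ (h_ i) (h_ j)).
  have h1 := infA _ (H1_0_lin oOm Omoo 2^-1 2^-1 (h_ i) (h_ j)).
  have [_ h2] := hv_ i; have [_ h3] := hv_ j.
  have -> : e / (K + 1) = 8 * (e / ((K + 1) * 8)) by field; rewrite gt_eqF.
  move: hi hj h1 h2 h3; move: (e / _) (J (lin _ _ _ _)) (J (v_ i)) (J (v_ j)) (inf A).
  by move: (i.+1%:R^-1) (j.+1%:R^-1) => s t a b c d f; lra.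
have Hy : H1_0 Om y.
  apply: H1_0_closed => // e e0; move/cvgn_leP : hy => /(_ e e0)[n0 /(_ n0 (leqnn n0))].
  rewrite subr0 ger0_norm; last exact: wsum_ge0.
  move=> h; exists (v_ n0); first exact: h_.
  have -> : lin 1 (-1) y (v_ n0) = fun x => (-1) * lin 1 (-1) (v_ n0) y x.
    by apply/funext => x; rewrite /lin; ring.
  apply: le_trans (wsumZ oOm (-1) (Wev_lin oOm 1 (-1) (w_ n0) wy)) _.
  by rewrite -[1.*2]/2%N sqrrN expr1n mul1r.
exists y; split => // v hv; have wv := H1_0_W1 oOm Omoo hv.
have gc : dotg (v_ n) v @[n --> \oo] --> dotg y v.
  apply: dotg_cvg => //; apply: cvg0_le hy => n.
  by rewrite dotg_ge0 /= dotg_le_wsum//; exact: Wev_lin.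
(* The energy along y + 2t v minus its minimum is a nonnegative quadratic in t without constant
   term, so its linear coefficient vanishes. The factor 2 in front of t matches the form of
   [quadratic_ge0]. *)
have : (dotg y v - G v) ^+ 2 <= 0 * (dotg v v / 2 * 4).
  apply: quadratic_ge0; first by rewrite mulr_ge0// divr_ge0// dotg_ge0.
  move=> t; rewrite add0r.
  have step n : - n.+1%:R^-1 <= 2 * t * (dotg (v_ n) v - G v) + (2 * t) ^+ 2 * (dotg v v / 2).
    have [_ h1] := hv_ n; have h2 := infA _ (H1_0_lin oOm Omoo 1 (2 * t) (h_ n) hv).
    move: h1 h2; rewrite /J (GE _ _ _ _ (h_ n) hv) (dotg_lin2 oOm 1 (2 * t) (w_ n) wv).
    move: (dotg (v_ n) (v_ n)) (dotg (v_ n) v) (dotg v v) (G (v_ n)) (G v) (inf A) (n.+1%:R^-1).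
    by move=> a b c d f g' z; rewrite expr1n mul1r; lra.
  have cl : - n.+1%:R^-1 @[n --> \oo] --> (- 0 : R) by apply: cvgN; exact: cvg_harmonic.
  have cr : 2 * t * (dotg (v_ n) v - G v) + (2 * t) ^+ 2 * (dotg v v / 2) @[n --> \oo] -->
      2 * t * (dotg y v - G v) + (2 * t) ^+ 2 * (dotg v v / 2).
    apply: cvgD; last exact: cvg_cst.
    by apply: cvgM; [exact: cvg_cst|apply: cvgB => //; exact: cvg_cst].
  have : 0 <= 2 * t * (dotg y v - G v) + (2 * t) ^+ 2 * (dotg v v / 2) - - 0.
    by apply: (cvgn_lower (cvgB cr cl)) => n; rewrite subr_ge0; exact: step.
  exact: arith.
rewrite mul0r => h; by apply/eqP; rewrite -subr_eq0 -sqrf_eq0 eq_le h sqr_ge0.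
Qed.

Lemma Lev_patch m (D : set E) u : measurable D -> Om `<=` D -> Lev mu Om m u ->
  Lev mu D m (u \_ Om) /\
  \int[mu]_(x in D) ((u \_ Om) x ^+ m.+1.*2) = \int[mu]_(x in Om) (u x ^+ m.+1.*2).
Proof.
move=> mD OD [mf iu]; have out x : D x -> ~ Om x -> (u \_ Om) x ^+ m.+1.*2 = 0.
  by move=> _ nx; rewrite patchE memNset// expr0n doubleS.
have inn x : Om x -> (u \_ Om) x ^+ m.+1.*2 = u x ^+ m.+1.*2.
  by move=> Ox; rewrite patchE mem_set.
split; last first.
  by rewrite (I_support mu OD out); apply: eq_Rintegral => x /set_mem/inn.
split.
  by apply: measurable_funS ((measurable_restrictT u mOm).1 mf).
apply: (L1_support mD mOm OD out); apply: eq_integrable iu => // x /set_mem Ox /=.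
by rewrite inn.
Qed.

(** The approximating test functions vanish outside Om and are smooth on the whole space, so the
    identity defining weak derivatives there passes to the limit. Cells may then overlap the
    boundary of Om. *)
Lemma zero_extension i y : H1_0 Om y ->
  weak_partial [set: E] i (y \_ Om) (wpartial Om i y \_ Om).
Proof.
move=> /(H1_0P oOm Omoo)[wy hy].
have eps n : 0 < (2^-1 : R) ^+ n by rewrite exprn_gt0.
have /choice[v_ hv_] : forall n : nat, exists v, test_function Om v /\
    wsum Om 1 0 (lin 1 (-1) y v) <= 2^-1 ^+ n.
  by move=> n; have [v tv hv] := hy _ (eps n); exists v.
have tv n : test_function Om (v_ n) by case: (hv_ n).
have wv n : Wev Om 1 0 (v_ n) := W1_test oOm Omoo (tv n).
have ly := W1_partial i wy; have l0 := Wev_Lev wy.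
have cv0 (a_ : nat -> R) : (forall n, 0 <= a_ n <= 2^-1 ^+ n) -> a_ n @[n --> \oo] --> 0.
  move=> h; apply: cvg0_le h _; apply/cvgn_leP => e e0.
  have [||n0 hn] := @expr_cvg0 R 2^-1 _ e => //.
    by rewrite invr_ge0 ler0n invf_lt1// ltr1n.
  by exists n0 => n /hn; rewrite subr0 ger0_norm// ltW.
have wd n := Wev_lin oOm 1 (-1) wy (wv n).
have L1T (s t : E -> R) : Lev mu Om 0 s -> Lev mu Om 0 t -> (forall x, ~ Om x -> s x = 0) ->
    mu.-integrable setT (EFin \o (fun x => `|s x - (t \_ Om) x|)) /\
    \int[mu]_x `|s x - (t \_ Om) x| = \int[mu]_(x in Om) `|s x - t x|.
  move=> ls lt sO; have out x : setT x -> ~ Om x -> `|s x - (t \_ Om) x| = 0.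
    by move=> _ nx; rewrite patchE memNset// sO// subrr normr0.
  split; last first.
    rewrite (I_support mu (@subsetT _ Om) out); apply: eq_Rintegral => x /set_mem Ox.
    by rewrite patchE mem_set.
  apply: (L1_support measurableT mOm (@subsetT _ Om) out).
  have : mu.-integrable Om (EFin \o (fun x => `|s x - t x|)).
    by apply: L1_norm; apply: (Lev_L1 mOm Omoo); exact: LevB.
  by apply: eq_integrable => // x /set_mem Ox /=; rewrite patchE mem_set.
have LT (s : E -> R) : Lev mu Om 0 s -> Lloc setT (s \_ Om).
  move=> [mf lf]; have ls := conj mf lf; have := Lev_L1 mOm Omoo ls => is1.
  split; first exact: ((measurable_restrictT s mOm).1 mf).
  move=> B _ cB; have mB : measurable B.
    by apply: rV_closed_measurable; apply: compact_closed => //; exact: norm_hausdorff.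
  apply: (L1_S measurableT mB) => //.
  apply: (L1_support measurableT mOm) => //; first by move=> x _ nx; rewrite patchE memNset.
  by apply: eq_integrable is1 => // x /set_mem Ox /=; rewrite patchE mem_set.
have tO w x : test_function Om w -> ~ Om x -> w x = 0.
  by move=> tw nx; apply: (test_out tw) => h; apply: nx; have [_ _] := tw; apply.
have lvm n : Lev mu Om 0 (v_ n) := Wev_Lev (wv n).
have ldv n : Lev mu Om 0 (pderiv i (v_ n)).
  by have := test_pderiv i (tv n) => /(W1_test oOm Omoo)/Wev_Lev.
apply: (@weak_partial_limit _ _ _ openT i v_ (fun n => pderiv i (v_ n))).
- by move=> n; apply: test_weak_partial (tv n); exact: openT.
- exact: LT.
- exact: LT.
- by move=> n; have [] := L1T _ _ (lvm n) l0 (fun x => tO _ x (tv n)).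
- by move=> n; have [] := L1T _ _ (ldv n) ly (fun x => tO _ x (test_pderiv i (tv n))).
- rewrite (_ : (fun n => _) = fun n => \int[mu]_(x in Om) `|v_ n x - y x|); last first.
    by apply/funext => n; have [] := L1T _ _ (lvm n) l0 (fun x => tO _ x (tv n)).
  apply: (@Lev_cvg_L1 _ _ _ mOm Omoo 0) => //.
  apply: cv0 => n; apply/andP; split; first exact: I_sqr_ge0.
  apply: le_trans (hv_ n).2; apply: le_trans (wsum_I _ _ _ _).
  by rewrite le_eqVlt; apply/orP; left; apply/eqP/eq_Rintegral => x _; rewrite /lin -[1.*2]/2%N; ring.
- rewrite (_ : (fun n => _) = fun n => \int[mu]_(x in Om) `|pderiv i (v_ n) x - wpartial Om i y x|); last first.
    by apply/funext => n; have [] := L1T _ _ (ldv n) ly (fun x => tO _ x (test_pderiv i (tv n))).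
  apply: (@Lev_cvg_L1 _ _ _ mOm Omoo 0) => //.
  apply: cv0 => n; apply/andP; split; first exact: I_sqr_ge0.
  apply: le_trans (hv_ n).2; apply: le_trans (wsum_partial _ _ _ _ i).
  apply: le_trans (wsum_I _ 0 0 _); rewrite le_eqVlt; apply/orP; left; apply/eqP.
  have [mdv _] := ldv n; have [my _] := ly; have [mdd _] := W1_partial i (wd n).
  apply: (ae_I mOm); [by apply: measurable_funX; exact: measurable_funB|exact: measurable_funX|].
  apply: filterS2 (wpartial_lin oOm 1 (-1) i wy (wv n))
    (wpartial_eq oOm (test_weak_partial i oOm (tv n))) => x h1 h2 Ox.
  by rewrite h1// /lin h2// -[1.*2]/2%N; ring.
Qed.

End poisson.

Section sup_bound.
Context (R : realType) (n : nat).
Local Notation N := n.+1.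
Local Notation E := 'rV[R]_N.
Local Notation mu := (lebesgue_rV R N).

(** Morrey's inequality on one cube containing Om, applied to the extension by zero; the exponent
    depends only on the bisection ratio. *)
Lemma H1_0_sup_bound (Om : set E) : open Om -> (mu Om < +oo)%E -> bounded_set Om ->
  exists m : nat, forall I0 J0 : R, exists C : R, forall y, H1_0 Om y ->
    (forall i, Lev mu Om m (wpartial Om i y)) ->
    (forall i, \int[mu]_(x in Om) (wpartial Om i y x ^+ m.+1.*2) <= I0) ->
    `|\int[mu]_(x in Om) y x| <= J0 ->
    {ae mu, forall x, Om x -> `|y x| <= C}.
Proof.
move=> oOm Omoo bO; have mOm := rV_open_measurable oOm.
have [M M0 hM] := bounded_sub_cbox bO.
(* M + 1 at the upper end, because cells are open there. *)
pose p : E * E := (const_mx (- M), const_mx (M + 1)).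
have h0 : 0 < M + 1 + M by rewrite !addr_gt0.
have sp i : side p i = M + 1 + M by rewrite /side !mxE opprK.
have Op : Om `<=` cell p.
  move=> x /hM hx i; have := hx i; rewrite /= !mxE !in_itv /= => /andP[-> h].
  by apply: le_lt_trans h _; rewrite ltrDl.
have [m hm] := morrey_cell h0 sp; exists m => I0 J0; have [C hC] := hm I0 J0.
exists C => y hy ld hI hJ; have ly := H1_0_Lev oOm Omoo hy.
have wy := H1_0_W1 oOm Omoo hy; have mc := measurable_cell p.
have : {ae mu, forall x, cell p x -> `|(y \_ Om) x| <= C}.
  apply: (hC setT (y \_ Om) (fun i => wpartial Om i y \_ Om)) => //.
  - exact: openT.
  - by move=> i; apply: zero_extension.
  - by have [] := Lev_patch oOm mc Op ly.
  - by move=> i; have [] := Lev_patch oOm mc Op (W1_partial i wy).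
  - by move=> i; have [] := Lev_patch oOm mc Op (ld i).
  - by move=> i; have [_ ->] := Lev_patch oOm mc Op (ld i).
  - rewrite (I_support mu Op); last by move=> x _ nx; rewrite patchE memNset.
    apply: le_trans hJ; rewrite le_eqVlt; apply/orP; left; apply/eqP; congr `|_|.
    by apply: eq_Rintegral => x Ox; rewrite patchE Ox.
by apply: filterS => x h Ox; have := h (Op x Ox); rewrite patchE mem_set.
Qed.

End sup_bound.

(** * From regularity to uniform regularity *)

Section uniform_regularity.
Context (R : realType) (N : nat).
Local Notation E := 'rV[R]_N.
Local Notation mu := (lebesgue_rV R N).
Variables (Om : set E) (oOm : open Om) (Omoo : (mu Om < +oo)%E).
Implicit Types (u v w g h y z : E -> R) (i : 'I_N).
Let mOm : measurable Om := rV_open_measurable oOm.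
Variables (K : R) (K0 : 0 < K).
Hypothesis pK : forall u, H1_0 Om u ->
  \int[mu]_(x in Om) (u x ^+ 2) <= K * dotg Om u u.

(** The closed ball of radius [r] in L^oo(Om), as a set of Borel functions: the complete space on
    which Baire's argument runs. *)
Definition ae_le (r : R) h := measurable_fun Om h /\ {ae mu, forall x, Om x -> `|h x| <= r}.

Lemma ae_le_Lev m r h : ae_le r h -> Lev mu Om m h.
Proof.
move=> [mh hr]; split => //.
apply: (L1_le_ae mOm _ (L1_cst mOm Omoo (`|r| ^+ m.+1.*2))); first exact: measurable_funX.
apply: filterS hr => x hx /hx h1; rewrite normrX; apply: lerXn2r; rewrite ?nnegrE//.
by apply: le_trans h1 _; exact: ler_norm.
Qed.

Lemma I_ae_le r h : ae_le r h -> \int[mu]_(x in Om) (h x ^+ 2) <= r ^+ 2 * fine (mu Om).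
Proof.
move=> hr; have [_ ih] := ae_le_Lev 0 hr; have [mh hh] := hr.
rewrite -Rintegral_cst//; apply: (I_le_ae mOm ih (L1_cst mOm Omoo _)).
apply: filterS hh => x hx /hx h1; rewrite -[1.*2]/2%N -[h x ^+ 2]ger0_norm ?sqr_ge0// normrX.
by apply: lerXn2r; rewrite ?nnegrE// (le_trans _ h1).
Qed.

Lemma ae_le_lin a c r s g h : ae_le r g -> ae_le s h -> ae_le (`|a| * r + `|c| * s) (lin a c g h).
Proof.
move=> [mg hg] [mh hh]; split; first by apply: measurable_funD; exact: measurable_funM.
apply: filterS2 hg hh => x h1 h2 Ox; apply: le_trans (ler_normD _ _) _; rewrite !normrM.
by apply: lerD; rewrite ler_wpM2l ?h1 ?h2.
Qed.

Lemma even_lin_le m (a c x y : R) : (a * x + c * y) ^+ m.+1.*2 <=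
  2 ^+ m.+1.*2.-1 * a ^+ m.+1.*2 * x ^+ m.+1.*2 + 2 ^+ m.+1.*2.-1 * c ^+ m.+1.*2 * y ^+ m.+1.*2.
Proof.
by apply: le_trans (even_exprD_le m _ _) _; rewrite !exprMn mulrDr !mulrA.
Qed.

Lemma wsum_lin_bound k m u v a c : Wev Om k m u -> Wev Om k m v ->
  wsum Om k m (lin a c u v) <= 2 ^+ m.+1.*2.-1 * a ^+ m.+1.*2 * wsum Om k m u +
    2 ^+ m.+1.*2.-1 * c ^+ m.+1.*2 * wsum Om k m v.
Proof. by move=> wu wv; apply: wsum_lin => // x y; exact: even_lin_le. Qed.

Lemma sol_lsc k m (C : R) (g_ y_ : nat -> E -> R) g y : (forall j, Lev mu Om 0 (g_ j)) ->
  Lev mu Om 0 g -> (forall j, sol Om (g_ j) (y_ j)) -> sol Om g y ->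
  (forall j, Wev Om k m (y_ j)) -> (forall j, wsum Om k m (y_ j) <= C) ->
  \int[mu]_(x in Om) (lin 1 (-1) (g_ j) g x ^+ 2) @[j --> \oo] --> 0 ->
  Wev Om k m y /\ wsum Om k m y <= C.
Proof.
move=> lg_ lg s_ s wy hC hg.
have ly_ j : Lev mu Om 0 (y_ j) by have [/(H1_0_Lev oOm Omoo)] := s_ j.
have ly : Lev mu Om 0 y by have [/(H1_0_Lev oOm Omoo)] := s.
have [|t _ hae] := @cvg_Lev_ae _ _ _ mu Om mOm 0 y_ y ly_ ly.
  apply: (@cvg0_le _ _ (fun j => (K + 1) * (2 * K) * \int[mu]_(x in Om) (lin 1 (-1) (g_ j) g x ^+ 2))).
    move=> j; rewrite I_linB I_sqr_ge0 /=; apply: le_trans (wsum_I _ 1 0 _) _.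
    exact: sol_dist.
  by rewrite -[X in _ --> X](mulr0 ((K + 1) * (2 * K))); apply: cvgM => //; exact: cvg_cst.
have [my _] := ly.
exact: (@Wev_lsc _ _ _ oOm Omoo k m (fun j => y_ (t j)) y C).
Qed.

(* Baire category argument: solvability in [W^{2,q}] for every right-hand side in the
   unit ball of [L^oo] is automatically uniform, because the bound is lower
   semicontinuous in the right-hand side. *)
Lemma uniform_regularity k m :
  (forall h z, ae_le 1 h -> sol Om h z -> Wev Om k m z) ->
  exists C, forall h z, ae_le 1 h -> sol Om h z -> wsum Om k m z <= C.
Proof.
move=> reg; apply: contrapT => unb.
have {unb} unb C : exists h z, [/\ ae_le 1 h, sol Om h z & C < wsum Om k m z].
  apply: contrapT => h; apply: unb; exists C => g z hg hz; rewrite leNgt; apply/negP => lt.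
  by apply: h; exists g, z.
(* Data with a large solution are dense: r h + (1 - r) s stays in the unit ball within 2r of [s],
   and if its solution were bounded by [C] the solution for [h] would be bounded too, being a
   combination of it and of the solution [y] for [s]. *)
have near_unb s (r C : R) : ae_le 1 s -> 0 < r <= 1 -> exists g z,
    [/\ ae_le 1 g, ae_le (2 * r) (lin 1 (-1) g s), sol Om g z & C < wsum Om k m z].
  move=> hs /andP[r0 r1]; have ls := ae_le_Lev 0 hs.
  have [y ys] := sol_exists oOm Omoo K0 pK ls.
  pose q := m.+1.*2; pose A := 2 ^+ q.-1 * r^-1 ^+ q; pose D := 2 ^+ q.-1 * (- ((1 - r) / r)) ^+ q.
  have [h [z [hh hz big]]] := unb (A * C + D * wsum Om k m y).
  have lh := ae_le_Lev 0 hh.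
  exists (lin r (1 - r) h s), (lin r (1 - r) z y).
  have sg := sol_lin oOm Omoo r (1 - r) lh ls hz ys.
  have bg : ae_le 1 (lin r (1 - r) h s).
    have := ae_le_lin r (1 - r) hh hs; rewrite !mulr1 !ger0_norm ?subr_ge0 ?(ltW r0)//.
    by rewrite subrKC.
  split => //.
    have := ae_le_lin r (- r) hh hs; rewrite normrN !mulr1 ger0_norm ?(ltW r0)//.
    by congr (ae_le _ _); [ring|apply/funext => x; rewrite /lin; ring].
  rewrite ltNge; apply/negP => le; move: big; apply/negP; rewrite -leNgt.
  have -> : z = lin r^-1 (- ((1 - r) / r)) (lin r (1 - r) z y) y.
    by apply/funext => x; rewrite /lin; field; rewrite gt_eqF.
  apply: le_trans (wsum_lin_bound _ _ (reg _ _ bg sg) (reg _ _ hs ys)) _.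
  rewrite lerD2r ler_wpM2l//.
  by rewrite mulr_ge0// exprn_ge0// invr_ge0 ltW.
(* The superlevel sets are relatively open: otherwise data tending to [g] uniformly would have
   solutions bounded by [C], against lower semicontinuity. *)
have open_unb g z (C : R) : ae_le 1 g -> sol Om g z -> C < wsum Om k m z ->
    exists2 r, 0 < r & forall g' z', ae_le 1 g' -> ae_le r (lin 1 (-1) g' g) -> sol Om g' z' ->
      C < wsum Om k m z'.
  move=> hg hz big; apply: contrapT => no.
  have eps j : 0 < j.+1%:R^-1 :> R by rewrite invr_gt0.
  have /choice[gz hgz] : forall j : nat, exists gz, [/\ ae_le 1 gz.1,
      ae_le j.+1%:R^-1 (lin 1 (-1) gz.1 g), sol Om gz.1 gz.2 & wsum Om k m gz.2 <= C].
    move=> j; apply: contrapT => h; apply: no; exists j.+1%:R^-1 => // g' z' h1 h2 h3.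
    by rewrite ltNge; apply/negP => h4; apply: h; exists (g', z').
  have lg := ae_le_Lev 0 hg.
  have [|||||||_ ] := @sol_lsc k m C (fun j => (gz j).1) (fun j => (gz j).2) g z => //.
  - by move=> j; have [h1 _ _ _] := hgz j; exact: ae_le_Lev h1.
  - by move=> j; have [_ _ h1 _] := hgz j.
  - by move=> j; have [h1 _ h2 _] := hgz j; exact: reg h1 h2.
  - by move=> j; have [_ _ _ h1] := hgz j.
  - apply: (@cvg0_le _ _ (fun j => j.+1%:R^-1 ^+ 2 * fine (mu Om))).
      by move=> j; have [_ h1 _ _] := hgz j; rewrite I_sqr_ge0 I_ae_le.
    rewrite -[X in _ --> X](mul0r (fine (mu Om))); apply: cvgM; last exact: cvg_cst.
    have := @cvgn_exprn R (fun j => j.+1%:R^-1) 0 2; rewrite expr0n; apply.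
    exact: cvg_harmonic.
  - by rewrite leNgt big.
pose ok (gr : (E -> R) * R) := ae_le 1 gr.1 /\ 0 < gr.2 <= 1.
pose st := {gr : (E -> R) * R | ok gr}.
(* A state is a centre and a radius. The centre moves by at most half of the old radius and the new
   radius is at most that half, so the balls are nested; the j-th step forces solutions to exceed
   j. *)
pose Next (C : R) (s t : st) :=
  [/\ ae_le ((sval s).2 / 2) (lin 1 (-1) (sval t).1 (sval s).1), (sval t).2 <= (sval s).2 / 2 &
    forall g z, ae_le 1 g -> ae_le (sval t).2 (lin 1 (-1) g (sval t).1) -> sol Om g z ->
      C < wsum Om k m z].
have /choice[next hnext] : forall Cs : nat * st, exists t, Next Cs.1%:R Cs.2 t.
  move=> [C s']; have [hs /andP[r0 r1]] := svalP s'; rewrite /Next /=.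
  move: (sval s').1 (sval s').2 hs r0 r1 => s r hs r0 r1.
  have [|g [z [hg hgs hz big]]] := near_unb s (r / 4) C%:R hs.
    by rewrite divr_gt0//= ler_pdivrMr// (le_trans r1)// mul1r ler1n.
  have [r' r'0 hr'] := open_unb g z _ hg hz big.
  have okg : ok (g, Num.min r' (r / 2)).
    split => //=; rewrite lt_min r'0 divr_gt0//= ge_min; apply/orP; right.
    by rewrite ler_pdivrMr// (le_trans r1)// mul1r ler1n.
  exists (exist ok _ okg); split => /=.
  - by have := hgs; congr (ae_le _ _); field.
  - by rewrite ge_min lexx orbT.
  - move=> g' z' h1 h2 h3; apply: (hr' g' z') => //; have [mh hh] := h2; split => //.
    by apply: filterS hh => x hx /hx /le_trans; apply; rewrite ge_min lexx.
have zero1 : ok ((cst 0 : E -> R), 1 : R).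
  split=> /=; last by rewrite ltr01 lexx.
  by split => //; apply: aeW => x _; rewrite normr0.
pose s_ := nat_rect (fun=> st) (exist ok _ zero1) (fun j s => next (j, s)).
pose g_ j := (sval (s_ j)).1; pose r_ j := (sval (s_ j)).2.
have B_ j : ae_le 1 (g_ j) by rewrite /g_; have [] := svalP (s_ j).
have r0 j : 0 < r_ j by have [_ /andP[]] := svalP (s_ j).
have rS j : r_ j.+1 <= r_ j / 2 by have [] := hnext (j, s_ j).
have gS j : ae_le (r_ j / 2) (lin 1 (-1) (g_ j.+1) (g_ j)) by have [] := hnext (j, s_ j).
have bigS j g z : ae_le 1 g -> ae_le (r_ j.+1) (lin 1 (-1) g (g_ j.+1)) -> sol Om g z ->
    j%:R < wsum Om k m z by have [_ _] := hnext (j, s_ j); exact.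
have rle j : r_ j <= 2^-1 ^+ j.
  elim: j => [|j ih]; first by rewrite expr0 /r_ /=.
  by apply: le_trans (rS j) _; rewrite exprSr ler_pM2r// invr_gt0.
have aeg : {ae mu, forall x, Om x -> (forall j, `|g_ j.+1 x - g_ j x| <= r_ j / 2) /\
    (forall j, `|g_ j x| <= 1)}.
  have h1 : {ae mu, forall x, forall j, Om x -> `|g_ j.+1 x - g_ j x| <= r_ j / 2}.
    apply: ae_foralln => j; have [_] := gS j; apply: filterS => x hx /hx.
    by rewrite linB.
  have h2 : {ae mu, forall x, forall j, Om x -> `|g_ j x| <= 1}.
    by apply: ae_foralln => j; have [_] := B_ j.
  by apply: filterS2 h1 h2 => x a1 a2 Ox; split => j; [exact: a1|exact: a2].
have inc (x : E) : (forall j, `|g_ j.+1 x - g_ j x| <= r_ j / 2) ->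
    forall j l, `|g_ (j + l)%N x - g_ j x| <= r_ j - r_ (j + l)%N.
  move=> hx j; elim=> [|l ih]; first by rewrite addn0 !subrr normr0.
  rewrite addnS -(subrK (g_ (j + l)%N x) (g_ (j + l).+1 x)) -addrA.
  apply: le_trans (ler_normD _ _) _; have h1 := hx (j + l)%N; have h2 := rS (j + l)%N.
  move: h1 h2 ih; move: `|_| `|_| (r_ _) (r_ _) (r_ _) => a c p q s; lra.
have cvx (x : E) : (forall j, `|g_ j.+1 x - g_ j x| <= r_ j / 2) -> cvgn (g_ ^~ x).
  move=> hx; apply: (@geometric_increments_cvg R _ 1 2^-1).
    by rewrite invr_ge0 ler0n /= invf_lt1// ltr1n.
  move=> j; rewrite mul1r; apply: le_trans (hx j) _; apply: le_trans (rle j).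
  by rewrite ler_pdivrMr// ler_pMr// ler1n.
have [||g mg hg] := @ae_limit _ _ _ mu Om g_.
- by move=> j; have [] := B_ j.
- by apply: filterS aeg => x hx /hx[/cvx].
have Bg : ae_le 1 g.
  split => //; apply: filterS2 aeg hg => x h1 h2 Ox.
  by apply: cvgn_upper (cvg_norm (h2 Ox)) _ => j; have [_] := h1 Ox; apply.
have [z hz] := sol_exists oOm Omoo K0 pK (ae_le_Lev 0 Bg).
have gr j : ae_le (r_ j) (lin 1 (-1) g (g_ j)).
  have [mgj _] := B_ j; split; first by rewrite linB; exact: measurable_funB.
  apply: filterS2 aeg hg => x h1 h2 Ox; rewrite linB.
  have [hx _] := h1 Ox; have := inc x hx j.
  have hc : `|g_ (j + l)%N x - g_ j x| @[l --> \oo] --> `|g x - g_ j x|.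
    apply: cvg_norm; apply: cvgB; last exact: cvg_cst.
    have := h2 Ox; rewrite -(cvg_shiftn j) /=.
    by apply: cvg_trans; apply: near_eq_cvg; apply: nearW => l; rewrite /= addnC.
  move=> hl; apply: cvgn_upper hc _ => l; apply: le_trans (hl l) _.
  by rewrite lerBlDr lerDl ltW.
(* The limit [g] of the centres lies in all the balls, so its solution would exceed every
   integer. *)
have := archi_boundP (wsum_ge0 Om k m z); set j := Num.bound _.
by move=> hj; have := lt_trans (bigS j g z Bg (gr j.+1) hz) hj; rewrite ltxx.
Qed.

End uniform_regularity.

(** x^{-1} = x (x^2)^{-1} reduces the claim to a real power of a nonnegative number; at 0 both sides
    are 0. *)
Lemma measurable_invr (R : realType) : measurable_fun setT (GRing.inv : R -> R).
Proof.
have -> : (GRing.inv : R -> R) = fun x => x * (x ^+ 2) `^ (-1).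
  apply/funext => x; rewrite powR_inv1 ?sqr_ge0//.
  by have [->|x0] := eqVneq x 0; [rewrite invr0 mul0r|field].
apply: measurable_funM => //; apply: (measurableT_comp (measurable_powR _)).
exact: measurable_funX.
Qed.

(** * Stability of the Kirchhoff equation *)

Section kirchhoff.
Context (R : realType) (n : nat).
Local Notation N := n.+1.
Local Notation E := 'rV[R]_N.
Local Notation mu := (lebesgue_rV R N).
Variables (Om : set E) (oOm : open Om) (Omoo : (mu Om < +oo)%E) (bO : bounded_set Om).
Implicit Types (u v w g h y z : E -> R) (i : 'I_N).
Let mOm : measurable Om := rV_open_measurable oOm.
Variables (f : E -> R) (F f0 : R) (hf : ae_le Om F f) (f00 : 0 < f0)
  (ff0 : {ae mu, forall x, Om x -> f0 <= f x}).
Variables (ua : E -> R) (u0 Ua : R) (mua : measurable_fun Om ua) (u00 : 0 < u0) (Ua0 : 0 <= Ua)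
  (hua : forall x, Om x -> u0 <= ua x <= Ua).
Variables (b : E -> R) (B b0 : R) (hb : ae_le Om B b) (b00 : 0 < b0)
  (bb0 : {ae mu, forall x, Om x -> b0 <= b x}).
Variables (S : (E -> R) -> E -> R) (hS : control_to_state Om f b ua S).
Variables (K : R) (K0 : 0 < K).
Hypothesis pK : forall u, H1_0 Om u ->
  \int[mu]_(x in Om) (u x ^+ 2) <= K * dotg Om u u.
Local Notation dotg := (dotg Om).
Local Notation sol := (sol Om).

Definition admissible w := Lev mu Om 0 w /\ {ae mu, forall x, Om x -> ua x <= w x}.

(** The Kirchhoff equation with the energy frozen at [c] is the Poisson problem with this datum. *)
Definition source w (c : R) : E -> R := fun x => f x / (w x + b x * c).

Lemma source_measurable w c : measurable_fun Om w -> measurable_fun Om (source w c).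
Proof.
move=> mw; have [mf _] := hf; have [mb _] := hb.
apply: measurable_funM => //; apply: (measurableT_comp (@measurable_invr R)).
by apply: measurable_funD => //; exact: measurable_funM.
Qed.

Lemma denominator_ge w c : admissible w -> 0 <= c ->
  {ae mu, forall x, Om x -> u0 <= w x + b x * c}.
Proof.
move=> [_ hw] c0; apply: filterS2 hw bb0 => x h1 h2 Ox.
have /andP[h3 _] := hua Ox; rewrite -[u0]addr0; apply: lerD; first exact: le_trans (h1 Ox).
by rewrite mulr_ge0// (le_trans (ltW b00))// h2.
Qed.

Lemma source_bound w c : admissible w -> 0 <= c -> ae_le Om (F / u0) (source w c).
Proof.
move=> aw c0; split; first by apply: source_measurable; have [[]] := aw.
have [_ fF] := hf; apply: filterS2 (denominator_ge aw c0) fF => x h1 h2 Ox.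
have d0 := lt_le_trans u00 (h1 Ox).
rewrite normrM normfV (ger0_norm (ltW d0)); apply: ler_pM; rewrite ?invr_ge0 ?(ltW d0)//.
  exact: h2.
by rewrite lef_pV2 ?posrE// h1.
Qed.

Lemma S_kirchhoff w : admissible w -> kirchhoff_solution Om f b w (S w).
Proof. by move=> [lw hw]; have [] := hS ((LpP mOm 0 w).2 lw) hw. Qed.

Lemma kirchhoff_sol w y : kirchhoff_solution Om f b w y <-> sol (source w (dotg y y)) y.
Proof.
split=> -[hy e]; split => // v hv; have := e v hv; rewrite /dotg => ->.
  by apply: eq_Rintegral => x _; rewrite /source mulrAC.
by apply: eq_Rintegral => x _; rewrite /source mulrAC.
Qed.

Lemma S_unique w y : admissible w -> sol (source w (dotg y y)) y -> y = S w %[ae mu in Om].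
Proof.
move=> [lw hw] /kirchhoff_sol; have [_ h _] := hS ((LpP mOm 0 w).2 lw) hw.
exact: h.
Qed.

Lemma S_Wev m w : admissible w -> Wev Om 2 m (S w).
Proof.
move=> [lw hw]; have [_ _ h] := hS ((LpP mOm 0 w).2 lw) hw.
by apply/(sobolevP oOm); apply: h; rewrite ler1n doubleS.
Qed.

(* Every right-hand side close to a small multiple of [f] is the one of an admissible
   control, so the assumed regularity of [S] is regularity for the Poisson equation. *)
Lemma poisson_regularity m h z : ae_le Om 1 h -> sol h z -> Wev Om 2 m z.
Proof.
have arith (d p q k : R) : 0 < d -> 0 < p -> p <= q -> -1 <= k -> k <= 1 ->
    [/\ 0 < q, 0 < 1 * (3 / 4 * d * q) + d * p / 4 * k,
      1 * (3 / 4 * d * q) + d * p / 4 * k <= d * q &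
      d * q <= 2 * (1 * (3 / 4 * d * q) + d * p / 4 * k)].
  move=> d0 p0 pq k1 k2; have dp : 0 < d * p by rewrite mulr_gt0.
  have h1 : d * p <= d * q by rewrite ler_pM2l.
  have h2 : d * p * k <= d * p by rewrite ler_piMr// ltW.
  have h3 : - (d * p) <= d * p * k by rewrite -[leLHS]mulrN1 ler_wpM2l// ltW.
  by split; lra.
pose C0 := 2 * K * (F ^+ 2 * fine (mu Om)).
have C00 : 0 <= C0.
  by apply: mulr_ge0; [rewrite mulr_ge0// ltW|rewrite mulr_ge0 ?sqr_ge0 ?fine_ge0].
(* [C0] bounds the energy of every solution with datum at most [F], so [D] exceeds ua + b c for all
   energies c that can occur: a datum below f/D comes from a control above ua. *)
pose D := 1 + Ua + `|B| * C0; have D1 : 1 <= D by rewrite /D -addrA lerDl addr_ge0// mulr_ge0.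
have D0 := lt_le_trans ltr01 D1.
pose d := D^-1; have d0 : 0 < d by rewrite invr_gt0.
have d1 : d <= 1 by rewrite invf_le1.
pose eta := d * f0 / 4; have eta0 : 0 < eta by rewrite divr_gt0// mulr_gt0.
(* With |k| <= 1 and eta = d f0/4, the datum h0 + eta k lies between d f/2 and d f: the upper bound
   makes the control admissible, the lower one makes it bounded. *)
pose h0 : E -> R := fun x => 3 / 4 * d * f x.
have [mf fF] := hf; have [mb bB] := hb.
have key (k y : E -> R) : ae_le Om 1 k -> sol (lin 1 eta h0 k) y -> Wev Om 2 m y.
  move=> [mk hk] sy; set g := lin 1 eta h0 k in sy *.
  have mg : measurable_fun Om g.
    by apply: measurable_funD; do ?[apply: measurable_funM => //].
  have gP : {ae mu, forall x, Om x -> [/\ 0 < f x, 0 < g x, g x <= d * f x & d * f x <= 2 * g x]}.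
    apply: filterS2 hk ff0 => x h1 h2 Ox.
    have := h1 Ox; rewrite ler_norml => /andP[a2 a3].
    exact: arith d0 f00 (h2 Ox) a2 a3.
  have gF : ae_le Om F g.
    split => //; apply: filterS2 gP fF => x h1 h2 Ox; have [a1 a2 a3 _] := h1 Ox.
    rewrite gtr0_norm//; apply: le_trans a3 _; apply: le_trans (h2 Ox).
    by rewrite gtr0_norm// ler_piMl// ltW.
  set c := dotg y y; have c0 : 0 <= c := dotg_ge0 Om y.
  have cC : c <= C0.
    have [h1 _] := sol_bound oOm Omoo K0 pK (ae_le_Lev oOm Omoo 0 gF) sy.
    by apply: le_trans h1 _; rewrite ler_pM2l ?mulr_gt0//; exact: I_ae_le.
  (* The equation [source w c = g] solved for [w], with [c] the energy of the given solution. *)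
  pose w x := f x / g x - b x * c.
  have mw : measurable_fun Om w.
    apply: measurable_funB; apply: measurable_funM => //.
    exact: (measurableT_comp (@measurable_invr R)).
  have wb : {ae mu, forall x, Om x -> ua x <= w x /\ `|w x| <= 2 * D + `|B| * C0}.
    apply: filterS2 gP bB => x h1 h2 Ox; have [a1 a2 a3 a4] := h1 Ox.
    have /andP[_ a5] := hua Ox.
    have bc : `|b x * c| <= `|B| * C0.
      rewrite normrM (ger0_norm c0); apply: ler_pM => //.
      exact: le_trans (h2 Ox) (ler_norm _).
    have q1 : D <= f x / g x.
      rewrite ler_pdivlMr//; apply: le_trans (ler_wpM2l (ltW D0) a3) _.
      by rewrite mulrA divff ?mul1r// gt_eqF.
    have q2 : f x / g x <= 2 * D.
      rewrite ler_pdivrMr//; have := ler_wpM2l (ltW D0) a4.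
      by rewrite mulrA divff ?gt_eqF// mul1r => h3; apply: le_trans h3 _; rewrite mulrA [D * 2]mulrC.
    have := bc; rewrite ler_norml => /andP[b1 b2]; split.
      apply: le_trans a5 _; rewrite /w lerBrDr; apply: le_trans q1.
      by rewrite /D -addrA -[leLHS]add0r; apply: lerD => //; exact: lerD.
    apply: le_trans (ler_normB _ _) _; apply: lerD => //.
    by rewrite ger0_norm// (le_trans (ltW D0)).
  have aw : admissible w.
    split; last by apply: filterS wb => x hx /hx[].
    apply: (ae_le_Lev oOm Omoo 0 (r := 2 * D + `|B| * C0)); split => //.
    by apply: filterS wb => x hx /hx[].
  have sw : sol (source w c) y.
    have [hy ey] := sy; split => // v hv; rewrite ey//.
    have [mv _] := H1_0_Lev oOm Omoo hv; have ms := source_measurable c mw.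
    apply: (ae_I mOm); [exact: measurable_funM|exact: measurable_funM|].
    apply: filterS gP => x hx /hx[a1 a2 _ _]; rewrite /source /w subrK.
    by congr (_ * _); field; rewrite !gt_eqF.
  have yS := S_unique aw sw; have [hy _] := sy; have [my _] := H1_0_Lev oOm Omoo hy.
  apply: (proj1 (Wev_ae oOm my _ (S_Wev m aw))).
  by apply: filterS yS => x hx Ox; rewrite hx.
move=> hh hz.
have lh0 : Lev mu Om 0 h0 by apply: LevZ => //; exact: ae_le_Lev hf.
have [y0 sy0] := sol_exists oOm Omoo K0 pK lh0.
have W0 : Wev Om 2 m y0.
  apply: (key (cst 0)); first by split => //; apply: aeW => x _; rewrite normr0.
  by rewrite (_ : lin 1 eta h0 (cst 0) = h0)//; apply/funext => x; rewrite /lin mulr0 mul1r addr0.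
have W1 := key h _ hh (sol_lin oOm Omoo 1 eta lh0 (ae_le_Lev oOm Omoo 0 hh) sy0 hz).
(* [y0] solves the problem with datum h0, so subtracting it isolates eta z. *)
have -> : z = lin eta^-1 (- eta^-1) (lin 1 eta y0 z) y0.
  by apply/funext => x; rewrite /lin; field; rewrite gt_eqF.
exact: Wev_lin.
Qed.

Lemma S_sol w : admissible w -> sol (source w (dotg (S w) (S w))) (S w).
Proof. by move=> aw; apply/kirchhoff_sol; exact: S_kirchhoff. Qed.

Lemma S_source_bound w : admissible w -> ae_le Om (F / u0) (source w (dotg (S w) (S w))).
Proof. by move=> aw; apply: source_bound => //; exact: dotg_ge0. Qed.

(** The source of every state is bounded by F/u0. Divided by [G] it lies in the unit ball, where the
    bound is uniform, and multiplying back costs G^q. *)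
Lemma S_wsum_bound m : exists C, forall w, admissible w -> wsum Om 2 m (S w) <= C.
Proof.
have [C hC] := uniform_regularity oOm Omoo K0 pK (@poisson_regularity m).
pose G := `|F / u0| + 1; have G0 : 0 < G by rewrite ltr_wpDl.
exists (G ^+ m.+1.*2 * C) => w aw.
have ss := S_sol aw; have gb := S_source_bound aw.
set g := source _ _ in ss gb; have lg := ae_le_Lev oOm Omoo 0 gb.
pose h := lin G^-1 0 g g; pose z := lin G^-1 0 (S w) (S w).
have sz : sol h z by exact: sol_lin.
have hh : ae_le Om 1 h.
  have [mg gg] := gb; split; first by apply: measurable_funD; exact: measurable_funM.
  apply: filterS gg => x hx /hx h1; rewrite /h /lin mul0r addr0 normrM ger0_norm ?invr_ge0 ?(ltW G0)//.
  rewrite mulrC ler_pdivrMr// mul1r; apply: le_trans h1 _; apply: le_trans (ler_norm _) _.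
  by rewrite lerDl.
have -> : S w = fun x => G * z x.
  by apply/funext => x; rewrite /z /lin; field; rewrite gt_eqF.
apply: le_trans (wsumZ oOm G (poisson_regularity m hh sz)) _.
rewrite ler_pM2l ?exprn_gt0//; exact: hC sz.
Qed.

Lemma S_energy_bound : exists C, forall w, admissible w ->
  dotg (S w) (S w) <= C /\ \int[mu]_(x in Om) (S w x ^+ 2) <= C.
Proof.
exists ((2 * K) * ((F / u0) ^+ 2 * fine (mu Om)) + (K + 1) * (2 * K) * ((F / u0) ^+ 2 * fine (mu Om))).
move=> w aw; have gb := S_source_bound aw.
have [h1 h2] := sol_bound oOm Omoo K0 pK (ae_le_Lev oOm Omoo 0 gb) (S_sol aw).
have h3 := I_ae_le oOm Omoo gb.
have P0 : 0 <= (F / u0) ^+ 2 * fine (mu Om) by rewrite mulr_ge0 ?sqr_ge0 ?fine_ge0.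
have K2 : 0 <= 2 * K by rewrite mulr_ge0// ltW.
have K3 : 0 <= (K + 1) * (2 * K) by rewrite mulr_ge0// addr_ge0// ltW.
split; first by apply: le_trans h1 (le_trans (ler_wpM2l K2 h3) _); rewrite lerDl mulr_ge0.
apply: le_trans (wsum_I _ 1 0 _) (le_trans h2 (le_trans (ler_wpM2l K3 h3) _)).
by rewrite lerDr mulr_ge0.
Qed.

Lemma S_sup_bound : exists M, forall w, admissible w -> {ae mu, forall x, Om x -> `|S w x| <= M}.
Proof.
have [m hm] := H1_0_sup_bound oOm Omoo bO.
have [C hC] := S_wsum_bound m; have [C2 hC2] := S_energy_bound.
have [M hM] := hm C (Num.sqrt C2 * Num.sqrt (fine (mu Om))); exists M => w aw.
have [hy _] := S_sol aw; have ly := H1_0_Lev oOm Omoo hy.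
have W := S_Wev m aw; have [_ h2] := hC2 w aw.
apply: hM => //.
- by move=> i; have [_ /Wev_Lev] := Wev_partial i W.
- move=> i; apply: le_trans (hC w aw); apply: le_trans (wsum_partial _ _ _ _ i).
  exact: wsum_I.
- apply: le_trans (le_normr_Rintegral mOm (Lev_L1 mOm Omoo ly)) _.
  apply: le_trans (I_norm_le_norm2 mOm Omoo ly) _.
  by rewrite ler_wpM2r ?sqrtr_ge0// ler_wsqrtr.
Qed.

(** The nonlocal coefficient is handled by extracting a limit [c] of the energies. The sources with
    frozen energies converge in L^2, so the states converge in H^1 to the Poisson solution [y] for
    that [c]; strong convergence gives c = |grad y|^2, and uniqueness identifies [y] with the state
    of [w]. *)
Lemma S_stable (w_ : nat -> E -> R) w : (forall j, admissible (w_ j)) -> admissible w ->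
  {ae mu, forall x, Om x -> w_ j x @[j --> \oo] --> w x} ->
  exists2 t, {homo t : i j / (i < j)%N} &
    {ae mu, forall x, Om x -> S (w_ (t j)) x @[j --> \oo] --> S w x}.
Proof.
move=> aw_ aw hw; have [C hC] := S_energy_bound.
have ar1 (p : R) : 2 * p - p + 0 = p by ring.
have ar2 (p q r : R) : 2 * q - r + (1 ^+ 2 * p + 1 * (-1) * q *+ 2 + (-1) ^+ 2 * r) = p by ring.
pose c_ j := dotg (S (w_ j)) (S (w_ j)); have c0_ j : 0 <= c_ j := dotg_ge0 Om _.
have [|t ht /cvg_ex[c hc]] := @bounded_subsequence R c_ C.
  by move=> j; rewrite ger0_norm//; have [] := hC _ (aw_ j).
rewrite /= in hc; have c0 : 0 <= c by apply: (cvgn_lower hc) => j; exact: c0_.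
pose g_ j := source (w_ (t j)) (c_ (t j)); pose g := source w c.
have gb_ j : ae_le Om (F / u0) (g_ j) := S_source_bound (aw_ (t j)).
have gb : ae_le Om (F / u0) g := source_bound aw c0.
have lg_ j := ae_le_Lev oOm Omoo 0 (gb_ j); have lg := ae_le_Lev oOm Omoo 0 gb.
have s_ j : sol (g_ j) (S (w_ (t j))) := S_sol (aw_ (t j)).
have [y sy] := sol_exists oOm Omoo K0 pK lg.
have gae : {ae mu, forall x, Om x -> g_ j x @[j --> \oo] --> g x}.
  apply: filterS2 hw (denominator_ge aw c0) => x h1 h2 Ox.
  have h3 : w_ (t j) x @[j --> \oo] --> w x.
    apply: (almost_subseq_cvg (a := fun j => w_ j x) (s := id)) (h1 Ox).
    by exists 0%N => j _; exists (t j) => //; exact: increasing_leq.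
  apply: cvgM; first exact: cvg_cst.
  apply: cvgV; first by rewrite gt_eqF// (lt_le_trans u00)// h2.
  by apply: cvgD => //; apply: cvgM => //; exact: cvg_cst.
have I0 : \int[mu]_(x in Om) (lin 1 (-1) (g_ j) g x ^+ 2) @[j --> \oo] --> 0.
  have bd j := ae_le_lin (1) (-1) (gb_ j) gb.
  set r := `|1| * _ + _ in bd.
  have [|||||_ h] := @I_dct _ _ _ mu Om mOm (fun j x => lin 1 (-1) (g_ j) g x ^+ 2) (cst 0) (cst (r ^+ 2)).
  - by move=> j; apply: measurable_funX; have [] := bd j.
  - exact: measurable_cst.
  - exact: L1_cst.
  - apply: filterS gae => x hx /hx h1.
    have h2 : lin 1 (-1) (g_ j) g x @[j --> \oo] --> 0.
      rewrite (_ : (fun j => _) = fun j => g_ j x - g x); last by apply/funext => j; rewrite linB.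
      by rewrite -(subrr (g x)); apply: cvgB => //; exact: cvg_cst.
    by have := @cvgn_exprn R _ _ 2 h2; rewrite expr0n.
  - move=> j; have [_ h] := bd j; apply: filterS h => x hx /hx h1.
    by rewrite normrX; apply: lerXn2r; rewrite ?nnegrE// (le_trans _ h1).
  by rewrite Rintegral_cst// mul0r in h.
have d0 : wsum Om 1 0 (lin 1 (-1) (S (w_ (t j))) y) @[j --> \oo] --> 0.
  apply: (@cvg0_le _ _ (fun j => (K + 1) * (2 * K) * \int[mu]_(x in Om) (lin 1 (-1) (g_ j) g x ^+ 2))).
    by move=> j; rewrite wsum_ge0 sol_dist.
  by rewrite -[X in _ --> X](mulr0 ((K + 1) * (2 * K))); apply: cvgM => //; exact: cvg_cst.
have [hy _] := sy; have wy := H1_0_W1 oOm Omoo hy.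
have ws j : Wev Om 1 0 (S (w_ (t j))) by have [/(H1_0_W1 oOm Omoo)] := s_ j.
have dd0 : dotg (lin 1 (-1) (S (w_ (t j))) y) (lin 1 (-1) (S (w_ (t j))) y) @[j --> \oo] --> 0.
  apply: cvg0_le d0 => j; rewrite dotg_ge0 dotg_le_wsum//; exact: Wev_lin.
(* The energy of a state is expanded around [y] into 2 <S, y> - <y, y> + <S - y, S - y> for the
   gradient product. *)
have cy : c = dotg y y.
  apply: cvgn_uniq hc _.
  have h1 : 2 * dotg (S (w_ (t j))) y - dotg y y +
      dotg (lin 1 (-1) (S (w_ (t j))) y) (lin 1 (-1) (S (w_ (t j))) y) @[j --> \oo] -->
      2 * dotg y y - dotg y y + 0.
    apply: cvgD => //; apply: cvgB; last exact: cvg_cst.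
    by apply: cvgM; [exact: cvg_cst|exact: dotg_cvg].
  rewrite -[X in _ --> X]ar1.
  rewrite (_ : (fun j => c_ (t j)) = fun j => 2 * dotg (S (w_ (t j))) y - dotg y y +
      dotg (lin 1 (-1) (S (w_ (t j))) y) (lin 1 (-1) (S (w_ (t j))) y)); first exact: h1.
  by apply/funext => j; rewrite (dotg_lin2 oOm 1 (-1) (ws j) wy) ar2.
have yS : y = S w %[ae mu in Om] by apply: S_unique => //; rewrite -cy.
have [|t2 ht2 hae] := @cvg_Lev_ae _ _ _ mu Om mOm 0 (fun j => S (w_ (t j))) y
  (fun j => Wev_Lev (ws j)) (Wev_Lev wy).
  apply: cvg0_le d0 => j; rewrite I_linB I_sqr_ge0 andTb; exact: wsum_I.
exists (t \o t2); first exact: comp_increasing.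
by apply: filterS2 yS hae => x h1 h2 Ox; rewrite -(h1 Ox); exact: h2.
Qed.

End kirchhoff.

(** * Superposition operators *)

Section ae_integral.
Context d (T : measurableType d) (R : realType) (mu : {measure set T -> \bar R}).
Import HBNNSimple.

(** A simple function below [h], set to zero on the exceptional null set, lies below [k] and keeps
    its integral. *)
Lemma ge0_ae_le_integralT (h k : T -> \bar R) : (forall x, 0 <= h x)%E -> (forall x, 0 <= k x)%E ->
  {ae mu, forall x, (h x <= k x)%E} -> (\int[mu]_x h x <= \int[mu]_x k x)%E.
Proof.
move=> h0 k0 [A [mA A0 hA]]; rewrite !ge0_integralTE//=.
apply: ge_ereal_sup => _ [s /= hs] <-.
have mAc : measurable (~` A) by exact: measurableC.
pose s' := mul_nnsfun s (indic_nnsfun R mAc).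
have sE (r : {nnsfun T >-> R}) : sintegral mu r = (\int[mu]_x (r x)%:E)%E.
  by rewrite integral_nnsfun// patch_setT.
have -> : sintegral mu s = sintegral mu s'.
  rewrite !sE; apply: ge0_ae_eq_integral => //.
  - by apply/measurable_EFinP; exact: measurable_funP.
  - by apply/measurable_EFinP; exact: measurable_funP.
  - by move=> x _; rewrite lee_fin; exact: fun_ge0.
  - by move=> x _; rewrite lee_fin; exact: fun_ge0.
  exists A; split => // x /= nx; apply: contrapT => Ax; apply: nx => _.
  by rewrite /s' /= mindicE mem_set// mulr1.
apply: ereal_sup_ubound; exists s' => //= x; rewrite mindicE.
have [/set_mem Ax|Ax] := boolP (x \in ~` A); last by rewrite mulr0.
rewrite mulr1; apply: le_trans (hs x) _; apply: contrapT => nle; apply: Ax; exact: hA.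
Qed.

(* No measurability is needed: the integral of the library is a supremum over simple functions. *)
Lemma ae_eq_Rintegral (D : set T) (g1 g2 : T -> R) : g1 = g2 %[ae mu in D] ->
  \int[mu]_(x in D) g1 x = \int[mu]_(x in D) g2 x.
Proof.
move=> g12; have eqT (h k : T -> \bar R) : (forall x, 0 <= h x)%E -> (forall x, 0 <= k x)%E ->
    {ae mu, forall x, h x = k x} -> (\int[mu]_x h x = \int[mu]_x k x)%E.
  move=> h0 k0 hk; apply/eqP; rewrite eq_le.
  by rewrite !ge0_ae_le_integralT//; apply: filterS hk => x ->.
rewrite /Rintegral integral_mkcond [in RHS]integral_mkcond integralE [in RHS]integralE.
congr (fine (_ - _)%E); apply: eqT => //.
  by apply: filterS g12 => x h; rewrite !funeposE !patchE; case: ifPn => // /set_mem/h ->.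
by apply: filterS g12 => x h; rewrite !funenegE !patchE; case: ifPn => // /set_mem/h ->.
Qed.

End ae_integral.

Lemma derivative_bound (R : realType) (g : R -> R) (M A : R) : (forall t : R, derivable g t 1) ->
  (forall t, `|t| <= M -> `|derive1 g t| <= A) ->
  forall t, `|t| <= M -> `|g t| <= `|g 0| + A * M.
Proof.
move=> dg hA t tM; have M0 : 0 <= M := le_trans (normr_ge0 _) tM.
have A0 : 0 <= A by apply: le_trans (hA 0 _); rewrite ?normr0.
have ds (x : R) : is_derive x 1 g (derive1 g x) by rewrite derive1E; split.
have cg : continuous g by move=> x; apply: differentiable_continuous; apply/derivable1_diffP.
have key (a c : R) : a < c -> `|a| <= M -> `|c| <= M -> `|g c - g a| <= A * `|c - a|.
  move=> ac aM cM; have [z zac ->] := MVT ac (fun x _ => ds x) (continuous_subspaceT cg).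
  rewrite normrM ler_wpM2r//; apply: hA; move: zac; rewrite in_itv /= => /andP[z1 z2].
  rewrite ler_norml; move: aM cM; rewrite !ler_norml => /andP[a1 _] /andP[_ c2].
  by rewrite (le_trans a1 (ltW z1)) (le_trans (ltW z2) c2).
have : `|g t - g 0| <= A * `|t|.
  have [t0|t0|->] := ltgtP t 0; last by rewrite subrr !normr0 mulr0.
    by have := key _ _ t0 tM; rewrite normr0 sub0r normrN distrC; apply.
  by have := key _ _ t0; rewrite normr0 subr0; apply.
move=> h; rewrite -(subrK (g 0) (g t)) addrC; apply: le_trans (ler_normD _ _) _.
by rewrite lerD2l (le_trans h)// ler_wpM2l.
Qed.

Section superposition.
Context (R : realType) (N : nat).
Local Notation E := 'rV[R]_N.
Local Notation mu := (lebesgue_rV R N).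
Variables (Om : set E) (mOm : measurable Om) (Omoo : (mu Om < +oo)%E).
Variables (phi : E -> R -> R) (hphi : nonlinearity Om phi).
Implicit Types y : E -> R.

Lemma phi_continuous : {ae mu, forall x, Om x -> continuous (phi x)}.
Proof.
have [_ h _ _] := hphi; apply: filterS h => x h Ox; have [h1 _] := h Ox.
by move=> t; apply: differentiable_continuous; apply/derivable1_diffP; exact: (h1 0%N).
Qed.

(** The local Lipschitz condition and the value at 0 bound the second derivative on [-M, M]; two
    applications of the mean value theorem give the rest. *)
Lemma phi_bound (M : R) : 0 < M -> exists C, {ae mu, forall x, Om x ->
  forall t, `|t| <= M -> `|phi x t| <= C}.
Proof.
move=> M0; have [_ hd [K K0 hK] hL] := hphi; have [L L0 hLM] := hL M M0.
pose A := K + L * M; pose A1 := K + A * M; exists (K + A1 * M).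
have k0 := hK 0%N isT; have k1 := hK 1%N isT; have k2 := hK 2%N isT.
apply: filterS2 hd (filterI k0 (filterI k1 (filterI k2 hLM))) => x h [h0 [h1 [h2 h3]]] Ox.
have [hder _] := h Ox; have {}h0 := h0 Ox; have {}h1 := h1 Ox; have {}h2 := h2 Ox.
have {}h3 := h3 Ox; have d0 t := hder 0%N t isT; have d1 t := hder 1%N t isT.
have b2 t : `|t| <= M -> `|derive1 (derive1 (phi x)) t| <= A.
  move=> tM; have := h3 t 0 tM; rewrite normr0 subr0 => /(_ (ltW M0)) h4.
  rewrite -[derive1 _ t](subrK (derive1 (derive1 (phi x)) 0)) addrC.
  apply: le_trans (ler_normD _ _) _; apply: lerD => //.
  by apply: le_trans h4 _; rewrite ler_pM2l.
have b1 t : `|t| <= M -> `|derive1 (phi x) t| <= A1.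
  by move=> tM; apply: le_trans (derivative_bound d1 b2 tM) _; rewrite lerD2r.
by move=> t tM; apply: le_trans (derivative_bound d0 b1 tM) _; rewrite lerD2r.
Qed.

(** Caratheodory's argument: [y] is rounded down to multiples of 1/(j+1). At countably many fixed
    arguments [phi] may be replaced by Borel representatives off one null set, and continuity in the
    second argument gives the limit. *)
Lemma phi_Lebesgue_measurable y : measurable_fun Om y ->
  Lebesgue_measurable_fun Om (fun x => phi x (y x)).
Proof.
move=> my; have [hm _ _ _] := hphi.
have /choice[psi hpsi] : forall t, exists g, measurable_fun Om g /\ phi^~ t = g %[ae mu in Om].
  by move=> t; have [g mg hg] := hm t; exists g.
pose q (j : nat) (i : int) : R := i%:~R / j.+1%:R.
pose fl (j : nat) x : int := Num.floor (j.+1%:R * y x).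
have flP j x i : (fl j x == i) = (i%:~R <= j.+1%:R * y x < (i + 1)%:~R).
  by apply/eqP/idP => [<-|/floor_def//]; exact: floor_itv.
pose h_ j x := psi (q j (fl j x)) x.
have mh j : measurable_fun Om (h_ j).
  move=> _ Y mY.
  have -> : Om `&` h_ j @^-1` Y = \bigcup_k (if unpickle k is Some i then
      (Om `&` [set x | fl j x == i]) `&` (Om `&` psi (q j i) @^-1` Y) else set0).
    apply/seteqP; split => [x [Ox Yx]|x [k _]].
      exists (pickle (fl j x)); first exact: I.
      by rewrite pickleK; split; split; [exact: Ox|exact: eqxx|exact: Ox|exact: Yx].
    by case: unpickle => [i [[Ox /eqP fx] [_ Yx]]|//]; split => //; rewrite /preimage/= /h_ fx.
  apply: bigcupT_measurable => k; case: unpickle => [i|]; last exact: measurable0.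
  apply: measurableI; last by have [mp _] := hpsi (q j i); exact: mp.
  have mz : measurable_fun Om (fun x => j.+1%:R * y x) by exact: measurable_funM.
  have := mz mOm `[i%:~R, (i + 1)%:~R[%classic (measurable_itv _).
  by congr (measurable (_ `&` _)); apply/seteqP; split => x /=; rewrite flP in_itv.
have aeq : {ae mu, forall x, Om x -> forall j, h_ j x = phi x (q j (fl j x))}.
  have : {ae mu, forall x, forall k j, Om x ->
      if unpickle k is Some i then phi x (q j i) = psi (q j i) x else True}.
    apply: ae_foralln => k; apply: ae_foralln => j; case: unpickle => [i|]; last exact: aeW.
    by have [_] := hpsi (q j i).
  by apply: filterS => x hx Ox j; have := hx (pickle (fl j x)) j Ox; rewrite pickleK => e; rewrite e.
have hc : {ae mu, forall x, Om x -> h_ j x @[j --> \oo] --> phi x (y x)}.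
  apply: filterS2 aeq phi_continuous => x h1 h2 Ox.
  rewrite (_ : (fun j => h_ j x) = fun j => phi x (q j (fl j x))); last first.
    by apply/funext => j; exact: h1.
  have cq : q j (fl j x) @[j --> \oo] --> y x.
    apply/cvgn_leP => e e0; have := @cvg_harmonic R => /cvgn_leP/(_ _ e0)[n0 hn].
    exists n0 => j /hn; rewrite subr0 ger0_norm ?invr_ge0// => hj.
    have /idP := eqxx (fl j x); rewrite flP intrD => /andP[f1 f2].
    have j0 : 0 < j.+1%:R :> R by [].
    have e1 : y x - j.+1%:R^-1 <= q j (fl j x).
      by rewrite /q ler_pdivlMr// mulrBl mulVf ?gt_eqF// [y x * _]mulrC lerBlDr ltW.
    have e2 : q j (fl j x) <= y x by rewrite /q ler_pdivrMr// mulrC.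
    rewrite ler_norml; apply/andP; split.
      by rewrite lerBrDr addrC; apply: le_trans e1; rewrite lerD2l lerN2.
    by apply: le_trans (ltW e0); rewrite subr_le0.
  by apply: continuous_cvg cq; exact: (h2 Ox (y x)).
have [||g mg hg] := @ae_limit _ _ _ mu Om h_ => //.
  by apply: filterS hc => x h Ox; apply/cvg_ex; exists (phi x (y x)); exact: h.
exists g => //; apply: filterS2 hc hg => x h1 h2 Ox.
exact: cvgn_uniq (h1 Ox) (h2 Ox).
Qed.

Lemma I_phi_cvg (M : R) (y_ : nat -> E -> R) y : (forall j, ae_le Om M (y_ j)) -> ae_le Om M y ->
  {ae mu, forall x, Om x -> y_ j x @[j --> \oo] --> y x} ->
  \int[mu]_(x in Om) phi x (y_ j x) @[j --> \oo] --> \int[mu]_(x in Om) phi x (y x).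
Proof.
move=> hy_ hy hc; pose M' := `|M| + 1; have M'0 : 0 < M' by rewrite ltr_wpDl.
have MM' : M <= M' by rewrite (le_trans (ler_norm M))// lerDl.
have [C hC] := phi_bound M'0.
have /choice[p hp] : forall j, exists g, measurable_fun Om g /\ (fun x => phi x (y_ j x)) = g %[ae mu in Om].
  by move=> j; have [my _] := hy_ j; have [g mg hg] := phi_Lebesgue_measurable my; exists g.
have [my _] := hy; have [g mg hg] := phi_Lebesgue_measurable my.
rewrite (ae_eq_Rintegral hg); under eq_fun => j do rewrite (ae_eq_Rintegral (hp j).2).
have [|||||_ //] := @I_dct _ _ _ mu Om mOm p g (cst C).
- by move=> j; have [] := hp j.
- by [].
- exact: L1_cst.
- have h1 : {ae mu, forall x, forall j, Om x -> phi x (y_ j x) = p j x}.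
    by apply: ae_foralln => j; have [] := hp j.
  apply: filterS2 (filterI h1 hg) (filterI hc phi_continuous) => x [e1 e2] [c1 c2] Ox.
  rewrite -e2//; rewrite (_ : (fun j => p j x) = fun j => phi x (y_ j x)); last first.
    by apply/funext => j; rewrite e1.
  by apply: continuous_cvg (c1 Ox); exact: (c2 Ox (y x)).
- move=> j; have [_ e1] := hp j; have [_ e2] := hy_ j.
  apply: filterS2 (filterI e1 e2) hC => x [a1 a2] a3 Ox; rewrite -a1//.
  by apply: a3 => //; exact: le_trans (a2 Ox) MM'.
Qed.

Lemma I_phi_bound (M : R) : exists C, forall y, ae_le Om M y ->
  `|\int[mu]_(x in Om) phi x (y x)| <= C.
Proof.
pose M' := `|M| + 1; have M'0 : 0 < M' by rewrite ltr_wpDl.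
have MM' : M <= M' by rewrite (le_trans (ler_norm M))// lerDl.
have [C hC] := phi_bound M'0; exists (C * fine (mu Om)) => y [my hy].
have [g mg hg] := phi_Lebesgue_measurable my; rewrite (ae_eq_Rintegral hg).
have gC : {ae mu, forall x, Om x -> `|g x| <= C}.
  apply: filterS2 (filterI hg hy) hC => x [a1 a2] a3 Ox; rewrite -a1//.
  by apply: a3 => //; exact: le_trans (a2 Ox) MM'.
have ig : mu.-integrable Om (EFin \o g) by exact: L1_le_ae mg (L1_cst mOm Omoo C) gC.
apply: le_trans (le_normr_Rintegral mOm ig) _; rewrite -(Rintegral_cst mu mOm).
by apply: (I_le_ae mOm (L1_norm ig) (L1_cst mOm Omoo C)).
Qed.

End superposition.

Lemma ae_cvg_subseq d (T : measurableType d) (R : realType) (mu : {measure set T -> \bar R})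
    (D : set T) (s : nat -> nat) (a_ : nat -> T -> R) (a : T -> R) :
  {homo s : i j / (i < j)%N} -> {ae mu, forall x, D x -> a_ j x @[j --> \oo] --> a x} ->
  {ae mu, forall x, D x -> a_ (s j) x @[j --> \oo] --> a x}.
Proof.
move=> hs; apply: filterS => x h Dx.
apply: (almost_subseq_cvg (a := fun j => a_ j x) (s := id)) (h Dx).
by exists 0%N => j _; exists (s j) => //; exact: increasing_leq.
Qed.

(** * Weak convergence *)

Section weak_convergence.
Context (R : realType) (N : nat).
Local Notation E := 'rV[R]_N.
Local Notation mu := (lebesgue_rV R N).
Variables (Om : set E) (oOm : open Om) (Omoo : (mu Om < +oo)%E).
Implicit Types (u v y : E -> R) (k m : nat).
Let mOm : measurable Om := rV_open_measurable oOm.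

Lemma Lev_Lp m p u : 1 <= p <= (m.+1.*2)%:R -> Lev mu Om m u -> Lp Om p%:E u.
Proof.
move=> pq lu; have /andP[p1 _] := pq; have p0 := lt_le_trans ltr01 p1.
have [iu _] := Lev_powR mOm Omoo lu pq ltr01; have [mfu _] := lu.
apply/andP; split; rewrite inE /=; first exact: ((measurable_restrictT u mOm).1 mfu).
rewrite /finite_norm unlock; apply: poweR_lty.
have -> : (\int[mu]_x `|(EFin \o u \_ Om) x| `^ p)%E =
    (\int[mu]_(x in Om) (`|u x| `^ p))%:E; last exact: ltry.
rewrite (I_EFin mOm iu) [RHS]integral_mkcond; apply: eq_integral => x _.
rewrite /= !patchE; case: ifP => // _; rewrite normr0 powR0 ?gt_eqF//.
Qed.

Lemma Wev_sobolev k m p u : 1 <= p <= (m.+1.*2)%:R -> Wev Om k m u -> sobolev Om k p%:E u.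
Proof.
move=> pq; elim: k u => [|k ih] u [lu hk] /=; split => //; try exact: Lev_Lp lu.
by move=> i; have [h1 h2] := hk i; exists (wpartial Om i u) => //; exact: ih.
Qed.

Lemma wsum_limit_ae k m (z : nat -> E -> R) u v : (forall n, Wev Om k m (z n)) ->
  Wev Om k m v -> measurable_fun Om u -> v = u %[ae mu in Om] ->
  wsum Om k m (lin 1 (-1) (z n) v) @[n --> \oo] --> 0 ->
  wsum Om k m (lin 1 (-1) (z n) u) @[n --> \oo] --> 0.
Proof.
move=> wz wv mfu vu hc.
rewrite (_ : (fun n => _) = fun n => wsum Om k m (lin 1 (-1) (z n) v))//.
apply/funext => n; apply/esym; have [mz _] := Wev_Lev (wz n).
apply: (proj2 (Wev_ae oOm _ _ (Wev_lin oOm 1 (-1) (wz n) wv))).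
  by apply: measurable_funD; exact: measurable_funM.
by apply: filterS vu => x h Ox; rewrite /lin h.
Qed.

Section mazur.
Variables (m : nat) (p : R) (pq : 1 <= p <= (m.+1.*2)%:R) (C : R).
Variables (y_ u_ : nat -> E -> R) (y u : E -> R).
Hypotheses (wy_ : forall j, Wev Om 2 m (y_ j)) (hy_ : forall j, wsum Om 2 m (y_ j) <= C).
Hypotheses (wu_ : forall j, Wev Om 1 0 (u_ j)) (hu_ : forall j, wsum Om 1 0 (u_ j) <= C).
Hypotheses (wy : Wev Om 2 m y) (wu : Wev Om 1 0 u).
Hypothesis cy : {ae mu, forall x, Om x -> y_ j x @[j --> \oo] --> y x}.
Hypothesis cu : {ae mu, forall x, Om x -> u_ j x @[j --> \oo] --> u x}.

Local Notation V := ((E -> R) * (E -> R))%type.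
Let X : set V := [set yu | sobolev Om 2 p%:E yu.1 /\ H1 Om yu.2].
(** The subspace of [X] with an even exponent q >= p, where Clarkson's inequality is available.
    Midpoints are formed in it, and distances are then measured in [X]. *)
Let X0 : set V := [set yu | Wev Om 2 m yu.1 /\ Wev Om 1 0 yu.2].
Let nrm (yu : V) : R := sobolev_norm Om 2 p%:E yu.1 + Num.sqrt (H1_norm2 Om yu.2).

Let X0X (v : V) : X0 v -> X v.
Proof. by move=> [w1 w2]; split; [exact: Wev_sobolev w1|exact/(H1P oOm)]. Qed.

Let X0mid (a b : V) : X0 a -> X0 b -> X0 (2^-1 *: (a + b)).
Proof.
move=> [a1 a2] [b1 b2]; split.
  by rewrite [X in Wev _ _ _ X](lin_midE a.1 b.1); exact: Wev_lin.
by rewrite [X in Wev _ _ _ X](lin_midE a.2 b.2); exact: Wev_lin.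
Qed.

Let X0half (a : V) : X0 a -> X0 (2^-1 *: a).
Proof.
have E v : 2^-1 *: v = lin 2^-1 0 v v :> (E -> R).
  by apply/funext => x; rewrite /lin mul0r addr0.
move=> [a1 a2]; split.
  by rewrite [X in Wev _ _ _ X](E a.1); exact: Wev_lin.
by rewrite [X in Wev _ _ _ X](E a.2); exact: Wev_lin.
Qed.

(** A Mazur-type statement along an arbitrary subsequence. [Phi] adds the two [wsum], so that the
    same iterated midpoints work for states and controls at once. *)
Lemma mazur_strong (s : nat -> nat) : {homo s : i j / (i < j)%N} ->
  forall e, 0 < e -> exists n z, [/\ @tail_hull R (V : lmodType R) (fun j => (y_ (s j), u_ (s j))) n z,
    X0 z, X0 (z - (y, u)) & nrm (z - (y, u)) <= e].
Proof.
move=> hs e e0; pose v_ j : V := (y_ (s j), u_ (s j)).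
pose Phi (v : V) := wsum Om 2 m v.1 + wsum Om 1 0 v.2.
have ar (a b c d A B C1 D : R) : a + b <= (A + B) / 2 -> c + d <= (C1 + D) / 2 ->
  (a + c) + (b + d) <= ((A + C1) + (B + D)) / 2 by lra.
have PhiB (a b : V) : Phi (2^-1 *: (a - b)) =
    wsum Om 2 m (lin 2^-1 (- 2^-1) a.1 b.1) + wsum Om 1 0 (lin 2^-1 (- 2^-1) a.2 b.2).
  by rewrite -!lin_midB.
have PhiD (a b : V) : Phi (2^-1 *: (a + b)) =
    wsum Om 2 m (lin 2^-1 2^-1 a.1 b.1) + wsum Om 1 0 (lin 2^-1 2^-1 a.2 b.2).
  by rewrite -!lin_midE.
have [||a b [a1 a2] [b1 b2]|||z hz hc] := @cauchy_tail_hull R (V : lmodType R) X0 Phi v_ (C + C).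
- exact: X0mid.
- by move=> a; rewrite addr_ge0// wsum_ge0.
- rewrite (PhiD a b) (PhiB a b).
  exact: ar (wsum_clarkson oOm a1 b1) (wsum_clarkson oOm a2 b2).
- by move=> j; split; [exact: wy_|exact: wu_].
- by move=> j; apply: lerD; [exact: hy_|exact: hu_].
have wz j : X0 (z j).
  by apply: (hz j X0) => [a b|i _]; [exact: X0mid|split; [exact: wy_|exact: wu_]].
have cau k m' (w : nat -> E -> R) : (forall j, Wev Om k m' (w j)) ->
    (forall e : R, 0 < e -> exists n0, forall i j, (n0 <= i)%N -> (n0 <= j)%N ->
      wsum Om k m' (lin 2^-1 (- 2^-1) (w i) (w j)) <= e) ->
    exists2 v, Wev Om k m' v & wsum Om k m' (lin 1 (-1) (w j) v) @[j --> \oo] --> 0.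
  move=> ww h; apply: Wev_complete => // d d0.
  have d1 : 0 < d / 2 ^+ m'.+1.*2 by rewrite divr_gt0// exprn_gt0.
  have [n0 hn] := h _ d1; exists n0 => i j i0 j0; have := hn i j i0 j0.
  rewrite ler_pdivlMr ?exprn_gt0// mulrC; apply: le_trans; exact: wsum_double.
have [||y' wy' hy'] := @cau 2%N m (fun j => (z j).1).
- by move=> j; have [] := wz j.
- move=> d /hc[n0 hn]; exists n0 => i j i0 j0; apply: le_trans (hn i j i0 j0).
  by rewrite (PhiB (z i) (z j)) lerDl wsum_ge0.
have [||u' wu' hu'] := @cau 1%N 0%N (fun j => (z j).2).
- by move=> j; have [] := wz j.
- move=> d /hc[n0 hn]; exists n0 => i j i0 j0; apply: le_trans (hn i j i0 j0).
  by rewrite (PhiB (z i) (z j)) lerDr wsum_ge0.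
have hz1 j : @tail_hull R (E -> R : lmodType R) (fun j => y_ (s j)) j (z j).1.
  move=> D hD hDk; apply: (hz j [set v : V | D v.1]) => [a b|i]; first exact: hD.
  exact: hDk.
have hz2 j : @tail_hull R (E -> R : lmodType R) (fun j => u_ (s j)) j (z j).2.
  move=> D hD hDk; apply: (hz j [set v : V | D v.2]) => [a b|i]; first exact: hD.
  exact: hDk.
have yy := hull_limit_ae oOm hz1 (fun j => (wz j).1) wy' hy' (ae_cvg_subseq hs cy).
have uu := hull_limit_ae oOm hz2 (fun j => (wz j).2) wu' hu' (ae_cvg_subseq hs cu).
have [my _] := Wev_Lev wy; have [mfu _] := Wev_Lev wu.
have {hy'} hy := wsum_limit_ae (fun j => (wz j).1) wy' my yy hy'.
have {hu'} hu := wsum_limit_ae (fun j => (wz j).2) wu' mfu uu hu'.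
have e2 : 0 < e / 2 by rewrite divr_gt0.
have [de de0 hde] := sobolev_norm_small oOm Omoo 2%N pq e2.
move/cvgn_leP : hy => /(_ _ de0)[n1 hn1]; move/cvgn_leP : hu => /(_ _ (exprn_gt0 2 e2))[n2 hn2].
pose j := maxn n1 n2; exists j, (z j); have [w1 w2] := wz j.
have E1 : (z j - (y, u)).1 = lin 1 (-1) (z j).1 y by rewrite linB.
have E2 : (z j - (y, u)).2 = lin 1 (-1) (z j).2 u by rewrite linB.
have W1 := Wev_lin oOm 1 (-1) w1 wy; have W2 := Wev_lin oOm 1 (-1) w2 wu.
split; [exact: hz|exact: wz|split; [rewrite E1; exact: W1|rewrite E2; exact: W2]|].
rewrite /nrm E1 E2 [leRHS]splitr; apply: lerD.
  apply: hde => //; apply: le_trans (hn1 j (leq_maxl _ _)).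
  by rewrite subr0 ler_norm.
rewrite (H1_norm2E oOm W2) -[leRHS]ger0_norm ?(ltW e2)// -sqrtr_sqr; apply: ler_wsqrtr.
by apply: le_trans (hn2 j (leq_maxr _ _)); rewrite subr0 ler_norm.
Qed.

(** If F(y_j, u_j) >= F(y, u) + e infinitely often, the half-space F >= F(y, u) + e is
    midpoint-closed and contains all iterated midpoints of that subsequence, some of which are close
    to (y, u) in norm. The argument is used for F and for -F. *)
Lemma weak_cvg_ae : weak_cvg X nrm (fun j => (y_ j, u_ j)) (y, u).
Proof.
have X0v j : X0 (y_ j, u_ j) by split; [exact: wy_|exact: wu_].
have X0yu : X0 (y, u) by split.
have ar (a b c d : R) : b = 2^-1 * b + c -> d <= a -> d <= b -> d <= 2^-1 * a + c by lra.
have ar3 (a b e : R) : - a < - b + e -> - e <= a - b by lra.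
have ar4 (a b e : R) : a < b + e -> a - b <= e by lra.
have ar2 (a b e : R) : 0 < e -> b + e <= a -> e / 2 < a - b by lra.
have arith (q e : R) : 0 <= q -> 0 < e -> q * (e / (2 * (q + 1))) <= e / 2.
  move=> q0 e0; have q1 : 0 < 2 * (q + 1) by rewrite mulr_gt0// ltr_wpDl.
  by rewrite mulrA ler_pdivrMr//; lra.
have key (F : V -> R) : (forall a x z, X x -> X z -> F (a *: x + z) = a * F x + F z) ->
    (exists C, forall x, X x -> `|F x| <= C * nrm x) ->
    forall e, 0 < e -> exists n0, forall j, (n0 <= j)%N -> F (y_ j, u_ j) < F (y, u) + e.
  move=> linF [D hD] e e0; apply: contrapT => no.
  have [s [hs sP]] : exists s, {homo s : i j / (i < j)%N} /\
      forall k, F (y, u) + e <= F (y_ (s k), u_ (s k)).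
    apply: (increasing_choice_frequent (P := fun k => F (y, u) + e <= F (y_ k, u_ k))) => n0.
    apply: contrapT => h; apply: no; exists n0 => j j0; rewrite ltNge; apply/negP => le.
    by apply: h; exists j.
  have e1 : 0 < e / (2 * (`|D| + 1)) by rewrite divr_gt0// mulr_gt0// ltr_wpDl.
  have [n [z [hz wz wd hn]]] := mazur_strong hs e1.
  have Fz : F (y, u) + e <= F z.
    have [|i _|//] := hz [set w | X0 w /\ F (y, u) + e <= F w].
      move=> a b [Xa Fa] [Xb Fb]; split; first exact: X0mid.
      (* Homogeneity extracted from the single linearity law by writing b as 2^{-1} b + 2^{-1} b. *)
      have h1 : F b = 2^-1 * F b + F (2^-1 *: b).
        rewrite -[in LHS](scale1r b) [in LHS](splitr 1) scalerDl mul1r.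
        exact: (linF 2^-1 b (2^-1 *: b) (X0X Xb) (X0X (X0half Xb))).
      rewrite scalerDr (linF 2^-1 a (2^-1 *: b) (X0X Xa) (X0X (X0half Xb))).
      exact: ar h1 Fa Fb.
    by split; [exact: X0v|exact: sP].
  have Fd : F (z - (y, u)) = F z - F (y, u).
    have -> : z - (y, u) = (-1) *: (y, u) + z by rewrite scaleN1r addrC.
    by rewrite (linF (-1) (y, u) z (X0X X0yu) (X0X wz)) mulN1r addrC.
  have := hD _ (X0X wd); rewrite Fd => h.
  have h1 : F z - F (y, u) <= `|D| * (e / (2 * (`|D| + 1))).
    apply: le_trans (ler_norm _) (le_trans h _); apply: le_trans (_ : `|D| * nrm (z - (y, u)) <= _).
      rewrite ler_wpM2r ?ler_norm// addr_ge0 ?sqrtr_ge0//.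
      have : forall k w, 0 <= sobolev_norm Om k p%:E w.
        elim=> [|k ih] w /=; rewrite addr_ge0 ?fine_ge0 ?Lnorm_ge0//.
        by apply: sumr_ge0 => i _; exact: ih.
      exact.
    by rewrite ler_wpM2l.
  have h2 : `|D| * (e / (2 * (`|D| + 1))) <= e / 2.
    exact: arith.
  by have := le_trans h1 h2; apply/negP; rewrite -ltNge; exact: ar2 e0 Fz.
move=> /= ; split => [j||F linF bF]; [exact: X0X|exact: X0X|].
have negF : forall a x z, X x -> X z -> - F (a *: x + z) = a * - F x + - F z.
  by move=> a x z Xx Xz; rewrite linF// opprD mulrN.
have [D hD] := bF.
have bN : exists C, forall x, X x -> `|- F x| <= C * nrm x.
  by exists D => x Xx; rewrite normrN; exact: hD.
apply/cvgn_leP => e e0; have [n1 h1] := key F linF bF e e0.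
have [n2 h2] := key (fun x => - F x) negF bN e e0.
exists (maxn n1 n2) => j; rewrite geq_max => /andP[/h1 a1 /h2 a2].
by rewrite ler_norml; apply/andP; split; [exact: ar3 a2|exact: ar4 a1].
Qed.

End mazur.

End weak_convergence.

Section compactness_tools.
Context (R : realType).

Lemma I_fatou_lim d (T : measurableType d) (mu : {measure set T -> \bar R}) (D : set T)
    (mD : measurable D) (f_ : nat -> T -> R) (f : T -> R) (a : nat -> R) (P : R) :
  (forall n, mu.-integrable D (EFin \o f_ n)) -> (forall n x, D x -> 0 <= f_ n x) ->
  measurable_fun D f -> {ae mu, forall x, D x -> f_ n x @[n --> \oo] --> f x} ->
  (forall n, \int[mu]_(x in D) f_ n x <= a n) -> a n @[n --> \oo] --> P ->
  \int[mu]_(x in D) f x <= P.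
Proof.
move=> if_ f0 mf cf ha /cvgn_leP aP; apply/ler_addgt0Pr => e e0.
have [n0 hn] := aP _ e0.
have cf' : {ae mu, forall x, D x -> f_ (n + n0)%N x @[n --> \oo] --> f x}.
  by apply: filterS cf => x h Dx; have := h Dx; rewrite -(cvg_shiftn n0).
have [|//|//|//|n|_ //] := @I_fatou _ _ _ mu D mD (fun n => f_ (n + n0)%N) f (P + e).
- by move=> n; exact: if_.
- by move=> n x Dx; exact: f0.
apply: le_trans (ha _) _; have := hn (n + n0)%N (leq_addl _ _).
by rewrite ler_norml => /andP[_]; rewrite lerBlDl.
Qed.

(** The limit [L] of the squared norms is part of the conclusion, since strong convergence is not
    claimed: the cost along the sequence tends to an expression in [L], which dominates the one in
    the limit function. *)
Lemma H1_compact n (Om : set 'rV[R]_n.+1) (M : R) (u_ : nat -> 'rV[R]_n.+1 -> R) :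
  open Om -> (lebesgue_rV R n.+1 Om < +oo)%E ->
  (forall j, Wev Om 1 0 (u_ j)) -> (forall j, wsum Om 1 0 (u_ j) <= M) ->
  exists t u (L : R), [/\ {homo t : i j / (i < j)%N}, Wev Om 1 0 u,
    {ae lebesgue_rV R n.+1, forall x, Om x -> u_ (t j) x @[j --> \oo] --> u x},
    wsum Om 1 0 (u_ (t j)) @[j --> \oo] --> L & wsum Om 1 0 u <= L].
Proof.
move=> oOm Omoo wu hM; set mu := lebesgue_rV R n.+1 in Omoo *.
have lu j : Lev mu Om 0 (u_ j) := Wev_Lev (wu j).
have [|||||t1 ht1 h1] := @rellich R n Om (Num.sqrt M) u_ (fun j i => wpartial Om i (u_ j)) oOm.
- by move=> j i; have [] := Wev_partial i (wu j).
- exact: lu.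
- by move=> j i; exact: (W1_partial i (wu j)).
- by move=> j; apply: ler_wsqrtr; apply: le_trans (hM j); exact: (@wsum_I R n.+1 Om 1 0 (u_ j)).
- move=> j i; apply: ler_wsqrtr; apply: le_trans (hM j).
  exact: le_trans (@wsum_I R n.+1 Om 0 0 _) (@wsum_partial R n.+1 Om 0 0 _ i).
have [|//|u mfu hu] := @ae_limit _ _ _ mu Om (fun j => u_ (t1 j)).
  by move=> j; have [] := lu (t1 j).
have [|t2 ht2 /cvg_ex[L hL]] := @bounded_subsequence R (fun j => wsum Om 1 0 (u_ (t1 j))) M.
  by move=> j; rewrite ger0_norm; [exact: hM | exact: wsum_ge0].
have cu := ae_cvg_subseq ht2 hu.
have lsc e : 0 < e -> Wev Om 1 0 u /\ wsum Om 1 0 u <= L + e.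
  move=> e0; move/cvgn_leP : hL => /(_ e e0)[n0 hn].
  apply: (@Wev_lsc _ _ _ oOm Omoo 1 0 (fun j => u_ (t1 (t2 (j + n0)%N)))) => //.
    move=> j; have := hn (j + n0)%N (leq_addl _ _).
    by rewrite /= ler_norml => /andP[_]; rewrite lerBlDl.
  by apply: filterS cu => x h Ox; have := h Ox; rewrite -(cvg_shiftn n0).
exists (t1 \o t2), u, L; split => //; first exact: comp_increasing.
  by have [] := lsc 1 ltr01.
by apply/ler_addgt0Pr => e /lsc[].
Qed.

End compactness_tools.

(** * Cut-off functions and their limit *)

Section cutoff_functions.
Context (R : realType) (e : R) (th : R -> R) (e0 : 0 < e) (hth : cutoff e th).

Lemma cutoff_continuous : continuous th.
Proof.
have [_ _ [h _] _ _] := hth; move=> t.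
by apply: differentiable_continuous; apply/derivable1_diffP; exact: (h 0%N).
Qed.

Lemma cutoff_ge0 t : 0 <= th t.
Proof.
have [hm _ _ [_ h0] _] := hth; have [te|te] := ltP t (- e); first by rewrite h0.
by rewrite -(h0 (- e - 1)) ?ltrBlDr ?ltrDl//; apply: hm; rewrite (le_trans _ te)// gerDl oppr_le0.
Qed.

(** For t <= e, monotonicity puts th(t) between 0 and th(2e) = 2e; the point 2e is used because
    th(t) = t is prescribed only for t > e. *)
Lemma cutoff_near t : `|th t - Num.max 0 t| <= 2 * e.
Proof.
have [hm _ _ [h1 h0] _] := hth; have [te|te] := ltP e t.
  by rewrite h1// max_r ?subrr ?normr0 ?mulr_ge0// ltW// (lt_trans e0).
have th2 : th t <= 2 * e.
  by rewrite -(h1 (2 * e)); [apply: hm; rewrite (le_trans te)// ler_peMl ?ltW// ltr1n|rewrite ltr_pMl// ltr1n].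
have t0 := cutoff_ge0 t; have m0 : 0 <= Num.max 0 t by rewrite le_max lexx.
have m2 : Num.max 0 t <= 2 * e by rewrite ge_max mulr_ge0 ?(ltW e0)//= (le_trans te)// ler_peMl ?ltW// ltr1n.
by rewrite ler_norml; apply/andP; split; lra.
Qed.

Lemma cutoff_le t : `|th t| <= `|t| + 2 * e.
Proof.
have := cutoff_near t; rewrite (ger0_norm (cutoff_ge0 t)) ler_norml => /andP[_].
rewrite lerBlDl => h; apply: le_trans h _; rewrite addrC [leRHS]addrC lerD2l.
by rewrite ge_max normr_ge0 ler_norm.
Qed.

End cutoff_functions.

Section cutoff_limits.
Context (R : realType).

Lemma cvgn_mono (a b : nat -> R) (l l' : R) : a n @[n --> \oo] --> l -> b n @[n --> \oo] --> l' ->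
  (forall n, a n <= b n) -> l <= l'.
Proof.
move=> al bl ab; rewrite -subr_le0; apply: cvgn_upper (cvgB al bl) _ => n.
by rewrite /= subr_le0.
Qed.

Lemma cvgn_subseq (a : nat -> R) (l : R) s : {homo s : i j / (i < j)%N} ->
  a j @[j --> \oo] --> l -> a (s j) @[j --> \oo] --> l.
Proof.
move=> hs /cvgn_leP h; apply/cvgn_leP => e /h[n0 hn]; exists n0 => j hj; apply: hn.
exact: leq_trans hj (increasing_leq hs j).
Qed.

Lemma max0_lipschitz (x y : R) : `|Num.max 0 x - Num.max 0 y| <= `|x - y|.
Proof.
have h1 := ler_norm (x - y); have h2 := ler_norm (y - x); rewrite distrC in h2.
by rewrite ler_norml; case: (leP 0 x) => hx; case: (leP 0 y) => hy; apply/andP; split; lra.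
Qed.

Lemma max0_cvg (a : nat -> R) l : a n @[n --> \oo] --> l ->
  Num.max 0 (a n) @[n --> \oo] --> Num.max 0 l.
Proof.
move=> /cvgn_leP ha; apply/cvgn_leP => e /ha[n0 h]; exists n0 => n /h.
exact: le_trans (max0_lipschitz _ _).
Qed.

Lemma cutoff_vanishing_cvg (e_ : nat -> R) (th_ : nat -> R -> R) (a : nat -> R) l :
  (forall j, 0 < e_ j) -> (forall j, cutoff (e_ j) (th_ j)) -> e_ n @[n --> \oo] --> 0 ->
  a n @[n --> \oo] --> l -> th_ n (a n) @[n --> \oo] --> Num.max 0 l.
Proof.
move=> e0 hth /cvgn_leP ce ca.
have -> : (fun n => th_ n (a n)) = (fun n => (th_ n (a n) - Num.max 0 (a n)) + Num.max 0 (a n)).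
  by apply/funext => n; rewrite subrK.
rewrite -[Num.max 0 l]add0r; apply: cvgD; last exact: max0_cvg.
apply/cvgn_leP => d d0; have [|n0 hn] := ce (d / 2); first by rewrite divr_gt0.
exists n0 => n /hn; rewrite !subr0 ger0_norm ?(ltW (e0 n))// => h.
by apply: le_trans (cutoff_near (e0 n) (hth n) _) _; rewrite mulrC -ler_pdivlMr.
Qed.

End cutoff_limits.

(** * The optimal control problems *)

Section optimal_control.
Context (R : realType) (n : nat).
Local Notation N := n.+1.
Local Notation E := 'rV[R]_N.
Local Notation mu := (lebesgue_rV R N).
Variables (Om : set E) (oOm : open Om) (Omoo : (mu Om < +oo)%E).
Implicit Types (u v w y : E -> R) (th : R -> R).
Let mOm : measurable Om := rV_open_measurable oOm.
Variables (ua ub : E -> R) (mua : measurable_fun Om ua) (mub : measurable_fun Om ub).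
Variables (Ua : R) (hua : forall x, Om x -> `|ua x| <= Ua) (hub : forall x, Om x -> `|ub x| <= Ua).
Variables (S : (E -> R) -> E -> R) (M : R).
Local Notation adm := (admissible Om ua).
(** With [hSs], this is all that the control problems use of the state equation: a sup bound uniform
    in the control, and stability along a subsequence. *)
Hypothesis hSb : forall w, adm w -> ae_le Om M (S w).
Hypothesis hSs : forall (w_ : nat -> E -> R) w, (forall j, adm (w_ j)) -> adm w ->
  {ae mu, forall x, Om x -> w_ j x @[j --> \oo] --> w x} ->
  exists2 t, {homo t : i j / (i < j)%N} &
    {ae mu, forall x, Om x -> S (w_ (t j)) x @[j --> \oo] --> S w x}.
Variables (phi : E -> R -> R) (hphi : nonlinearity Om phi) (lam : R) (lam0 : 0 < lam).

Local Notation Iphi y := (\int[mu]_(x in Om) phi x (y x)).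
Local Notation W1 u := (Wev Om 1 0 u).

Definition shifted_cutoff th u : E -> R := fun x => ua x + th (u x - ua x).

Definition penalty u : E -> R := fun x =>
  Num.max 0 (ua x - u x) ^+ 2 + Num.max 0 (u x - ub x) ^+ 2.

Local Notation Pen u := (\int[mu]_(x in Om) penalty u x).

Definition reduced th u : R := Iphi (S (shifted_cutoff th u)) + lam / 2 * wsum Om 1 0 u.

Lemma Lev_ua : Lev mu Om 0 ua. Proof. exact: (Lev_bounded mOm Omoo 0 mua hua). Qed.

Lemma Lev_ub : Lev mu Om 0 ub. Proof. exact: (Lev_bounded mOm Omoo 0 mub hub). Qed.

Lemma adm_shifted th u r : measurable_fun setT th -> (forall t, 0 <= th t) ->
  (forall t, `|th t| <= `|t| + r) -> Lev mu Om 0 u -> adm (shifted_cutoff th u).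
Proof.
move=> mth th0 thr lu; split; last by apply: aeW => x _; rewrite lerDl.
apply: (LevD mOm Lev_ua); have lt := LevB mOm lu Lev_ua; have [mt it] := lt.
have mc : measurable_fun Om (fun x => th (u x - ua x)) by exact: (measurableT_comp mth mt).
split => //; have l2 := LevD mOm lt lt.
apply: (L1_le mOm _ (L1D mOm (L1Z mOm 2 it) (L1_cst mOm Omoo (2 * r ^+ 2)))).
  exact: measurable_funX.
move=> x _; have := thr (u x - ua x); rewrite normrX.
set t := u x - ua x; set c := th t => h.
have r0 : `|c| ^+ 2 <= (`|t| + r) ^+ 2 by apply: lerXn2r; rewrite ?nnegrE ?(le_trans _ h).
apply: le_trans r0 _; rewrite /= -(real_normK (num_real t)).
by have := sqr_ge0 (`|t| - r); nra.
Qed.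

Lemma adm_cutoff e th u : 0 < e -> cutoff e th -> Lev mu Om 0 u -> adm (shifted_cutoff th u).
Proof.
move=> e0 hth; apply: (@adm_shifted th u (2 * e)); last exact: cutoff_le.
  by apply: continuous_measurable_fun; exact: (cutoff_continuous hth).
by move=> t; exact: (cutoff_ge0 hth).
Qed.

Lemma adm_max0 u : Lev mu Om 0 u -> adm (shifted_cutoff (Num.max 0) u).
Proof.
apply: (@adm_shifted _ u 0); first exact: measurable_maxr.
  by move=> t; rewrite le_max lexx.
by move=> t; rewrite addr0; have := max0_lipschitz t 0; rewrite maxxx !subr0.
Qed.

(** [S] acts on representatives; its compatibility with a.e. equality is stability for a constant
    sequence. *)
Lemma S_ae w w' : adm w -> adm w' -> w = w' %[ae mu in Om] -> S w = S w' %[ae mu in Om].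
Proof.
move=> aw aw' ww'; have [|t _ ht] := @hSs (fun=> w) w' (fun=> aw) aw'.
  by apply: filterS ww' => x h /h ->; exact: cvg_cst.
by apply: filterS ht => x h Ox; apply: cvgn_uniq (cvg_cst _) (h Ox).
Qed.

Lemma S_phi_cvg (w_ : nat -> E -> R) w : (forall j, adm (w_ j)) -> adm w ->
  {ae mu, forall x, Om x -> S (w_ j) x @[j --> \oo] --> S w x} ->
  Iphi (S (w_ j)) @[j --> \oo] --> Iphi (S w).
Proof.
move=> aw_ aw; apply: (I_phi_cvg mOm Omoo hphi (M := M)); last exact: hSb.
by move=> j; exact: hSb.
Qed.

Lemma penalty_ge0 u x : 0 <= penalty u x. Proof. by rewrite addr_ge0// sqr_ge0. Qed.

Lemma L1_penalty u : Lev mu Om 0 u -> mu.-integrable Om (EFin \o penalty u).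
Proof.
have sq (f : E -> R) : Lev mu Om 0 f -> mu.-integrable Om (EFin \o (fun x => Num.max 0 (f x) ^+ 2)).
  move=> [mf hf]; apply: (L1_le mOm _ hf); first by apply: measurable_funX; exact: measurable_maxr.
  move=> x _; rewrite normrX -[leRHS](real_normK (num_real _)); apply: lerXn2r; rewrite ?nnegrE//.
  by have := max0_lipschitz (f x) 0; rewrite maxxx !subr0.
by move=> lu; apply: (L1D mOm); apply: sq; apply: (LevB mOm) => //; [exact: Lev_ua|exact: Lev_ub].
Qed.

Lemma penalty_cvg (u_ : nat -> E -> R) u :
  {ae mu, forall x, Om x -> u_ j x @[j --> \oo] --> u x} ->
  {ae mu, forall x, Om x -> penalty (u_ j) x @[j --> \oo] --> penalty u x}.
Proof.
apply: filterS => x h /h hx; rewrite /penalty; apply: cvgD; apply: cvgn_exprn; apply: max0_cvg.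
  by apply: cvgB => //; exact: cvg_cst.
by apply: cvgB => //; exact: cvg_cst.
Qed.

Lemma penalty0P u x : penalty u x = 0 <-> ua x <= u x <= ub x.
Proof.
have P0 (t : R) : (Num.max 0 t == 0) = (t <= 0) by rewrite eq_le le_max lexx andbT ge_max lexx.
rewrite /penalty; split=> [/eqP|/andP[h1 h2]].
  by rewrite paddr_eq0 ?sqr_ge0// !sqrf_eq0 !P0 !subr_le0.
by rewrite !max_l ?subr_le0// expr0n addr0.
Qed.

Lemma Uad_shifted u : {ae mu, forall x, Om x -> ua x <= u x <= ub x} ->
  {ae mu, forall x, Om x -> shifted_cutoff (Num.max 0) u x = u x}.
Proof.
apply: filterS => x h /h/andP[h1 _]; rewrite /shifted_cutoff max_r ?subr_ge0//.
by rewrite addrC subrK.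
Qed.

Lemma Uad_penalty u : {ae mu, forall x, Om x -> ua x <= u x <= ub x} -> Pen u = 0.
Proof.
move=> h; rewrite (@ae_eq_Rintegral _ _ _ mu Om (penalty u) (cst 0)).
  by rewrite /Rintegral integral0.
by apply: filterS h => x h /h/penalty0P.
Qed.

(** [W] is the control that enters the state equation in the limit: the cut-off shift for a fixed
    parameter, or the shift by max(0, .) when the parameters tend to 0. One statement thus serves
    existence and convergence of minimizers. *)
Lemma control_compact (w_ u_ : nat -> E -> R) (W : (E -> R) -> E -> R) (C : R) :
  (forall j, W1 (u_ j)) -> (forall j, wsum Om 1 0 (u_ j) <= C) -> (forall j, adm (w_ j)) ->
  (forall u t, {homo t : i j / (i < j)%N} -> W1 u ->
    {ae mu, forall x, Om x -> u_ (t j) x @[j --> \oo] --> u x} ->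
    adm (W u) /\ {ae mu, forall x, Om x -> w_ (t j) x @[j --> \oo] --> W u x}) ->
  exists s u (L : R), [/\ {homo s : i j / (i < j)%N}, W1 u,
    {ae mu, forall x, Om x -> u_ (s j) x @[j --> \oo] --> u x},
    {ae mu, forall x, Om x -> S (w_ (s j)) x @[j --> \oo] --> S (W u) x} &
    [/\ Iphi (S (w_ (s j))) @[j --> \oo] --> Iphi (S (W u)),
    wsum Om 1 0 (u_ (s j)) @[j --> \oo] --> L & wsum Om 1 0 u <= L]].
Proof.
move=> wu hC aw hW; have [t [u [L [ht w1 cu cL uL]]]] := H1_compact oOm Omoo wu hC.
have [aW cW] := hW u t ht w1 cu.
have [t2 ht2 cS] := hSs (fun j => aw (t j)) aW cW.
exists (fun j => t (t2 j)), u, L; split.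
- exact: (comp_increasing ht ht2).
- exact: w1.
- exact: (ae_cvg_subseq ht2 cu).
- exact: cS.
- split; last exact: uL.
    exact: (S_phi_cvg (fun j => aw (t (t2 j))) aW cS).
  exact: (cvgn_subseq ht2 cL).
Qed.

Lemma shifted_cutoff_cvg th (u_ : nat -> E -> R) u : continuous th ->
  {ae mu, forall x, Om x -> u_ j x @[j --> \oo] --> u x} ->
  {ae mu, forall x, Om x -> shifted_cutoff th (u_ j) x @[j --> \oo] --> shifted_cutoff th u x}.
Proof.
move=> cth; apply: filterS => x h /h hx; apply: cvgD; first exact: cvg_cst.
apply: continuous_cvg (cth _) _; apply: cvgB => //; exact: cvg_cst.
Qed.

Lemma Iphi_bound : exists A, forall w, adm w -> `|Iphi (S w)| <= A.
Proof.
by have [A hA] := I_phi_bound mOm Omoo hphi M; exists A => w aw; exact: hA (hSb aw).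
Qed.

Definition penalized e th u : R := reduced th u + (2 * e)^-1 * Pen u.

Lemma penalized_min e th : 0 < e -> cutoff e th -> exists u, W1 u /\
  forall v, W1 v -> penalized e th u <= penalized e th v.
Proof.
move=> e0 hth; have [A hA] := Iphi_bound; set l := lam / 2; have l0 : 0 < l by rewrite divr_gt0.
have e20 : 0 < 2 * e by rewrite mulr_gt0.
have ar1 (P a W Q i h : R) : `|P| <= a -> 0 <= Q -> P + l * W + Q <= i + h -> h <= 1 ->
    l * W <= i + 1 + a by rewrite ler_norml => /andP[h1 h2]; set k := l * W; lra.
have ar2 (P W Q i h : R) : P + l * W + Q <= i + h -> Q <= i + h - P - l * W.
  by set k := l * W; lra.
have ar3 (P W L Q i : R) : l * W <= l * L -> Q <= i + 0 - P - l * L -> P + l * W + Q <= i.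
  by set k := l * W; set k' := l * L; lra.
have ar4 (P a W Q : R) : `|P| <= a -> 0 <= W -> 0 <= Q -> - a <= P + W + Q.
  by rewrite ler_norml => /andP[h1 h2]; lra.
have aw u : W1 u -> adm (shifted_cutoff th u) := fun wu => adm_cutoff e0 hth (Wev_Lev wu).
have Q0 u : 0 <= (2 * e)^-1 * Pen u.
  by apply: mulr_ge0; [rewrite invr_ge0 ltW|apply: Rintegral_ge0 => x _; exact: penalty_ge0].
pose X : set R := [set r | exists2 u, W1 u & r = penalized e th u].
have hi : has_inf X.
  split; first by exists (penalized e th (cst 0)), (cst 0) => //; exact: (W1_test oOm Omoo (test_0 Om)).
  exists (- A) => _ [u wu ->]; apply: ar4; [exact: hA (aw u wu)| |exact: Q0].
  by apply: mulr_ge0; [exact: ltW|exact: wsum_ge0].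
have /choice[u_ hu_] : forall j, exists u, W1 u /\ penalized e th u <= inf X + harmonic j.
  by move=> j; have [_ [u wu ->] /ltW h] := inf_adherent (harmonic_gt0 j) hi; exists u.
have wu_ j := (hu_ j).1.
have hC j : wsum Om 1 0 (u_ j) <= l^-1 * (inf X + 1 + A).
  rewrite ler_pdivlMl//; apply: ar1 (hA _ (aw _ (wu_ j))) (Q0 (u_ j)) (hu_ j).2 _.
  by rewrite /harmonic/= invf_le1 ?ler1n ?ltr0Sn.
have [s [u [L [hs w1 cu _ [cI cL uL]]]]] := control_compact wu_ hC (fun j => aw _ (wu_ j))
  (fun u t _ wu cu => conj (aw u wu) (shifted_cutoff_cvg (cutoff_continuous hth) cu)).
exists u; split => // v wv; apply: (@le_trans _ _ (inf X)); last by apply: (ge_inf hi.2); exists v.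
(* Only the penalty is passed by Fatou. Near-minimality bounds it by the infimum minus the other two
   terms, which converge; [L] may then be lowered to the norm of the limit. *)
apply: (ar3 _ _ L); first by rewrite ler_pM2l.
rewrite ler_pdivrMl//; apply: (@I_fatou_lim R _ _ mu Om mOm (fun j => penalty (u_ (s j))) (penalty u)
  (fun j => 2 * e * (inf X + harmonic (s j) - Iphi (S (shifted_cutoff th (u_ (s j))))
     - l * wsum Om 1 0 (u_ (s j))))).
- by move=> j; exact: L1_penalty (Wev_Lev (wu_ (s j))).
- by move=> j x _; exact: penalty_ge0.
- exact: (L1_measurable (L1_penalty (Wev_Lev w1))).
- exact: penalty_cvg cu.
- by move=> j; rewrite -ler_pdivrMl//; apply: ar2; exact: (hu_ (s j)).2.
apply: cvgMr; apply: cvgB; last exact: cvgMr cL.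
apply: cvgB; last exact: cI.
by apply: cvgD; [exact: cvg_cst|exact: (cvgn_subseq hs cvg_harmonic)].
Qed.

Local Notation in_bounds u := {ae mu, forall x, Om x -> ua x <= u x <= ub x}.

Lemma adm_in_bounds u : Lev mu Om 0 u -> in_bounds u -> adm u.
Proof. by move=> lu hu; split => //; apply: filterS hu => x h /h/andP[]. Qed.

(** The competitor [v0] has zero penalty for every parameter. The first integral has no sign, so
    each comparison loses twice its bound [A]; this is the constant [B]. The a.e. limit of the
    states is kept in the conclusion, as it identifies their weak limit. *)
Lemma penalized_limit (e_ : nat -> R) (th_ : nat -> R -> R) (u_ : nat -> E -> R) v0 :
  (forall j, 0 < e_ j) -> (forall j, cutoff (e_ j) (th_ j)) -> e_ j @[j --> \oo] --> 0 ->
  (forall j, W1 (u_ j)) ->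
  (forall j v, W1 v -> penalized (e_ j) (th_ j) (u_ j) <= penalized (e_ j) (th_ j) v) ->
  W1 v0 -> in_bounds v0 ->
  exists s u C, [/\ {homo s : i j / (i < j)%N}, W1 u,
    {ae mu, forall x, Om x -> u_ (s j) x @[j --> \oo] --> u x},
    {ae mu, forall x, Om x ->
      S (shifted_cutoff (th_ (s j)) (u_ (s j))) x @[j --> \oo] --> S u x} &
    [/\ forall j, wsum Om 1 0 (u_ j) <= C, in_bounds u & forall v, W1 v -> in_bounds v ->
      Iphi (S u) + lam / 2 * wsum Om 1 0 u <= Iphi (S v) + lam / 2 * wsum Om 1 0 v]].
Proof.
move=> e0 hth ce wu hmin w0 b0; have [A hA] := Iphi_bound.
set l := lam / 2; have l0 : 0 < l by rewrite divr_gt0.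
have e20 j : 0 < 2 * e_ j by rewrite mulr_gt0.
have ar1 (P P' W W' Q q : R) : `|P| <= A -> `|P'| <= A -> 0 <= Q ->
    P + l * W + Q <= P' + l * W' + q * 0 -> l * W <= 2 * A + l * W'.
  by rewrite mulr0 !ler_norml => /andP[h1 h2] /andP[h3 h4]; set k := l * W; set k' := l * W'; lra.
have ar2 (P P' W W' Q q : R) : `|P| <= A -> `|P'| <= A -> 0 <= l * W ->
    P + l * W + Q <= P' + l * W' + q * 0 -> Q <= 2 * A + l * W'.
  by rewrite mulr0 !ler_norml => /andP[h1 h2] /andP[h3 h4]; set k := l * W; set k' := l * W'; lra.
have ar3 (P W Q P' W' q : R) : 0 <= Q -> P + W + Q <= P' + W' + q * 0 -> P + W <= P' + W'.
  by rewrite mulr0; lra.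
have aw u j : W1 u -> adm (shifted_cutoff (th_ j) u) :=
  fun wu => adm_cutoff (e0 j) (hth j) (Wev_Lev wu).
have Q0 u j : 0 <= (2 * e_ j)^-1 * Pen u.
  by apply: mulr_ge0; [rewrite invr_ge0 ltW|apply: Rintegral_ge0 => x _; exact: penalty_ge0].
have cmp j v : W1 v -> in_bounds v -> reduced (th_ j) (u_ j) + (2 * e_ j)^-1 * Pen (u_ j) <=
    reduced (th_ j) v + (2 * e_ j)^-1 * 0.
  by move=> wv bv; have := hmin j v wv; rewrite /penalized (Uad_penalty bv).
set B := 2 * A + l * wsum Om 1 0 v0.
have hC j : wsum Om 1 0 (u_ j) <= l^-1 * B.
  rewrite ler_pdivlMl//.
  exact: ar1 (hA _ (aw _ j (wu j))) (hA _ (aw _ j w0)) (Q0 (u_ j) j) (cmp j v0 w0 b0).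
have hQ j : Pen (u_ j) <= 2 * e_ j * B.
  rewrite -ler_pdivrMl//; apply: ar2 (hA _ (aw _ j (wu j))) (hA _ (aw _ j w0)) _ (cmp j v0 w0 b0).
  by apply: mulr_ge0; [exact: ltW|exact: wsum_ge0].
have vanish (v_ : nat -> E -> R) (t : nat -> nat) v : {homo t : i j / (i < j)%N} ->
    {ae mu, forall x, Om x -> v_ j x @[j --> \oo] --> v x} ->
    {ae mu, forall x, Om x -> shifted_cutoff (th_ (t j)) (v_ j) x @[j --> \oo] -->
      shifted_cutoff (Num.max 0) v x}.
  move=> ht; apply: filterS => x h /h hx; apply: cvgD; first exact: cvg_cst.
  apply: (@cutoff_vanishing_cvg R (fun j => e_ (t j)) (fun j => th_ (t j)) (fun j => v_ j x - ua x)).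
  - by move=> j; exact: e0.
  - by move=> j; exact: hth.
  - exact: (cvgn_subseq ht ce).
  - by apply: cvgB => //; exact: cvg_cst.
(* The limit control is first taken as ua + max(0, u - ua), which is admissible before any bound on
   [u] is known; it becomes [u] a.e. once u >= ua is proved. *)
have [s [u [L [hs w1 cu cS [cI cL uL]]]]] := control_compact wu hC (fun j => aw _ j (wu j))
  (fun u t ht wu cu => conj (adm_max0 (Wev_Lev wu)) (vanish _ t u ht cu)).
have lu := Wev_Lev w1.
have bu : in_bounds u.
  have Pu : Pen u <= 0.
    apply: (@I_fatou_lim R _ _ mu Om mOm (fun j => penalty (u_ (s j))) (penalty u)
      (fun j => 2 * e_ (s j) * B)).
    - by move=> j; exact: L1_penalty (Wev_Lev (wu (s j))).
    - by move=> j x _; exact: penalty_ge0.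
    - exact: (L1_measurable (L1_penalty lu)).
    - exact: penalty_cvg cu.
    - by move=> j; exact: hQ.
    rewrite [X in _ --> X](_ : 0 = 2 * 0 * B); last by rewrite mulr0 mul0r.
    by apply: cvgMl; apply: cvgMr; exact: (cvgn_subseq hs ce).
  have P0 : Pen u = 0.
    by apply/le_anti; rewrite Pu; apply: Rintegral_ge0 => x _; exact: penalty_ge0.
  have := I_eq0_ae mOm (L1_penalty lu) (fun x _ => penalty_ge0 u x) P0.
  by apply: filterS => x h /h/penalty0P.
have au := adm_in_bounds lu bu.
have Su := S_ae (adm_max0 lu) au (Uad_shifted bu).
exists s, u, (l^-1 * B); split; [exact: hs|exact: w1|exact: cu| |split; [exact: hC|exact: bu|]].
  by apply: filterS2 cS Su => x h1 h2 Ox; rewrite -(h2 Ox); exact: h1.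
move=> v wv bv; have lv := Wev_Lev wv; have av := adm_in_bounds lv bv.
have cv : {ae mu, forall x, Om x -> shifted_cutoff (th_ (s j)) v x @[j --> \oo] --> v x}.
  have h1 := vanish (fun=> v) s v hs (aeW _ (fun x _ => @cvg_cst _ (v x) _ \oo (@eventually_filter))).
  by apply: filterS2 h1 (Uad_shifted bv) => x h1x h2x Ox; rewrite -[X in _ --> X](h2x Ox); exact: h1x.
(* The competitor also enters the penalized problems through its shift, so its states vary with j; a
   further subsequence brings them to [S v]. *)
have [t ht ct] := hSs (fun j => aw v (s j) wv) av cv.
have cPv := S_phi_cvg (fun j => aw v (s (t j)) wv) av ct.
have cPu : Iphi (S (shifted_cutoff (th_ (s (t j))) (u_ (s (t j))))) @[j --> \oo] --> Iphi (S u).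
  have -> : Iphi (S u) = Iphi (S (shifted_cutoff (Num.max 0) u)).
    by apply: ae_eq_Rintegral; apply: filterS Su => x h /h ->.
  exact: (cvgn_subseq ht cI).
have cWu := cvgn_subseq ht cL.
apply: (@le_trans _ _ (Iphi (S u) + l * L)); first by rewrite lerD2l ler_pM2l.
apply: (@cvgn_mono R
  (fun j => Iphi (S (shifted_cutoff (th_ (s (t j))) (u_ (s (t j))))) + l * wsum Om 1 0 (u_ (s (t j))))
  (fun j => Iphi (S (shifted_cutoff (th_ (s (t j))) v)) + l * wsum Om 1 0 v)).
- by apply: cvgD; [exact: cPu|exact: (cvgMr cWu)].
- by apply: cvgD; [exact: cPv|exact: cvg_cst].
move=> j.
exact: ar3 (Q0 _ (s (t j))) (cmp (s (t j)) v wv bv).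
Qed.

End optimal_control.

Section domain_tools.
Context (R : realType) (n : nat).
Local Notation N := n.+1.
Local Notation E := 'rV[R]_N.
Local Notation mu := (lebesgue_rV R N).
Variables (Om : set E) (oOm : open Om).
Implicit Types (u v w y : E -> R).

Lemma cost_state phi lam w y y' u : H1 Om u -> y = w %[ae mu in Om] -> y' = y ->
  cost Om phi lam (y', u) = \int[mu]_(x in Om) phi x (w x) + lam / 2 * wsum Om 1 0 u.
Proof.
move=> /(H1P oOm) wu yw ->; rewrite /cost /= (H1_norm2E oOm wu); congr (_ + _).
by apply: ae_eq_Rintegral; apply: filterS yw => x h /h ->.
Qed.

Lemma closure_continuous_bounded (g : E -> R) : bounded_set Om -> {within closure Om, continuous g} ->
  measurable_fun Om g /\ exists2 M, 0 <= M & forall x, Om x -> `|g x| <= M.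
Proof.
move=> bO cg; have [A _ hA] := bounded_sub_cbox bO.
have cK : compact (closure Om).
  apply: subclosed_compact (@closed_closure _ Om) (@compact_cbox R N (const_mx (- A)) (const_mx A)) _.
  have /closure_id -> : closed (cbox (const_mx (- A) : E) (const_mx A)).
    by apply: compact_closed; [exact: norm_hausdorff|exact: compact_cbox].
  exact: closureS.
have mK := rV_closed_measurable (@closed_closure _ Om); split.
  exact: measurable_funS mK (@subset_closure _ Om) (rV_within_continuous_measurable mK cg).
have [M [_ hM]] := compact_bounded (continuous_compact cg cK).
exists (`|M| + 1) => [|x Ox]; first by rewrite addr_ge0.
apply: hM; last by exists x => //; exact: subset_closure.
by rewrite (le_lt_trans (ler_norm _))// ltrDl.
Qed.

End domain_tools.

(** The second part assumes a feasible control: for bounds that are merely continuous the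
    intersection of U_ad with H^1 can be empty, for instance if ua = ub is not in H^1. This control
    is the competitor that bounds the penalized minimizers. *)
Theorem theorem3p4 (R : realType) (N : nat) (hN : (1 <= N <= 3)%N)
  (Om : set 'rV[R]_N) (hOm : bounded_C11_domain Om)
  (f : 'rV[R]_N -> R) (hf : Lp Om +oo%E f)
  (f0 : R) (hf0 : 0 < f0)
  (hff0 : {ae lebesgue_rV R N, forall x, Om x -> f0 <= f x})
  (ua ub : 'rV[R]_N -> R)
  (hua : {within closure Om, continuous ua})
  (hub : {within closure Om, continuous ub})
  (u0 : R) (hu0 : 0 < u0)
  (huab : forall x, closure Om x -> u0 <= ua x /\ ua x <= ub x)
  (b : 'rV[R]_N -> R) (hb : sobolev Om 1 +oo%E b)
  (b0 : R) (hb0 : 0 < b0)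
  (hbb0 : {ae lebesgue_rV R N, forall x, Om x -> b0 <= b x})
  (phi : 'rV[R]_N -> R -> R) (hphi : nonlinearity Om phi)
  (theta : R -> R -> R) (htheta : forall e, 0 < e -> cutoff e (theta e))
  (lam : R) (hlam : 0 < lam)
  (S : ('rV[R]_N -> R) -> 'rV[R]_N -> R) (hS : control_to_state Om f b ua S) :
  (forall e, 0 < e ->
    exists y u,
      global_min (penalized_feasible Om S ua (theta e))
        (penalized_cost Om phi lam ua ub e) (y, u) /\
      forall p, 1 <= p -> sobolev Om 2 p%:E y)
  /\
  ((exists u, H1 Om u /\ Uad Om ua ub u) ->
   forall p, 1 <= p ->
   forall (e_ : nat -> R) (yu_ : nat -> ('rV[R]_N -> R) * ('rV[R]_N -> R)),
     (forall n, 0 < e_ n) -> nonincreasing_seq e_ -> e_ n @[n --> \oo] --> 0 ->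
     (forall n, global_min (penalized_feasible Om S ua (theta (e_ n)))
        (penalized_cost Om phi lam ua ub (e_ n)) (yu_ n)) ->
   exists (s : nat -> nat) (ys us : 'rV[R]_N -> R),
     [/\ {homo s : m n / (m < n)%N},
         weak_cvg [set yu | sobolev Om 2 p%:E yu.1 /\ H1 Om yu.2]
           (fun yu => sobolev_norm Om 2 p%:E yu.1 + Num.sqrt (H1_norm2 Om yu.2))
           (yu_ \o s) (ys, us),
         Uad Om ua ub us &
         global_min (feasible Om S ua ub) (cost Om phi lam) (ys, us)]).
Proof.
(* Dimension zero is excluded by [hN]; a positive dimension supplies the coordinates for cyclic
   bisection and for Poincare's inequality. *)
destruct N as [|n]; first by [].
case: hOm => oOm _ _ bO _; set mu := lebesgue_rV R n.+1 in hff0 hbb0 *.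
have mOm := rV_open_measurable oOm; have Omoo := bounded_lebesgue_lty mOm bO.
have [mf [F _ hF]] := Lp_oo_bounded mOm hf; have hf' : ae_le Om F f := conj mf hF.
have [mb [B _ hB]] := Lp_oo_bounded mOm (proj1 hb); have hb' : ae_le Om B b := conj mb hB.
have [mua [Ma Ma0 hMa]] := closure_continuous_bounded bO hua.
have [mub [Mb Mb0 hMb]] := closure_continuous_bounded bO hub.
have clO x : Om x -> closure Om x by move=> Ox; exact: subset_closure.
have hua' x : Om x -> u0 <= ua x <= Ma.
  by move=> Ox; rewrite (huab x (clO x Ox)).1/= (le_trans (ler_norm _))// hMa.
have hMa' x : Om x -> `|ua x| <= Ma + Mb by move=> Ox; rewrite (le_trans (hMa x Ox))// lerDl.
have hMb' x : Om x -> `|ub x| <= Ma + Mb by move=> Ox; rewrite (le_trans (hMb x Ox))// lerDr.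
have [K K0 pK] := poincare oOm Omoo bO (ord0 : 'I_n.+1).
have [M hM] := S_sup_bound oOm Omoo bO hf' hf0 hff0 hu0 Ma0 hua' hb' hb0 hbb0 hS K0 pK.
have hsol w := S_sol oOm hS (w := w).
have hSb w : admissible Om ua w -> ae_le Om M (S w).
  by move=> aw; split; [exact: (H1_0_Lev oOm Omoo (hsol w aw).1).1|exact: hM].
have hSs w_ w := S_stable oOm Omoo hf' hu0 hua' hb' hb0 hbb0 hS K0 pK (w_ := w_) (w := w).
have aw e u : 0 < e -> Wev Om 1 0 u -> admissible Om ua (shifted_cutoff ua (theta e) u).
  by move=> e0 wu; exact: (adm_cutoff oOm Omoo mua hMa e0 (htheta e e0) (Wev_Lev wu)).
have pcE e y u : penalized_feasible Om S ua (theta e) (y, u) ->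
    penalized_cost Om phi lam ua ub e (y, u) = penalized Om ua ub S phi lam e (theta e) u.
  by move=> [_ yS hu]; rewrite /penalized_cost (cost_state oOm _ _ hu yS).
have pfS e u : 0 < e -> Wev Om 1 0 u ->
    penalized_feasible Om S ua (theta e) (S (shifted_cutoff ua (theta e) u), u).
  move=> e0 wu; split; [exact: (hsol _ (aw e u e0 wu)).1|exact: aeW|exact/(H1P oOm)].
split=> [e e0|[v0 [hv0 [_ bv0]]] p p1 e_ yu_ e0 _ ce hmin].
  have [u [wu hu]] := penalized_min oOm Omoo mua mub hMa' hMb' hSb hSs hphi hlam e0 (htheta e e0).
  exists (S (shifted_cutoff ua (theta e) u)), u; split.
    split; first exact: pfS.
    move=> [y v] fv; rewrite (pcE _ _ _ fv) (pcE _ _ _ (pfS e u e0 wu)).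
    by apply: hu; case: fv => _ _ /(H1P oOm).
  have [lw uw] := aw e u e0 wu.
  have [|//|_ _ h] := hS (shifted_cutoff ua (theta e) u); last exact: h.
  exact: ((LpP mOm 0 _).2 lw).
have fyu j := (hmin j).1.
have wu_ j : Wev Om 1 0 (yu_ j).2 by apply/(H1P oOm); case: (fyu j).
have pmin j v : Wev Om 1 0 v ->
    penalized Om ua ub S phi lam (e_ j) (theta (e_ j)) (yu_ j).2 <=
    penalized Om ua ub S phi lam (e_ j) (theta (e_ j)) v.
  move=> wv; have fj := fyu j; have fv := pfS (e_ j) v (e0 j) wv.
  by have := (hmin j).2 _ fv; rewrite (pcE _ _ _ fv); move: fj; case: (yu_ j) => y u fj; rewrite (pcE _ _ _ fj).
have [s [u [C [hs w1 cu cS [hC bu umin]]]]] := penalized_limit oOm Omoo mua mub hMa' hMb' hSb hSs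
  hphi hlam e0 (fun j => htheta _ (e0 j)) ce wu_ pmin ((H1P oOm v0).1 hv0) bv0.
have au : admissible Om ua u := adm_in_bounds (Wev_Lev w1) bu.
have Uu : Uad Om ua ub u.
  split => //; apply: (bounded_Lp_oo mOm (M := Ma + Mb)); first by case: (Wev_Lev w1).
  apply: filterS bu => x h Ox; have /andP[h1 h2] := h Ox; rewrite ler_norml.
  by have := hMa x Ox; have := hMb x Ox; rewrite !ler_norml => /andP[h3 h4] /andP[h5 h6]; apply/andP; split; lra.
exists s, (S u), u; split => //.
(* An even exponent above [p]; the bounds on the states are taken in W^{2,q} for this q. *)
- set m := Num.truncn p; have pq : 1 <= p <= (m.+1.*2)%:R.
    by rewrite p1/= (le_trans (ltW (truncnS_gt p)))// ler_nat -addnn leq_addr.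
  have [C2 hC2] := S_wsum_bound oOm Omoo hf' hf0 hff0 hu0 Ma0 hua' hb' hb0 hbb0 hS K0 pK m.
  have hy j : Wev Om 2 m (yu_ j).1 /\ wsum Om 2 m (yu_ j).1 <= C2.
    have [hy1 hy2 _] := fyu j; have aj := aw (e_ j) _ (e0 j) (wu_ j).
    have [W1 E1] := Wev_ae oOm (H1_0_Lev oOm Omoo hy1).1 (ae_eq_sym hy2) (S_Wev oOm hS m aj).
    by split; [exact: W1|rewrite -E1; exact: (hC2 _ aj)].
  have -> : yu_ \o s = fun j => ((yu_ (s j)).1, (yu_ (s j)).2).
    by apply/funext => j /=; case: (yu_ (s j)).
  have C20 : 0 <= C2 by apply: le_trans (hy 0%N).2; exact: wsum_ge0.
  have C0 : 0 <= C by apply: le_trans (hC 0%N); exact: wsum_ge0.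
  apply: (@weak_cvg_ae R n.+1 Om oOm Omoo m p pq (C2 + C)).
  - by move=> j; exact: (hy (s j)).1.
  - by move=> j; apply: le_trans (hy (s j)).2 _; rewrite lerDl.
  - by move=> j; exact: wu_.
  - by move=> j; apply: le_trans (hC (s j)) _; rewrite lerDr.
  - exact: (S_Wev oOm hS m au).
  - exact: w1.
  - have /ae_foralln hy2 : forall j, {ae mu, forall x, Om x -> (yu_ (s j)).1 x =
        S (shifted_cutoff ua (theta (e_ (s j))) (yu_ (s j)).2) x}.
      by move=> j; have [_ h _] := fyu (s j).
    apply: filterS2 cS hy2 => x h1 h2 Ox.
    by rewrite (_ : (fun j => _) = fun j => S (shifted_cutoff ua (theta (e_ (s j))) (yu_ (s j)).2) x);
      [exact: h1|apply/funext => j; exact: h2].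
  - exact: cu.
- have uf : feasible Om S ua ub (S u, u).
    by split => //; [exact: (hsol _ au).1|exact: aeW|exact/(H1P oOm)].
  split; [exact: uf|move=> [z v] [_ zv hv [_ bv]]].
  have hu : H1 Om u by exact/(H1P oOm).
  rewrite (@cost_state R n Om oOm phi lam (S v) z z v hv zv (erefl z)).
  rewrite (@cost_state R n Om oOm phi lam (S u) (S u) (S u) u hu (aeW _ (fun=> fun=> erefl)) (erefl (S u))).
  exact: (umin v ((H1P oOm v).1 hv) bv).
Qed.
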